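(* Suppose $V$ satisfies Assumption 1 (stated in the context) with constants $M,L,m>0$, and suppose $d\le\gamma n$, where $\gamma := c_0\bigl(\frac{m}{M}\wedge \frac{m^2}{L\sqrt{M}}\bigr)^2$ with a small enough (absolute) constant $c_0>0$. Let $f\in C^s$ for some $s=k+1+\rho$, where $k\ge0$ is an integer and $\rho\in(0,1]$, and let $\sigma_f^2(\theta):=\langle\mathcal{I}^{-1}f'(\theta),f'(\theta)\rangle$. Then, for all convex non-decreasing functions $\psi:\mathbb{R}_+\to\mathbb{R}_+$ with $\psi(0)=0$, satisfying the condition $\psi(u)\le\psi_{2/3}(cu)$, $u\ge0$, for some constant $c>0$, where $\psi_{2/3}(u)=e^{u^{2/3}}-1$, $$\sup_{\theta\in\mathbb{R}^d}\Bigl|\,\|f_k(\hat\theta)-f(\theta)\|_{L_\psi(\mathbb{P}_\theta)}-\frac{\sigma_f(\theta)}{\sqrt n}\|Z\|_\psi\Bigr|\lesssim_{L,M,m,s}\|f\|_{C^s}\Bigl[\sqrt{\frac{c(V)}{n}}\Bigl(\frac dn\Bigr)^{\rho/2}+\Bigl(\sqrt{\frac dn}\Bigr)^s\Bigr],$$ where $Z\sim N(0,1)$.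
   Context: Notation. For $A,B\ge0$, $A\lesssim_{L,M,m,s}B$ means that $A\le CB$ for some constant $C>0$ that may depend on $L,M,m,s$ (only). $a\wedge b=\min(a,b)$, $a\vee b=\max(a,b)$. $\|\cdot\|$ is the Euclidean norm of vectors and the operator norm of matrices and multilinear forms. Model. Let $n,d\ge 1$ be integers and let $V:\mathbb{R}^d\to\mathbb{R}$ be a (known) convex function with $\int e^{-V(x)}dx=1$. Put $P(dx)=e^{-V(x)}dx$ and $P_\theta(dx)=e^{-V(x-\theta)}dx$, $\theta\in\mathbb{R}^d$. Under $\mathbb{P}_\theta$, $X_1,\dots,X_n$ are i.i.d. with law $P_\theta$; $\xi$ denotes a random vector with law $P$. The maximum likelihood estimator is $\hat\theta:=\operatorname{argmin}_{\theta\in\mathbb{R}^d}\frac1n\sum_{j=1}^nV(X_j-\theta)$ (it exists and is unique when $V$ is strictly convex). $V',V''$ are the gradient and Hessian of $V$; $\mathcal{I}:=\mathbb{E}V'(\xi)\otimes V'(\xi)$ is the Fisher information matrix (under Assumption 1 it equals $\mathbb{E}V''(\xi)$). Assumption 1 (constants $M,L,m>0$): (i) $V$ is strictly convex and twice continuously differentiable with $\|V''\|_{L_\infty}=\sup_x\|V''(x)\|\le M$ and $\|V''\|_{\rm Lip}=\sup_{x\ne y}\|V''(x)-V''(y)\|/\|x-y\|\le L$; (ii) $\mathcal{I}\succeq mI_d$. Poincaré constant: $c(V)$ is the smallest $C$ such that $\mathrm{Var}(g(\xi))\le C\,\mathbb{E}\|\nabla g(\xi)\|^2$ for all locally Lipschitz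 $g:\mathbb{R}^d\to\mathbb{R}$. Hölder norm: for $s=l+\rho$, $l\ge0$ an integer, $\rho\in(0,1]$, and $f:\mathbb{R}^d\to\mathbb{R}$ that is $l$ times differentiable, $\|f\|_{C^s}:=\max_{0\le j\le l}\sup_x\|f^{(j)}(x)\|\vee\sup_{x\neq y}\frac{\|f^{(l)}(x)-f^{(l)}(y)\|}{\|x-y\|^\rho}$; $f\in C^s$ means this is finite. The functions $f_k$: for bounded $g$ on $\mathbb{R}^d$ let $(\mathcal{T}g)(\theta):=\mathbb{E}_\theta g(\hat\theta)$ and $(\mathcal{B}g)(\theta):=(\mathcal{T}g)(\theta)-g(\theta)$. Then $f_k:=\sum_{j=0}^k(-1)^j\mathcal{B}^jf$. Orlicz norm: for convex non-decreasing $\psi$ with $\psi(0)=0$, $\|\eta\|_\psi:=\inf\{a\ge0:\mathbb{E}\psi(|\eta|/a)\le1\}$; $\|\cdot\|_{L_\psi(\mathbb{P}_\theta)}$ is this norm with expectation under $\mathbb{P}_\theta$. *)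

(* Defs.v *)
From HB Require Import structures.
From mathcomp Require Import all_boot all_order all_algebra.
From mathcomp Require Import all_classical all_reals all_analysis.

Set Implicit Arguments.
Unset Strict Implicit.
Unset Printing Implicit Defensive.

Import Order.TTheory GRing.Theory Num.Theory.
Import numFieldNormedType.Exports.

Local Open Scope classical_set_scope.
Local Open Scope ring_scope.

(* R^d is ['rV[R]_d].  Its library norm is the max norm, which induces the
   usual topology and the usual Frechet derivatives; every norm appearing
   explicitly in the mathematics is built from [enorm]. *)
Definition enorm {R : realType} {d : nat} (u : 'rV[R]_d) : R :=
  Num.sqrt (\sum_i u 0 i ^+ 2).

(* The product sigma-algebra, i.e. the Borel sigma-algebra, of R^d. *)
Section measurable_rV.
Variables (R : realType) (n : nat).

Let coord : 'I_n -> 'rV[R]_n -> R := fun i u => u 0 i.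

Let rV_set0 : g_sigma_preimage coord set0.
Proof. exact: sigma_algebra0. Qed.

Let rV_setC A : g_sigma_preimage coord A -> g_sigma_preimage coord (~` A).
Proof. exact: sigma_algebraC. Qed.

Let rV_bigcup (F : _^nat) : (forall i, g_sigma_preimage coord (F i)) ->
  g_sigma_preimage coord (\bigcup_i (F i)).
Proof. exact: sigma_algebra_bigcup. Qed.

HB.instance Definition _ := @isMeasurable.Build default_measure_display
  'rV[R]_n (g_sigma_preimage coord) rV_set0 rV_setC rV_bigcup.

End measurable_rV.

Definition consrV {R : realType} {n : nat} (p : 'rV[R]_n * measurableTypeR R) :
    'rV[R]_n.+1 :=
  \row_i (if unlift ord0 i is Some j then p.1 0 j else p.2).

Lemma measurable_coord_rV {R : realType} {n : nat} (i : 'I_n) :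
  measurable_fun [set: 'rV[R]_n] (fun u : 'rV[R]_n => u 0 i).
Proof.
move=> _ Y mY; rewrite setTI; apply: sub_sigma_algebra => /=.
rewrite -bigcup_seq/=; exists i => /=; first by rewrite mem_index_enum.
by exists Y => //; rewrite setTI.
Qed.

Lemma measurable_consrV {R : realType} {n : nat} :
  measurable_fun [set: 'rV[R]_n * measurableTypeR R] (@consrV R n).
Proof.
move=> _ A mA; rewrite setTI.
apply: (mA [set B | measurable (@consrV R n @^-1` B)]); split.
  split => /=.
  - by rewrite preimage_set0.
  - move=> B mB; rewrite setTD preimage_setC; exact: measurableC.
  - by move=> F mF; rewrite preimage_bigcup; exact: bigcupT_measurable.
rewrite -bigcup_seq/=; apply: bigcup_sub => i _ B [C mC <-] /=.
rewrite setTI -comp_preimage.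
rewrite (_ : _ \o _ = if unlift ord0 i is Some j then
  (fun u : 'rV[R]_n => u 0 j) \o fst else snd); last first.
  by apply/funext => p /=; rewrite mxE; case: (unlift ord0 i).
rewrite -[X in measurable X]setTI.
case: (unlift ord0 i) => [j|]; last exact: measurable_snd.
exact: (measurableT_comp (measurable_coord_rV j) measurable_fst).
Qed.

(* Lebesgue measure on R^d, as an iterated product of Lebesgue measures on R. *)
Definition leb_step {R : realType} {n : nat}
    (mu : {measure set 'rV[R]_n -> \bar R}) :
    {measure set 'rV[R]_n.+1 -> \bar R} :=
  measure_function_pushforward__canonical__measure_function_Measure
    (mu \x (@lebesgue_measure R))%E measurable_consrV.

Fixpoint leb {R : realType} (d : nat) : {measure set 'rV[R]_d -> \bar R} :=
  if d is n.+1 then leb_step (leb n) else \d_(0 : 'rV[R]_0).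

Lemma measurable_box {R : realType} (d : nat) (A : 'I_d -> set (measurableTypeR R)) :
  (forall i, measurable (A i)) ->
  measurable [set u : 'rV[R]_d | forall i, A i (u 0 i)].
Proof.
move=> mA; rewrite (_ : mkset _ =
    \bigcap_(i in [set: 'I_d]) [set u : 'rV[R]_d | A i (u 0 i)]); last first.
  by apply/seteqP; split => u /= h i; [move=> _|]; exact: h.
apply: fin_bigcap_measurable => // i _.
rewrite -[X in measurable X]setTI.
exact: (measurable_coord_rV i measurableT (mA i)).
Qed.

Lemma leb_box {R : realType} (d : nat) (A : 'I_d -> set (measurableTypeR R)) :
  (forall i, measurable (A i)) ->
  leb d [set u : 'rV[R]_d | forall i, A i (u 0 i)] =
  (\prod_(i < d) lebesgue_measure (A i))%E.
Proof.
elim: d A => [|d IH] A mA.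
  by rewrite big_ord0 /= diracE mem_set// => -[].
have mB i : measurable (A (lift ord0 i)) by [].
rewrite big_ord_recl muleC -(IH _ mB) /= /pushforward.
rewrite -(product_measure1E (leb d) (@lebesgue_measure R)); last 2 first.
- exact: (measurable_box mB).
- exact: mA.
congr (_ _); apply/seteqP; split => -[u x] /=.
  move=> h; split=> [i|].
    by have := h (lift ord0 i); rewrite mxE liftK.
  by have := h ord0; rewrite mxE unlift_none.
case=> h0 h1 i; rewrite mxE.
by case: unliftP => [j|] -> //=.
Qed.

(* Derivatives as multilinear forms: [mderive f j x vs] is
   f^(j)(x)[v_1, ..., v_j]. *)
Definition mderive {R : realType} {d : nat} (f : 'rV[R]_d -> R) (j : nat)
    (x : 'rV[R]_d) (vs : j.-tuple 'rV[R]_d) : R :=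
  foldr (fun v (g : 'rV[R]_d -> R) (y : 'rV[R]_d) => 'D_v g y) f vs x.

(* In finite dimension, x |-> f'(x) is l times Frechet differentiable as soon
   as each of its values x |-> f'(x)[v] is. *)
Fixpoint ntimes_differentiable {R : realType} {d : nat} (l : nat)
    (f : 'rV[R]_d -> R) : Prop :=
  if l is l'.+1 then
    (forall x, differentiable f x) /\
    (forall v : 'rV[R]_d, ntimes_differentiable l' (fun x => 'D_v f x))
  else True.

Definition opnorm {R : realType} {d j : nat}
    (F : j.-tuple 'rV[R]_d -> R) : \bar R :=
  ereal_sup [set `|F vs|%:E |
    vs in [set vs : j.-tuple 'rV[R]_d | forall i, enorm (tnth vs i) <= 1]].

Definition deriv_sup {R : realType} {d : nat} (j : nat)
    (f : 'rV[R]_d -> R) : \bar R :=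
  ereal_sup [set opnorm (mderive f (j := j) x) | x in [set: 'rV[R]_d]].

Definition deriv_holder {R : realType} {d : nat} (l : nat) (rho : R)
    (f : 'rV[R]_d -> R) : \bar R :=
  ereal_sup [set (opnorm (fun vs : l.-tuple 'rV[R]_d =>
                     (mderive f xy.1 vs - mderive f xy.2 vs)%R)
                  * ((enorm (xy.1 - xy.2) `^ rho)^-1)%:E)%E |
    xy in [set xy : 'rV[R]_d * 'rV[R]_d | xy.1 <> xy.2]].

(* The Holder norm of C^s, s = l + rho. *)
Definition holder_norm {R : realType} {d : nat} (l : nat) (rho : R)
    (f : 'rV[R]_d -> R) : \bar R :=
  maxe (\big[maxe/0%E]_(j < l.+1) deriv_sup j f) (deriv_holder l rho f).

Definition holder_class {R : realType} {d : nat} (l : nat) (rho : R)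
    (f : 'rV[R]_d -> R) : Prop :=
  ntimes_differentiable l f /\ (holder_norm l rho f < +oo)%E.

Definition gradient {R : realType} {d : nat} (f : 'rV[R]_d -> R)
    (x : 'rV[R]_d) : 'rV[R]_d :=
  \row_i 'D_(delta_mx 0 i) f x.

Definition strictly_convex {R : realType} {d : nat} (V : 'rV[R]_d -> R) : Prop :=
  forall (x y : 'rV[R]_d) (t : R), x <> y -> 0 < t < 1 ->
    V (t *: x + (1 - t) *: y) < t * V x + (1 - t) * V y.

Definition twice_continuously_differentiable {R : realType} {d : nat}
    (V : 'rV[R]_d -> R) : Prop :=
  ntimes_differentiable 2 V /\
  forall vs : 2.-tuple 'rV[R]_d, continuous (fun x => mderive V x vs).

Definition fisher_information {R : realType} {d : nat}
    (P : probability 'rV[R]_d R) (V : 'rV[R]_d -> R) : 'M[R]_d :=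
  \matrix_(i, j) fine 'E_P[fun x => (gradient V x 0 i * gradient V x 0 j)%R]%E.

(* P is the law of xi.  The Lipschitz seminorm of V'' is its Holder seminorm
   of exponent 1. *)
Definition assumption1 {R : realType} {d : nat} (P : probability 'rV[R]_d R)
    (V : 'rV[R]_d -> R) (L M m : R) : Prop :=
  [/\ strictly_convex V,
      twice_continuously_differentiable V,
      (deriv_sup 2 V <= M%:E)%E,
      (deriv_holder 2 1 V <= L%:E)%E &
      forall u : 'rV[R]_d,
        m * enorm u ^+ 2 <= (u *m fisher_information P V *m u^T) 0 0].

(* The library's local Lipschitz predicate asks for a Lipschitz bound near every
   pair of points; off the diagonal this is only local boundedness, so it is
   local Lipschitz continuity.
   The gradient of a locally Lipschitz function exists almost everywhere; the
   values of [gradient] at the remaining points do not affect the integral.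
   The variance is +oo when g is not square integrable.  The constant is +oo
   when no C is admissible. *)
Definition poincare_constant {R : realType} {d : nat}
    (P : probability 'rV[R]_d R) : \bar R :=
  ereal_inf [set C%:E | C in [set C : R | 0 <= C /\
    forall g : 'rV[R]_d -> R, [locally [lipschitz g x | x in setT]] ->
      ('V_P[g] <= C%:E * \int[P]_x (enorm (gradient g x) ^+ 2)%:E)%E]].

(* The value a = 0 is left out because x / 0 = 0 in MathComp; this does not
   change the infimum. *)
Definition orlicz_norm {R : realType} {disp : measure_display}
    {T : measurableType disp} (P : probability T R) (psi : R -> R)
    (eta : T -> R) : \bar R :=
  ereal_inf [set a%:E | a in [set a : R | 0 < a /\
    (\int[P]_w (psi (`|eta w| / a))%:E <= 1)%E]].

Definition density_law {R : realType} {d : nat} (V : 'rV[R]_d -> R)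
    (theta : 'rV[R]_d) (A : set 'rV[R]_d) : \bar R :=
  (\int[leb d]_(x in A) (expR (- V (x - theta)))%:E)%E.

(* Under [Pr theta], the X_i are i.i.d. with density x |-> e^{-V(x-theta)}. *)
Definition location_sample {R : realType} {d n : nat} {disp : measure_display}
    {T : measurableType disp} (V : 'rV[R]_d -> R)
    (Pr : 'rV[R]_d -> probability T R) (X : 'I_n -> {mfun T >-> 'rV[R]_d}) :
    Prop :=
  forall theta,
    (forall i A, measurable A ->
       distribution (Pr theta) (X i) A = density_law V theta A) /\
    (forall A : 'I_n -> set 'rV[R]_d, (forall i, measurable (A i)) ->
       Pr theta [set w | forall i, A i (X i w)] =
       (\prod_(i < n) Pr theta (X i @^-1` A i))%E).

Definition mle {R : realType} {d n : nat} (V : 'rV[R]_d -> R)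
    (x : 'I_n -> 'rV[R]_d) : 'rV[R]_d :=
  let risk t := n%:R^-1 * \sum_j V (x j - t) in
  xget 0 [set t | forall t', risk t <= risk t'].

Section estimator.
Context {R : realType} {d : nat} {disp : measure_display}
  {T : measurableType disp}.
Variables (Pr : 'rV[R]_d -> probability T R) (that : T -> 'rV[R]_d).

Definition calT (g : 'rV[R]_d -> R) (theta : 'rV[R]_d) : R :=
  fine ('E_(Pr theta)[g \o that])%E.

Definition calB (g : 'rV[R]_d -> R) (theta : 'rV[R]_d) : R :=
  calT g theta - g theta.

Definition bias_reduced (k : nat) (f : 'rV[R]_d -> R) (theta : 'rV[R]_d) : R :=
  \sum_(j < k.+1) (-1) ^+ j * iter j calB f theta.

End estimator.

Definition sigma_f {R : realType} {d : nat} (I : 'M[R]_d)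
    (f : 'rV[R]_d -> R) (theta : 'rV[R]_d) : R :=
  Num.sqrt ((gradient f theta *m invmx I *m (gradient f theta)^T) 0 0).

(* Main.v *)
Require Import Defs.
From HB Require Import structures.
From mathcomp Require Import all_boot all_order all_algebra.
From mathcomp Require Import all_classical all_reals all_analysis.
From mathcomp Require Import measurable_realfun.
From mathcomp Require Import ring lra zify.

(* The maximum likelihood estimator is compared with theta + z, where z is the (k+1)-st Newton-type iterate for the score
   equation with the Hessian frozen at the Fisher information I.  Up to constants the two differ by W^(k+2), where W is the
   size of the score plus the deviation of the empirical Hessian from I, and W^2 <= C (d + T)/n with T of bounded exponential
   moment.  For the estimator theta + z the operator B maps C^(l+1+rho) into C^(l+rho) with norm O(E|z|) = O(sqrt(d/n)), and
   E z = O(d/n) gives a factor (d/n)^((1+rho)/2) in its last application, so that E f_k(theta + z) - f(theta) is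
   O((d/n)^(s/2)).  The gradient in each observation of
   F = f_k(theta + z) - <f'(theta), I^-1 score> is O(n^-1 (d/n)^(rho/2) (1 + W sqrt(n/d))), and the tensorized Poincare
   inequality, applied to powers of F - E F, bounds its 2^i-th moments by (C sqrt(c(V)/n) (d/n)^(rho/2) p^(3/2))^p, p = 2^i,
   which is a psi_(2/3) tail.

   There remains the linear term S, an average of n independent summands of variance sigma^2.  Rotate from sqrt(n) S to
   sigma Z, X_b = cos b sqrt(n) S + sin b sigma Z.  A translation of the sample acts on X_b like a translation of Z, so the
   derivative of X_b can be replaced, in expectations against functions of X_b, by cos b Z (sigma^2 - tau)/sigma, where tau is
   an average with mean sigma^2 and fluctuations O(n^-1/2).  Convexity of psi then bounds the variation of the Orlicz norm
   along the path by the Orlicz norm of Z (sigma^2 - tau)/sigma.  All 1/n errors are absorbed because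
   c(V) >= m/M^2, as the test function <V', e> shows. *)

Set Implicit Arguments.
Unset Strict Implicit.
Unset Printing Implicit Defensive.
Import Order.TTheory GRing.Theory Num.Theory.
Import numFieldNormedType.Exports.
Local Open Scope classical_set_scope.
Local Open Scope ring_scope.

(** * Expectations and tame random variables *)

(** Two obstacles shape the proof. The maximum likelihood estimator depends on the sample only
    implicitly, with no measurability or derivative at hand, whereas the Poincare inequality wants a
    locally Lipschitz function whose gradient in each observation is controlled. Hence the explicit
    proxy; the estimator itself enters only through pointwise inequalities, under integrals that are
    monotone on all functions. With k+1 iterations the distance between the two is of order
    (d/n)^((k+2)/2), at most (d/n)^(s/2) because rho <= 1 and d <= n. The exponent 3/2 of p has two
    sources: a factor p from the derivative of the p-th power, and p^(1/2) from the moments of the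
    sub-Gaussian gradient bound. The exponents are powers of 2 because the variance of the j-th
    power controls the 2j-th moment through the j-th one. As psi need not be smooth, Orlicz norms
    are not differentiated along the rotation: the quarter turn is cut into small steps, and at each
    step an admissible scale is passed on by a subgradient inequality. *)

Section expectation.
Context {d} {T : measurableType d} {R : realType} (P : probability T R).
Implicit Types f g : T -> R.

Definition itg f := P.-integrable setT (EFin \o f).
Definition Ex f : R := Rintegral P setT f.

Lemma itg_meas f : itg f -> measurable_fun setT f.
Proof. by move=> /integrableP[/measurable_EFinP]. Qed.

Lemma itg_le f g : measurable_fun setT f -> itg g ->
  (forall x, `|f x| <= g x) -> itg f.
Proof.
move=> mf ig fg; apply: (le_integrable measurableT _ _ ig).
- exact/measurable_EFinP.
- by move=> x _ /=; rewrite lee_fin (le_trans (fg x))// ler_norm.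
Qed.

Lemma itg_ge0 f : measurable_fun setT f -> (forall x, 0 <= f x) ->
  (\int[P]_x (f x)%:E < +oo)%E -> itg f.
Proof.
move=> mf f0 fi; apply/integrableP; split; first exact/measurable_EFinP.
by under eq_integral do rewrite /= ger0_norm//.
Qed.

Lemma itg_cst c : itg (fun=> c).
Proof. exact: finite_measure_integrable_cst. Qed.

Lemma itg_bounded f M : measurable_fun setT f -> (forall x, `|f x| <= M) ->
  itg f.
Proof. by move=> mf fM; apply: (itg_le mf (itg_cst M)). Qed.

Lemma itgD f g : itg f -> itg g -> itg (fun x => f x + g x).
Proof. by move=> i j; have := integrableD measurableT i j. Qed.

Lemma itgN f : itg f -> itg (fun x => - f x).
Proof. by move=> i; have := integrableN i. Qed.

Lemma itgB f g : itg f -> itg g -> itg (fun x => f x - g x).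
Proof. by move=> i j; apply: itgD => //; exact: itgN. Qed.

Lemma itgZ c f : itg f -> itg (fun x => c * f x).
Proof. by move=> i; have := integrableZl measurableT c i. Qed.

Lemma itg_norm f : itg f -> itg (fun x => `|f x|).
Proof. by move=> i; have := integrable_abse i. Qed.

Lemma ExE f : itg f -> (\int[P]_x (f x)%:E = (Ex f)%:E)%E.
Proof. by move=> i; rewrite /Ex /Rintegral fineK// integrable_fin_num. Qed.

Lemma ExD f g : itg f -> itg g -> Ex (fun x => f x + g x) = Ex f + Ex g.
Proof. by move=> i j; rewrite /Ex RintegralD. Qed.

Lemma ExB f g : itg f -> itg g -> Ex (fun x => f x - g x) = Ex f - Ex g.
Proof. by move=> i j; rewrite /Ex RintegralB. Qed.

Lemma ExZ c f : itg f -> Ex (fun x => c * f x) = c * Ex f.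
Proof. by move=> i; rewrite /Ex RintegralZl. Qed.

Lemma Ex_cst c : Ex (fun=> c) = c.
Proof. by rewrite /Ex Rintegral_cst//= [X in fine X]probability_setT mulr1. Qed.

Lemma Ex_le f g : itg f -> itg g -> (forall x, f x <= g x) -> Ex f <= Ex g.
Proof. by move=> i j fg; apply: le_Rintegral. Qed.

Lemma Ex_ge0 f : (forall x, 0 <= f x) -> 0 <= Ex f.
Proof. by move=> f0; apply: Rintegral_ge0. Qed.

Lemma Ex_norm f : itg f -> `|Ex f| <= Ex (fun x => `|f x|).
Proof. by move=> i; apply: le_normr_Rintegral. Qed.

Lemma Ex_le_cst f c : itg f -> (forall x, f x <= c) -> Ex f <= c.
Proof. by move=> i fc; rewrite -[leRHS]Ex_cst; apply: Ex_le => //; exact: itg_cst. Qed.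

Lemma Ex_norm_le_cst f c : measurable_fun setT f -> (forall x, `|f x| <= c) ->
  `|Ex f| <= c.
Proof.
move=> mf fc; have i := itg_bounded mf fc.
by rewrite (le_trans (Ex_norm i))// Ex_le_cst//; exact: itg_norm.
Qed.

Lemma eq_Ex f g : (forall x, f x = g x) -> Ex f = Ex g.
Proof. by move=> fg; congr Ex; apply/funext. Qed.

Lemma itg_sum (I : Type) (s : seq I) (p : pred I) (F : I -> T -> R) :
  (forall i, p i -> itg (F i)) -> itg (fun x => \sum_(i <- s | p i) F i x).
Proof.
move=> h; elim: s => [|i s IH].
  by under [X in itg X]eq_fun do rewrite big_nil; exact: itg_cst.
under [X in itg X]eq_fun do rewrite big_cons.
by case: (boolP (p i)) => // pi; apply: itgD => //; exact: h.
Qed.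

Lemma Ex_sum (I : Type) (s : seq I) (p : pred I) (F : I -> T -> R) :
  (forall i, p i -> itg (F i)) ->
  Ex (fun x => \sum_(i <- s | p i) F i x) = \sum_(i <- s | p i) Ex (F i).
Proof.
move=> h; elim: s => [|i s IH].
  by rewrite big_nil -[RHS]Ex_cst; apply: eq_Ex => x; rewrite big_nil.
rewrite big_cons (eq_Ex (g := fun x => if p i then F i x +
   \sum_(i <- s | p i) F i x else \sum_(i <- s | p i) F i x)); last first.
  by move=> x; rewrite big_cons.
by case: ifPn => // pi; rewrite ExD// ?IH//; [exact: h|exact: itg_sum].
Qed.

(* [ge0_le_integral] without measurability of the smaller function. *)
Lemma le_EE (f g : T -> \bar R) : (forall x, 0 <= f x)%E ->
  (forall x, f x <= g x)%E -> (\int[P]_x f x <= \int[P]_x g x)%E.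
Proof.
move=> f0 fg; have g0 x : (0 <= g x)%E by exact: le_trans (f0 x) (fg x).
rewrite !ge0_integralTE//; apply: ereal_sup_le => _ [h hf <-] /=.
by exists h => // x; exact: le_trans (hf x) (fg x).
Qed.

Lemma EE_cst c : (\int[P]_x c%:E = c%:E)%E.
Proof. by rewrite integral_cst//= [X in (_ * X)%E]probability_setT mule1. Qed.

Lemma EE_Zl c f : 0 <= c -> measurable_fun setT f -> (forall x, 0 <= f x) ->
  (\int[P]_x (c * f x)%:E = c%:E * \int[P]_x (f x)%:E)%E.
Proof.
move=> c0 mf f0; under eq_integral do rewrite EFinM.
rewrite ge0_integralZl//; first exact/measurable_EFinP.
by move=> x _; rewrite lee_fin.
Qed.

(** The passage from extended to real integrals: bounds are first proved for extended integrals,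
    which make sense before integrability is known, and then yield it. *)
Lemma EE_leE f c : measurable_fun setT f -> (forall x, 0 <= f x) ->
  (\int[P]_x (f x)%:E <= c%:E)%E -> itg f /\ Ex f <= c.
Proof.
move=> mf f0 h; have i : itg f by apply: itg_ge0 => //; exact: le_lt_trans h (ltry _).
by split=> //; rewrite -lee_fin -ExE.
Qed.

(** Nonnegativity of the variance, expanded; integrability of [f] comes first, from
    [|f| <= 1 + f^2]. *)
Lemma Ex_cauchy_schwarz_norm f : measurable_fun setT f -> itg (fun x => f x ^+ 2) ->
  itg f /\ Ex f ^+ 2 <= Ex (fun x => f x ^+ 2).
Proof.
move=> mf i2.
have i : itg f.
  apply: (itg_le mf (itgD (itg_cst 1) i2)) => x.
  rewrite ler_norml; apply/andP; split; nra.
split=> //; have : 0 <= Ex (fun x => (f x - Ex f) ^+ 2).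
  by apply: Ex_ge0 => x; exact: sqr_ge0.
rewrite (eq_Ex (g := fun x => f x ^+ 2 - (2 * Ex f) * f x + Ex f ^+ 2)); last first.
  by move=> x; ring.
have iZ := itgZ (2 * Ex f) i.
rewrite ExD; [|by apply: itgB|exact: itg_cst].
by rewrite ExB// ExZ// Ex_cst; nra.
Qed.

(** Finiteness of all moments is stable under sums, products and powers, so that side conditions on
    products of scores, Hessians and test functions follow from the shape of the expression. *)
Definition tame f := measurable_fun setT f /\
  forall k : nat, itg (fun x => `|f x| ^+ k).

Lemma tame_itg f : tame f -> itg f.
Proof.
by move=> [mf /(_ 1%N) h]; apply: (itg_le mf h) => x; rewrite expr1.
Qed.

Lemma tame_le f g : measurable_fun setT f -> tame g ->
  (forall x, `|f x| <= `|g x|) -> tame f.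
Proof.
move=> mf [mg tg] fg; split=> // k; apply: itg_le (tg k) _.
  by apply: measurable_funX; exact: measurableT_comp.
by move=> x; rewrite normrX normr_id; apply: lerXn2r (fg x); rewrite nnegrE.
Qed.

Lemma tame_cst c : tame (fun=> c).
Proof. by split => // k; exact: itg_cst. Qed.

Lemma ler_normD_pow (a b : R) k : `|a + b| ^+ k <= 2 ^+ k * (`|a| ^+ k + `|b| ^+ k).
Proof.
wlog ab : a b / `|a| <= `|b|.
  by move=> h; case/orP: (le_total `|a| `|b|) => /h //; rewrite addrC [in X in _ * X]addrC.
apply: (@le_trans _ _ ((2 * `|b|) ^+ k)).
  apply: lerXn2r; rewrite ?nnegrE ?mulr_ge0//.
  by rewrite (le_trans (ler_normD _ _))// mulr2n mulrDl mul1r lerD2r.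
by rewrite exprMn ler_wpM2l ?exprn_ge0// lerDr exprn_ge0.
Qed.

Lemma tameD f g : tame f -> tame g -> tame (fun x => f x + g x).
Proof.
move=> [mf tf] [mg tg]; have mfg : measurable_fun setT (fun x => f x + g x).
  exact: measurable_funD.
split=> // k; apply: (itg_le _ (itgZ (2 ^+ k) (itgD (tf k) (tg k)))).
  by apply: measurable_funX; exact: measurableT_comp.
by move=> x; rewrite normrX normr_id; exact: ler_normD_pow.
Qed.

Lemma tameM f g : tame f -> tame g -> tame (fun x => f x * g x).
Proof.
move=> [mf tf] [mg tg]; have mfg : measurable_fun setT (fun x => f x * g x).
  exact: measurable_funM.
split=> // k; apply: (itg_le _ (itgD (tf (k * 2)%N) (tg (k * 2)%N))).
  by apply: measurable_funX; exact: measurableT_comp.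
move=> x; rewrite normrX normr_id normrM exprMn !exprM.
move: (`|f x| ^+ k) (`|g x| ^+ k) => a b; nra.
Qed.

Lemma tameZ c f : tame f -> tame (fun x => c * f x).
Proof. by move=> tf; apply: tameM => //; exact: tame_cst. Qed.

Lemma tameN f : tame f -> tame (fun x => - f x).
Proof.
by move=> /(tameZ (-1)); under eq_fun do rewrite mulN1r.
Qed.

Lemma tameB f g : tame f -> tame g -> tame (fun x => f x - g x).
Proof. by move=> tf tg; apply: tameD => //; exact: tameN. Qed.

Lemma tame_norm f : tame f -> tame (fun x => `|f x|).
Proof.
move=> tf; apply: (tame_le _ tf); first by apply: measurableT_comp => //; exact: tf.1.
by move=> x; rewrite normr_id.
Qed.

Lemma tameX f k : tame f -> tame (fun x => f x ^+ k).
Proof.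
move=> tf; elim: k => [|k IH]; first by under eq_fun do rewrite expr0; exact: tame_cst.
by under eq_fun do rewrite exprS; exact: tameM.
Qed.

Lemma tame_bounded f M : measurable_fun setT f -> (forall x, `|f x| <= M) ->
  tame f.
Proof.
move=> mf fM; apply: (tame_le mf (tame_cst M)) => x.
by rewrite (le_trans (fM x))// ler_norm.
Qed.

End expectation.

Lemma exprn_fact_le_expR (R : realType) (x : R) n : 0 <= x -> x ^+ n <= n`!%:R * expR x.
Proof.
move=> x0; rewrite -ler_pdivrMl ?ltr0n ?fact_gt0// mulrC.
case: n => [|n]; first by rewrite fact0 expr0 divr1 (le_trans _ (expR_ge1Dx x))// lerDl.
by rewrite (le_trans _ (expR_ge1Dxn n x0))// lerDr.
Qed.

Lemma measurable_expR_comp {d} {T : measurableType d} {R : realType} (f : T -> R) :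
  measurable_fun setT f -> measurable_fun setT (fun x => expR (f x)).
Proof. exact: measurableT_comp. Qed.

Section tame_exp.
Context {d} {T : measurableType d} {R : realType} (P : probability T R).
Implicit Types f g : T -> R.

(** Powers of [expR f] are again exponentials, and [|f|^k <= k! exp |f|]. *)
Lemma tame_exp f : measurable_fun setT f ->
  (forall l : R, (\int[P]_x (expR (l * `|f x|))%:E < +oo)%E) ->
  tame P (fun x => expR (f x)) /\ tame P f.
Proof.
move=> mf h; have mn : measurable_fun setT (fun x => `|f x|) by exact: measurableT_comp.
have ie (l : R) : itg P (fun x => expR (l * `|f x|)).
  apply: itg_ge0 => [|x|]; [|exact: expR_ge0|exact: h].
  by apply: measurableT_comp => //; exact: measurable_funM.
split; split=> //.
- exact: measurableT_comp.
- move=> k; apply: (itg_le _ (ie k%:R)).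
    by apply: measurable_funX; do 2 apply: measurableT_comp => //.
  move=> x; rewrite normrX normr_id ger0_norm ?expR_ge0// -expRM_natl ler_expR.
  by rewrite ler_wpM2l ?ler0n// ler_norm.
- move=> k; apply: (itg_le _ (itgZ k`!%:R (ie 1))).
    exact: measurable_funX.
  by move=> x; rewrite normrX normr_id mul1r; exact: exprn_fact_le_expR.
Qed.

End tame_exp.

(** * Laws of independent samples, and integration against a density *)

Section iid.
Context {d} {T : measurableType d} {R : realType} (P : probability T R).

Definition consT n (p : T * n.-tuple T) : n.+1.-tuple T := [tuple of p.1 :: p.2].

Lemma measurable_consT n : measurable_fun setT (@consT n).
Proof. exact: measurable_cons. Qed.

HB.instance Definition _ n := isMeasurableFun.Build _ _ _ _ (@consT n) (@measurable_consT n).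

(** Built by adding one observation at a time at the front, so that statements on samples are proved
    by induction and Tonelli's theorem; the base case is the Dirac mass at the empty tuple. *)
Fixpoint piid n : probability (n.-tuple T) R :=
  if n is m.+1 then distribution (P \x piid m)%E (@consT m)
  else dirac [tuple].

Lemma ge0_piidS n (f : n.+1.-tuple T -> \bar R) : measurable_fun setT f ->
  (forall t, 0 <= f t)%E ->
  (\int[piid n.+1]_t f t = \int[P]_x \int[piid n]_t f (consT (x, t)))%E.
Proof.
move=> mf f0; rewrite ge0_integral_distribution// fubini_tonelli1//.
- exact: measurableT_comp.
- by move=> x /=.
Qed.

Lemma piid0 (f : 0.-tuple T -> \bar R) : (\int[piid 0]_t f t = f [tuple])%E.
Proof.
rewrite (_ : f = cst (f [tuple])); last by apply/funext => t; rewrite tuple0.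
by rewrite integral_cst//= [X in (_ * X)%E]probability_setT mule1.
Qed.

End iid.
Section density.
Import HBNNSimple.
Context {d} {T : measurableType d} {R : realType}.
Variables (mu nu : {measure set T -> \bar R}) (p : T -> R).
Hypotheses (mp : measurable_fun setT p) (p0 : forall x, 0 <= p x).
Hypothesis nuE : forall A, measurable A -> nu A = (\int[mu]_(x in A) (p x)%:E)%E.

(** True for indicators by [nuE], hence for simple functions; monotone convergence along
    [nnsfun_approx] is used on both sides. *)
Lemma ge0_integral_density (g : T -> \bar R) : measurable_fun setT g ->
  (forall x, 0 <= g x)%E ->
  (\int[nu]_x g x = \int[mu]_x (g x * (p x)%:E))%E.
Proof.
move=> mg g0; pose h := nnsfun_approx measurableT mg.
have gE x : g x = lim ((EFin \o h n) x @[n --> \oo]).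
  by apply/esym/cvg_lim => //; exact: cvg_nnsfun_approx.
have -> : (\int[nu]_x g x)%E = lim ((\int[nu]_x (EFin \o h n) x)%E @[n --> \oo]).
  under eq_integral => x _ do rewrite gE.
  apply: monotone_convergence => //.
  - by move=> n; apply/measurable_EFinP.
  - by move=> n x _ /=; rewrite lee_fin.
  - by move=> x _ a b ab; rewrite lee_fin; exact/lefP/nd_nnsfun_approx.
have -> : (\int[mu]_x (g x * (p x)%:E))%E =
    lim ((\int[mu]_x ((EFin \o h n) x * (p x)%:E))%E @[n --> \oo]).
  have gpE x : (g x * (p x)%:E)%E = lim (((EFin \o h n) x * (p x)%:E)%E @[n --> \oo]).
    by apply/esym/cvg_lim => //; apply: cvgeZr => //; exact: cvg_nnsfun_approx.
  under eq_integral => x _ do rewrite gpE.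
  apply: monotone_convergence => //.
  - by move=> n; apply: emeasurable_funM; apply/measurable_EFinP.
  - by move=> n x _ /=; rewrite mule_ge0// lee_fin.
  - move=> x _ a b ab /=; rewrite lee_wpmul2r ?lee_fin//.
    exact/lefP/nd_nnsfun_approx.
suff suf n : (\int[mu]_x ((EFin \o h n) x * (p x)%:E) = \int[nu]_x (EFin \o h n) x)%E.
  by congr (limn _); apply/funext => n; rewrite suf.
transitivity (\int[nu]_x
   (\sum_(y \in range (h n)) (y * \1_(h n @^-1` [set y]) x)%:E))%E; last first.
  by apply: eq_integral => t _; rewrite /= fimfunE -fsumEFin.
have indich m r : measurable_fun setT (fun x => (r * \1_(h m @^-1` [set r]) x)%:E).
  by apply/measurable_EFinP; exact: measurable_funM.
rewrite ge0_integral_fsum//; last by move=> m y Ey; exact: nnfun_muleindic_ge0.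
transitivity (\int[mu]_x (\sum_(y \in range (h n))
    ((y * \1_(h n @^-1` [set y]) x)%:E * (p x)%:E)))%E.
  under [RHS]eq_integral => x xE.
    rewrite -ge0_mule_fsuml => [|y]; last exact: nnfun_muleindic_ge0.
    rewrite fsumEFin // -(fimfunE _ x); over.
  by [].
rewrite ge0_integral_fsum//; last 2 first.
  - by move=> y; apply: emeasurable_funM => //; exact/measurable_EFinP.
  - move=> m y Ey; rewrite mule_ge0 ?lee_fin// -lee_fin EFinM.
    exact: nnfun_muleindic_ge0.
apply: eq_fsbigr => r /[!inE] -[x _ <-].
under eq_integral do rewrite EFinM -muleA.
rewrite ge0_integralZl//; first last.
- by rewrite lee_fin.
- by move=> y _; rewrite mule_ge0 ?lee_fin.
- by apply: emeasurable_funM; exact/measurable_EFinP.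
under [RHS]eq_integral do rewrite EFinM.
rewrite [RHS]ge0_integralZl//; [|exact/measurable_EFinP|by rewrite lee_fin].
rewrite integral_indic// setIT nuE// [in RHS]integral_mkcond; congr (_ * _)%E.
apply: eq_integral => y _; rewrite patchE indicE.
by case: ifPn => _; rewrite ?mul1e ?mul0e.
Qed.

End density.

(** * The standard Gaussian law *)

Section std_gauss.
Context {R : realType}.
Notation gam := (@normal_prob R 0 1).

Lemma ge0_integral_gauss (g : R -> \bar R) : measurable_fun setT g ->
  (forall x, 0 <= g x)%E ->
  (\int[gam]_x g x = \int[lebesgue_measure]_x (g x * (normal_pdf 0 1 x)%:E))%E.
Proof.
move=> mg g0; apply: (@ge0_integral_density _ _ _ lebesgue_measure gam) => //.
- exact: measurable_normal_pdf.
- by move=> x; exact: normal_pdf_ge0.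
Qed.

Lemma normal_pdf01E (x : R) :
  normal_pdf 0 1 x = (Num.sqrt (pi *+ 2))^-1 * expR (- (x ^+ 2 / 2)).
Proof.
rewrite /normal_pdf oner_eq0 /normal_peak /normal_fun.
by rewrite expr1n mul1r subr0 mulNr.
Qed.

(** The product of [exp (z^2 / 4)] and the standard density is [sqrt 2] times the centred normal
    density of variance 2. The integral is [sqrt 2], and [e] is a convenient upper bound. *)
Lemma integral_gauss_exp_sqr :
  (\int[gam]_z (expR (z ^+ 2 / 4))%:E <= (expR 1)%:E)%E.
Proof.
have m1 : measurable_fun setT (fun z : R => (expR (z ^+ 2 / 4))%:E).
  apply/measurable_EFinP; apply: measurableT_comp => //.
  by apply: measurable_funM => //; exact: measurable_funX.
rewrite ge0_integral_gauss//.
have s20 : Num.sqrt 2 != 0 :> R by rewrite sqrtr_eq0 -ltNge ltr0n.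
have E x : ((expR (x ^+ 2 / 4))%:E * (normal_pdf 0 1 x)%:E =
    (Num.sqrt 2)%:E * (normal_pdf 0 (Num.sqrt 2) x)%:E :> \bar R)%E.
  rewrite -!EFinM; congr EFin; rewrite normal_pdf01E.
  rewrite /normal_pdf (negbTE s20) /normal_peak /normal_fun subr0 sqr_sqrtr//.
  rewrite -[2 * pi *+ 2]mulrnAr sqrtrM// invfM -[in RHS]mulrA mulVKf//.
  by rewrite mulrCA -expRD; congr (_ * expR _); field.
under eq_integral do rewrite E.
rewrite ge0_integralZl//; first last.
- by move=> x _; rewrite lee_fin normal_pdf_ge0.
- by apply/measurable_EFinP; exact: measurable_normal_pdf.
rewrite integral_normal_pdf mule1 lee_fin.
rewrite (@le_trans _ _ 2)//; last by rewrite (le_trans _ (expR_ge1Dx 1)).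
have := sqr_sqrtr (ler0n R 2); have := sqrtr_ge0 (2 : R); nra.
Qed.

Lemma lebesgue_measure_shift (k : R) (A : set R) : measurable A ->
  pushforward lebesgue_measure ((fun x => x + k) : _ -> measurableTypeR R) A =
  lebesgue_measure A.
Proof.
move=> mA; apply/esym.
have mphi : measurable_fun setT ((fun x => x + k) : R -> measurableTypeR R).
  exact: measurable_funD.
apply: (lebesgue_measure_unique (mu :=
  measure_function_pushforward__canonical__measure_function_Measure
    lebesgue_measure mphi)) => //= _ [[a b]] _ <-.
rewrite /pushforward (_ : _ @^-1` _ = `]a - k, b - k]%classic); last first.
  by apply/seteqP; split => x /=; rewrite !in_itv/= ltrBlDr lerBrDr.
rewrite !lebesgue_measure_itv/= !lte_fin ltrD2r; case: ifP => // _.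
by rewrite -!EFinD opprB addrA subrK.
Qed.

Lemma ge0_integral_shift (g : R -> \bar R) (k : R) : measurable_fun setT g ->
  (forall x, 0 <= g x)%E ->
  (\int[lebesgue_measure]_z g (z + k)%R = \int[lebesgue_measure]_z g z)%E.
Proof.
move=> mg g0.
pose phi := (fun x : R => x + k) : _ -> measurableTypeR R.
have mphi : measurable_fun setT phi by exact: measurable_funD.
transitivity (\int[pushforward lebesgue_measure phi]_z g z)%E.
  by rewrite ge0_integral_pushforward// => x _.
by apply: eq_measure_integral => A mA _; exact: lebesgue_measure_shift.
Qed.

(** Cameron-Martin formula: translation invariance of Lebesgue measure, and the ratio of two normal
    densities. *)
Lemma integral_gauss_shift (g : R -> \bar R) (k : R) : measurable_fun setT g ->
  (forall x, 0 <= g x)%E ->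
  (\int[gam]_z g (z + k)%R = \int[gam]_z (g z * (expR (k * z - k ^+ 2 / 2)%R)%:E))%E.
Proof.
move=> mg g0.
have mk : measurable_fun setT (fun z : R => (expR (k * z - k ^+ 2 / 2))%:E).
  apply/measurable_EFinP; apply: measurableT_comp => //.
  by apply: measurable_funB => //; exact: measurable_funM.
rewrite !ge0_integral_gauss//; last 3 first.
- exact: emeasurable_funM.
- by move=> x; rewrite mule_ge0// lee_fin expR_ge0.
- by apply: measurableT_comp mg _; exact: measurable_funD.
rewrite -(@ge0_integral_shift (fun z => _ * (expR _)%:E * _)%E k); last 2 first.
- apply: emeasurable_funM; first exact: emeasurable_funM.
  by apply/measurable_EFinP; exact: measurable_normal_pdf.
- by move=> x; rewrite !mule_ge0// lee_fin ?expR_ge0// normal_pdf_ge0.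
apply: eq_integral => z _; rewrite -muleA; congr (_ * _)%E.
rewrite -EFinM !normal_pdf01E mulrCA -expRD; congr (_ * expR _)%:E.
by field.
Qed.

(** The weight in [integral_gauss_shift] has total mass 1, by taking the constant function there. *)
Lemma integral_gauss_exp (a : R) :
  (\int[gam]_z (expR (a * z))%:E = (expR (a ^+ 2 / 2))%:E)%E.
Proof.
have := integral_gauss_shift a (measurable_cst (1%E : \bar R)) (fun=> lee01).
rewrite integral_cst//= [X in (_ * X)%E]probability_setT mule1 => h.
have m1 : measurable_fun setT (fun z : R => (expR (a * z))%:E).
  by apply/measurable_EFinP; apply: measurableT_comp => //; exact: measurable_funM.
under eq_integral do rewrite -[_ * _](subrK (a ^+ 2 / 2)) expRD mulrC EFinM.
rewrite ge0_integralZl//.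
- by under eq_integral do rewrite -[(_%:E)%E]mul1e; rewrite -h mule1.
- apply/measurable_EFinP; apply: measurableT_comp => //.
  by apply: measurable_funB => //; exact: measurable_funM.
Qed.

End std_gauss.

(** * Product laws, the Efron-Stein and McDiarmid inequalities *)

Section bounded_product.
Context {d1 d2} {T1 : measurableType d1} {T2 : measurableType d2} {R : realType}.
Variables (P : probability T1 R) (Q : probability T2 R).

(** Adding the bound [M] makes the integrand nonnegative, so that Tonelli's theorem applies; the
    constant is subtracted afterwards. [Ex_prod] and [Ex_swap] proceed in the same way. *)
Lemma measurable_Ex2 (f : T1 * T2 -> R) (M : R) : measurable_fun setT f ->
  (forall z, `|f z| <= M) -> measurable_fun setT (fun x => Ex Q (fun y => f (x, y))).
Proof.
move=> mf fM.
have mg : measurable_fun setT (fun z => (f z + M)%:E).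
  by apply/measurable_EFinP; exact: measurable_funD.
have g0 z : (0 <= (f z + M)%:E)%E.
  by rewrite lee_fin -lerBlDr sub0r; have := fM z; rewrite ler_norml => /andP[].
have mfx x : measurable_fun setT (fun y => f (x, y)).
  exact: measurableT_comp.
have := measurable_fun_fubini_tonelli_F (m2 := Q) _ mg g0.
rewrite /fubini_F => /= h.
rewrite (_ : (fun x => Ex Q _) = (fun x => fine (\int[Q]_y (f (x, y) + M)%:E)%E - M)).
  apply: measurable_funB => //; exact: measurableT_comp h.
apply/funext => x; have i1 := itg_bounded Q (mfx x) (fun y => fM (x, y)).
have := ExE (itgD i1 (itg_cst Q M)) => ->.
by rewrite ExD ?Ex_cst/= ?addrK//; exact: itg_cst.
Qed.

Lemma Ex_prod (f : T1 * T2 -> R) (M : R) : measurable_fun setT f ->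
  (forall z, `|f z| <= M) ->
  Ex (P \x Q)%E f = Ex P (fun x => Ex Q (fun y => f (x, y))).
Proof.
move=> mf fM.
have mg : measurable_fun setT (fun z => (f z + M)%:E).
  by apply/measurable_EFinP; exact: measurable_funD.
have g0 z : (0 <= (f z + M)%:E)%E.
  by rewrite lee_fin -lerBlDr sub0r; have := fM z; rewrite ler_norml => /andP[].
have mfx x : measurable_fun setT (fun y => f (x, y)).
  exact: measurableT_comp.
have i12 := itg_bounded (P \x Q)%E mf fM.
have := fubini_tonelli1 (m1 := P) (m2 := Q) _ mg g0.
rewrite (ExE (itgD i12 (itg_cst _ M))) /fubini_F.
have i2 x := itg_bounded Q (mfx x) (fun y => fM (x, y)).
have eqi x : (\int[Q]_y (f (x, y) + M)%:E)%E = (Ex Q (fun y => f (x, y)) + M)%:E.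
  by rewrite (ExE (itgD (i2 x) (itg_cst _ M))) ExD ?Ex_cst//; exact: itg_cst.
under eq_integral do rewrite eqi.
have mE := measurable_Ex2 mf fM.
have i1 : itg P (fun x => Ex Q (fun y => f (x, y))).
  by apply: (itg_bounded _ mE) => x; apply: Ex_norm_le_cst (mfx x) _ => y.
rewrite (ExE (itgD i1 (itg_cst _ M))) => -[].
by rewrite !ExD ?Ex_cst//; [move/addIr|exact: itg_cst|exact: itg_cst].
Qed.

End bounded_product.

Lemma Ex_swap {d1 d2} {T1 : measurableType d1} {T2 : measurableType d2} {R : realType}
  (P : probability T1 R) (Q : probability T2 R) (f : T1 * T2 -> R) (M : R) :
  measurable_fun setT f -> (forall z, `|f z| <= M) ->
  Ex P (fun x => Ex Q (fun y => f (x, y))) = Ex Q (fun y => Ex P (fun x => f (x, y))).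
Proof.
move=> mf fM.
pose g := fun z : T2 * T1 => f (z.2, z.1).
have mg : measurable_fun setT g.
  by apply: measurableT_comp => //; exact: measurable_fun_pair.
have mh (c : R) : measurable_fun setT (fun z : T1 * T2 => (f z + c)%:E).
  by apply/measurable_EFinP; exact: measurable_funD.
have h0 z : (0 <= (f z + M)%:E)%E.
  by rewrite lee_fin -lerBlDr sub0r; have := fM z; rewrite ler_norml => /andP[].
have := fubini_tonelli (m1 := P) (m2 := Q) _ (mh M) h0.
have m1 x : measurable_fun setT (fun y => f (x, y)) by exact: measurableT_comp.
have m2 y : measurable_fun setT (fun x => f (x, y)) by exact: measurableT_comp.
have i1 x := itg_bounded Q (m1 x) (fun y => fM (x, y)).
have i2 y := itg_bounded P (m2 y) (fun x => fM (x, y)).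
have e1 x : (\int[Q]_y (f (x, y) + M)%:E)%E = (Ex Q (fun y => f (x, y)) + M)%:E.
  by rewrite (ExE (itgD (i1 x) (itg_cst _ M))) ExD ?Ex_cst//; exact: itg_cst.
have e2 y : (\int[P]_x (f (x, y) + M)%:E)%E = (Ex P (fun x => f (x, y)) + M)%:E.
  by rewrite (ExE (itgD (i2 y) (itg_cst _ M))) ExD ?Ex_cst//; exact: itg_cst.
under eq_integral do rewrite e1.
under [RHS]eq_integral do rewrite e2.
have j1 : itg P (fun x => Ex Q (fun y => f (x, y))).
  by apply: (itg_bounded _ (measurable_Ex2 Q mf fM)) => x; apply: Ex_norm_le_cst (m1 x) _ => y.
have j2 : itg Q (fun y => Ex P (fun x => f (x, y))).
  by apply: (itg_bounded _ (measurable_Ex2 P mg (fun z => fM (z.2, z.1)))) => x; apply: Ex_norm_le_cst (m2 x) _ => y.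
rewrite (ExE (itgD j1 (itg_cst _ M))) (ExE (itgD j2 (itg_cst _ M))) => -[].
by rewrite !ExD ?Ex_cst//; [move/addIr|exact: itg_cst|exact: itg_cst].
Qed.

(* The Hoeffding (Efron-Stein) decomposition of the variance: expand
   [0 <= E (f - E_x f - E_y f + E f)^2]. *)
Lemma variance_prod_le {d1 d2} {T1 : measurableType d1} {T2 : measurableType d2}
  {R : realType} (P : probability T1 R) (Q : probability T2 R) (f : T1 * T2 -> R) (M : R) :
  measurable_fun setT f -> (forall z, `|f z| <= M) ->
  Ex (P \x Q)%E (fun z => f z ^+ 2) - Ex (P \x Q)%E f ^+ 2 <=
  Ex Q (fun y => Ex P (fun x => f (x, y) ^+ 2) - Ex P (fun x => f (x, y)) ^+ 2) +
  Ex P (fun x => Ex Q (fun y => f (x, y) ^+ 2) - Ex Q (fun y => f (x, y)) ^+ 2).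
Proof.
move=> mf fM.
have M0 : 0 <= M by apply: le_trans (fM (point, point)).
have mf2 : measurable_fun setT (fun z => f z ^+ 2) by exact: measurable_funX.
have fM2 z : `|f z ^+ 2| <= M ^+ 2.
  by rewrite normrX; apply: lerXn2r (fM z); rewrite nnegrE.
have m1 x : measurable_fun setT (fun y => f (x, y)) by exact: measurableT_comp.
have m2 y : measurable_fun setT (fun x => f (x, y)) by exact: measurableT_comp.
pose a y := Ex P (fun x => f (x, y)); pose b x := Ex Q (fun y => f (x, y)).
have mg : measurable_fun setT (fun z : T2 * T1 => f (z.2, z.1)).
  by apply: measurableT_comp => //; exact: measurable_fun_pair.
have mg2 : measurable_fun setT (fun z : T2 * T1 => f (z.2, z.1) ^+ 2) by exact: measurable_funX.
have ma : measurable_fun setT a := measurable_Ex2 P mg (fun z => fM (z.2, z.1)).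
have mb : measurable_fun setT b := measurable_Ex2 Q mf fM.
have aM y : `|a y| <= M by apply: Ex_norm_le_cst (m2 y) _ => x.
have bM x : `|b x| <= M by apply: Ex_norm_le_cst (m1 x) _ => y.
set PQ := (P \x Q)%E; pose c := Ex PQ f.
have cb : c = Ex P b by exact: Ex_prod mf fM.
have ca : c = Ex Q a by rewrite cb; exact: Ex_swap mf fM.
have sq_le (u : R) : `|u| <= M -> `|u ^+ 2| <= M ^+ 2.
  by move=> uM; rewrite normrX; apply: lerXn2r uM; rewrite nnegrE.
have mul_le (u v : R) : `|u| <= M -> `|v| <= M -> `|u * v| <= M ^+ 2.
  by move=> uM vM; rewrite normrM expr2; apply: ler_pM.
have maz : measurable_fun setT (fun z : T1 * T2 => a z.2) by exact: measurableT_comp.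
have mbz : measurable_fun setT (fun z : T1 * T2 => b z.1) by exact: measurableT_comp.
have Ea2 : Ex PQ (fun z => a z.2 ^+ 2) = Ex Q (fun y => a y ^+ 2).
  rewrite (Ex_prod P Q (M := M ^+ 2)); [|exact: measurable_funX|by move=> z; exact: sq_le].
  by rewrite /= Ex_cst.
have Eb2 : Ex PQ (fun z => b z.1 ^+ 2) = Ex P (fun x => b x ^+ 2).
  rewrite (Ex_prod P Q (M := M ^+ 2)); [|exact: measurable_funX|by move=> z; exact: sq_le].
  by apply: eq_Ex => x /=; rewrite Ex_cst.
have Efa : Ex PQ (fun z => f z * a z.2) = Ex Q (fun y => a y ^+ 2).
  rewrite (Ex_prod P Q (M := M ^+ 2)); [|exact: measurable_funM|by move=> z; exact: mul_le].
  rewrite (Ex_swap P Q (f := fun z => f z * a z.2) (M := M ^+ 2)); [|exact: measurable_funM|by move=> z; exact: mul_le].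
  apply: eq_Ex => y /=; rewrite expr2 -ExZ; last exact: itg_bounded (m2 y) (fun x => fM (x, y)).
  by apply: eq_Ex => x; rewrite mulrC.
have Efb : Ex PQ (fun z => f z * b z.1) = Ex P (fun x => b x ^+ 2).
  rewrite (Ex_prod P Q (M := M ^+ 2)); [|exact: measurable_funM|by move=> z; exact: mul_le].
  apply: eq_Ex => x /=; rewrite expr2 -ExZ; last exact: itg_bounded (m1 x) (fun y => fM (x, y)).
  by apply: eq_Ex => y; rewrite mulrC.
have Eab : Ex PQ (fun z => a z.2 * b z.1) = c ^+ 2.
  rewrite (Ex_prod P Q (M := M ^+ 2)); [|exact: measurable_funM|by move=> z; exact: mul_le].
  rewrite expr2 {2}cb -ExZ; last exact: itg_bounded mb bM.
  apply: eq_Ex => x /=; rewrite ca mulrC -ExZ; last exact: itg_bounded ma aM.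
  by apply: eq_Ex => y; rewrite mulrC.
have Ea : Ex PQ (fun z => a z.2) = c.
  by rewrite (Ex_prod P Q (M := M)) /= ?Ex_cst//; move=> z; exact: aM.
have Eb : Ex PQ (fun z => b z.1) = c.
  rewrite (Ex_prod P Q (M := M)) //= cb.
  by apply: eq_Ex => x /=; rewrite Ex_cst.
have Eff : Ex PQ (fun z => f z ^+ 2) = Ex P (fun x => Ex Q (fun y => f (x, y) ^+ 2)).
  exact: Ex_prod mf2 fM2.
have Eff' : Ex PQ (fun z => f z ^+ 2) = Ex Q (fun y => Ex P (fun x => f (x, y) ^+ 2)).
  by rewrite Eff; exact: Ex_swap mf2 fM2.
have mg2' := measurable_Ex2 P mg2 (fun z => fM2 (z.2, z.1)).
have mf2' := measurable_Ex2 Q mf2 fM2.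
have g2M y : `|Ex P (fun x => f (x, y) ^+ 2)| <= M ^+ 2.
  by apply: Ex_norm_le_cst => [|x]; [exact: measurable_funX|exact: fM2].
have f2M x : `|Ex Q (fun y => f (x, y) ^+ 2)| <= M ^+ 2.
  by apply: Ex_norm_le_cst => [|y]; [exact: measurable_funX|exact: fM2].
have ia2 : itg Q (fun y => a y ^+ 2).
  by apply: (@itg_bounded _ _ _ _ _ (M ^+ 2)) => [|y]; [exact: measurable_funX|exact: sq_le].
have ib2 : itg P (fun y => b y ^+ 2).
  by apply: (@itg_bounded _ _ _ _ _ (M ^+ 2)) => [|y]; [exact: measurable_funX|exact: sq_le].
rewrite ExB//; last exact: itg_bounded mg2' g2M.
rewrite ExB//; last exact: itg_bounded mf2' f2M.
rewrite -Eff -Eff' -/c.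
have I2 (u v : T1 * T2 -> R) : measurable_fun setT u -> measurable_fun setT v ->
    (forall z, `|u z| <= M) -> (forall z, `|v z| <= M) -> itg PQ (fun z => u z * v z).
  move=> mu mv uM vM; apply: (@itg_bounded _ _ _ _ _ (M ^+ 2)) => [|z]; first exact: measurable_funM.
  exact: mul_le.
have iff := I2 _ _ mf mf fM fM; have ifa := I2 _ _ mf maz fM (fun z => aM z.2).
have ifb := I2 _ _ mf mbz fM (fun z => bM z.1).
have iaa := I2 _ _ maz maz (fun z => aM z.2) (fun z => aM z.2).
have ibb := I2 _ _ mbz mbz (fun z => bM z.1) (fun z => bM z.1).
have iab := I2 _ _ maz mbz (fun z => aM z.2) (fun z => bM z.1).
have if1 := itg_bounded PQ mf fM.
have ia1 := itg_bounded PQ maz (fun z => aM z.2).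
have ib1 := itg_bounded PQ mbz (fun z => bM z.1).
(* After expansion with the cross terms just computed, this reads
   [E f^2 - E a^2 - E b^2 + c^2 >= 0], which is a rearrangement of the claim. *)
have : 0 <= Ex PQ (fun z => (f z - a z.2 - b z.1 + c) ^+ 2).
  by apply: Ex_ge0 => z; exact: sqr_ge0.
pose G z := (f z * f z + (a z.2 * a z.2 + (b z.1 * b z.1 + c ^+ 2)))
   + (- 2) * (f z * a z.2 + (f z * b z.1 + ((- 1) * (a z.2 * b z.1) +
     ((- c) * f z + (c * a z.2 + c * b z.1))))).
rewrite (@eq_Ex _ _ _ _ _ G); last by move=> z; rewrite /G; ring.
rewrite /G.
have iT1 : itg PQ (fun z => a z.2 * a z.2 + (b z.1 * b z.1 + c ^+ 2)).
  by apply: itgD => //; apply: itgD => //; exact: itg_cst.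
have iT2 : itg PQ (fun z => b z.1 * b z.1 + c ^+ 2) by apply: itgD => //; exact: itg_cst.
have iU1 : itg PQ (fun z => c * a z.2 + c * b z.1) by apply: itgD; exact: itgZ.
have iU2 : itg PQ (fun z => (- c) * f z + (c * a z.2 + c * b z.1)).
  by apply: itgD => //; exact: itgZ.
have iU3 : itg PQ (fun z => (- 1) * (a z.2 * b z.1) + ((- c) * f z + (c * a z.2 + c * b z.1))).
  by apply: itgD => //; exact: itgZ.
have iU4 : itg PQ (fun z => f z * b z.1 + ((- 1) * (a z.2 * b z.1) +
   ((- c) * f z + (c * a z.2 + c * b z.1)))) by apply: itgD.
rewrite ExD//; [|exact: itgD|by apply: itgZ; exact: itgD].
rewrite ExD// ExD// ExD//; last exact: itg_cst.
rewrite (ExZ (- 2)); last by apply: itgD.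
rewrite ExD// ExD// ExD//; last exact: itgZ.
rewrite ExD//; last exact: itgZ.
rewrite ExD//; [|exact: itgZ|exact: itgZ].
rewrite (Ex_cst (P \x Q)%E) (ExZ (- 1))// (ExZ (- c))// !(ExZ c)//.
rewrite Efa Efb Eab Ea Eb -/c.
rewrite (_ : Ex PQ (fun z => a z.2 * a z.2) = Ex PQ (fun z => a z.2 ^+ 2))//.
rewrite (_ : Ex PQ (fun z => b z.1 * b z.1) = Ex PQ (fun z => b z.1 ^+ 2))//.
rewrite (_ : Ex PQ (fun z => f z * f z) = Ex PQ (fun z => f z ^+ 2))// Ea2 Eb2.
rewrite /a /b; generalize (Ex PQ (fun z => f z ^+ 2)) (Ex Q (fun y => Ex P (fun x => f (x, y)) ^+ 2))
  (Ex P (fun x => Ex Q (fun y => f (x, y)) ^+ 2)); clear; move=> *; lra.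
Qed.

Section upd_tuple.
Context {T : Type} {n : nat}.
Definition upd_tuple (t : n.-tuple T) (i : 'I_n) (y : T) : n.-tuple T :=
  [tuple if j == i then y else tnth t j | j < n].

Lemma tnth_updT t i y j : tnth (upd_tuple t i y) j = if j == i then y else tnth t j.
Proof. by rewrite tnth_mktuple. Qed.

Lemma upd_tuple_id t i : upd_tuple t i (tnth t i) = t.
Proof. by apply: eq_from_tnth => j; rewrite tnth_updT; case: eqP => [->|]. Qed.

Lemma upd_tuple_updT t i y y' : upd_tuple (upd_tuple t i y) i y' = upd_tuple t i y'.
Proof. by apply: eq_from_tnth => j; rewrite !tnth_updT; case: eqP. Qed.
End upd_tuple.

Section upd_tuple_consT.
Context {d} {T : measurableType d}.

Lemma tnth_consT0 n (x : T) (t : n.-tuple T) : tnth (consT (x, t)) ord0 = x.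
Proof. by []. Qed.

Lemma tnth_consTS n (x : T) (t : n.-tuple T) i : tnth (consT (x, t)) (lift ord0 i) = tnth t i.
Proof. by rewrite /consT tnthS. Qed.

Lemma upd_tuple_cons0 n (x : T) (t : n.-tuple T) y : upd_tuple (consT (x, t)) ord0 y = consT (y, t).
Proof.
apply: eq_from_tnth => j; rewrite tnth_updT.
by case: (unliftP ord0 j) => [j'|] ->; rewrite ?tnth_consTS ?eqxx.
Qed.

Lemma upd_tuple_consS n (x : T) (t : n.-tuple T) i y :
  upd_tuple (consT (x, t)) (lift ord0 i) y = consT (x, upd_tuple t i y).
Proof.
apply: eq_from_tnth => j; rewrite tnth_updT.
case: (unliftP ord0 j) => [j'|] ->; first by rewrite !tnth_consTS tnth_updT (inj_eq lift_inj).
by rewrite (negbTE (neq_lift ord0 i)) !tnth_consT0.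
Qed.

Lemma measurable_upd_tuple n i (t : n.-tuple T) : measurable_fun setT (upd_tuple t i).
Proof.
apply/measurable_fun_tnthP => j; rewrite (_ : _ \o _ = fun y => if j == i then y else tnth t j).
  by case: (j == i).
by apply/funext => y /=; rewrite tnth_updT.
Qed.

End upd_tuple_consT.

Section iid_inequalities.
Context {d} {T : measurableType d} {R : realType} (P : probability T R).

Lemma Ex_piidS n (f : n.+1.-tuple T -> R) (M : R) : measurable_fun setT f ->
  (forall t, `|f t| <= M) ->
  Ex (piid P n.+1) f = Ex (P \x piid P n)%E (fun z => f (consT z)).
Proof.
move=> mf fM; have mc : measurable_fun setT (fun z : T * n.-tuple T => f (consT z)).
  by apply: measurableT_comp mf _; exact: measurable_consT.
apply: (@EFin_inj R); rewrite -!ExE.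
- rewrite integral_distribution//; first exact/measurable_EFinP.
  exact: itg_bounded mc (fun z => fM (consT z)).
- exact: itg_bounded mc (fun z => fM (consT z)).
- exact: itg_bounded mf fM.
Qed.

(** Induction on [n], [variance_prod_le] splitting off the first coordinate. The coordinatewise
    bound is given by a single function [D] integrated over the resampled coordinate, so that each
    of the [n] coordinates contributes one full integral of [D]. *)
Theorem efron_stein n (F D : n.-tuple T -> R) (M : R) :
  measurable_fun setT F -> (forall t, `|F t| <= M) ->
  measurable_fun setT D -> (forall t, 0 <= D t) ->
  (forall t i, ((Ex P (fun y => F (upd_tuple t i y) ^+ 2) - Ex P (fun y => F (upd_tuple t i y)) ^+ 2)%:E
     <= \int[P]_y (D (upd_tuple t i y))%:E)%E) ->
  ((Ex (piid P n) (fun t => F t ^+ 2) - Ex (piid P n) F ^+ 2)%:E <=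
   n%:R%:E * \int[piid P n]_t (D t)%:E)%E.
Proof.
elim: n F D => [|n IH] F D mF FM mD D0 h.
  have E0 (f : 0.-tuple T -> R) : Ex (piid P 0) f = f [tuple].
    rewrite -[RHS](Ex_cst (piid P 0)); apply: eq_Ex => t; by rewrite tuple0.
  by rewrite !E0 subrr mul0e.
have M0 : 0 <= M by apply: le_trans (FM point).
pose f := fun z : T * n.-tuple T => F (consT z).
have mf : measurable_fun setT f by apply: measurableT_comp mF _; exact: measurable_consT.
have fM z : `|f z| <= M by exact: FM.
have mF2 : measurable_fun setT (fun t => F t ^+ 2) by exact: measurable_funX.
have FM2 t : `|F t ^+ 2| <= M ^+ 2 by rewrite normrX; apply: lerXn2r (FM t); rewrite nnegrE.
rewrite (Ex_piidS mF FM) (Ex_piidS mF2 FM2).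
have mD' : measurable_fun setT (fun z : T * n.-tuple T => (D (consT z))%:E).
  by apply/measurable_EFinP; apply: measurableT_comp mD _; exact: measurable_consT.
have vle := variance_prod_le P (piid P n) mf fM.
rewrite -lee_fin in vle; apply: le_trans vle _.
have EED : (\int[piid P n.+1]_t (D t)%:E = \int[P]_x \int[piid P n]_t (D (consT (x, t)))%:E)%E.
  by rewrite ge0_piidS//; exact/measurable_EFinP.
have EED' : (\int[piid P n.+1]_t (D t)%:E = \int[piid P n]_t \int[P]_x (D (consT (x, t)))%:E)%E.
  by rewrite EED (fubini_tonelli (fun z => (D (consT z))%:E))// => z; rewrite lee_fin.
have mf2 : measurable_fun setT (fun z => f z ^+ 2) by exact: measurable_funX.
have fM2 z : `|f z ^+ 2| <= M ^+ 2 by exact: FM2.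
have mg : measurable_fun setT (fun z : n.-tuple T * T => f (z.2, z.1)).
  by apply: measurableT_comp => //; exact: measurable_fun_pair.
have mg2 : measurable_fun setT (fun z : n.-tuple T * T => f (z.2, z.1) ^+ 2) by exact: measurable_funX.
have mfx x : measurable_fun setT (fun t => f (x, t)) by exact: measurableT_comp.
have mft t : measurable_fun setT (fun x => f (x, t)) by exact: measurableT_comp.
have bdiff (a b : R) : `|a| <= M ^+ 2 -> `|b| <= M -> `|a - b ^+ 2| <= M ^+ 2 + M ^+ 2.
  move=> aM bM; rewrite (le_trans (ler_normB _ _))// lerD// normrX.
  by apply: lerXn2r bM; rewrite nnegrE.
have i1 : itg (piid P n) (fun t => Ex P (fun x => f (x, t) ^+ 2) - Ex P (fun x => f (x, t)) ^+ 2).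
  apply: (@itg_bounded _ _ _ _ _ (M ^+ 2 + M ^+ 2)) => [|t].
    apply: measurable_funB; first exact: measurable_Ex2 mg2 (fun z => fM2 (z.2, z.1)).
    by apply: measurable_funX; exact: measurable_Ex2 mg (fun z => fM (z.2, z.1)).
  apply: bdiff; apply: Ex_norm_le_cst => //; exact: measurable_funX.
have i2 : itg P (fun x => Ex (piid P n) (fun t => f (x, t) ^+ 2) - Ex (piid P n) (fun t => f (x, t)) ^+ 2).
  apply: (@itg_bounded _ _ _ _ _ (M ^+ 2 + M ^+ 2)) => [|x].
    apply: measurable_funB; first exact: measurable_Ex2 mf2 fM2.
    by apply: measurable_funX; exact: measurable_Ex2 mf fM.
  apply: bdiff; apply: Ex_norm_le_cst => //; exact: measurable_funX.
have -> : (n.+1%:R%:E * \int[piid P n.+1]_t (D t)%:E = \int[piid P n.+1]_t (D t)%:E +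
    n%:R%:E * \int[piid P n.+1]_t (D t)%:E)%E.
  by rewrite -[n.+1%:R]natr1 EFinD ge0_muleDl ?mul1e ?lee_fin// addeC.
rewrite EFinD; apply: leeD; rewrite -ExE//.
- rewrite EED'; apply: le_EE => [t|t].
    rewrite lee_fin subr_ge0.
    by have [] := @Ex_cauchy_schwarz_norm _ _ _ P _ (mft t) (itg_bounded P (measurable_funX 2 (mft t)) (fun x => fM2 (x, t))).
  (* The slot about to be resampled may hold anything, hence the default point. *)
  have := h (consT (point, t)) ord0.
  rewrite (_ : upd_tuple (consT (point, t)) ord0 = fun y => consT (y, t))//.
  by apply/funext => y; exact: upd_tuple_cons0.
- have mDx x : measurable_fun setT (fun t => D (consT (x, t))).
    by apply: measurableT_comp mD _; apply: measurableT_comp (@measurable_consT _ _ n) _.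
  rewrite EED -ge0_integralZl//; first last.
  + by move=> x _; apply: integral_ge0 => t _; rewrite lee_fin.
  + have D0' z : (0 <= (D (@consT _ T n z))%:E)%E by rewrite lee_fin.
    exact: (measurable_fun_fubini_tonelli_F (m2 := piid P n) _ mD' D0').
  apply: le_EE => [x|x].
    rewrite lee_fin subr_ge0.
    by have [] := @Ex_cauchy_schwarz_norm _ _ _ (piid P n) _ (mfx x) (itg_bounded (piid P n) (measurable_funX 2 (mfx x)) (fun t => fM2 (x, t))).
  apply: IH => // [t i].
  have := h (consT (x, t)) (lift ord0 i).
  rewrite (_ : upd_tuple (consT (x, t)) (lift ord0 i) = fun y => consT (x, upd_tuple t i y))//.
  by apply/funext => y; exact: upd_tuple_consS.
Qed.

(** A substitute for Hoeffding's lemma: for a centred variable bounded by [c] it yields an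
    exponential moment of at most [exp (2 c^2)]. For [|y| <= 1/2] it comes from
    [exp y <= 1 / (1 - y) <= 1 + y + 2 y^2]; otherwise [2 y^2] is at least [|y|]. *)
Lemma expR_le_id_sqr (y : R) : expR y <= y + expR (2 * y ^+ 2).
Proof.
have h1 := expR_ge1Dx (2 * y ^+ 2); have h2 := expR_gt0 y.
case: (leP y (- 2^-1)) => [y1|y1].
  have e1 : expR y <= 1 by rewrite expR_le1; lra.
  nra.
case: (leP y 2^-1) => [y2|y2].
  have := expR_ge1Dx (- y); rewrite expRN => h3.
  have : expR y * (1 - y) <= 1 by rewrite mulrC -ler_pdivlMr// mul1r.
  move: (expR y) h2 => e e0 h4.
  have : (e - (1 + y + 2 * y ^+ 2)) * (1 - y) <= 0 by nra.
  rewrite pmulr_lle0; lra.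
have : expR y <= expR (2 * y ^+ 2) by rewrite ler_expR; nra.
lra.
Qed.

(** The deviation of [F] is split into its deviation from the mean [a] over the first coordinate and
    that of [a], which has the same bounded differences in the other coordinates. The factor [2 c^2]
    comes from [expR_le_id_sqr]; a sharper one would only change constants. *)
Theorem mcdiarmid n (F : n.-tuple T -> R) (M c : R) :
  measurable_fun setT F -> (forall t, `|F t| <= M) -> 0 <= c ->
  (forall t i y y', `|F (upd_tuple t i y) - F (upd_tuple t i y')| <= c) ->
  (\int[piid P n]_t (expR (F t - Ex (piid P n) F))%:E <= (expR (n%:R * (2 * c ^+ 2)))%:E)%E.
Proof.
move=> + + c0; elim: n F => [|n IH] F mF FM h.
  have E0 (f : 0.-tuple T -> R) : Ex (piid P 0) f = f [tuple].
    rewrite -[RHS](Ex_cst (piid P 0)); apply: eq_Ex => t; by rewrite tuple0.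
  by rewrite piid0 E0 subrr mul0r.
pose f := fun z : T * n.-tuple T => F (consT z).
have mf : measurable_fun setT f by apply: measurableT_comp mF _; exact: measurable_consT.
have fM z : `|f z| <= M by exact: FM.
have mft t : measurable_fun setT (fun x => f (x, t)) by exact: measurableT_comp.
have mg : measurable_fun setT (fun z : n.-tuple T * T => f (z.2, z.1)).
  by apply: measurableT_comp => //; exact: measurable_fun_pair.
pose a t := Ex P (fun x => f (x, t)).
have ma : measurable_fun setT a := measurable_Ex2 P mg (fun z => fM (z.2, z.1)).
have aM t : `|a t| <= M by apply: Ex_norm_le_cst (mft t) _ => x.
have it t : itg P (fun x => f (x, t)) := itg_bounded P (mft t) (fun x => fM (x, t)).
have EF : Ex (piid P n.+1) F = Ex (piid P n) a.
  by rewrite (Ex_piidS mF FM) (Ex_prod P (piid P n) mf fM); exact: Ex_swap mf fM.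
have key t : (\int[P]_x (expR (f (x, t) - a t))%:E <= (expR (2 * c ^+ 2))%:E)%E.
  have fa x : `|f (x, t) - a t| <= c.
    rewrite -{1}(Ex_cst P (f (x, t))) /a -ExB//; last exact: itg_cst.
    apply: Ex_norm_le_cst => [|x']; first exact: measurable_funB.
    by have := h (consT (x, t)) ord0 x x'; rewrite !upd_tuple_cons0.
  have mfa : measurable_fun setT (fun x => f (x, t) - a t) by exact: measurable_funB.
  have me : measurable_fun setT (fun x => expR (f (x, t) - a t)) by exact: measurableT_comp.
  have ie : itg P (fun x => expR (f (x, t) - a t)).
    apply: (itg_le me (itg_cst P (expR c))) => x; rewrite ger0_norm ?expR_ge0// ler_expR.
    by rewrite (le_trans _ (fa x))// ler_norm.
  rewrite ExE// lee_fin.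
  apply: (@le_trans _ _ (Ex P (fun x => (f (x, t) - a t) + expR (2 * c ^+ 2)))).
    apply: Ex_le => // [|x].
      by apply: itgD; [apply: itgB => //; exact: itg_cst|exact: itg_cst].
    rewrite (le_trans (expR_le_id_sqr _))// lerD2l ler_expR ler_wpM2l//.
    by rewrite -[leLHS]real_normK ?num_real//; apply: lerXn2r (fa x); rewrite nnegrE.
  rewrite ExD ?Ex_cst; [|by apply: itgB => //; exact: itg_cst|exact: itg_cst].
  by rewrite ExB ?Ex_cst ?subrr ?add0r//; exact: itg_cst.
have mE : measurable_fun setT (fun t => (expR (F t - Ex (piid P n.+1) F))%:E).
  by apply/measurable_EFinP; apply: measurableT_comp => //; exact: measurable_funB.
rewrite ge0_piidS//.
have mE' : measurable_fun setT (fun z : T * n.-tuple T => (expR (F (consT z) - Ex (piid P n.+1) F))%:E).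
  by apply: measurableT_comp mE _; exact: measurable_consT.
rewrite (fubini_tonelli (fun z => (expR (F (consT z) - Ex (piid P n.+1) F))%:E))//.
apply: (@le_trans _ _ (\int[piid P n]_t (expR (2 * c ^+ 2) * expR (a t - Ex (piid P n) a))%:E)%E).
  apply: le_EE => t; first by apply: integral_ge0 => x _; rewrite lee_fin expR_ge0.
  rewrite EF.
  under eq_integral => x _ do rewrite -[F _ - _](subrKA (a t)) addrC expRD.
  rewrite EE_Zl; [|exact: expR_ge0| |by move=> x; exact: expR_ge0].
    by rewrite mulrC EFinM lee_wpmul2l ?lee_fin ?expR_ge0//; exact: key.
  by apply: measurable_expR_comp; apply: measurable_funB => //; exact: (mft t).
rewrite EE_Zl; [|exact: expR_ge0| |by move=> x; exact: expR_ge0]; last first.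
  by apply: measurable_expR_comp; exact: measurable_funB.
have -> : expR (n.+1%:R * (2 * c ^+ 2)) = expR (2 * c ^+ 2) * expR (n%:R * (2 * c ^+ 2)).
  by rewrite -expRD -[n.+1%:R]natr1 [in LHS]mulrDl mul1r addrC.
rewrite EFinM lee_wpmul2l ?lee_fin ?expR_ge0//.
apply: IH => // t i y y'.
rewrite /a -ExB//; apply: Ex_norm_le_cst => [|x]; first exact: measurable_funB.
by have := h (consT (x, t)) (lift ord0 i) y y'; rewrite !upd_tuple_consS.
Qed.

Lemma iid_mgf_le n (g : T -> R) B : measurable_fun setT g -> 0 <= B ->
  (\int[P]_x (expR (g x))%:E <= B%:E)%E ->
  (\int[piid P n]_t (expR (\sum_i g (tnth t i)))%:E <= (B ^+ n)%:E)%E.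
Proof.
move=> mg B0 hB; have mG' m : measurable_fun setT (fun t : m.-tuple T => expR (\sum_i g (tnth t i))).
  apply: measurableT_comp => //; apply: measurable_sum => i.
  by apply: measurableT_comp mg _; exact: measurable_tnth.
have mG m : measurable_fun setT (fun t : m.-tuple T => (expR (\sum_i g (tnth t i)))%:E).
  by apply/measurable_EFinP; exact: mG'.
elim: n => [|n IH]; first by rewrite piid0 big_ord0 expR0.
rewrite ge0_piidS//.
apply: (@le_trans _ _ (\int[P]_x (B ^+ n * expR (g x))%:E)%E).
  apply: le_EE => x; first by apply: integral_ge0 => t _; rewrite lee_fin expR_ge0.
  under eq_integral => t _.
    rewrite big_ord_recl tnth_consT0; under eq_bigr do rewrite tnth_consTS.
    rewrite expRD; over.
  rewrite EE_Zl; [|exact: expR_ge0|exact: mG'|by move=> t; exact: expR_ge0].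
  by rewrite mulrC EFinM lee_wpmul2l ?lee_fin ?expR_ge0.
rewrite EE_Zl; [|exact: exprn_ge0|exact: measurable_expR_comp|by move=> t; exact: expR_ge0].
by rewrite exprSr EFinM lee_wpmul2l ?lee_fin ?exprn_ge0.
Qed.

End iid_inequalities.

(** * Moments from a Poincare inequality *)

Section moments.
Context {d} {T : measurableType d} {R : realType} (P : probability T R).

Lemma EE_fatou (h : nat -> T -> R) (f : T -> R) (B : R) :
  (forall n, measurable_fun setT (h n)) -> (forall n x, 0 <= h n x) ->
  (forall x, h n x @[n --> \oo] --> f x) ->
  (forall n, (\int[P]_x (h n x)%:E <= B%:E)%E) ->
  (\int[P]_x (f x)%:E <= B%:E)%E.
Proof.
move=> mh h0 hf hB.
have mEh n : measurable_fun setT (fun x => (h n x)%:E) by apply/measurable_EFinP.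
have := @fatou _ _ _ P setT measurableT (fun n x => (h n x)%:E) mEh
  (fun n x _ => eqbLR (lee_fin _ _) (h0 n x)).
have -> : (\int[P]_x limn_einf (fun n => (h n x)%:E) = \int[P]_x (f x)%:E)%E.
  apply: eq_integral => x _.
  have hE : (fun n => (h n x)%:E) @ \oo --> (f x)%:E by apply: cvg_EFin; [exact: nearW|exact: hf].
  by rewrite is_cvg_limn_einfE; [exact/cvg_lim|apply/cvg_ex; exists (f x)%:E].
move=> /le_trans; apply.
rewrite limn_einf_lim; apply: lime_le; first exact: is_cvg_einfs.
apply: nearW => n; apply: le_trans (hB n).
by apply: ereal_inf_lbound; exists n => /=.
Qed.

Lemma Ex_dominated_cvg (h : nat -> T -> R) (f g : T -> R) :
  (forall n, measurable_fun setT (h n)) -> measurable_fun setT f -> itg P g ->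
  (forall n x, `|h n x| <= g x) ->
  (forall x, h n x @[n --> \oo] --> f x) ->
  Ex P (h n) @[n --> \oo] --> Ex P f.
Proof.
move=> mh mf ig hg hf.
have ih n : itg P (h n) := itg_le (mh n) ig (hg n).
have fg x : `|f x| <= g x.
  have hn : `|h n x| @[n --> \oo] --> `|f x| by exact: cvg_norm.
  by rewrite -(cvg_lim _ hn)//; apply: limr_le; [apply/cvg_ex; exists `|f x| |exact: nearW].
have iff : itg P f := itg_le mf ig fg.
have [] := @dominated_convergence _ _ _ P setT measurableT (fun n x => (h n x)%:E)
  (fun x => (f x)%:E) (fun x => (g x)%:E).
- by move=> n; apply/measurable_EFinP.
- exact/measurable_EFinP.
- by apply: aeW => x _; apply: cvg_EFin; [exact: nearW|exact: hf].
- exact: ig.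
- by apply: aeW => x n _; rewrite lee_fin.
move=> _ _; under eq_fun do rewrite ExE//.
by rewrite ExE// => /fine_cvgP[].
Qed.

Lemma EE_exp_moment (X : T -> R) B q : measurable_fun setT X -> (forall x, 0 <= X x) ->
  (\int[P]_x (expR (X x))%:E <= B%:E)%E ->
  (\int[P]_x (X x ^+ q)%:E <= (q`!%:R * B)%:E)%E.
Proof.
move=> mX X0 h; apply: (@le_trans _ _ (\int[P]_x (q`!%:R * expR (X x))%:E)%E).
  apply: le_EE => x; rewrite lee_fin ?exprn_ge0//.
  exact: exprn_fact_le_expR.
rewrite EE_Zl; [|by []|exact: measurable_expR_comp|by move=> x; exact: expR_ge0].
by rewrite EFinM lee_wpmul2l// lee_fin.
Qed.

(* [exp (y^2 / 2)] is a Gaussian mixture of exponentials [exp (z y)]; the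
   coordinates of a sub-Gaussian vector are treated one after the other. *)
Lemma subgaussian_exp_sqr k (Y : 'I_k -> T -> R) (Z : T -> R) (B s : R) :
  0 < s -> 0 <= B -> (forall i, measurable_fun setT (Y i)) -> measurable_fun setT Z ->
  (forall u : 'I_k -> R, (\int[P]_x (expR (\sum_i u i * Y i x + Z x))%:E <=
     (B * expR (s ^+ 2 / 2 * \sum_i u i ^+ 2))%:E)%E) ->
  (\int[P]_x (expR (\sum_i Y i x ^+ 2 / (4 * s ^+ 2) + Z x))%:E <= (B * expR 1 ^+ k)%:E)%E.
Proof.
move=> s0; elim: k Y Z B => [|k IH] Y Z B B0 mY mZ h.
  have := h (fun=> 0); rewrite big_ord0 mulr0 expR0 => h0.
  have -> : expR 1 ^+ 0 = 1 :> R by [].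
  move: h0.
  by under [X in (_ -> X <= _)%E]eq_integral do rewrite big_ord0;
     under [X in (X <= _ -> _)%E]eq_integral do rewrite big_ord0.
pose Z' x := Y ord0 x ^+ 2 / (4 * s ^+ 2) + Z x.
have mZ' : measurable_fun setT Z'.
  by apply: measurable_funD => //; apply: measurable_funM => //; exact: measurable_funX.
under eq_integral => x _ do rewrite big_ord_recl [_ + \sum_(i < k) _]addrC -addrA -/(Z' x).
rewrite [expR 1 ^+ k.+1]exprS mulrA.
apply: (IH (fun i => Y (lift ord0 i)) Z' (B * expR 1)) => [|i||]//; first by rewrite mulr_ge0 ?expR_ge0.
move=> u.
(* Chosen so that [(c y)^2 / 2 = y^2 / (4 s^2)], the exponent to be produced by the Gaussian
   integral in [z]. The coefficient [z c] then adds [s^2 / 2 * (z c)^2 = z^2 / 4] to the exponent in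
   the hypothesis, and [integral_gauss_exp_sqr] turns this into one factor [e] per coordinate. *)
pose c : R := (Num.sqrt 2 * s)^-1.
have c2 : c ^+ 2 = (2 * s ^+ 2)^-1 by rewrite /c exprVn exprMn sqr_sqrtr.
pose lin x := \sum_(i < k) u i * Y (lift ord0 i) x + Z x.
have mlin : measurable_fun setT lin.
  by apply: measurable_funD => //; apply: measurable_sum => i; apply: measurable_funM.
have split_exp x : (expR (\sum_(i < k) u i * Y (lift ord0 i) x + Z' x))%:E =
    (\int[@normal_prob R 0 1]_z (expR (z * c * Y ord0 x + lin x))%:E)%E.
  have e z : z * c * Y ord0 x + lin x = lin x + (c * Y ord0 x) * z by ring.
  under eq_integral => z _ do rewrite e expRD.
  rewrite EE_Zl; [|exact: expR_ge0| |by move=> z; exact: expR_ge0]; last first.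
    by apply: measurable_expR_comp; exact: measurable_funM.
  rewrite integral_gauss_exp -EFinM -expRD; congr (expR _)%:E.
  rewrite /lin /Z' exprMn c2 addrA addrAC; congr (_ + _ + _).
  have : s != 0 by rewrite gt_eqF.
  by move=> s'; field.
under eq_integral do rewrite split_exp.
have mjoint : measurable_fun setT (fun w : T * R => (expR (w.2 * c * Y ord0 w.1 + lin w.1))%:E).
  apply/measurable_EFinP; apply: measurable_expR_comp; apply: measurable_funD.
    apply: measurable_funM; first exact: measurable_funM.
    exact: measurableT_comp.
  exact: measurableT_comp.
have := fubini_tonelli (m1 := P) (m2 := @normal_prob R 0 1) _ mjoint
   (fun w => eqbLR (lee_fin _ _) (expR_ge0 _)).
move=> /= ->.
pose S := \sum_(i < k) u i ^+ 2.
apply: (@le_trans _ _ (\int[@normal_prob R 0 1]_z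
   ((B * expR (s ^+ 2 / 2 * S)) * expR (z ^+ 2 / 4))%:E)%E).
  apply: le_EE => z; first by apply: integral_ge0 => x _; rewrite lee_fin expR_ge0.
  pose v (i : 'I_k.+1) := if unlift ord0 i is Some j then u j else z * c.
  have vE (w : 'I_k.+1 -> R) : \sum_i v i * w i = z * c * w ord0 + \sum_(i < k) u i * w (lift ord0 i).
    rewrite big_ord_recl /v unlift_none; congr (_ + _).
    by apply: eq_bigr => i _; rewrite liftK.
  have v2 : \sum_i v i ^+ 2 = z ^+ 2 * c ^+ 2 + S.
    rewrite big_ord_recl {1}/v unlift_none exprMn; congr (_ + _).
    by apply: eq_bigr => i _; rewrite /v liftK.
  have := h v.
  under eq_integral do rewrite vE -addrA -/(lin _).
  move=> /le_trans; apply; rewrite lee_fin -[leRHS]mulrA -expRD ler_wpM2l// ler_expR v2 c2.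
  have s' : s != 0 by rewrite gt_eqF.
  rewrite le_eqVlt; by apply/orP; left; apply/eqP; field.
rewrite EE_Zl; first last.
- by move=> z; exact: expR_ge0.
- by apply: measurable_expR_comp; apply: measurable_funM => //; exact: measurable_funX.
- by rewrite mulr_ge0 ?expR_ge0.
apply: (@le_trans _ _ ((B * expR (s ^+ 2 / 2 * S))%:E * (expR 1)%:E)%E).
  by rewrite lee_wpmul2l ?lee_fin ?mulr_ge0 ?expR_ge0//; exact: integral_gauss_exp_sqr.
by rewrite -EFinM lee_fin mulrAC.
Qed.

Lemma subgaussian_exp_sqr1 (Y : T -> R) (s : R) : 0 < s -> measurable_fun setT Y ->
  (forall l : R, (\int[P]_x (expR (l * Y x))%:E <= (expR (s ^+ 2 / 2 * l ^+ 2))%:E)%E) ->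
  (\int[P]_x (expR (Y x ^+ 2 / (4 * s ^+ 2)))%:E <= (expR 1)%:E)%E.
Proof.
move=> s0 mY h.
have := @subgaussian_exp_sqr 1 (fun=> Y) (fun=> 0) 1 s s0 ler01 (fun=> mY) (measurable_cst _).
rewrite expr1 mul1r => h1.
have := h1 (fun u => _); under eq_integral do rewrite big_ord1 addr0.
apply => u; rewrite !big_ord1 mul1r.
by under eq_integral do rewrite big_ord1 addr0; exact: h.
Qed.

End moments.

(** The arithmetic-geometric mean inequality for [m] copies of [a] and one [b]. In the inductive
    step the defect equals [(m+1) a^m (a - b)^2] plus [b] times the previous defect. *)
Lemma young_pow (R : realType) (a b : R) m : 0 <= a -> 0 <= b ->
  m.+1%:R * (a ^+ m * b) <= m%:R * a ^+ m.+1 + b ^+ m.+1.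
Proof.
move=> a0 b0; elim: m => [|m IH]; first by rewrite expr0 !mul1r mul0r add0r expr1.
have h1 : 0 <= (m.+1%:R * a ^+ m) * (a - b) ^+ 2.
  by rewrite mulr_ge0 ?sqr_ge0// mulr_ge0// exprn_ge0.
have h2 : 0 <= b * (m%:R * a ^+ m.+1 + b ^+ m.+1 - m.+1%:R * (a ^+ m * b)).
  by rewrite mulr_ge0// subr_ge0.
rewrite -subr_ge0; have : 0 <= (m.+1%:R * a ^+ m) * (a - b) ^+ 2 + b * (m%:R * a ^+ m.+1 + b ^+ m.+1 - m.+1%:R * (a ^+ m * b)) by rewrite addr_ge0.
congr (0 <= _); rewrite !exprS -![_.+2%:R]natr1 -![_.+1%:R]natr1; ring.
Qed.

(* The Poincare inequality is applied to [trunc r F]: the moments of [F] are not known to be finite beforehand. *)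
Section truncation.
Context {R : realType}.
(** A smooth form of clipping: bounded by [r], dominated by [|y|], with a continuous derivative of
    size at most 1, as the test functions of the Poincare hypothesis require. *)
Definition trunc (r y : R) : R := y / (1 + (y / r) ^+ 2).
Definition trunc' (r y : R) : R := (1 - (y / r) ^+ 2) / (1 + (y / r) ^+ 2) ^+ 2.

Lemma trunc_den_gt0 (r y : R) : 0 < 1 + (y / r) ^+ 2.
Proof. by rewrite ltr_pwDl ?sqr_ge0. Qed.

Lemma is_derive_trunc (r y : R) : is_derive y 1 (trunc r) (trunc' r y).
Proof.
have n0 : 1 + (y / r) ^+ 2 != 0 by rewrite gt_eqF ?trunc_den_gt0.
have d1 : is_derive y 1 (fun x : R => 1 + (x / r) ^+ 2) (2 * (y / r) / r).
  have := @is_deriveD _ _ _ (cst (1:R)) (fun x : R => (x / r) ^+ 2) y 1 0 (2 * (y / r) / r) _ _.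
  rewrite add0r; apply.
  have dd : is_derive y 1 (fun x : R => x / r) (r^-1).
    by apply: is_derive_eq; rewrite scaler0 add0r -[_ *: _]/(_ * _) mulr1.
  have := @is_deriveX _ _ (fun x : R => x / r) 2 y 1 r^-1 dd.
  by rewrite expr1 -[_ *: _]/(_ * _) => h; apply: is_derive_eq h _; rewrite mulr_natl.
have h := is_deriveM (is_derive_id y (1 : R)) (@is_deriveV R (fun x => 1 + (x / r) ^+ 2) y _ 1 n0 d1).
apply: is_derive_eq h _.
rewrite /trunc' -![_ *: _]/(_ * _) /=; move: n0; set u := y / r => n0.
have -> : y * (- (1 + u ^+ 2) ^- 2 * (2 * u / r)) = - (2 * u ^+ 2) / (1 + u ^+ 2) ^+ 2.
  by rewrite [in RHS]expr2 {3}/u; ring.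
by field.
Qed.

Lemma continuous_trunc' (r : R) : continuous (trunc' r).
Proof.
move=> y.
have hq : (x / r) ^+ 2 @[x --> y] --> (y / r) ^+ 2.
  have h : x / r @[x --> y] --> y / r by apply: cvgM => //; exact: cvg_cst.
  by rewrite expr2; under eq_fun do rewrite expr2; exact: cvgM.
have hd : (1 + (x / r) ^+ 2) @[x --> y] --> 1 + (y / r) ^+ 2.
  by apply: cvgD => //; exact: cvg_cst.
rewrite /continuous_at /trunc'; apply: cvgM.
  by apply: cvgB => //; exact: cvg_cst.
apply: cvgV; first by rewrite expf_neq0// gt_eqF ?trunc_den_gt0.
by rewrite expr2; under eq_fun do rewrite expr2; exact: cvgM.
Qed.

Lemma trunc_le (r y : R) : `|trunc r y| <= `|y|.
Proof.
rewrite /trunc normrM normfV (gtr0_norm (trunc_den_gt0 _ _)) ler_pdivrMr ?trunc_den_gt0//.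
by rewrite ler_peMr// lerDl sqr_ge0.
Qed.

Lemma trunc_bounded (r y : R) : 0 < r -> `|trunc r y| <= r.
Proof.
move=> r0; rewrite /trunc normrM normfV (gtr0_norm (trunc_den_gt0 _ _)) ler_pdivrMr ?trunc_den_gt0//.
have -> : `|y| = r * `|y / r| by rewrite normrM normfV (gtr0_norm r0) mulrCA divff ?gt_eqF// mulr1.
rewrite ler_pM2l// -[(y / r) ^+ 2]real_normK ?num_real//.
by move: (`|y / r|) (normr_ge0 (y / r)) => u; nra.
Qed.

Lemma trunc'_le1 (r y : R) : `|trunc' r y| <= 1.
Proof.
have h := trunc_den_gt0 r y; rewrite /trunc'.
move: ((y / r) ^+ 2) (sqr_ge0 (y / r)) h => u u0 h.
have h2 : 0 < (1 + u) ^+ 2 by exact: exprn_gt0.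
rewrite normrM normfV (gtr0_norm h2) ler_pdivrMr// mul1r ler_norml.
by apply/andP; split; nra.
Qed.

Lemma cvg_trunc (y : R) : trunc n.+1%:R y @[n --> \oo] --> y.
Proof.
rewrite /trunc -[X in _ --> X]divr1; apply: cvgM; first exact: cvg_cst.
apply: cvgV; first exact: oner_neq0.
rewrite -[X in _ --> X](addr0 1); apply: cvgD; first exact: cvg_cst.
have h : y / x.+1%:R @[x --> \oo] --> 0.
  rewrite -[X in _ --> X](mulr0 y); apply: cvgM; first exact: cvg_cst.
  exact: cvg_harmonic.
by rewrite -[X in _ --> X](mulr0 0); under eq_fun do rewrite expr2; exact: cvgM.
Qed.
End truncation.

Section poincare_moments.
Context {d} {T : measurableType d} {R : realType} (P : probability T R) (n : nat).
Variables (C b2 : R) (F Q : n.-tuple T -> R).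
Hypotheses (C0 : 0 <= C) (b20 : 0 <= b2).
Hypotheses (mF : measurable_fun setT F) (mQ : measurable_fun setT Q) (Q0 : forall t, 0 <= Q t).
Hypothesis iF : itg (piid P n) F.
(* A coordinatewise Poincare inequality, [Q] bounding the partial gradients of [F]. *)
Hypothesis poin : forall (phi phi' : R -> R),
  (forall x : R, is_derive x 1 phi (phi' x)) -> continuous phi' ->
  (exists M : R, forall x, `|phi x| <= M) -> (exists M : R, forall x, `|phi' x| <= M) ->
  forall t i, ((Ex P (fun y => phi (F (upd_tuple t i y)) ^+ 2) -
     Ex P (fun y => phi (F (upd_tuple t i y))) ^+ 2)%:E <=
     \int[P]_y (C * (phi' (F (upd_tuple t i y)) ^+ 2 * Q (upd_tuple t i y) ^+ 2))%:E)%E.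
Hypothesis momQ : forall i : nat, (0 < i)%N ->
  (\int[piid P n]_t (Q t ^+ (2 ^ i))%:E <= (b2 ^+ (2 ^ i.-1) * (2 ^ i)%:R ^+ (2 ^ i.-1))%:E)%E.
Let D2 := n%:R * C * b2.

(** Doubling of exponents. With [G] the centred truncation, Efron-Stein and the Poincare hypothesis
    bound the variance of [G^j], whence [E G^(2j) <= j (E G^j)^2 + D2^j j^(2j) (2j)^j]. Here
    [j^(2j)] stems from the derivative of the power and [(2j)^j] from the moments of [Q]. *)
Let trunc_moment (r c : R) (i : nat) : 0 < r -> (0 < i)%N ->
  c = Ex (piid P n) (fun t => trunc r (F t)) ->
  Ex (piid P n) (fun t => (trunc r (F t) - c) ^+ (2 ^ i)) <=
  D2 ^+ (2 ^ i.-1) * (2 ^ i)%:R ^+ (3 * 2 ^ i.-1).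
Proof.
case: i => [|i] r0 // _ cE /=.
have mtr : measurable_fun setT (trunc r).
  apply: continuous_measurable_fun => y.
  have h := is_derive_trunc r y.
  by apply: differentiable_continuous; apply/derivable1_diffP; exact: (@ex_derive _ _ _ _ _ _ _ h).
have mG : measurable_fun setT (fun t => trunc r (F t) - c).
  by apply: measurable_funB => //; exact: measurableT_comp.
have Gb t : `|trunc r (F t) - c| <= 2 * r.
  rewrite (le_trans (ler_normB _ _))// mulr2n mulrDl mul1r lerD ?trunc_bounded// cE.
  apply: Ex_norm_le_cst => [|x]; first exact: measurableT_comp.
  exact: trunc_bounded.
have Gbj j t : `|(trunc r (F t) - c) ^+ j| <= (2 * r) ^+ j.
  by rewrite normrX; apply: lerXn2r (Gb t); rewrite nnegrE ?mulr_ge0// ltW.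
have iG j := itg_bounded (piid P n) (measurable_funX j mG) (Gbj j).
have D20 : 0 <= D2 by rewrite /D2 !mulr_ge0.
have rec j : (0 < j)%N -> (exists i', j = (2 ^ i')%N) ->
    Ex (piid P n) (fun t => (trunc r (F t) - c) ^+ (2 * j)) <=
    j%:R * Ex (piid P n) (fun t => (trunc r (F t) - c) ^+ j) ^+ 2 +
    D2 ^+ j * j%:R ^+ (2 * j) * (2 * j)%:R ^+ j.
  case: j => // j _ [i' ji'].
  pose phi y := (trunc r y - c) ^+ j.+1.
  pose phi' y := j.+1%:R * (trunc r y - c) ^+ j * trunc' r y.
  have dphi (x : R) : is_derive x 1 phi (phi' x).
    have h1 : is_derive x 1 (fun y => trunc r y - c) (trunc' r x).
      have := is_deriveB (is_derive_trunc r x) (is_derive_cst c x (1 : R)).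
      by rewrite subr0.
    have -> : phi = (fun y => trunc r y - c) ^+ j.+1 by apply/funext => y; rewrite exprfctE.
    exact: (is_deriveX j.+1 h1).
  have ctr : continuous (trunc r).
    move=> x; have h := is_derive_trunc r x.
    by apply: differentiable_continuous; apply/derivable1_diffP; exact: (@ex_derive _ _ _ _ _ _ _ h).
  have cphi' : continuous phi'.
    move=> x; apply: cvgM; last exact: continuous_trunc'.
    apply: cvgM; first exact: cvg_cst.
    have hc : trunc r y - c @[y --> x] --> trunc r x - c by apply: cvgB; [exact: ctr|exact: cvg_cst].
    have : continuous (fun y : R => y ^+ j).
      by move=> y; apply: differentiable_continuous; apply/derivable1_diffP; exact: exprn_derivable.
    by move=> /(_ (trunc r x - c)); exact: (@cvg_comp _ _ _ _ _ _ _ _ hc).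
  have phib : exists M : R, forall x, `|phi x| <= M.
    exists ((r + `|c|) ^+ j.+1) => x; rewrite /phi normrX; apply: lerXn2r; rewrite ?nnegrE//.
      by rewrite addr_ge0// ltW.
    by rewrite (le_trans (ler_normB _ _))// lerD2r trunc_bounded.
  have phib' : exists M : R, forall x, `|phi' x| <= M.
    exists (j.+1%:R * (r + `|c|) ^+ j) => x; rewrite /phi' normrM -[leRHS]mulr1.
    apply: ler_pM => //; last exact: trunc'_le1.
    rewrite normrM ger0_norm// ler_wpM2l// normrX; apply: lerXn2r; rewrite ?nnegrE//.
      by rewrite addr_ge0// ltW.
    by rewrite (le_trans (ler_normB _ _))// lerD2r trunc_bounded.
  have mdom : measurable_fun setT (fun t => C * (phi' (F t) ^+ 2 * Q t ^+ 2)).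
    apply: measurable_funM => //; apply: measurable_funM; last exact: measurable_funX.
    by apply: measurable_funX; apply: measurableT_comp => //; exact: continuous_measurable_fun.
  have := @efron_stein _ _ _ P n (fun t => phi (F t)) (fun t => C * (phi' (F t) ^+ 2 * Q t ^+ 2))
    ((2 * r) ^+ j.+1) (measurable_funX _ mG) (Gbj j.+1) mdom.
  have D0 t : 0 <= C * (phi' (F t) ^+ 2 * Q t ^+ 2).
    by apply: mulr_ge0 => //; apply: mulr_ge0; exact: sqr_ge0.
  move=> /(_ D0 (poin dphi cphi' phib phib')).
  set Eq := Ex _ (fun t => (trunc r (F t) - c) ^+ (2 * j.+1)).
  have -> : Ex (piid P n) (fun t => phi (F t) ^+ 2) = Eq.
    by apply: eq_Ex => t; rewrite /phi -exprM mulnC.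
  rewrite -/(Ex (piid P n) (fun t => (trunc r (F t) - c) ^+ j.+1)).
  set Ej := Ex _ (fun t => (trunc r (F t) - c) ^+ j.+1) => hES.
  have key : (n%:R%:E * \int[piid P n]_t (C * (phi' (F t) ^+ 2 * Q t ^+ 2))%:E <=
      \int[piid P n]_t (j.+1%:R^-1 * (j%:R * (trunc r (F t) - c) ^+ (2 * j.+1)
         + (n%:R * C * j.+1%:R ^+ 2) ^+ j.+1 * Q t ^+ (2 * j.+1)))%:E)%E.
    rewrite -EE_Zl//; apply: le_EE => t; rewrite lee_fin; first by rewrite mulr_ge0.
    rewrite ler_pdivlMl ?ltr0n//.
    have b0 : 0 <= (n%:R * C * j.+1%:R ^+ 2) * Q t ^+ 2 by rewrite !mulr_ge0// sqr_ge0.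
    (* Applied to the squared centred value and a multiple of [Q^2]. The first term is a fraction
       [j / (j+1)] of the moment to be bounded, so that it can be absorbed on the left. *)
    have := young_pow j (sqr_ge0 (trunc r (F t) - c)) b0.
    rewrite -!exprM [(_ * _ * _ * Q t ^+ 2) ^+ _]exprMn -exprM.
    apply: le_trans; rewrite ler_wpM2l// /phi'.
    have T1 : trunc' r (F t) ^+ 2 <= 1.
      rewrite -[leLHS]real_normK ?num_real// -[leRHS](expr1n _ 2).
      by apply: lerXn2r (trunc'_le1 r (F t)); rewrite nnegrE.
    move: (trunc' r (F t)) T1 => tp T1; rewrite !exprMn -exprM [(j * 2)%N]mulnC.
    set A := (trunc r (F t) - c) ^+ (2 * j).
    have A0 : 0 <= A by rewrite /A exprM exprn_ge0// sqr_ge0.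
    rewrite [leLHS](_ : _ = tp ^+ 2 * (A * (n%:R * C * j.+1%:R ^+ 2 * Q t ^+ 2))); last by ring.
    by rewrite ler_piMl// mulr_ge0.
  have := le_trans hES key => {hES key}.
  have [iQ EQ] : itg (piid P n) (fun t => Q t ^+ (2 * j.+1)) /\
     Ex (piid P n) (fun t => Q t ^+ (2 * j.+1)) <= b2 ^+ j.+1 * (2 * j.+1)%:R ^+ j.+1.
    apply: EE_leE => [|t|]; [exact: measurable_funX|exact: exprn_ge0|].
    by have := momQ (ltn0Sn i'); rewrite expnS /= -ji'.
  rewrite ExE; last first.
    by apply: itgZ; apply: itgD; apply: itgZ.
  rewrite ExZ; last by apply: itgD; apply: itgZ.
  rewrite ExD; [|exact: itgZ|exact: itgZ].
  rewrite !ExZ// -/Eq lee_fin => hE.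
  have j0 : 0 < j.+1%:R :> R by rewrite ltr0n.
  have : j.+1%:R * (Eq - Ej ^+ 2) <= j%:R * Eq + (n%:R * C * j.+1%:R ^+ 2) ^+ j.+1 *
      Ex (piid P n) (fun t => Q t ^+ (2 * j.+1)).
    by rewrite -ler_pdivlMl.
  have : (n%:R * C * j.+1%:R ^+ 2) ^+ j.+1 * Ex (piid P n) (fun t => Q t ^+ (2 * j.+1)) <=
      D2 ^+ j.+1 * j.+1%:R ^+ (2 * j.+1) * (2 * j.+1)%:R ^+ j.+1.
    apply: (@le_trans _ _ ((n%:R * C * j.+1%:R ^+ 2) ^+ j.+1 * (b2 ^+ j.+1 * (2 * j.+1)%:R ^+ j.+1))).
      by rewrite ler_wpM2l// exprn_ge0// !mulr_ge0.
    rewrite [_ ^+ (2 * j.+1)]exprM /D2; move: (j.+1%:R ^+ 2) ((2 * j.+1)%:R) => a e.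
    by rewrite !exprMn le_eqVlt; apply/orP; left; apply/eqP; ring.
  rewrite -[j.+1%:R * (_ - _)]/(j.+1%:R * _) -natr1 => h1 h2.
  lra.
elim: i => [|i IH].
  (* The recursion starts from the first moment, which vanishes by the choice of [c]. *)
  have := rec 1%N isT (ex_intro _ 0%N erefl).
  have -> : Ex (piid P n) (fun t => (trunc r (F t) - c) ^+ 1) = 0.
    rewrite (@eq_Ex _ _ _ _ _ (fun t => trunc r (F t) - c))//.
    rewrite ExB ?Ex_cst -?cE ?subrr//; last exact: itg_cst.
    apply: (@itg_bounded _ _ _ _ _ r) => [|t]; last exact: trunc_bounded.
    exact: measurableT_comp.
  rewrite expr0n mulr0 add0r expr1n mulr1 !expr1 => /le_trans; apply.
  by rewrite ler_wpM2l// -natrX ler_nat.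
have := rec (2 ^ i.+1)%N (expn_gt0 2 i.+1) (ex_intro _ i.+1 erefl).
rewrite -expnS => /le_trans; apply.
set j := (2 ^ i.+1)%N.
have jE : j = (2 * 2 ^ i)%N by rewrite /j expnS.
have E0 : 0 <= Ex (piid P n) (fun t => (trunc r (F t) - c) ^+ j).
  by apply: Ex_ge0 => t; rewrite jE exprM exprn_ge0// sqr_ge0.
have h1 : Ex (piid P n) (fun t => (trunc r (F t) - c) ^+ j) ^+ 2 <= D2 ^+ j * j%:R ^+ (3 * j).
  apply: (@le_trans _ _ ((D2 ^+ (2 ^ i) * j%:R ^+ (3 * 2 ^ i)) ^+ 2)).
    by apply: lerXn2r; rewrite ?nnegrE// mulr_ge0// exprn_ge0.
  by rewrite exprMn -!exprM mulnC -jE -mulnA [(2 ^ i * 2)%N]mulnC -jE.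
have jS : (2 ^ i.+2)%N = (2 * j)%N by rewrite expnS.
rewrite jS natrM [(2 * j%:R) ^+ j]exprMn.
apply: (@le_trans _ _ (j%:R * (D2 ^+ j * j%:R ^+ (3 * j)) + D2 ^+ j * j%:R ^+ (2 * j) * (2 ^+ j * j%:R ^+ j))).
  by rewrite lerD2r ler_wpM2l.
have -> : (2 * j%:R : R) ^+ (3 * j) = 8 ^+ j * j%:R ^+ (3 * j).
  by rewrite exprMn [in 2 ^+ _]exprM; congr (_ ^+ _ * _); rewrite !exprS expr0; ring.
have -> : (3 * j = 2 * j + j)%N by rewrite mulSn addnC.
rewrite !(exprD _ (2 * j) j).
set A := D2 ^+ j; set B := j%:R ^+ (2 * j); set E := j%:R ^+ j.
have -> : j%:R * (A * (B * E)) + A * B * (2 ^+ j * E) = (j%:R + 2 ^+ j) * (A * B * E) by ring.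
have -> : A * (8 ^+ j * (B * E)) = 8 ^+ j * (A * B * E) by ring.
apply: ler_wpM2r; first by rewrite !mulr_ge0// exprn_ge0.
(* What remains is [j + 2^j <= 8^j], where [8^j] is the ratio of [(2j)^(3j)] to [j^(3j)]. *)
rewrite -natrX -natrX -natrD ler_nat.
have h2 : (j <= 2 ^ j)%N by rewrite ltnW// ltn_expl.
rewrite (leq_trans (leq_add h2 (leqnn _)))// addnn -mul2n -expnS (_ : 8 = 2 ^ 3)%N// -expnM leq_exp2l//.
by have : (0 < j)%N; [exact: expn_gt0|lia].
Qed.

(** The bound of [trunc_moment] does not depend on the truncation level, so Fatou's lemma removes
    it; the centring constants converge by domination with [|F|]. *)
Lemma poincare_moment (i : nat) : (0 < i)%N ->
  (\int[piid P n]_t ((F t - Ex (piid P n) F) ^+ (2 ^ i))%:E <=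
   (D2 ^+ (2 ^ i.-1) * (2 ^ i)%:R ^+ (3 * 2 ^ i.-1))%:E)%E.
Proof.
move=> i0; have mtr r : measurable_fun setT (trunc r : R -> R).
  apply: continuous_measurable_fun => y.
  have h := is_derive_trunc r y.
  by apply: differentiable_continuous; apply/derivable1_diffP; exact: (@ex_derive _ _ _ _ _ _ _ h).
pose c m := Ex (piid P n) (fun t => trunc m.+1%:R (F t)).
have cc : c m @[m --> \oo] --> Ex (piid P n) F.
  apply: (Ex_dominated_cvg (g := fun t => `|F t|)) => //.
  - by move=> m; exact: measurableT_comp.
  - exact: itg_norm.
  - by move=> m t; exact: trunc_le.
  - by move=> t; exact: cvg_trunc.
have cont : continuous (fun y : R => y ^+ (2 ^ i)).
  by move=> y; apply: differentiable_continuous; apply/derivable1_diffP; exact: exprn_derivable.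
have mTF m : measurable_fun setT (fun t => trunc m.+1%:R (F t) - c m).
  by apply: measurable_funB => //; exact: measurableT_comp.
apply: (EE_fatou (h := fun m t => (trunc m.+1%:R (F t) - c m) ^+ (2 ^ i))).
- by move=> m; exact: measurable_funX.
- by move=> m t; case: i i0 {cont} => // i _; rewrite expnS exprM exprn_ge0// sqr_ge0.
- move=> t; have h : trunc m.+1%:R (F t) - c m @[m --> \oo] --> F t - Ex (piid P n) F.
    by apply: cvgB => //; exact: cvg_trunc.
  exact: (@cvg_comp _ _ _ _ _ _ _ _ h (cont _)).
- move=> m; have c0 : 0 < m.+1%:R :> R by rewrite ltr0n.
  have Gb t : `|trunc m.+1%:R (F t) - c m| <= 2 * m.+1%:R.
    rewrite (le_trans (ler_normB _ _))// mulr2n mulrDl mul1r lerD ?trunc_bounded//.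
    apply: Ex_norm_le_cst => [|x]; first exact: measurableT_comp.
    exact: trunc_bounded.
  rewrite ExE; first by rewrite lee_fin; exact: trunc_moment.
  apply: (@itg_bounded _ _ _ _ _ ((2 * m.+1%:R) ^+ (2 ^ i))) => [|t]; first exact: measurable_funX.
  by rewrite normrX; apply: lerXn2r (Gb t); rewrite nnegrE.
Qed.

End poincare_moments.
(** * Samples from a location model *)

Section borel_rV.
Context {R : realType} {d : nat}.

(** An open set is the union of the rational boxes it contains, which are countably many. The
    sigma-algebra is generated by the coordinates, so this is what relates it to continuity. *)
Lemma open_measurable_rV (A : set 'rV[R]_d) : open A -> measurable A.
Proof.
move=> oA.
pose box (q : 'rV[rat]_d) (k : nat) : set 'rV[R]_d :=
  [set u : 'rV[R]_d | forall i, `]ratr (q 0 i) - k.+1%:R^-1, ratr (q 0 i) + k.+1%:R^-1[%classic (u 0 i)].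
have mbox q k : measurable (box q k) by apply: (@measurable_box _ _ (fun i => `]ratr (q 0 i) - k.+1%:R^-1, ratr (q 0 i) + k.+1%:R^-1[%classic)) => i; exact: measurable_itv.
have -> : A = \bigcup_(p in [set p : 'rV[rat]_d * nat | box p.1 p.2 `<=` A]) box p.1 p.2.
  apply/seteqP; split => [u Au|u [p /= pA pu]]; last exact: pA.
  have /nbhs_ballP[e /= e0 eA] : nbhs u A by exact: open_nbhs_nbhs.
  (* Each coordinate of the centre is within [1/(k+1)] of [u], and the box has half-side [1/(k+1)],
     so [1/(k+1) < e/2] keeps the box in the ball around [u]. *)
  have [k] := ltr_add_invr (y := 0 : R) (x := e / 2) (divr_gt0 e0 (ltr0n _ 2)).
  rewrite add0r => ke.
  have k0 : 0 < k.+1%:R^-1 :> R by rewrite invr_gt0 ltr0n.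
  have qex i : {q : rat | ratr q \in `]u 0 i - k.+1%:R^-1, u 0 i + k.+1%:R^-1[}.
    by apply: cid; apply: rat_in_itvoo; rewrite ltrBlDr -addrA ltrDl addr_gt0.
  exists (\row_i sval (qex i), k) => /=.
    move=> v vbox; apply: eA; rewrite -ball_normE /= /ball_ /=.
    have [->|[i0 ih]] : u - v = 0 \/ exists i, `|u - v| = `|(u - v) 0 i|.
        have [->|h] := eqVneq (u - v) 0; [by left|right].
        have hn : mx_norm (u - v) != 0 by apply: contra_neq h; exact: mx_norm_eq0.
        rewrite (_ : `|u - v| = mx_norm (u - v))//.
        have [[a b] ->] := mx_norm_neq0 hn.
        by exists b; rewrite (ord1 a).
      by rewrite normr0.
    rewrite ih; have := vbox i0; rewrite /= !mxE in_itv /=.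
    have := svalP (qex i0); rewrite in_itv /= => /andP[a1 a2] /andP[b1 b2].
    move: {k0 vbox} (k.+1%:R^-1) (ratr _) a1 a2 b1 b2 ke => a q a1 a2 b1 b2 ke.
    by rewrite ltr_norml; apply/andP; split; lra.
  move=> i; rewrite /= mxE in_itv /=.
  have := svalP (qex i); rewrite in_itv /= => /andP[a1 a2].
  move: {k0 ke} (k.+1%:R^-1) (ratr _) a1 a2 => a q a1 a2.
  by apply/andP; split; lra.
rewrite bigcup_mkcond; apply: countable_bigcupT_measurable => // p.
by case: ifPn.
Qed.

Lemma continuous_measurable_rV (f : 'rV[R]_d -> R) : continuous f -> measurable_fun setT f.
Proof.
move=> cf; apply: (measurability _ (RGenOpens.measurableE R)).
move=> _ [_ [a [b ->] <-]]; rewrite setTI; apply: open_measurable_rV.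
by move/continuousP: cf; apply; exact: interval_open.
Qed.

Lemma measurable_fun_rVP d' (T : measurableType d') (f : T -> 'rV[R]_d) :
  (forall i, measurable_fun setT (fun x => f x 0 i)) -> measurable_fun setT f.
Proof.
move=> mf _ A mA; rewrite setTI.
apply: (mA [set B | measurable (f @^-1` B)]); split.
  split => /=.
  - by rewrite preimage_set0.
  - by move=> B mB; rewrite setTD preimage_setC; exact: measurableC.
  - by move=> F mF; rewrite preimage_bigcup; exact: bigcupT_measurable.
rewrite -bigcup_seq/=; apply: bigcup_sub => i _ B [C mC <-] /=.
by rewrite setTI -[X in measurable X]setTI; exact: mf.
Qed.

Lemma measurable_addrV (v : 'rV[R]_d) : measurable_fun setT (fun x : 'rV[R]_d => x + v).
Proof.
apply: measurable_fun_rVP => i; under eq_fun do rewrite mxE.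
by apply: measurable_funD => //; exact: measurable_coord_rV.
Qed.

Lemma measurable_rV_boxes :
  (measurable : set (set 'rV[R]_d)) = <<s [set B | exists2 A : 'I_d -> set (measurableTypeR R),
    (forall i, measurable (A i)) & B = [set u : 'rV[R]_d | forall i, A i (u 0 i)] ] >>.
Proof.
apply/seteqP; split.
  apply: smallest_sub; first exact: smallest_sigma_algebra.
  rewrite -bigcup_seq/=; apply: bigcup_sub => i _ B [C mC <-] /=.
  apply: sub_sigma_algebra; exists (fun j => if j == i then C else setT).
    by move=> j; case: ifP.
  apply/seteqP; split => u /=.
    by move=> [_ Cu] j; case: eqP => // ->.
  by move=> /(_ i); rewrite eqxx.
apply: smallest_sub; first exact: sigma_algebra_measurable.
by move=> B [A mA ->]; exact: measurable_box.
Qed.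

(** Both measures agree on boxes, by translation invariance in each coordinate; boxes are stable
    under intersection, and cubes of finite measure exhaust the space. *)
Lemma leb_shift (v : 'rV[R]_d) (A : set 'rV[R]_d) : measurable A ->
  leb d ((fun x => x + v) @^-1` A) = leb d A.
Proof.
pose G := [set B | exists2 A : 'I_d -> set (measurableTypeR R),
    (forall i, measurable (A i)) & B = [set u : 'rV[R]_d | forall i, A i (u 0 i)] ].
pose g (k : nat) : set 'rV[R]_d := [set u : 'rV[R]_d | forall i, `[- k%:R, k%:R]%classic (u 0 i)].
pose m2 : {measure set 'rV[R]_d -> \bar R} :=
  measure_function_pushforward__canonical__measure_function_Measure (leb d) (measurable_addrV v).
move=> mA; apply/esym.
apply: (@measure_unique _ _ _ G g _ _ _ _ (leb d) m2) => //.
- exact: measurable_rV_boxes.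
- move=> _ _ [B mB ->] [C mC ->]; exists (fun i => B i `&` C i).
    by move=> i; exact: measurableI.
  by apply/seteqP; split => u /= h; [move=> i; split; [exact: h.1|exact: h.2]|split => i; have [] := h i].
- by move=> k; exists (fun=> `[- k%:R, k%:R]%classic) => // i; exact: measurable_itv.
- apply/seteqP; split => // u _.
  have [k hk] : exists k : nat, `|u| <= k%:R.
    exists (Num.truncn `|u|).+1; exact/ltW/truncnS_gt.
  exists k => // i; rewrite /= in_itv /= -ler_norml.
  rewrite (le_trans _ hk)// (_ : `|u| = mx_norm u)// mx_normrE.
  exact: (@le_bigmax _ _ _ _ (fun ij : 'I_1 * 'I_d => `|u ij.1 ij.2|) (ord0, i)).
- move=> _ [B mB ->]; rewrite leb_box// /m2 /= /pushforward.
  rewrite (_ : _ @^-1` _ = [set u : 'rV[R]_d | forall i, ((fun x : R => x + v 0 i) @^-1` B i) (u 0 i)]); last first.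
    by apply/seteqP; split => u /= h i; have := h i; rewrite mxE.
  have mshift i : measurable ((fun x : R => x + v 0 i) @^-1` B i).
    rewrite -[X in measurable X]setTI.
    have mk : measurable_fun setT (fun x : measurableTypeR R => x + v 0 i : measurableTypeR R) by exact: measurable_funD.
    exact: (mk measurableT _ (mB i)).
  rewrite (leb_box mshift); apply: eq_bigr => i _.
  by have := lebesgue_measure_shift (v 0 i) (mB i); rewrite /pushforward => ->.
- move=> k; rewrite (leb_box (A := fun=> `[- k%:R, k%:R]%classic)); last by move=> i; exact: measurable_itv.
  under eq_bigr do rewrite lebesgue_measure_itv /=.
  have : (\prod_(i < d) (if (- k%:R)%:E < (k%:R : R)%:E then ((k%:R : R)%:E - (- k%:R)%:E) else 0))%E \is a fin_num.
    by elim/big_ind : _ => [|x y xo yo|i _]; [|exact: fin_numM|case: ifP].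
  by rewrite fin_numElt => /andP[].
Qed.
End borel_rV.

Section tuple_law.
Context {d} {T : measurableType d} {R : realType}.

Lemma measurable_tuple_box n (A : 'I_n -> set T) : (forall i, measurable (A i)) ->
  measurable [set t : n.-tuple T | forall i, A i (tnth t i)].
Proof.
move=> mA; rewrite (_ : mkset _ =
    \bigcap_(i in [set: 'I_n]) [set t : n.-tuple T | A i (tnth t i)]); last first.
  by apply/seteqP; split => u /= h i; [move=> _|]; exact: h.
apply: fin_bigcap_measurable => // i _.
rewrite -[X in measurable X]setTI.
exact: (measurable_tnth i measurableT (mA i)).
Qed.

Lemma measurable_tuple_boxes n :
  (measurable : set (set (n.-tuple T))) = <<s [set B | exists2 A : 'I_n -> set T,
    (forall i, measurable (A i)) & B = [set t : n.-tuple T | forall i, A i (tnth t i)] ] >>.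
Proof.
apply/seteqP; split.
  apply: smallest_sub; first exact: smallest_sigma_algebra.
  rewrite -bigcup_seq/=; apply: bigcup_sub => i _ B [C mC <-] /=.
  apply: sub_sigma_algebra; exists (fun j => if j == i then C else setT).
    by move=> j; case: ifP.
  apply/seteqP; split => u /=.
    by move=> [_ Cu] j; case: eqP => // ->.
  by move=> /(_ i); rewrite eqxx.
apply: smallest_sub; first exact: sigma_algebra_measurable.
by move=> B [A mA ->]; exact: measurable_tuple_box.
Qed.

Lemma piid_box (P : probability T R) n (A : 'I_n -> set T) : (forall i, measurable (A i)) ->
  piid P n [set t | forall i, A i (tnth t i)] = (\prod_(i < n) P (A i))%E.
Proof.
elim: n A => [|n IH] A mA.
  by rewrite big_ord0 /= diracE mem_set// => -[].
rewrite big_ord_recl -(IH (fun i => A (lift ord0 i)))//.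
rewrite [LHS]/= /distribution /pushforward.
rewrite -(product_measure1E P (piid P n))//; last first.
  by apply: (@measurable_tuple_box n (fun i => A (lift ord0 i))).
congr (_ _); apply/seteqP; split => -[x t] /=.
  move=> h; split=> [|i]; first exact: (h ord0).
  by have := h (lift ord0 i); rewrite tnth_consTS.
case=> h0 h1 i; case: (unliftP ord0 i) => [j|] -> //=.
by rewrite tnth_consTS.
Qed.

Lemma piid_unique (P : probability T R) n (m : {measure set (n.-tuple T) -> \bar R}) :
  (forall A : 'I_n -> set T, (forall i, measurable (A i)) ->
    m [set t | forall i, A i (tnth t i)] = (\prod_(i < n) P (A i))%E) ->
  forall A, measurable A -> m A = piid P n A.
Proof.
move=> h A mA; apply/esym.
apply: (@measure_unique _ _ _ [set B | exists2 A : 'I_n -> set T,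
    (forall i, measurable (A i)) & B = [set t : n.-tuple T | forall i, A i (tnth t i)] ] (fun=> setT)) => //.
- exact: measurable_tuple_boxes.
- move=> _ _ [B mB ->] [C mC ->]; exists (fun i => B i `&` C i).
    by move=> i; exact: measurableI.
  by apply/seteqP; split => u /= hh; [move=> i; split; [exact: hh.1|exact: hh.2]|split => i; have [] := hh i].
- by move=> k; exists (fun=> setT) => //; apply/seteqP; split.
- by apply/seteqP; split => // u _; exists 0%N.
- by move=> _ [B mB ->]; rewrite h//; exact: piid_box.
- by move=> k; rewrite [X in (X < _)%E]probability_setT ltry.
Qed.
Lemma ge0_integral_tnth (P : probability T R) n (i : 'I_n) (g : T -> \bar R) :
  measurable_fun setT g -> (forall x, 0 <= g x)%E ->
  (\int[piid P n]_t g (tnth t i) = \int[P]_x g x)%E.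
Proof.
move=> mg g0; have mt : measurable_fun setT (fun t : n.-tuple T => tnth t i) by exact: measurable_tnth.
transitivity (\int[pushforward (piid P n) (fun t : n.-tuple T => tnth t i)]_z g z)%E.
  by rewrite (ge0_integral_pushforward mt)// => x _.
apply: eq_measure_integral => A mA _; rewrite /= /pushforward.
have := @piid_box P n (fun j => if j == i then A else setT).
rewrite (bigD1 i)//= eqxx big1 ?mule1 => [|j /negPf ->]; last exact: probability_setT.
move=> <-; last by move=> j; case: ifP.
congr (piid P n _); apply/seteqP; split => t /=.
  by move=> h j; case: eqP => // ->.
by move=> /(_ i); rewrite eqxx.
Qed.

(** Signed functions are reduced to the nonnegative ones [|g|] and [|g| - g]. *)
Lemma Ex_tnth (P : probability T R) n (i : 'I_n) (g : T -> R) : itg P g ->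
  itg (piid P n) (fun t => g (tnth t i)) /\ Ex (piid P n) (fun t => g (tnth t i)) = Ex P g.
Proof.
move=> ig; have mg := itg_meas ig; have mt := @measurable_tnth _ T n i.
have ge0 (h : T -> R) : itg P h -> (forall x, 0 <= h x) ->
    itg (piid P n) (fun t => h (tnth t i)) /\ Ex (piid P n) (fun t => h (tnth t i)) = Ex P h.
  move=> ih h0; have mh := itg_meas ih.
  have e : (\int[piid P n]_t (h (tnth t i))%:E = (Ex P h)%:E)%E.
    by rewrite (@ge0_integral_tnth P n i (EFin \o h))//; [exact: ExE|exact/measurable_EFinP].
  have := @EE_leE _ _ _ (piid P n) (fun t => h (tnth t i)) (Ex P h).
  case=> //; [exact: measurableT_comp|by rewrite e|move=> i1 _].
  by split=> //; apply/EFin_inj; rewrite -ExE.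
have [i1 e1] := ge0 _ (itg_norm ig) (fun x => normr_ge0 _).
have [||i2 e2] := ge0 (fun x => `|g x| - g x).
- by apply: itgB => //; exact: itg_norm.
- by move=> x; rewrite subr_ge0 ler_norm.
have i3 : itg (piid P n) (fun t => g (tnth t i)).
  rewrite (_ : (fun t => _) = (fun t => `|g (tnth t i)| - (`|g (tnth t i)| - g (tnth t i)))).
    exact: itgB.
  by apply/funext => t; rewrite opprB addrC subrK.
split=> //; move: e2; rewrite ExB// e1 ExB//; last exact: itg_norm.
by move/addrI/oppr_inj.
Qed.

End tuple_law.

Section location_law.
Context {R : realType} {d : nat}.
Variables (V : 'rV[R]_d -> R) (P : probability 'rV[R]_d R).
Hypothesis mV : measurable_fun setT V.
Hypothesis hP : forall A, measurable A -> P A = density_law V 0 A.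

Let mE : measurable_fun setT (fun x => expR (- V x)).
Proof. by apply: measurable_expR_comp; exact: measurableT_comp. Qed.

Let mEs v : measurable_fun setT (fun x : 'rV[R]_d => expR (- V (x + v))).
Proof. by apply: (measurableT_comp mE); exact: measurable_addrV. Qed.

Lemma ge0_integral_location (g : 'rV[R]_d -> \bar R) : measurable_fun setT g ->
  (forall x, 0 <= g x)%E ->
  (\int[P]_x g x = \int[leb d]_x (g x * (expR (- V x))%:E))%E.
Proof.
move=> mg g0; apply: (@ge0_integral_density _ _ _ (leb d) P (fun x => expR (- V x))) => //.
move=> A mA; apply: etrans (hP mA) _; by apply: eq_integral => x _; rewrite subr0.
Qed.

Lemma ge0_integral_leb_shift (g : 'rV[R]_d -> \bar R) (v : 'rV[R]_d) : measurable_fun setT g ->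
  (forall x, 0 <= g x)%E ->
  (\int[leb d]_x g (x + v)%R = \int[leb d]_x g x)%E.
Proof.
move=> mg g0.
transitivity (\int[pushforward (leb d) (fun x : 'rV[R]_d => (x + v)%R)]_z g z)%E.
  by rewrite (ge0_integral_pushforward (measurable_addrV v))// => x _.
apply: eq_measure_integral => [|mf A mA _]; first exact: measurable_addrV.
exact: leb_shift.
Qed.

(** The density ratio of [P] and its translate. The integrations by parts below are first order
    terms in [v] of this identity and of its Gaussian analogue [integral_gauss_shift]. *)
Lemma location_shift (g : 'rV[R]_d -> \bar R) (v : 'rV[R]_d) : measurable_fun setT g ->
  (forall x, 0 <= g x)%E ->
  (\int[P]_x g (x + v)%R = \int[P]_x (g x * (expR (V x - V (x - v)))%:E))%E.
Proof.
move=> mg g0; rewrite !ge0_integral_location//; last 3 first.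
- apply: emeasurable_funM => //; apply/measurable_EFinP; apply: measurable_expR_comp.
  by apply: measurable_funB => //; apply: (measurableT_comp mV); exact: measurable_addrV.
- by move=> x; rewrite mule_ge0// lee_fin expR_ge0.
- by apply: measurableT_comp mg _; exact: measurable_addrV.
rewrite -[RHS](ge0_integral_leb_shift v); last 2 first.
- apply: emeasurable_funM; last exact/measurable_EFinP.
  apply: emeasurable_funM => //; apply/measurable_EFinP; apply: measurable_expR_comp.
  by apply: measurable_funB => //; apply: (measurableT_comp mV); exact: measurable_addrV.
- by move=> x; rewrite !mule_ge0// lee_fin expR_ge0.
apply: eq_integral => x _; rewrite -muleA -EFinM -expRD addrK.
by congr (_ * (expR _)%:E)%E; ring.
Qed.

Lemma density_lawE theta A : measurable A ->
  density_law V theta A = P ((fun x => x + theta) @^-1` A).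
Proof.
move=> mA; have mA' : measurable ((fun x => x + theta) @^-1` A).
  by rewrite -[X in measurable X]setTI; exact: measurable_addrV.
transitivity (\int[P]_x (\1_((fun x => x + theta) @^-1` A) x)%:E)%E; last by rewrite integral_indic// setIT.
rewrite ge0_integral_location; first last.
- by move=> x; rewrite lee_fin.
- by apply/measurable_EFinP; exact: measurable_indic.
rewrite /density_law integral_mkcond -[LHS](ge0_integral_leb_shift theta); last 2 first.
- by apply/(measurable_restrictT _ _).1 => //; apply: measurable_funTS; apply/measurable_EFinP; exact: mEs.
- by move=> x; rewrite patchE; case: ifP => // _; rewrite lee_fin expR_ge0.
apply: eq_integral => x _; rewrite patchE addrK indicE.
have -> : (x \in (fun x0 => x0 + theta) @^-1` A) = (x + theta \in A).
  by apply/idP/idP; rewrite !inE.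
by case: ifP => _; rewrite ?mul1e ?mul0e.
Qed.

Section sample.
Context {n : nat} {disp : measure_display} {T : measurableType disp}.
Variables (Pr : 'rV[R]_d -> probability T R) (X : 'I_n -> {mfun T >-> 'rV[R]_d}).
Hypothesis hX : location_sample V Pr X.

Definition centered (theta : 'rV[R]_d) (w : T) : n.-tuple 'rV[R]_d :=
  [tuple X i w - theta | i < n].

Lemma measurable_centered theta : measurable_fun setT (centered theta).
Proof.
apply/measurable_fun_tnthP => i.
rewrite (_ : _ \o _ = (fun x => x - theta) \o X i); last first.
  by apply/funext => w /=; rewrite tnth_mktuple.
by apply: measurableT_comp => //; exact: measurable_addrV.
Qed.

(** Uniformity in [theta] starts here: under every [Pr theta] the centred sample has the same law,
    under which all estimates are made. *)
Lemma ge0_integral_centered theta (h : n.-tuple 'rV[R]_d -> \bar R) :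
  measurable_fun setT h -> (forall t, 0 <= h t)%E ->
  (\int[Pr theta]_w h (centered theta w) = \int[piid P n]_t h t)%E.
Proof.
move=> mh h0; have mc := measurable_centered theta.
transitivity (\int[pushforward (Pr theta) (centered theta)]_z h z)%E.
  by rewrite (ge0_integral_pushforward mc)// => x _.
apply: eq_measure_integral => A mA _; apply: (@piid_unique _ _ _ P n (measure_function_pushforward__canonical__measure_function_Measure (Pr theta) mc)) => // B mB.
rewrite /= /pushforward.
have [hX1 hX2] := hX theta.
have mB' i : measurable ((fun x => x - theta) @^-1` B i).
  by rewrite -[X in measurable X]setTI; exact: measurable_addrV.
have := hX2 (fun i => (fun x => x - theta) @^-1` B i) mB'.
rewrite (_ : [set w | _] = centered theta @^-1` [set t | forall i, B i (tnth t i)]); last first.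
  by apply/seteqP; split => w /= hw i; have := hw i; rewrite tnth_mktuple.
move=> ->; apply: eq_bigr => i _.
have := hX1 i _ (mB' i); rewrite /distribution /pushforward => ->.
rewrite density_lawE//; congr (P _); apply/seteqP; split => x /=; by rewrite addrK.
Qed.
End sample.

Definition shiftT n (v : 'rV[R]_d) (t : n.-tuple 'rV[R]_d) : n.-tuple 'rV[R]_d :=
  [tuple tnth t i + v | i < n].

Lemma shiftT_cons n v x (t : n.-tuple 'rV[R]_d) :
  shiftT v (consT (x, t)) = consT (x + v, shiftT v t).
Proof.
apply: eq_from_tnth => i; rewrite tnth_mktuple.
case: (unliftP ord0 i) => [j|] ->; last by rewrite !tnth_consT0.
by rewrite !tnth_consTS tnth_mktuple.
Qed.

Lemma measurable_shiftT n v : measurable_fun setT (@shiftT n v).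
Proof.
apply/measurable_fun_tnthP => i.
rewrite (_ : _ \o _ = (fun x => x + v) \o (@tnth n _ ^~ i)); last first.
  by apply/funext => w /=; rewrite tnth_mktuple.
by apply: measurableT_comp; [exact: measurable_addrV|exact: measurable_tnth].
Qed.

Lemma piid_shift n v (g : n.-tuple 'rV[R]_d -> \bar R) : measurable_fun setT g ->
  (forall t, 0 <= g t)%E ->
  (\int[piid P n]_t g (shiftT v t) =
   \int[piid P n]_t (g t * (expR (\sum_i (V (tnth t i) - V (tnth t i - v))))%:E))%E.
Proof.
have mW m : measurable_fun setT (fun t : m.-tuple 'rV[R]_d =>
    (expR (\sum_i (V (tnth t i) - V (tnth t i - v))))%:E).
  apply/measurable_EFinP; apply: measurable_expR_comp; apply: measurable_sum => i.
  apply: measurable_funB; first by apply: measurableT_comp mV _; exact: measurable_tnth.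
  apply: measurableT_comp mV _; apply: measurableT_comp (measurable_addrV _) _.
  exact: measurable_tnth.
elim: n g => [|n IH] g mg g0.
  by rewrite !piid0 big_ord0 expR0 mule1; congr g; rewrite [LHS]tuple0.
rewrite ge0_piidS//; last by apply: measurableT_comp mg _; exact: measurable_shiftT.
have mgW : measurable_fun setT (fun t : n.+1.-tuple 'rV[R]_d => g t * (expR (\sum_i (V (tnth t i) - V (tnth t i - v))))%:E)%E.
  by apply: (emeasurable_funM mg (mW n.+1)).
have gW0 (t : n.+1.-tuple 'rV[R]_d) : (0 <= g t * (expR (\sum_i (V (tnth t i) - V (tnth t i - v))))%:E)%E.
  by rewrite mule_ge0// lee_fin expR_ge0.
rewrite [RHS](ge0_piidS P mgW gW0).
have mgx x : measurable_fun setT (fun t : n.-tuple 'rV[R]_d => g (consT (x, t))).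
  by apply: measurableT_comp mg _; apply: measurableT_comp (@measurable_consT _ _ n) _.
pose h x := (\int[piid P n]_t (g (consT (x, t)) * (expR (\sum_i (V (tnth t i) - V (tnth t i - v))))%:E))%E.
have mh : measurable_fun setT h.
  apply: (measurable_fun_fubini_tonelli_F (m2 := piid P n)
    (fun z => g (consT z) * (expR (\sum_i (V (tnth z.2 i) - V (tnth z.2 i - v))))%:E)%E) => [|z].
    apply: emeasurable_funM; first by apply: measurableT_comp mg _; exact: measurable_consT.
    exact: measurableT_comp (mW n) _.
  by rewrite mule_ge0// lee_fin expR_ge0.
have h0 x : (0 <= h x)%E.
  by apply: integral_ge0 => t _; rewrite mule_ge0// lee_fin expR_ge0.
transitivity (\int[P]_x h (x + v)%R)%E.
  apply: eq_integral => x _; under eq_integral do rewrite shiftT_cons.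
  exact: (IH (fun t => g (consT (x + v, t)))).
apply: etrans (location_shift v mh h0) _.
apply: eq_integral => x _.
under [RHS]eq_integral => t _.
  rewrite big_ord_recl tnth_consT0; under eq_bigr do rewrite tnth_consTS.
  rewrite expRD EFinM muleCA muleC; over.
rewrite ge0_integralZr//; [by apply: (emeasurable_funM (mgx x) (mW n))|by move=> t _; rewrite mule_ge0// lee_fin expR_ge0].
Qed.

End location_law.
(** * Euclidean norm and differential calculus *)

Section euclidean.
Context {R : realType} {d : nat}.
Implicit Types u v w : 'rV[R]_d.

Definition dot u v : R := \sum_i u 0 i * v 0 i.

Lemma dot_mx u v : (u *m v^T) 0 0 = dot u v.
Proof. by rewrite mxE; apply: eq_bigr => i _; rewrite mxE. Qed.

Lemma dotC u v : dot u v = dot v u.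
Proof. by apply: eq_bigr => i _; rewrite mulrC. Qed.

Lemma dotDl u v w : dot (u + v) w = dot u w + dot v w.
Proof. by rewrite -big_split; apply: eq_bigr => i _; rewrite mxE mulrDl. Qed.

Lemma dotZl a u v : dot (a *: u) v = a * dot u v.
Proof. by rewrite mulr_sumr; apply: eq_bigr => i _; rewrite mxE mulrA. Qed.

Lemma dotNl u v : dot (- u) v = - dot u v.
Proof. by rewrite -scaleN1r dotZl mulN1r. Qed.

Lemma dotDr u v w : dot w (u + v) = dot w u + dot w v.
Proof. by rewrite ![dot w _]dotC dotDl. Qed.

Lemma dotZr a u v : dot u (a *: v) = a * dot u v.
Proof. by rewrite ![dot u _]dotC dotZl. Qed.

Lemma dotNr u v : dot u (- v) = - dot u v.
Proof. by rewrite ![dot u _]dotC dotNl. Qed.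

Lemma dotBl u v w : dot (u - v) w = dot u w - dot v w.
Proof. by rewrite dotDl dotNl. Qed.

Lemma dotBr u v w : dot w (u - v) = dot w u - dot w v.
Proof. by rewrite dotDr dotNr. Qed.

Lemma dot0l u : dot 0 u = 0.
Proof. by rewrite /dot big1// => i _; rewrite mxE mul0r. Qed.

Lemma dot0r u : dot u 0 = 0.
Proof. by rewrite dotC dot0l. Qed.

Lemma dot_suml (I : Type) (s : seq I) (F : I -> 'rV[R]_d) u :
  dot (\sum_(i <- s) F i) u = \sum_(i <- s) dot (F i) u.
Proof. by apply: (big_morph (dot^~ u)) => [a b|]; rewrite ?dotDl ?dot0l. Qed.

Lemma dotvv_ge0 u : 0 <= dot u u.
Proof. by apply: sumr_ge0 => i _; rewrite -expr2 sqr_ge0. Qed.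

Lemma enorm_ge0 u : 0 <= enorm u.
Proof. exact: sqrtr_ge0. Qed.

Lemma enorm_sqr u : enorm u ^+ 2 = dot u u.
Proof.
rewrite sqr_sqrtr; last by apply: sumr_ge0 => i _; rewrite sqr_ge0.
by apply: eq_bigr => i _; rewrite expr2.
Qed.

Lemma enormZ a u : enorm (a *: u) = `|a| * enorm u.
Proof.
apply/eqP; rewrite -(@eqrXn2 _ 2)// ?mulr_ge0// ?enorm_ge0//.
by rewrite exprMn !enorm_sqr dotZl dotZr mulrA real_normK ?num_real// expr2.
Qed.

Lemma enormN u : enorm (- u) = enorm u.
Proof. by rewrite -scaleN1r enormZ normrN1 mul1r. Qed.

Lemma enorm0 : enorm (0 : 'rV[R]_d) = 0.
Proof. by rewrite -(scale0r 0) enormZ normr0 mul0r. Qed.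

Lemma dot_le u v : `|dot u v| <= enorm u * enorm v.
Proof.
rewrite -(@ler_pXn2r _ 2)// ?nnegrE ?mulr_ge0 ?enorm_ge0//.
rewrite exprMn real_normK ?num_real// !enorm_sqr.
have [u0|u0] := eqVneq (dot u u) 0.
  have -> : u = 0.
    apply/rowP => i; rewrite mxE; apply/eqP; rewrite -sqrf_eq0.
    move: u0; rewrite /dot => /eqP; rewrite psumr_eq0 => [|j _]; last by rewrite -expr2 sqr_ge0.
    by move=> /allP /(_ i); rewrite mem_index_enum -expr2 => /(_ isT).
  by rewrite !dot0l expr0n mul0r.
have u1 : 0 < dot u u by rewrite lt0r u0 dotvv_ge0.
have := dotvv_ge0 (dot u u *: v - dot u v *: u).
rewrite !(dotBl, dotBr, dotZl, dotZr) (dotC v u).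
rewrite (_ : _ - _ = dot u u * (dot u u * dot v v - dot u v ^+ 2)); last by ring.
by rewrite pmulr_rge0// subr_ge0.
Qed.

Lemma dot_le' u v : dot u v <= enorm u * enorm v.
Proof. exact: le_trans (ler_norm _) (dot_le _ _). Qed.

Lemma enormD u v : enorm (u + v) <= enorm u + enorm v.
Proof.
rewrite -(@ler_pXn2r _ 2)// ?nnegrE ?addr_ge0 ?enorm_ge0//.
rewrite enorm_sqr !(dotDl, dotDr) (dotC v u) sqrrD !enorm_sqr.
by have := dot_le' u v; lra.
Qed.

Lemma enormB u v : enorm (u - v) <= enorm u + enorm v.
Proof. by rewrite -(enormN v) enormD. Qed.

Lemma enormBC u v : enorm (u - v) = enorm (v - u).
Proof. by rewrite -enormN opprB. Qed.

Lemma enorm_sum (I : Type) (s : seq I) (F : I -> 'rV[R]_d) :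
  enorm (\sum_(i <- s) F i) <= \sum_(i <- s) enorm (F i).
Proof.
apply: (big_ind2 (fun u a => enorm u <= a)) => [|a b c e h1 h2|//]; first by rewrite enorm0.
exact: le_trans (enormD _ _) (lerD h1 h2).
Qed.

Lemma ler_dist_enorm u v : `|enorm u - enorm v| <= enorm (u - v).
Proof.
have := enormD (u - v) v; have := enormD (v - u) u.
by rewrite !subrK (enormBC v u) ler_norml => h1 h2; apply/andP; split; lra.
Qed.

Lemma coord_le_enorm u i : `|u 0 i| <= enorm u.
Proof.
rewrite -(@ler_pXn2r _ 2)// ?nnegrE ?enorm_ge0// enorm_sqr real_normK ?num_real//.
rewrite /dot (bigD1 i)//= -expr2 lerDl sumr_ge0// => j _.
by rewrite -expr2 sqr_ge0.
Qed.

Lemma coord_le_norm u i : `|u 0 i| <= `|u|.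
Proof.
rewrite (_ : `|u| = mx_norm u)// mx_normrE.
exact: (@le_bigmax _ _ _ _ (fun ij : 'I_1 * 'I_d => `|u ij.1 ij.2|) (ord0, i)).
Qed.

Lemma norm_le_enorm u : `|u| <= enorm u.
Proof.
have [->|h] := eqVneq u 0; first by rewrite normr0 enorm_ge0.
have hn : mx_norm u != 0 by apply: contra_neq h; exact: mx_norm_eq0.
rewrite (_ : `|u| = mx_norm u)//; have [[a b] ->] := mx_norm_neq0 hn.
by rewrite /= (ord1 a) coord_le_enorm.
Qed.

(** The factor [d] is crude, but it enters only qualitative statements (continuity,
    differentiability, local Lipschitz continuity), never the constants of the theorem. *)
Lemma enorm_le_norm u : enorm u <= d%:R * `|u|.
Proof.
rewrite -(@ler_pXn2r _ 2)// ?nnegrE ?mulr_ge0 ?enorm_ge0//.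
rewrite enorm_sqr (@le_trans _ _ (\sum_(i < d) `|u| ^+ 2))//.
  apply: ler_sum => i _; rewrite -expr2 -(real_normK (num_real (u 0 i))).
  by apply: lerXn2r; rewrite ?nnegrE// coord_le_norm.
rewrite sumr_const card_ord -[leLHS]mulr_natl exprMn ler_wpM2r ?sqr_ge0//.
by rewrite -natrX ler_nat; case: (d) => // k; rewrite leq_pmulr.
Qed.

Lemma enorm_dual u (K : R) : 0 <= K -> (forall v, dot u v <= K * enorm v) -> enorm u <= K.
Proof.
move=> K0 h; have := h u; rewrite -enorm_sqr expr2.
have [->//|u0] := eqVneq (enorm u) 0.
by rewrite ler_pM2r// lt0r u0 enorm_ge0.
Qed.

Lemma enorm_eq0 u : enorm u = 0 -> u = 0.
Proof.
move=> u0; apply/rowP => i; rewrite mxE; apply/eqP; rewrite -normr_le0 -u0.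
exact: coord_le_enorm.
Qed.

Lemma enorm_delta i : enorm (delta_mx 0 i : 'rV[R]_d) = 1.
Proof.
apply/eqP; rewrite -(@eqrXn2 _ 2)// ?enorm_ge0// enorm_sqr expr1n /dot (bigD1 i)//= big1.
  by rewrite !mxE !eqxx mulr1 addr0.
by move=> j /negPf ji; rewrite !mxE ji andbF mul0r.
Qed.

End euclidean.

Section calculus.
Context {R : realType} {d : nat}.
Implicit Types (g : 'rV[R]_d -> R) (x h v : 'rV[R]_d).

Lemma derive_dot g x v : differentiable g x -> 'D_v g x = dot (gradient g x) v.
Proof.
move=> dg; rewrite deriveE// [in LHS](row_sum_delta v) linear_sum.
by apply: eq_bigr => i _; rewrite linearZ /= mxE deriveE// mulrC.
Qed.

Lemma mvt_rV g x h : (forall y, differentiable g y) ->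
  exists2 c : R, 0 < c < 1 & g (x + h) - g x = 'D_h g (x + c *: h).
Proof.
move=> dg; pose G (t : R) := g (x + t *: h).
have dG (t : R) : is_derive t 1 G ('D_h g (x + t *: h)).
  have E : (fun s : R => s^-1 *: ((G \o shift t) (s *: (1 : R)) - G t)) =
      (fun s : R => s^-1 *: ((g \o shift (x + t *: h)) (s *: h) - g (x + t *: h))).
    apply/funext => s; rewrite /G /=; congr (_ *: (g _ - _)).
    by rewrite [s *: _]mulr1 scalerDl addrCA.
  apply: DeriveDef; first by rewrite /derivable E; exact: diff_derivable.
  by rewrite /derive E.
have [|c cI] := @MVT R G (fun t => 'D_h g (x + t *: h)) 0 1 ltr01 (fun t _ => dG t).
  apply: continuous_subspaceT => t; apply: differentiable_continuous.
  by apply/derivable1_diffP; exact: (@ex_derive _ _ _ _ _ _ _ (dG t)).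
rewrite /G scale1r scale0r addr0 subr0 mulr1 => gE.
by exists c => //; move: cI; rewrite in_itv.
Qed.

(** Along the sequence [1/(n+1)] a derivative becomes a limit to which dominated convergence
    applies. *)
Lemma derive_seq g x v : differentiable g x ->
  n.+1%:R * (g (x + n.+1%:R^-1 *: v) - g x) @[n --> \oo] --> 'D_v g x.
Proof.
move=> dg; have /cvgr_dnbhsP h : h^-1 *: ((g \o shift x) (h *: v) - g x) @[h --> (0:R)^'] --> 'D_v g x.
  exact: (@diff_derivable _ _ _ _ _ v dg).
rewrite (_ : (fun n => _) = (fun n : nat => ((n.+1%:R : R)^-1)^-1 *: ((g \o shift x) ((n.+1%:R : R)^-1 *: v) - g x))).
  by apply: h; split; [move=> n; rewrite invr_eq0 pnatr_eq0|exact: cvg_harmonic].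
by apply/funext => n /=; rewrite invrK [_ *: v + x]addrC.
Qed.

Lemma derive_bound g x v (A B : R) (b : nat -> R) : differentiable g x ->
  (forall n, `|g (x + n.+1%:R^-1 *: v) - g x - n.+1%:R^-1 * A| <= n.+1%:R^-1 * b n) ->
  b n @[n --> \oo] --> B -> `|'D_v g x - A| <= B.
Proof.
move=> dg hb bB; apply: (ler_cvg_to _ bB).
  apply: cvg_norm; apply: cvgB; [exact: derive_seq|exact: cvg_cst].
apply: nearW => n; have n0 : (0 : R) < n.+1%:R by rewrite ltr0n.
rewrite -(ler_pM2l (x := n.+1%:R^-1)) ?invr_gt0//.
rewrite -[X in X * _]gtr0_norm ?invr_gt0// -normrM mulrBr mulKf ?gt_eqF//.
Qed.

(** Meant for functions given as expectations, where a quadratic remainder is at hand and [A]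
    collects the expected partial derivatives. *)
Lemma differentiable_quad g x (A : 'rV[R]_d) (K : R) :
  (forall h, `|g (x + h) - g x - dot A h| <= K * enorm h ^+ 2) ->
  differentiable g x /\ forall v, 'D_v g x = dot A v.
Proof.
move=> hK.
have lA : linear_for *%R (dot A) by move=> a u w; rewrite dotDr dotZr.
pose lAM := GRing.isLinear.Build _ _ _ _ _ lA.
pose df : {linear 'rV[R]_d -> R} := HB.pack (dot A) lAM.
have dfc : continuous df.
  apply: (linear_bounded_continuous df).1; apply/linear_boundedP.
  near=> r => y; rewrite (le_trans (dot_le _ _))// (@le_trans _ _ (enorm A * (d%:R * `|y|)))//.
    by rewrite ler_wpM2l ?enorm_ge0// enorm_le_norm.
  by rewrite mulrA ler_wpM2r//; near: r; exact: nbhs_pinfty_ge (num_real _).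
have K0 : 0 <= `|K| by [].
have K1 : 0 < (`|K| + 1) * (d%:R * d%:R + 1) :> R by rewrite mulr_gt0// ltr_wpDl// mulr_ge0.
have exp : g \o shift x = cst (g x) + df +o_ (0 : 'rV[R]_d) id.
  apply/eqaddoP => e e0; near=> h => /=.
  rewrite [X in `|X|](_ : _ = g (x + h) - g x - dot A h); last first.
    by rewrite /= !fctE /= opprD addrA [h + x]addrC.
  rewrite (le_trans (hK h))// (@le_trans _ _ (`|K| * (d%:R * `|h|) ^+ 2))//.
    rewrite (@le_trans _ _ (`|K| * enorm h ^+ 2))//.
      by rewrite ler_wpM2r ?sqr_ge0// ler_norm.
    by rewrite ler_wpM2l// lerXn2r ?nnegrE ?enorm_ge0 ?mulr_ge0// enorm_le_norm.
  rewrite exprMn expr2 [`|h| ^+ 2]expr2 !mulrA ler_wpM2r// -!mulrA mulrA.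
  apply: (@le_trans _ _ ((`|K| + 1) * (d%:R * d%:R + 1) * `|h|)).
    by rewrite mulrA -[`|K| * _ * _]mulrA ler_wpM2r// ler_pM ?lerDl// mulr_ge0.
  rewrite -ler_pdivlMl//.
  have : ball (0 : 'rV[R]_d) (((`|K| + 1) * (d%:R * d%:R + 1))^-1 * e) h.
    by near: h; apply: nbhsx_ballx; rewrite mulr_gt0// invr_gt0.
  by rewrite -ball_normE /= sub0r normrN => /ltW.
have dg : differentiable g x.
  by apply/diff_locallyP; rewrite (diff_unique dfc exp).
split=> // v; rewrite deriveE//.
by rewrite (diff_unique dfc exp).
Unshelve. all: by end_near.
Qed.

Lemma differentiable_rV {m : nat} (F : 'rV[R]_d -> 'rV[R]_m) x :
  (forall i, differentiable (fun y => F y 0 i) x) -> differentiable F x.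
Proof.
move=> h; rewrite (_ : F = \sum_i (fun y => F y 0 i *: delta_mx 0 i)); last first.
  by apply/funext => y; rewrite fct_sumE [LHS]row_sum_delta.
by apply: differentiable_sum => i; exact: differentiableZl.
Qed.

Lemma enorm_lipschitz_locally g (K : R) :
  (forall x y, `|g x - g y| <= K * enorm (x - y)) -> [locally [lipschitz g x | x in setT]].
Proof.
move=> h; apply: lipschitz_locally; rewrite /lipschitz_on.
near=> M => -[x y] _ /=; rewrite (le_trans (h x y))// (@le_trans _ _ (`|K| * (d%:R * `|x - y|)))//.
  rewrite (@le_trans _ _ (`|K| * enorm (x - y)))//.
    by rewrite ler_wpM2r ?enorm_ge0// ler_norm.
  by rewrite ler_wpM2l// enorm_le_norm.
by rewrite mulrA ler_wpM2r//; near: M; exact: nbhs_pinfty_ge (num_real _).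
Unshelve. all: by end_near.
Qed.

Lemma enorm_lipschitz_continuous g (K : R) :
  (forall x y, `|g x - g y| <= K * enorm (x - y)) -> continuous g.
Proof.
move=> h x; have K1 : 0 < `|K| * d%:R + 1 by rewrite ltr_wpDl// mulr_ge0.
apply/(@cvgrPdist_le _ _ _ (nbhs x)) => e e0; near=> y.
rewrite (le_trans (h x y))// (@le_trans _ _ (`|K| * (d%:R * `|x - y|)))//.
  rewrite (@le_trans _ _ (`|K| * enorm (x - y)))//.
    by rewrite ler_wpM2r ?enorm_ge0// ler_norm.
  by rewrite ler_wpM2l// enorm_le_norm.
rewrite mulrA (@le_trans _ _ ((`|K| * d%:R + 1) * `|x - y|))//.
  by rewrite ler_wpM2r// lerDl.
rewrite -ler_pdivlMl//.
have : ball x ((`|K| * d%:R + 1)^-1 * e) y.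
  by near: y; apply: nbhsx_ballx; rewrite mulr_gt0// invr_gt0.
by rewrite -ball_normE /= => /ltW.
Unshelve. all: by end_near.
Qed.

End calculus.

Lemma derive_comp1 {R : realType} {d : nat} (G : 'rV[R]_d -> R) (phi : R -> R) (p : R)
    (y v : 'rV[R]_d) : differentiable G y -> is_derive (G y) 1 phi p ->
  'D_v (phi \o G) y = 'D_v G y * p.
Proof.
move=> dG dphi.
have dp : differentiable phi (G y) by apply/derivable1_diffP; exact: (@ex_derive _ _ _ _ _ _ _ dphi).
rewrite deriveE; last exact: differentiable_comp.
rewrite diff_comp//= diff1E// derive1E (@derive_val _ _ _ _ _ _ _ dphi) deriveE//.
Qed.

Lemma mvt_lipschitz {R : realType} (phi phi' : R -> R) (B : R) :
  (forall x : R, is_derive x 1 phi (phi' x)) -> (forall x, `|phi' x| <= B) ->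
  forall x y, `|phi x - phi y| <= B * `|x - y|.
Proof.
move=> dphi hB.
have cphi : continuous phi.
  by move=> x; apply/differentiable_continuous/derivable1_diffP; exact: (@ex_derive _ _ _ _ _ _ _ (dphi x)).
move=> x y; wlog xy : x y / x < y.
  move=> hw; have [xy|xy|->] := ltgtP x y; [exact: hw| |by rewrite !subrr !normr0 mulr0].
  by rewrite distrC [`|x - y|]distrC; exact: hw.
have [c _ hc] := MVT xy (fun x _ => dphi x) (continuous_subspaceT cphi).
by rewrite distrC hc normrM [`|x - y|]distrC ler_wpM2r.
Qed.

(** * Holder norms in terms of directional derivatives *)

Section iterated_derivatives.
Context {R : realType} {d : nat}.
Implicit Types (f g : 'rV[R]_d -> R) (vs : seq 'rV[R]_d).

Definition iter_derive f vs : 'rV[R]_d -> R :=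
  foldr (fun v (g : 'rV[R]_d -> R) (y : 'rV[R]_d) => 'D_v g y) f vs.

Lemma iter_derive_rcons f vs v : iter_derive f (rcons vs v) = iter_derive (fun y => 'D_v f y) vs.
Proof. by rewrite /iter_derive foldr_rcons. Qed.

Lemma ntimes_differentiableW l f : ntimes_differentiable l.+1 f -> ntimes_differentiable l f.
Proof.
elim: l f => [//|l IH] f [h1 h2]; split => // v.
by apply: IH; exact: h2.
Qed.

Lemma ntimes_differentiable_ders l f vs :
  ntimes_differentiable (size vs + l) f -> ntimes_differentiable l (iter_derive f vs).
Proof.
elim/last_ind: vs f => [//|vs v IH] f; rewrite size_rcons addSn iter_derive_rcons => -[_ h].
exact/IH/h.
Qed.

Lemma dersZ f vs (a : R) : ntimes_differentiable (size vs) f ->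
  iter_derive (fun y => a * f y) vs = (fun y => a * iter_derive f vs y).
Proof.
elim/last_ind: vs f => [//|vs v IH] f; rewrite size_rcons => -[h1 h2].
rewrite !iter_derive_rcons -(IH _ (h2 v)); congr (iter_derive _ vs); apply/funext => x.
by apply: (@deriveZ _ _ _ f); exact: diff_derivable.
Qed.

(** Since [0^-1 = 0], the zero vector is sent to itself and the two lemmas below include it. *)
Definition unitv (v : 'rV[R]_d) : 'rV[R]_d := (enorm v)^-1 *: v.

Lemma unitvK v : enorm v *: unitv v = v.
Proof.
rewrite /unitv scalerA; have [v0|v0] := eqVneq (enorm v) 0.
  by rewrite v0 mul0r scale0r; exact/esym/enorm_eq0.
by rewrite mulfV// scale1r.
Qed.

Lemma enorm_unitv v : enorm (unitv v) <= 1.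
Proof.
rewrite enormZ ger0_norm ?invr_ge0 ?enorm_ge0//.
by have [->|v0] := eqVneq (enorm v) 0; [rewrite mulr0|rewrite mulVf].
Qed.

Lemma iter_derive_unitv f vs x : ntimes_differentiable (size vs) f ->
  iter_derive f vs x = (\prod_(v <- vs) enorm v) * iter_derive f (map unitv vs) x.
Proof.
elim/last_ind: vs f => [|vs v IH] f; first by rewrite big_nil mul1r.
rewrite size_rcons => -[h1 h2]; rewrite map_rcons !iter_derive_rcons -cats1 big_cat big_seq1 /=.
rewrite (_ : (fun y => 'D_v f y) = (fun y => enorm v * 'D_(unitv v) f y)); last first.
  by apply/funext => y; rewrite -[in LHS](unitvK v) !deriveE// linearZ.
rewrite dersZ /=; last exact: (h2 (unitv v)).
by rewrite IH; [rewrite mulrA [enorm v * _]mulrC|exact: (h2 (unitv v))].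
Qed.

Lemma deriv_sup_le f vs x (B : R) : ntimes_differentiable (size vs) f ->
  (deriv_sup (size vs) f <= B%:E)%E -> `|iter_derive f vs x| <= B * \prod_(v <- vs) enorm v.
Proof.
move=> hf hB; rewrite iter_derive_unitv// normrM mulrC [X in _ * X]ger0_norm; last first.
  by apply: prodr_ge0 => v _; exact: enorm_ge0.
apply: ler_wpM2r; first by apply: prodr_ge0 => v _; exact: enorm_ge0.
rewrite -lee_fin (le_trans _ hB)//.
apply: (@le_trans _ _ (opnorm (mderive f (j := size vs) x))); last first.
  by apply: ereal_sup_ubound; exists x.
apply: ereal_sup_ubound; exists (map_tuple unitv (in_tuple vs)) => //= i.
by rewrite tnth_map enorm_unitv.
Qed.

Lemma deriv_holder_le f vs x y (rho B : R) : 0 <= B -> ntimes_differentiable (size vs) f ->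
  (deriv_holder (size vs) rho f <= B%:E)%E ->
  `|iter_derive f vs x - iter_derive f vs y| <= B * enorm (x - y) `^ rho * \prod_(v <- vs) enorm v.
Proof.
move=> B0 hf hB; rewrite (iter_derive_unitv x)// (iter_derive_unitv y)// -mulrBr normrM mulrC [X in _ * X]ger0_norm; last first.
  by apply: prodr_ge0 => v _; exact: enorm_ge0.
apply: ler_wpM2r; first by apply: prodr_ge0 => v _; exact: enorm_ge0.
have [->|xy] := eqVneq x y.
  rewrite !subrr normr0 enorm0 mulr_ge0// ?powR_ge0//.
have e0 : 0 < enorm (x - y).
  rewrite lt0r enorm_ge0 andbT; apply: contra_neq xy => /enorm_eq0 /eqP.
  by rewrite subr_eq0 => /eqP.
rewrite -ler_pdivrMr ?powR_gt0// -lee_fin (le_trans _ hB)//.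
apply: (@le_trans _ _ (opnorm (fun ws : (size vs).-tuple 'rV[R]_d =>
                     (mderive f x ws - mderive f y ws)%R)
                  * ((enorm (x - y) `^ rho)^-1)%:E)%E); last first.
  by apply: ereal_sup_ubound; exists (x, y) => //=; exact/eqP.
rewrite EFinM lee_wpmul2r ?lee_fin ?invr_ge0 ?powR_ge0//.
apply: ereal_sup_ubound; exists (map_tuple unitv (in_tuple vs)) => //= i.
by rewrite tnth_map enorm_unitv.
Qed.

(* The ball of radius [K] of [C^(l + rho)], in terms of directional derivatives so that each differentiation
   lowers [l] by one. *)
Fixpoint holder_ball (l : nat) (rho K : R) (g : 'rV[R]_d -> R) : Prop :=
  (forall x, `|g x| <= K) /\
  if l is l'.+1 then
    (forall x, differentiable g x) /\
    (forall v, holder_ball l' rho (K * enorm v) (fun x => 'D_v g x))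
  else forall x y, `|g x - g y| <= K * enorm (x - y) `^ rho.

(** Induction on the remaining order [l], with the directions already used collected in [vs]; their
    lengths become part of the radius, as [holder_ball] prescribes. *)
Lemma holder_ball_ders l f vs (rho A : R) :
  (forall ws x, (size ws <= size vs + l)%N -> `|iter_derive f ws x| <= A * \prod_(w <- ws) enorm w) ->
  (forall ws x y, (size ws = size vs + l)%N ->
     `|iter_derive f ws x - iter_derive f ws y| <= A * enorm (x - y) `^ rho * \prod_(w <- ws) enorm w) ->
  ntimes_differentiable (size vs + l) f ->
  holder_ball l rho (A * \prod_(w <- vs) enorm w) (iter_derive f vs).
Proof.
elim: l vs => [|l IH] vs h1 h2 nd.
  split=> [x|x y]; first by apply: h1; rewrite addn0.
  by rewrite mulrAC; apply: h2; rewrite addn0.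
split=> [x|]; first by apply: h1; rewrite leq_addr.
split; first by have [] := ntimes_differentiable_ders nd.
move=> v; have := IH (v :: vs); rewrite big_cons mulrAC -mulrA; apply.
- by move=> ws x /=; rewrite addSnnS; exact: h1.
- by move=> ws x y /=; rewrite addSnnS; exact: h2.
- by rewrite [size _]/= addSnnS.
Qed.

Lemma ntimes_differentiable_le l k f : (k <= l)%N ->
  ntimes_differentiable l f -> ntimes_differentiable k f.
Proof.
elim: l => [|l IH]; first by rewrite leqn0 => /eqP ->.
by rewrite leq_eqVlt ltnS => /predU1P[->//|kl] /ntimes_differentiableW; exact: IH.
Qed.

Lemma holder_class_hol l f (rho A : R) : ntimes_differentiable l f -> 0 <= A ->
  (holder_norm l rho f <= A%:E)%E -> holder_ball l rho A f.
Proof.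
move=> nd A0; rewrite /holder_norm ge_max => /andP[hs hh].
have := @holder_ball_ders l f [::] rho A; rewrite big_nil mulr1; apply => //=.
- move=> ws x; rewrite add0n => ws_le.
  apply: deriv_sup_le; first exact: ntimes_differentiable_le nd.
  have ws_lt : (size ws < l.+1)%N by [].
  apply: le_trans hs; exact: (@le_bigmax _ _ _ _ (fun j : 'I_l.+1 => deriv_sup j f) (Ordinal ws_lt)).
- move=> ws x y wsl; by apply: deriv_holder_le => //; rewrite wsl.
Qed.

End iterated_derivatives.

(** * Differentiation of exponential changes of measure *)

Section exponential_weights.
Context {disp} {T : measurableType disp} {R : realType} (P : probability T R).

Lemma expR_sub1_bounds (u : R) : u <= expR u - 1 <= u * expR u.
Proof.
have h1 := expR_ge1Dx u; have h2 := expR_ge1Dx (- u).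
have : (1 - u) * expR u <= 1 by rewrite -ler_pdivlMr ?expR_gt0// mul1r -expRN.
by move=> h3; apply/andP; split; lra.
Qed.

Lemma expR_sub1_le (u : R) : `|expR u - 1| <= `|u| * expR `|u|.
Proof.
have /andP[h1 h2] := expR_sub1_bounds u.
have e1 : 1 <= expR `|u| by rewrite -expR0 ler_expR.
have h4 : `|u| <= `|u| * expR `|u| by rewrite ler_peMr.
have h5 : - `|u| <= u by rewrite lerNl -normrN ler_norm.
have h6 : u * expR u <= `|u| * expR `|u|.
  rewrite (le_trans (ler_norm _))// normrM (ger0_norm (expR_ge0 u)) ler_wpM2l// ler_expR.
  exact: ler_norm.
by rewrite ler_norml; apply/andP; split; lra.
Qed.

Lemma expR_sub1_sub_le (u : R) : `|expR u - 1 - u| <= u ^+ 2 * expR `|u|.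
Proof.
have /andP[h1 h2] := expR_sub1_bounds u.
rewrite ger0_norm ?subr_ge0//; apply: (@le_trans _ _ (u * (expR u - 1))); first by lra.
rewrite (le_trans (ler_norm _))// normrM -(real_normK (num_real u)) expr2 -mulrA.
by rewrite ler_wpM2l// expR_sub1_le.
Qed.

Lemma expR_mid (a b : R) : expR ((a + b) / 2) <= expR a / 2 + expR b / 2.
Proof.
have h (x : R) : expR (x / 2) ^+ 2 = expR x by rewrite expr2 -expRD -splitr.
have := sqr_ge0 (expR (a / 2) - expR (b / 2)).
by rewrite mulrDl expRD sqrrB !h; lra.
Qed.

Lemma variance_affine_le (h : T -> R) (a b : R) : itg P h -> itg P (fun x => h x ^+ 2) ->
  Ex P (fun x => (a + b * h x) ^+ 2) - Ex P (fun x => a + b * h x) ^+ 2 <= b ^+ 2 * Ex P (fun x => h x ^+ 2).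
Proof.
move=> ih ih2.
rewrite [X in _ - X ^+ 2]ExD; [|exact: itg_cst|exact: itgZ].
have -> : (fun x => (a + b * h x) ^+ 2) = (fun x => (a ^+ 2 + (2 * a * b) * h x) + b ^+ 2 * h x ^+ 2).
  by apply/funext => x; ring.
rewrite ExD; [|by apply: itgD; [exact: itg_cst|exact: itgZ]|exact: itgZ].
rewrite ExD; [|exact: itg_cst|exact: itgZ].
rewrite !Ex_cst !ExZ//.
by have := sqr_ge0 (b * Ex P h); move: (Ex P h) (Ex P _) => p q; nra.
Qed.

Lemma cvg_harmonic_bound (a : nat -> R) (b K : R) :
  (forall n, `|a n - b| <= n.+1%:R^-1 * K) -> a n @[n --> \oo] --> b.
Proof.
move=> h; have hk : n.+1%:R^-1 * K @[n --> \oo] --> 0.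
  by rewrite -(mul0r K); apply: cvgMr_tmp; exact: cvg_harmonic.
apply/cvgrPdist_le => e e0.
have /cvgrPdist_le /(_ e e0) := hk; apply: filterS => n.
rewrite sub0r normrN distrC => hn; rewrite (le_trans (h n))// (le_trans _ hn)//.
exact: ler_norm.
Qed.

(** The derivative at [h = 0] of the expectation of [g exp U], where [U] is [h B] up to [h^2 E] and
    [h = 1/(n+1)]. Applied to exact change-of-measure identities it produces integration by
    parts. *)
Lemma Ex_expB_cvg (U : nat -> T -> R) (B E g : T -> R) :
  (forall n, measurable_fun setT (U n)) ->
  measurable_fun setT B -> (forall l : R, (\int[P]_x (expR (l * `|B x|))%:E < +oo)%E) ->
  measurable_fun setT E -> (forall l : R, (\int[P]_x (expR (l * `|E x|))%:E < +oo)%E) ->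
  (forall n x, `|U n x - n.+1%:R^-1 * B x| <= n.+1%:R^-1 ^+ 2 * `|E x|) ->
  tame P g ->
  n.+1%:R * (Ex P (fun x => g x * expR (U n x)) - Ex P g) @[n --> \oo] -->
  Ex P (fun x => g x * B x).
Proof.
move=> mU mB eB mE eE hU tg.
have [teB tB] : tame P (fun x => expR `|B x|) /\ tame P (fun x => `|B x|).
  by apply: tame_exp => [|l]; [exact: measurableT_comp|under eq_integral do rewrite normr_id].
have [teE tE] : tame P (fun x => expR `|E x|) /\ tame P (fun x => `|E x|).
  by apply: tame_exp => [|l]; [exact: measurableT_comp|under eq_integral do rewrite normr_id].
have mg := itg_meas (tame_itg tg).
have t1 n : 0 < (n.+1%:R : R)^-1 <= 1 by rewrite invr_gt0 ltr0n/= invf_le1 ?ltr0n// ler1n.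
(* Dominates the difference quotients for all [n] at once, because [|U n| <= h (|B| + |E|)] with
   [h <= 1]. *)
pose D x := `|g x| * ((`|B x| + `|E x|) * (expR `|B x| * expR `|E x|)).
have tD : tame P D by apply: tameM; [exact: tame_norm|apply: tameM; [exact: tameD|exact: tameM]].
have hUle n x : `|U n x| <= n.+1%:R^-1 * (`|B x| + `|E x|).
  have := hU n x; move: (t1 n); move: (n.+1%:R^-1) (U n x) => t u /andP[t0 tt] h.
  have := ler_normD (u - t * B x) (t * B x); rewrite subrK normrM (gtr0_norm t0) => h2.
  have : t ^+ 2 * `|E x| <= t * `|E x| by rewrite ler_wpM2r// expr2 ler_piMl// ltW.
  by rewrite mulrDr; lra.
have hUle1 n x : `|U n x| <= `|B x| + `|E x|.
  by rewrite (le_trans (hUle n x))// ler_piMl ?addr_ge0//; case/andP: (t1 n).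
have eUle n x : expR `|U n x| <= expR `|B x| * expR `|E x| by rewrite -expRD ler_expR.
have dom n x : `|n.+1%:R * (g x * (expR (U n x) - 1))| <= D x.
  rewrite normrM (ger0_norm (ler0n _ _)) normrM mulrCA ler_wpM2l//.
  rewrite (@le_trans _ _ (n.+1%:R * (`|U n x| * expR `|U n x|)))//.
    by rewrite ler_wpM2l// expR_sub1_le.
  rewrite mulrA ler_pM ?expR_ge0 ?mulr_ge0//.
  by rewrite -ler_pdivlMl ?ltr0n// hUle.
have cv x : n.+1%:R * (g x * (expR (U n x) - 1)) @[n --> \oo] --> g x * B x.
  apply: (@cvg_harmonic_bound _ _ (`|g x| * (`|E x| + (`|B x| + `|E x|) ^+ 2 * (expR `|B x| * expR `|E x|)))) => n.
  rewrite mulrCA -mulrBr normrM [leRHS]mulrCA ler_wpM2l//.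
  have h1 := expR_sub1_sub_le (U n x); have h2 := hU n x; have h3 := hUle n x.
  have h4 : U n x ^+ 2 * expR `|U n x| <= n.+1%:R^-1 ^+ 2 * ((`|B x| + `|E x|) ^+ 2 * (expR `|B x| * expR `|E x|)).
    rewrite mulrA -exprMn ler_pM ?sqr_ge0 ?expR_ge0//.
    by rewrite -(real_normK (num_real (U n x))) lerXn2r ?nnegrE// mulr_ge0 ?addr_ge0// ltW//; case/andP: (t1 n).
  have n0 : (0 : R) < n.+1%:R by rewrite ltr0n.
  rewrite -(ler_pM2l (x := n.+1%:R^-1)) ?invr_gt0//.
  rewrite -[X in X * _]gtr0_norm ?invr_gt0// -normrM mulrBr mulKf ?gt_eqF//.
  rewrite mulrA -expr2 mulrDr.
  have := ler_normD (expR (U n x) - 1 - U n x) (U n x - n.+1%:R^-1 * B x).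
  have -> : expR (U n x) - 1 - U n x + (U n x - n.+1%:R^-1 * B x) = expR (U n x) - 1 - n.+1%:R^-1 * B x by ring.
  move=> h5; rewrite (le_trans h5)// addrC lerD// (le_trans h1)//.
have iE n : itg P (fun x => g x * (expR (U n x) - 1)).
  apply: (@itg_le _ _ _ _ _ D) => [||x]; [|exact: tame_itg|].
    by apply: measurable_funM => //; apply: measurable_funB => //; exact: measurable_expR_comp.
  apply: (le_trans _ (dom n x)); rewrite [leRHS]normrM (ger0_norm (ler0n _ _)) ler_peMl// ler1n//.
rewrite (_ : (fun n : nat => _) = (fun n => Ex P (fun x => n.+1%:R * (g x * (expR (U n x) - 1))))); last first.
  apply/funext => n; rewrite ExZ//; congr (_ * _).
  have -> : (fun x => g x * expR (U n x)) = (fun x => g x * (expR (U n x) - 1) + g x).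
    by apply/funext => x; ring.
  by rewrite ExD// ?addrK//; exact: tame_itg.
apply: (Ex_dominated_cvg (g := D)) => //.
- by move=> n; apply: measurable_funM => //; exact: itg_meas (iE n).
- exact: measurable_funM.
- exact: tame_itg.
Qed.

(** Positive and negative parts are transported separately; [Ex] being the [fine] part of their
    difference, the identity persists even if an integral diverges. *)
Lemma Ex_transport (s : T -> T) (W g : T -> R) :
  (forall h : T -> \bar R, measurable_fun setT h -> (forall x, 0 <= h x)%E ->
    (\int[P]_x h (s x) = \int[P]_x (h x * (expR (W x))%:E))%E) ->
  measurable_fun setT g ->
  Ex P (g \o s) = Ex P (fun x => g x * expR (W x)).
Proof.
move=> hs mg; rewrite /Ex /Rintegral; congr fine.
rewrite [LHS]integralE [RHS]integralE.
have mp : measurable_fun setT (fun x => (Num.max (g x) 0)%:E).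
  by apply/measurable_EFinP; exact: measurable_maxr.
have mn : measurable_fun setT (fun x => (Num.max (- g x) 0)%:E).
  by apply/measurable_EFinP; apply: measurable_maxr => //; exact: measurableT_comp.
congr (_ - _)%E.
- transitivity (\int[P]_x (Num.max (g (s x)) 0)%:E)%E.
    by apply: eq_integral => x _; rewrite funeposE /= -EFin_max.
  rewrite (hs _ mp) => [|x]; last by rewrite lee_fin le_max lexx orbT.
  apply: eq_integral => x _; rewrite funeposE /= -EFin_max -EFinM.
  by rewrite maxr_pMl ?expR_ge0// mul0r.
- transitivity (\int[P]_x (Num.max (- g (s x)) 0)%:E)%E.
    by apply: eq_integral => x _; rewrite funenegE /= -EFin_max.
  rewrite (hs _ mn) => [|x]; last by rewrite lee_fin le_max lexx orbT.
  apply: eq_integral => x _; rewrite funenegE /= -EFin_max -EFinM.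
  by rewrite maxr_pMl ?expR_ge0// mul0r mulNr.
Qed.
Lemma le_integral_sandwich (f g : T -> R) : (forall x, f x <= g x) ->
  (\int[P]_x ((EFin \o f)^\+ x) <= \int[P]_x ((EFin \o g)^\+ x) /\
   \int[P]_x ((EFin \o g)^\- x) <= \int[P]_x ((EFin \o f)^\- x))%E.
Proof.
move=> fg; split; apply: le_EE => x; rewrite ?funepos_ge0 ?funeneg_ge0//.
  by rewrite !funeposE ge_max !le_max lexx orbT andbT lee_fin fg.
by rewrite !funenegE ge_max !le_max lexx orbT andbT leeN2 lee_fin fg.
Qed.

(* No measurability of [f] is needed: the integral is monotone on all functions. *)
Lemma fine_sandwich (f u e : T -> R) : itg P u -> itg P e ->
  (forall x, `|f x - u x| <= e x) -> `|fine (\int[P]_x (f x)%:E) - Ex P u| <= Ex P e.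
Proof.
move=> iu ie h.
have fin (g : T -> R) : itg P g -> (\int[P]_x ((EFin \o g)^\+ x) \is a fin_num)%E /\
    (\int[P]_x ((EFin \o g)^\- x) \is a fin_num)%E.
  by move=> ig; split; [exact: integrable_pos_fin_num|exact: integrable_neg_fin_num].
have iU : itg P (fun x => u x + e x) by exact: itgD.
have iL : itg P (fun x => u x - e x) by exact: itgB.
have [|h1 h2] := @le_integral_sandwich f (fun x => u x + e x).
  by move=> x; have := h x; rewrite ler_distl => /andP[].
have [|h3 h4] := @le_integral_sandwich (fun x => u x - e x) f.
  by move=> x; have := h x; rewrite ler_distl => /andP[].
have [U1 U2] := fin _ iU; have [L1 L2] := fin _ iL.
have p0 (g : T -> R) : (0 <= \int[P]_x ((EFin \o g)^\+ x))%E by apply: integral_ge0 => x _; exact: funepos_ge0.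
have n0 (g : T -> R) : (0 <= \int[P]_x ((EFin \o g)^\- x))%E by apply: integral_ge0 => x _; exact: funeneg_ge0.
have F1 : (\int[P]_x ((EFin \o f)^\+ x) \is a fin_num)%E.
  by rewrite ge0_fin_numE// (le_lt_trans h1)// -ge0_fin_numE.
have F2 : (\int[P]_x ((EFin \o f)^\- x) \is a fin_num)%E.
  by rewrite ge0_fin_numE// (le_lt_trans h4)// -ge0_fin_numE.
have E (g : T -> R) : (\int[P]_x ((EFin \o g)^\+ x) \is a fin_num)%E ->
   (\int[P]_x ((EFin \o g)^\- x) \is a fin_num)%E ->
   fine (\int[P]_x (g x)%:E) = fine (\int[P]_x ((EFin \o g)^\+ x)) - fine (\int[P]_x ((EFin \o g)^\- x)).
  by move=> g1 g2; rewrite integralE fineB.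
have EU := ExD iu ie; have EL := ExB iu ie.
rewrite {1}/Ex /Rintegral E// in EU; rewrite {1}/Ex /Rintegral E// in EL.
rewrite E// ler_distl -EU -EL; apply/andP; split.
  by apply: lerB; apply: fine_le.
by apply: lerB; apply: fine_le.
Qed.
End exponential_weights.
(** * Hoelder classes and smoothing *)

Section holder_classes.
Context {R : realType} {d : nat}.
Implicit Types (g : 'rV[R]_d -> R) (l : nat) (rho K : R).

Lemma holder_ball_le l rho K g x : holder_ball l rho K g -> `|g x| <= K.
Proof. by case: l => [|l] [h _]. Qed.

Lemma holder_ball_ge0 l rho K g : holder_ball l rho K g -> 0 <= K.
Proof. by move=> h; rewrite (le_trans _ (holder_ball_le 0 h)). Qed.

Lemma holder_ball_differentiable l rho K g x : holder_ball l.+1 rho K g -> differentiable g x.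
Proof. by case=> _ [h _]. Qed.

Lemma holder_ball_derive l rho K g v : holder_ball l.+1 rho K g -> holder_ball l rho (K * enorm v) (fun x => 'D_v g x).
Proof. by move=> [_ [_ h]]; exact: h. Qed.

Lemma holder_ball_measurable l rho K g : holder_ball l.+1 rho K g -> measurable_fun setT g.
Proof.
move=> hg; apply: continuous_measurable_rV => x.
exact/differentiable_continuous/(holder_ball_differentiable x hg).
Qed.

Lemma holder_ball_derive_le l rho K g x v : holder_ball l.+1 rho K g -> `|'D_v g x| <= K * enorm v.
Proof. by move=> /holder_ball_derive -/(_ v) /holder_ball_le; apply. Qed.

Lemma holder_ball_lip l rho K g x y : holder_ball l.+1 rho K g -> `|g x - g y| <= K * enorm (x - y).
Proof.
move=> hg; have [c _] := mvt_rV y (x - y) (fun p => holder_ball_differentiable p hg).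
rewrite [y + (x - y)]addrC subrK => ->; exact: holder_ball_derive_le hg.
Qed.

Lemma holder_ball_taylor l rho K g x v : holder_ball l.+2 rho K g ->
  `|g (x + v) - g x - 'D_v g x| <= K * enorm v ^+ 2.
Proof.
move=> hg; have [c /andP[c0 c1] ->] := mvt_rV x v (fun p => holder_ball_differentiable p hg).
rewrite (le_trans (holder_ball_lip _ _ (holder_ball_derive v hg)))//.
rewrite addrAC subrr add0r enormZ gtr0_norm// expr2 mulrA ler_wpM2l//.
  by rewrite mulr_ge0 ?(holder_ball_ge0 hg) ?enorm_ge0.
by rewrite ler_piMl ?enorm_ge0// ltW.
Qed.

Lemma powR_le_1D (u rho : R) : 0 <= u -> 0 < rho <= 1 -> u `^ rho <= 1 + u.
Proof.
move=> u0 /andP[r0 r1]; have [u1|u1] := leP u 1.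
  rewrite (@le_trans _ _ (1 `^ rho))//; last by rewrite powR1 lerDl.
  by apply: ge0_ler_powR; rewrite ?nnegrE// ltW.
rewrite (@le_trans _ _ u)// ?lerDr//.
by rewrite -[leRHS]powRr1//; apply: ler_powR; rewrite // ltW.
Qed.

(** For [l = 0] this is the definition. For larger [l] the derivative is bounded and Lipschitz:
    distances up to 1 use the Lipschitz bound, larger ones boundedness, which costs the factor 2. *)
Lemma holder_ball_derive_holder l rho K g x y v : 0 < rho <= 1 -> holder_ball l.+1 rho K g ->
  `|'D_v g x - 'D_v g y| <= 2 * K * enorm v * enorm (x - y) `^ rho.
Proof.
move=> r01 hg; have hD := holder_ball_derive v hg; have K0 := holder_ball_ge0 hg.
have P0 : 0 <= K * enorm v * enorm (x - y) `^ rho by rewrite !mulr_ge0 ?enorm_ge0 ?powR_ge0.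
case: l hg hD => [|l] hg hD.
  by have := hD.2 x y; rewrite -!mulrA mulr2n mulrDl mul1r !mulrA; lra.
have h1 := holder_ball_lip x y hD; have h2 := holder_ball_le x hD; have h3 := holder_ball_le y hD.
case/andP: r01 => r0 r1.
have [u1|u1] := leP (enorm (x - y)) 1.
  have : enorm (x - y) <= enorm (x - y) `^ rho.
    have [->|u0] := eqVneq (enorm (x - y)) 0; first exact: powR_ge0.
    rewrite -{1}[enorm _]powRr1 ?enorm_ge0//; apply: ger_powR => //.
    by rewrite lt0r u0 enorm_ge0.
  move=> h; have : K * enorm v * enorm (x - y) <= K * enorm v * enorm (x - y) `^ rho.
    by rewrite ler_wpM2l// mulr_ge0 ?enorm_ge0.
  by rewrite -[2 * K * _ * _]mulrA -[2 * K * _]mulrA [K * (_ * _)]mulrA; lra.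
have h : 1 <= enorm (x - y) `^ rho.
  have <- : (1 : R) `^ rho = 1 by rewrite powR1.
  by apply: ge0_ler_powR; rewrite ?nnegrE ?enorm_ge0// ltW.
have : K * enorm v <= K * enorm v * enorm (x - y) `^ rho by rewrite ler_peMr// mulr_ge0 ?enorm_ge0.
have := ler_normB ('D_v g x) ('D_v g y).
by rewrite -[2 * K * _ * _]mulrA -[2 * K * _]mulrA [K * (_ * _)]mulrA; lra.
Qed.

Section smoothing.
Context {disp} {T : measurableType disp} (Q : probability T R) (Z : T -> 'rV[R]_d).
Hypothesis mZ : measurable_fun setT Z.
Hypothesis iZ : itg Q (fun t => enorm (Z t)).
Let e1 := Ex Q (fun t => enorm (Z t)).

(* The operator [B] of an estimator of the form [theta + Z] with [Z] free of [theta]. *)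
Definition bias_op g (theta : 'rV[R]_d) : R := Ex Q (fun t => g (theta + Z t)) - g theta.

Lemma bias_op_measurable g theta : measurable_fun setT g ->
  measurable_fun setT (fun t => g (theta + Z t)).
Proof.
move=> mg; apply: (measurableT_comp mg); apply: measurable_fun_rVP => i.
under eq_fun do rewrite mxE; apply: measurable_funD => //.
exact: measurableT_comp (measurable_coord_rV i) mZ.
Qed.

Lemma bias_op_itg l rho K g theta : holder_ball l.+1 rho K g -> itg Q (fun t => g (theta + Z t)).
Proof.
move=> hg; apply: (@itg_bounded _ _ _ _ _ K) => [|t]; last exact: holder_ball_le hg.
by apply: bias_op_measurable; exact: holder_ball_measurable hg.
Qed.

Lemma bias_opE l rho K g theta : holder_ball l.+1 rho K g ->
  bias_op g theta = Ex Q (fun t => g (theta + Z t) - g theta).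
Proof.
move=> hg; rewrite ExB ?Ex_cst//; [exact: bias_op_itg hg|exact: itg_cst].
Qed.

Lemma bias_op_le l rho K g theta : holder_ball l.+1 rho K g -> `|bias_op g theta| <= K * e1.
Proof.
move=> hg; have ig := bias_op_itg theta hg.
rewrite (bias_opE theta hg) -ExZ// (le_trans (Ex_norm _))//.
  by apply: itgB => //; exact: itg_cst.
apply: Ex_le; [by apply: itg_norm; apply: itgB => //; exact: itg_cst|exact: itgZ|].
move=> t; rewrite (le_trans (holder_ball_lip _ _ hg))// addrAC subrr add0r//.
Qed.

(** Differentiation under the expectation: the Taylor bound is uniform in the base point and so
    survives averaging, with [2 * K] because [g] is taken both under the expectation and at
    [theta]. *)
Lemma bias_op_derive l rho K g theta : holder_ball l.+2 rho K g ->
  differentiable (bias_op g) theta /\ forall v, 'D_v (bias_op g) theta = bias_op (fun x => 'D_v g x) theta.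
Proof.
move=> hg; have K0 := holder_ball_ge0 hg.
pose A : 'rV[R]_d := \row_i bias_op (fun x => 'D_(delta_mx 0 i) g x) theta.
have hA v : dot A v = bias_op (fun x => 'D_v g x) theta.
  rewrite (bias_opE theta (holder_ball_derive v hg)).
  have E t : 'D_v g (theta + Z t) - 'D_v g theta =
     \sum_i v 0 i * ('D_(delta_mx 0 i) g (theta + Z t) - 'D_(delta_mx 0 i) g theta).
    rewrite !derive_dot; try exact: holder_ball_differentiable hg.
    rewrite /dot -sumrB; apply: eq_bigr => i _; rewrite !mxE; ring.
  rewrite (eq_Ex Q E) Ex_sum; last first.
    move=> i _; apply: itgZ; apply: itgB; last exact: itg_cst.
    exact: bias_op_itg (holder_ball_derive _ hg).
  apply: eq_bigr => i _; rewrite ExZ ?mxE; last first.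
    by apply: itgB; [exact: bias_op_itg (holder_ball_derive _ hg)|exact: itg_cst].
  by rewrite -(bias_opE theta (holder_ball_derive _ hg)) mulrC.
have := @differentiable_quad _ _ (bias_op g) theta A (2 * K); case.
  move=> v; rewrite hA.
  pose r x := g (x + v) - g x - 'D_v g x.
  have hr x : `|r x| <= K * enorm v ^+ 2 by exact: holder_ball_taylor hg.
  have i1 := bias_op_itg (theta + v) hg; have i2 := bias_op_itg theta hg.
  have i3 := bias_op_itg theta (holder_ball_derive v hg).
  have -> : bias_op g (theta + v) - bias_op g theta - bias_op (fun x => 'D_v g x) theta =
     Ex Q (fun t => r (theta + Z t)) - r theta.
    have -> : (fun t => r (theta + Z t)) =
        (fun t => g (theta + v + Z t) - g (theta + Z t) - 'D_v g (theta + Z t)).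
      by apply/funext => t; rewrite /r [theta + Z t + v]addrAC.
    by rewrite /bias_op ExB//; [rewrite ExB// /r; ring|exact: itgB].
  rewrite (le_trans (ler_normB _ _))// -mulrA mulr2n mulrDl mul1r lerD//.
  apply: Ex_norm_le_cst => // ; rewrite /r.
  apply: measurable_funB; last exact: itg_meas i3.
  apply: measurable_funB; last exact: itg_meas i2.
  by have := itg_meas i1; under eq_fun do rewrite addrAC.
by move=> df h; split=> // v; rewrite h hA.
Qed.

(** One derivative is exchanged for a factor [E |Z|], as [bias_op g] averages increments of [g] over
    [Z]. At [l = 0] the Holder bound in [x - y] comes from the mean value theorem along [Z] for
    [g (p + (x - y)) - g p], which calls on the Holder continuity of [g'] only. *)
Lemma bias_op_hol l rho K g : holder_ball l.+1 rho K g -> holder_ball l rho (K * e1) (bias_op g).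
Proof.
elim: l K g => [|l IH] K g hg; split.
- by move=> x; exact: bias_op_le hg.
- move=> x y; rewrite !(bias_opE _ hg).
  have ix := bias_op_itg x hg; have iy := bias_op_itg y hg.
  rewrite -ExB; [|by apply: itgB => //; exact: itg_cst..].
  rewrite mulrAC -ExZ// (le_trans (Ex_norm _))//.
    by apply: itgB; apply: itgB => //; exact: itg_cst.
  apply: Ex_le; [|exact: itgZ|].
    by apply: itg_norm; apply: itgB; apply: itgB => //; exact: itg_cst.
  move=> t; pose psi p := g (p + (x - y)) - g p.
  have dpsi p : differentiable psi p.
    apply: differentiableB; last exact: holder_ball_differentiable hg.
    apply: (@differentiable_comp _ _ _ _ (fun p => p + (x - y)) g); last exact: holder_ball_differentiable hg.
    exact: differentiableD.
  have [c _] := mvt_rV y (Z t) dpsi.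
  have -> : psi (y + Z t) - psi y = g (x + Z t) - g x - (g (y + Z t) - g y).
    rewrite /psi (_ : y + Z t + (x - y) = x + Z t); last by apply/rowP => i; rewrite !mxE; ring.
    by rewrite [y + (x - y)]addrC subrK; ring.
  move=> ->; rewrite deriveB.
  - rewrite (_ : 'D_(Z t) (fun p => g (p + (x - y))) (y + c *: Z t) = 'D_(Z t) g (x + c *: Z t)).
      rewrite (le_trans ((holder_ball_derive (Z t) hg).2 _ _))// (_ : _ - _ = x - y).
        by rewrite mulrAC.
      by rewrite opprD addrACA subrr addr0.
    have xy (p : 'rV[R]_d) : y + p + (x - y) = x + p by apply/rowP => i; rewrite !mxE; ring.
    suff E : (fun s : R => s^-1 *: (((fun p => g (p + (x - y))) \o shift (y + c *: Z t)) (s *: Z t) -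
        g (y + c *: Z t + (x - y)))) =
      (fun s : R => s^-1 *: ((g \o shift (x + c *: Z t)) (s *: Z t) - g (x + c *: Z t))) by rewrite /derive E.
    apply/funext => s /=; rewrite xy; congr (_ *: (g _ - _)).
    by apply/rowP => i; rewrite !mxE; ring.
  - apply: diff_derivable; apply: (@differentiable_comp _ _ _ _ (fun p => p + (x - y)) g).
      exact: differentiableD.
    exact: holder_ball_differentiable hg.
  - exact/diff_derivable/(holder_ball_differentiable _ hg).
- by move=> x; exact: bias_op_le hg.
- split=> [x|v]; first by have [] := bias_op_derive x hg.
  rewrite (_ : (fun x => _) = bias_op (fun x => 'D_v g x)).
    by rewrite mulrAC; apply: IH; exact: holder_ball_derive hg.
  by apply/funext => x; have [_ ->] := bias_op_derive x hg.
Qed.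

Lemma iter_bias_op_hol l rho K g j : (j <= l)%N -> holder_ball l rho K g ->
  holder_ball (l - j) rho (K * e1 ^+ j) (iter j bias_op g).
Proof.
move=> + hg; elim: j => [|j IH] jl; first by rewrite subn0 expr0 mulr1.
rewrite iterS exprSr mulrA; apply: bias_op_hol.
by rewrite -subSn//; rewrite subSS; apply: IH; exact: ltnW.
Qed.

(** Expansion of [g] at [theta]: the linear term sees only the mean of [Z], and the rest is
    controlled by the Holder continuity of [g']. The bound [bias_op_le] would give just [E |Z|]. *)
Lemma bias_op_second_order rho K g theta (e2 : R) : 0 <= e2 -> 0 < rho <= 1 -> holder_ball 1 rho K g ->
  (forall v, `|Ex Q (fun t => dot v (Z t))| <= e2 * enorm v) ->
  itg Q (fun t => enorm (Z t) * enorm (Z t) `^ rho) ->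
  `|bias_op g theta| <= K * (e2 + 2 * Ex Q (fun t => enorm (Z t) * enorm (Z t) `^ rho)).
Proof.
move=> e20 r01 hg he2 i3; have K0 := holder_ball_ge0 hg.
have iZi i : itg Q (fun t => Z t 0 i).
  apply: (@itg_le _ _ _ _ _ (fun t => enorm (Z t))) => // [|t].
    exact: measurableT_comp (measurable_coord_rV i) mZ.
  exact: coord_le_enorm.
have iD : itg Q (fun t => dot (gradient g theta) (Z t)).
  by apply: itg_sum => i _; exact: itgZ.
have i1 : itg Q (fun t => g (theta + Z t) - g theta) by apply: itgB; [exact: bias_op_itg hg|exact: itg_cst].
have -> : bias_op g theta = Ex Q (fun t => dot (gradient g theta) (Z t)) +
   Ex Q (fun t => g (theta + Z t) - g theta - dot (gradient g theta) (Z t)).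
  by rewrite ExB// addrC subrK; exact: bias_opE hg.
have hgr : enorm (gradient g theta) <= K.
  apply: enorm_dual => // v; rewrite -derive_dot; last exact: holder_ball_differentiable hg.
  by rewrite (le_trans (ler_norm _))// (holder_ball_derive_le _ _ hg).
rewrite (le_trans (ler_normD _ _))// mulrDr lerD//.
  by rewrite (le_trans (he2 _))// mulrC ler_wpM2r.
rewrite mulrA -ExZ//; rewrite (le_trans (Ex_norm _))//; first exact: itgB.
apply: Ex_le; [by apply: itg_norm; exact: itgB|exact: itgZ|].
move=> t; have [c /andP[c0 c1] ->] := mvt_rV theta (Z t) (fun p => holder_ball_differentiable p hg).
rewrite -derive_dot; last exact: holder_ball_differentiable hg.
rewrite (le_trans (holder_ball_derive_holder _ _ _ r01 hg))//.
rewrite [K * 2]mulrC -mulrA ler_wpM2l ?mulr_ge0// ler_wpM2l ?enorm_ge0//.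
rewrite addrAC subrr add0r enormZ gtr0_norm//; apply: ge0_ler_powR.
- by case/andP: r01 => /ltW.
- by rewrite nnegrE mulr_ge0 ?enorm_ge0// ltW.
- by rewrite nnegrE enorm_ge0.
- by rewrite ler_piMl ?enorm_ge0// ltW.
Qed.

End smoothing.
End holder_classes.

Lemma EE_D {disp : measure_display} {T : measurableType disp} {R : realType}
    (P : probability T R) (f g : T -> R) :
  measurable_fun setT f -> measurable_fun setT g ->
  (forall x, 0 <= f x) -> (forall x, 0 <= g x) ->
  (\int[P]_x (f x + g x)%:E = \int[P]_x (f x)%:E + \int[P]_x (g x)%:E)%E.
Proof.
move=> mf mg f0 g0; under eq_integral do rewrite EFinD.
by rewrite ge0_integralD//=; try (by move=> x _; rewrite lee_fin); exact/measurable_EFinP.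
Qed.

(** Convexity of the exponential between [0] and [g], from two tangent inequalities. It serves to
    bring an exponential moment down to the level 1 in the definition of the Orlicz norm. *)
Lemma expR_interp {R : realType} (g e : R) : 0 <= e -> e <= 1 ->
  expR (e * g) <= 1 - e + e * expR g.
Proof.
move=> e0 e1; have h1 := expR_ge1Dx (g - e * g); have h2 := expR_ge1Dx (- (e * g)).
have p := expR_gt0 (e * g).
have h3 : expR (e * g) * (1 + (g - e * g)) <= expR g.
  have -> : expR g = expR (e * g) * expR (g - e * g) by rewrite -expRD addrC subrK.
  by rewrite ler_pM2l.
have h4 : expR (e * g) * (1 - e * g) <= 1.
  apply: (@le_trans _ _ (expR (e * g) * expR (- (e * g)))); first by rewrite ler_pM2l.
  by rewrite -expRD subrr expR0.
have h5 : e * (expR (e * g) * (1 + (g - e * g))) <= e * expR g by rewrite ler_wpM2l.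
have h6 : (1 - e) * (expR (e * g) * (1 - e * g)) <= (1 - e) * 1 by rewrite ler_wpM2l// subr_ge0.
move: h5 h6; move: (expR (e * g)) (expR g) => x y h5 h6.
have -> : x = e * (x * (1 + (g - e * g))) + (1 - e) * (x * (1 - e * g)) by ring.
by lra.
Qed.

Lemma powR_add_le {R : realType} (a b q : R) : 0 <= a -> 0 <= b -> 0 < q <= 1 ->
  (a + b) `^ q <= 2 * (a `^ q + b `^ q).
Proof.
move=> a0 b0 /andP[q0 q1]; wlog ab : a b a0 b0 / a <= b.
  by move=> h; case: (leP a b) => ab; [exact: h|rewrite addrC [_ `^ q + _]addrC; apply: h => //; exact: ltW].
apply: (@le_trans _ _ ((2 * b) `^ q)).
  by apply: ge0_ler_powR; rewrite ?nnegrE ?addr_ge0 ?mulr_ge0 ?(ltW q0)//; lra.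
rewrite powRM//; apply: ler_pM; rewrite ?powR_ge0//; last by rewrite lerDr powR_ge0.
rewrite -[leRHS]powRr1//; apply: ler_powR => //; lra.
Qed.

(* [exp v <= e + sum_i exp (2 * 2^i) * (v / 2^i)^(3 * 2^i)] for [v >= 0]. *)
Lemma dyadic_moment_exp {R : realType} {disp : measure_display} {T : measurableType disp}
    (P : probability T R) (U : T -> R) (b2 : R) : 0 < b2 -> measurable_fun setT U ->
  (forall i, (0 < i)%N -> (\int[P]_w (U w ^+ (2 ^ i))%:E <=
     (b2 ^+ (2 ^ i.-1) * (2 ^ i)%:R ^+ (3 * 2 ^ i.-1))%:E)%E) ->
  (\int[P]_w (expR ((`|U w| / Num.sqrt b2 / (4 * expR 1)) `^ (2 / 3)))%:E <= (expR 1 + 1)%:E)%E.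
Proof.
move=> b0 mU mom; pose v w := (`|U w| / Num.sqrt b2 / (4 * expR 1)) `^ (2 / 3).
have e0 : 0 < expR 1 :> R := expR_gt0 1.
have v0 w : 0 <= v w by exact: powR_ge0.
have mv : measurable_fun setT v.
  apply: (measurableT_comp (f := fun x : R => x `^ (2 / 3))); first exact: measurable_powR.
  by do 2 apply: measurable_funM => //; exact: measurableT_comp.
have v3 w : v w ^+ 3 = (16 * expR 1 ^+ 2 * b2)^-1 * U w ^+ 2.
  rewrite /v -powR_mulrn ?powR_ge0// -powRrM (_ : 2 / 3 * 3%:R = 2%:R); last by field.
  rewrite powR_mulrn; last by rewrite !divr_ge0 ?sqrtr_ge0 ?mulr_ge0 ?(ltW e0).
  rewrite !exprMn !exprVn sqr_sqrtr ?(ltW b0)// real_normK ?num_real// !exprMn.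
  by field; rewrite !gt_eqF.
(* Induction over the cut-off [2^N]. The bounds [e + 1 - 2^-N] leave room for increments that form a
   geometric series. *)
have key N : (\int[P]_w (expR (Num.min (v w) (2 ^ N)%:R))%:E <= (expR 1 + 1 - 2^-1 ^+ N)%:E)%E.
  elim: N => [|N IH].
    rewrite expn0 expr0 addrK -[leRHS](EE_cst P); apply: le_EE => w; rewrite lee_fin ?expR_ge0//.
    by rewrite ler_expR ge_min lexx orbT.
  set j := (2 ^ N)%N in IH *; have j0 : (0 < j)%N by rewrite expn_gt0.
  have jN : (N < j)%N by exact: ltn_expl.
  pose K := (expR 1 ^+ (2 * j) / (j%:R ^+ 3 * (16 * expR 1 ^+ 2 * b2)) ^+ j) : R.
  have K0 : 0 <= K.
    rewrite divr_ge0 ?exprn_ge0 ?(ltW e0)// !mulr_ge0 ?exprn_ge0 ?(ltW b0) ?(ltW e0)//.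
  have step w : expR (Num.min (v w) (2 ^ N.+1)%:R) <= expR (Num.min (v w) j%:R) + K * U w ^+ (2 ^ N.+1).
    have KE : K * U w ^+ (2 ^ N.+1) = expR 1 ^+ (2 * j) * (v w / j%:R) ^+ (3 * j).
      rewrite [(v w / _) ^+ _]exprM [(v w / _) ^+ 3]exprMn v3 [(2 ^ N.+1)%N]expnS exprM -/j /K -mulrA.
      by congr (_ * _); rewrite -exprVn -exprMn; congr (_ ^+ j); field; rewrite !gt_eqF// ltr0n.
    have U0 : 0 <= K * U w ^+ (2 ^ N.+1).
      by rewrite mulr_ge0// expnS exprM exprn_ge0// sqr_ge0.
    have [vj|vj] := leP (v w) j%:R.
      rewrite (@le_trans _ _ (expR (v w)))//; last by rewrite lerDl.
      by rewrite ler_expR ge_min lexx.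
    rewrite (@le_trans _ _ (K * U w ^+ (2 ^ N.+1)))//; last by rewrite lerDr expR_ge0.
    rewrite KE (@le_trans _ _ (expR 1 ^+ (2 * j)))//.
      rewrite -expRM_natl mulr1 ler_expR ge_min expnS lexx orbT//.
    by rewrite ler_peMr ?exprn_ge0 ?(ltW e0)// exprn_ege1// ler_pdivlMr ?ltr0n// mul1r ltW.
  apply: (@le_trans _ _ (\int[P]_w (expR (Num.min (v w) j%:R) + K * U w ^+ (2 ^ N.+1))%:E)%E).
    by apply: le_EE => w; rewrite lee_fin ?expR_ge0.
  have mm : measurable_fun setT (fun w => expR (Num.min (v w) j%:R)).
    by apply: measurable_expR_comp; exact: measurable_minr.
  have U0 w : 0 <= U w ^+ (2 ^ N.+1) by rewrite expnS exprM exprn_ge0// sqr_ge0.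
  rewrite EE_D//; last 2 first.
  - by apply: measurable_funM => //; exact: measurable_funX.
  - by move=> w; rewrite mulr_ge0.
  rewrite EE_Zl//; last exact: measurable_funX.
  apply: (@le_trans _ _ ((expR 1 + 1 - 2^-1 ^+ N)%:E + K%:E * (b2 ^+ j * (2 * j)%:R ^+ (3 * j))%:E)%E).
    apply: leeD => //; apply: lee_wpmul2l; first by rewrite lee_fin.
    by have := mom N.+1 isT; rewrite /= -/j -expnS.
  rewrite -EFinM -EFinD lee_fin.
  (* The normalisation [4 e] of [U] is made for this: since [(4 e)^2 = 16 e^2], the increment is
     [(8 e^2 / (16 e^2))^j = 2^-j]. *)
  have -> : K * (b2 ^+ j * (2 * j)%:R ^+ (3 * j)) = 2^-1 ^+ j.
    rewrite /K 2!exprM -exprVn -!exprMn; congr (_ ^+ j); rewrite natrM.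
    by field; rewrite !gt_eqF// ltr0n.
  have h : 2^-1 ^+ j <= 2^-1 ^+ N.+1 :> R by apply: ler_wiXn2l => //; lra.
  by rewrite (le_trans (lerD (lexx _) h))// exprS; lra.
apply: (EE_fatou (h := fun N w => expR (Num.min (v w) (2 ^ N)%:R))) => [N|N w|w|N].
- by apply: measurable_expR_comp; exact: measurable_minr.
- exact: expR_ge0.
- apply: cvg_near_cst; exists (Num.truncn (v w)).+1 => // N /= hN.
  rewrite min_l// (le_trans (ltW (truncnS_gt _)))// ler_nat (leq_trans hN)//.
  exact/ltnW/ltn_expl.
- by rewrite (le_trans (key N))// lee_fin lerBlDr lerDl exprn_ge0// invr_ge0.
Qed.

(** * Orlicz norms and Gaussian interpolation *)

Section orlicz.
Context {R : realType} (psi : R -> R).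
Hypothesis psi_cvx : forall x y l : R, 0 <= x -> 0 <= y -> 0 <= l <= 1 ->
  psi (l * x + (1 - l) * y) <= l * psi x + (1 - l) * psi y.
Hypothesis psi_mono : forall x y : R, 0 <= x -> x <= y -> psi x <= psi y.
Hypothesis psi_0 : psi 0 = 0.

Lemma psi_ge0 (x : R) : 0 <= x -> 0 <= psi x.
Proof. by move=> x0; rewrite -psi_0 psi_mono. Qed.

Lemma psi_abs_ge0 (x a : R) : 0 < a -> 0 <= psi (`|x| / a).
Proof. by move=> a0; rewrite psi_ge0// divr_ge0// ltW. Qed.

Lemma nondecreasing_psi_max : {homo (fun x : R => psi (Num.max 0 x)) : x y / x <= y}.
Proof.
move=> x y xy; apply: psi_mono; first by rewrite le_max lexx.
by rewrite ge_max !le_max lexx xy orbT.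
Qed.

(** The scales whose infimum is [orlicz_norm]. Norms are compared through them, so that infinite
    values and unattained infima are dealt with only once, in [orlicz_close]. *)
Definition orlicz_adm {disp} {T : measurableType disp} (P : probability T R) (g : T -> R) (a : R) : Prop :=
  0 < a /\ (\int[P]_w (psi (`|g w| / a))%:E <= 1)%E.

Section one_law.
Context {disp : measure_display} {T : measurableType disp} (P : probability T R).
Implicit Types (g h S D Y : T -> R).

Lemma measurable_psi g a : measurable_fun setT g -> 0 < a ->
  measurable_fun setT (fun w => psi (`|g w| / a)).
Proof.
move=> mg a0; rewrite (_ : (fun w => _) = (fun x => psi (Num.max 0 x)) \o (fun w => `|g w| / a)).
  apply: measurableT_comp; first exact: nondecreasing_measurable nondecreasing_psi_max.
  by apply: measurable_funM => //; exact: measurableT_comp.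
by apply/funext => w /=; rewrite max_r// divr_ge0// ltW.
Qed.

Lemma orlicz_adm_mono g h a : (forall w, `|g w| <= `|h w|) -> orlicz_adm P h a -> orlicz_adm P g a.
Proof.
move=> gh [a0 ha]; split => //; apply: le_trans ha; apply: le_EE => w; rewrite lee_fin.
  exact: psi_abs_ge0.
by apply: psi_mono; [rewrite divr_ge0// ltW|rewrite ler_wpM2r ?invr_ge0// ltW].
Qed.

Lemma orlicz_adm_le g a b : a <= b -> orlicz_adm P g a -> orlicz_adm P g b.
Proof.
move=> ab [a0 ha]; have b0 : 0 < b by exact: lt_le_trans ab.
split => //; apply: le_trans ha; apply: le_EE => w; rewrite lee_fin.
  exact: psi_abs_ge0.
apply: psi_mono; first by rewrite divr_ge0// ltW.
by rewrite ler_wpM2l// lef_pV2.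
Qed.

Lemma orlicz_adm_scale g (a b : R) : 0 < b -> orlicz_adm P g a -> orlicz_adm P (fun w => b * g w) (b * a).
Proof.
move=> b0 [a0 ha]; split; first exact: mulr_gt0.
apply: le_trans ha; apply: le_EE => w; rewrite lee_fin.
  by apply: psi_abs_ge0; exact: mulr_gt0.
have -> // : `|b * g w| / (b * a) = `|g w| / a.
by rewrite normrM gtr0_norm// -mulf_div divff ?gt_eqF// mul1r.
Qed.

(** Convexity with weights [x / (x + y)] and [y / (x + y)]. [Y] occurs only under a monotone
    integral, so it may be the estimation error, whose measurability is not established. *)
Lemma orlicz_adm_triangle S D Y x y : measurable_fun setT S -> measurable_fun setT D ->
  (forall w, `|Y w| <= `|S w| + `|D w|) -> orlicz_adm P S x -> orlicz_adm P D y -> orlicz_adm P Y (x + y).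
Proof.
move=> mS mD hY [x0 hx] [y0 hy]; have xy0 : 0 < x + y by exact: addr_gt0.
split => //; pose l := x / (x + y).
have lE : 1 - l = y / (x + y).
  by rewrite /l -{1}(@divff _ (x + y)) ?gt_eqF// -mulrBl addrC addKr.
have l0 : 0 <= l by rewrite divr_ge0// ltW.
have l1 : 0 <= 1 - l by rewrite lE divr_ge0// ltW.
apply: (@le_trans _ _ (\int[P]_w (l * psi (`|S w| / x) + (1 - l) * psi (`|D w| / y))%:E)%E).
  apply: le_EE => w; rewrite lee_fin; first exact: psi_abs_ge0.
  apply: le_trans (psi_cvx _ _ _); last 3 first.
  - by rewrite divr_ge0// ltW.
  - by rewrite divr_ge0// ltW.
  - by rewrite l0 -subr_ge0.
  apply: psi_mono; first by rewrite divr_ge0// ltW.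
  have -> : l * (`|S w| / x) + (1 - l) * (`|D w| / y) = (`|S w| + `|D w|) / (x + y).
    by rewrite lE /l; field; rewrite !gt_eqF.
  by rewrite ler_wpM2r// invr_ge0 ltW.
have mpS := measurable_psi mS x0; have mpD := measurable_psi mD y0.
rewrite EE_D; last 4 first.
- exact: measurable_funM.
- exact: measurable_funM.
- by move=> w; rewrite mulr_ge0// psi_abs_ge0.
- by move=> w; rewrite mulr_ge0// psi_abs_ge0.
rewrite !EE_Zl//; [|by move=> w; exact: psi_abs_ge0..].
have -> : 1%E = (l%:E * 1 + (1 - l)%:E * 1)%E :> \bar R.
  by rewrite !mule1 -EFinD addrC subrK.
by apply: leeD; apply: lee_wpmul2l; rewrite ?lee_fin.
Qed.

(* [Y] may fail to be measurable; [max 0 (|S| - |D|)], which it dominates, is measurable. *)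
Lemma orlicz_adm_lower S D Y x y : measurable_fun setT S -> measurable_fun setT D ->
  (forall w, `|S w| <= `|Y w| + `|D w|) -> orlicz_adm P Y x -> orlicz_adm P D y -> orlicz_adm P S (x + y).
Proof.
move=> mS mD hS hx hy; pose S' w := Num.max 0 (`|S w| - `|D w|).
have mS' : measurable_fun setT S'.
  by apply: measurable_maxr => //; apply: measurable_funB; exact: measurableT_comp.
have S'0 w : 0 <= S' w by rewrite le_max lexx.
apply: (orlicz_adm_triangle mS' mD _ _ hy) => [w|].
  by rewrite (ger0_norm (S'0 w)) -lerBlDr le_max lexx orbT.
apply: orlicz_adm_mono hx => w; rewrite (ger0_norm (S'0 w)) ge_max normr_ge0/=.
by rewrite lerBlDr.
Qed.

Lemma orlicz_le g a : orlicz_adm P g a -> (orlicz_norm P psi g <= a%:E)%E.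
Proof. by move=> ha; apply: ereal_inf_lbound; exists a. Qed.

Lemma orlicz_ge0 g : (0 <= orlicz_norm P psi g)%E.
Proof. by apply: le_ereal_inf_tmp => _ [a [a0 _] <-]; rewrite lee_fin ltW. Qed.

End one_law.

(** The slack [e] is there because neither infimum need be attained. For [s = 0] the lower bound is
    the nonnegativity of the norm, and [h2] is asked for [0 < s] only. *)
Lemma orlicz_close {d1 d2} {T1 : measurableType d1} {T2 : measurableType d2}
    (P1 : probability T1 R) (P2 : probability T2 R) (Y : T1 -> R) (S : T2 -> R) (s y : R) :
  0 <= s -> 0 <= y -> (exists a, orlicz_adm P2 S a) ->
  (forall a e, 0 < e -> orlicz_adm P2 S a -> orlicz_adm P1 Y (s * a + y + e)) ->
  (forall a e, 0 < e -> 0 < s -> orlicz_adm P1 Y a -> orlicz_adm P2 S ((a + y + e) / s)) ->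
  (`| orlicz_norm P1 psi Y - s%:E * orlicz_norm P2 psi S | <= y%:E)%E.
Proof.
move=> s0 y0 [a0 ha0] h1 h2.
have adh (d : measure_display) (T : measurableType d) (P : probability T R) (g : T -> R) (b e : R) :
    orlicz_norm P psi g = b%:E -> 0 < e -> exists2 a, orlicz_adm P g a & a < b + e.
  move=> gb e0; have : (orlicz_norm P psi g < (b + e)%:E)%E by rewrite gb lte_fin ltrDl.
  by move=> /ereal_inf_lt[_ [a ha <-]]; rewrite lte_fin => ab; exists a.
have [b hb] : exists b : R, orlicz_norm P2 psi S = b%:E.
  have := orlicz_le ha0; have := orlicz_ge0 P2 S.
  by case: (orlicz_norm P2 psi S) => [b _ _| |]//; exists b.
have [c hc] : exists c : R, orlicz_norm P1 psi Y = c%:E.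
  have := orlicz_le (h1 _ 1 ltr01 ha0); have := orlicz_ge0 P1 Y.
  by case: (orlicz_norm P1 psi Y) => [c _ _| |]//; exists c.
rewrite hc hb -EFinM -EFinB abse_EFin lee_fin ler_norml; apply/andP; split.
  have c0 : 0 <= c by have := orlicz_ge0 P1 Y; rewrite hc lee_fin.
  move: s0; rewrite le_eqVlt => /predU1P[<-|s0]; first by rewrite mul0r subr0 (le_trans _ c0)// oppr_le0.
  rewrite lerBrDr addrC lerBlDr; apply/ler_addgt0Pr => e e0.
  have e2 : 0 < e / 2 by rewrite divr_gt0.
  have [a ha ac] := adh _ _ _ _ _ _ hc e2.
  have := orlicz_le (h2 _ _ e2 s0 ha); rewrite hb lee_fin ler_pdivlMr// mulrC => h.
  by rewrite (le_trans h)//; lra.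
rewrite lerBlDr; apply/ler_addgt0Pr => e e0.
(* The near-optimal scale gets multiplied by [s], hence the division by [s + 1], which is also safe
   at [s = 0]. *)
have e2 : 0 < e / (2 * (s + 1)) by rewrite divr_gt0// mulr_gt0// ltr_wpDl.
have [a ha ac] := adh _ _ _ _ _ _ hb e2.
have := orlicz_le (h1 _ _ e2 ha); rewrite hc lee_fin => h.
rewrite (le_trans h)//; set e' := e / _ in e2 ac *.
have -> : e = 2 * (s + 1) * e' by rewrite /e' mulrCA mulfV ?mulr1// gt_eqF// mulr_gt0// ltr_wpDl.
have : s * a <= s * (b + e') by rewrite ler_wpM2l// ltW.
have : 0 <= s * e' by rewrite mulr_ge0// ltW.
by lra.
Qed.

Section exponential_tail.
Context {disp : measure_display} {T : measurableType disp} (P : probability T R).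
Variable c : R.
Hypothesis c0 : 0 < c.
Hypothesis psi_exp : forall u : R, 0 <= u -> psi u <= expR ((c * u) `^ (2 / 3)) - 1.

(** [psi] is dominated by [exp (e G) - 1], hence by [e exp G] thanks to [expR_interp]; the weight
    [e] is small enough to bring the exponential moment [B] down to 1. *)
Lemma orlicz_adm_exp (D G : T -> R) (y e B : R) : 0 < y -> 0 <= e <= 1 -> e * B <= 1 ->
  measurable_fun setT G ->
  (forall w, (c * (`|D w| / y)) `^ (2 / 3) <= e * G w) ->
  (\int[P]_w (expR (G w))%:E <= B%:E)%E -> orlicz_adm P D y.
Proof.
move=> y0 /andP[e0 e1] eB mG hD hG; split => //.
apply: (@le_trans _ _ (\int[P]_w (e * expR (G w))%:E)%E).
  apply: le_EE => w; rewrite lee_fin; first exact: psi_abs_ge0.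
  have h0 : 0 <= `|D w| / y by rewrite divr_ge0// ltW.
  rewrite (le_trans (psi_exp h0))// lerBlDr.
  rewrite (@le_trans _ _ (expR (e * G w)))//; first by rewrite ler_expR.
  by have := expR_interp (G w) e0 e1; lra.
rewrite EE_Zl//; last exact: measurable_expR_comp.
apply: (@le_trans _ _ (e%:E * B%:E)%E); last by rewrite -EFinM lee_fin.
by apply: lee_wpmul2l => //; rewrite lee_fin.
Qed.

(** The exponent [2/3] of [psi_{2/3}] undoes the power [3/2] and leaves [1/r], with
    [r = 16 e^2 (e + 1)]. Of this, [1 / (e (e + 1))] is the weight required by the exponential
    moment [e (e + 1)] in [orlicz_adm_mix], and [1 / (16 e)] pays for the splitting of
    [1 + T0 + Y]. *)
Definition kappa : R := c * (16 * expR 1 ^+ 2 * (expR 1 + 1)) `^ (3 / 2).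

Lemma kappa_gt0 : 0 < kappa.
Proof.
have e0 : 0 < expR 1 :> R := expR_gt0 1.
by rewrite /kappa mulr_gt0// powR_gt0// mulr_gt0// ?addr_gt0// mulr_gt0// exprn_gt0.
Qed.

(** Joins a part with exponential tails and a part with [psi_{2/3}] tails. They may be dependent, so
    their exponential moments are combined by convexity, each with weight one half ([expR_mid]). *)
Lemma orlicz_adm_mix (D T0 Y : T -> R) (B : R) : 0 < B -> measurable_fun setT T0 ->
  measurable_fun setT Y -> (forall w, 0 <= T0 w) -> (forall w, 0 <= Y w) ->
  (\int[P]_w (expR (T0 w))%:E <= (expR 1)%:E)%E ->
  (\int[P]_w (expR ((Y w / (4 * expR 1)) `^ (2 / 3)))%:E <= (expR 1 + 1)%:E)%E ->
  (forall w, `|D w| <= B * (1 + T0 w + Y w)) -> orlicz_adm P D (kappa * B).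
Proof.
move=> B0 mT mY T00 Y0 hT hY hD.
have e0 : 0 < expR 1 :> R := expR_gt0 1.
have e1 : 1 <= expR 1 :> R by rewrite -{1}expR0 ler_expR.
pose r := 16 * expR 1 ^+ 2 * (expR 1 + 1) : R.
have r0 : 0 < r by rewrite mulr_gt0// ?addr_gt0// mulr_gt0// exprn_gt0.
pose q := 2 / 3 : R; have q0 : 0 <= q by rewrite /q; lra.
have q1 : 0 < q <= 1 by rewrite /q; apply/andP; split; lra.
pose v w := (Y w / (4 * expR 1)) `^ q.
have v0 w : 0 <= v w by exact: powR_ge0.
have mv : measurable_fun setT v.
  apply: (measurableT_comp (f := fun x => x `^ q)); first exact: measurable_powR.
  exact: measurable_funM.
pose G w := 1 + (T0 w + v w) / 2.
have k0 := kappa_gt0.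
apply: (@orlicz_adm_exp D G _ (expR 1 * (expR 1 + 1))^-1 (expR 1 * (expR 1 + 1))).
- by rewrite mulr_gt0.
- have : 1 <= expR 1 * (expR 1 + 1) :> R by nra.
  by move=> h; rewrite invr_ge0 invf_le1 ?h ?andbT// ltW// (lt_le_trans _ h).
- by rewrite mulVf// gt_eqF// mulr_gt0// addr_gt0.
- apply: measurable_funD => //; apply: measurable_funM => //; exact: measurable_funD.
- move=> w; have x0 : 0 <= 1 + T0 w + Y w by rewrite !addr_ge0.
  apply: (@le_trans _ _ ((r `^ (3 / 2))^-1 `^ q * (1 + T0 w + Y w) `^ q)).
    rewrite -powRM ?invr_ge0 ?powR_ge0//; apply: ge0_ler_powR => //; rewrite ?nnegrE.
    - by rewrite mulr_ge0 ?divr_ge0 ?(ltW c0)// ltW// mulr_gt0.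
    - by rewrite mulr_ge0// invr_ge0 powR_ge0.
    have rp : 0 < r `^ (3 / 2) by exact: powR_gt0.
    rewrite /kappa -/r mulrA ler_pdivrMr ?mulr_gt0//.
    have -> : (r `^ (3 / 2))^-1 * (1 + T0 w + Y w) * (c * r `^ (3 / 2) * B) = c * (B * (1 + T0 w + Y w)).
      by field; rewrite gt_eqF.
    by rewrite ler_wpM2l// ltW.
  have -> : (r `^ (3 / 2))^-1 `^ q = r^-1.
    rewrite -powR_inv1 ?powR_ge0// -!powRrM.
    rewrite (_ : 3 / 2 * (- 1 * q) = -1); last by rewrite /q; field.
    by rewrite powR_inv1// ltW.
  have h : (1 + T0 w + Y w) `^ q <= 2 * ((2 + T0 w) + 4 * expR 1 * v w).
    rewrite (le_trans (powR_add_le _ _ q1))// ?addr_ge0// ler_wpM2l//; apply: lerD.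
      rewrite (le_trans (powR_le_1D _ q1))// ?addr_ge0//; lra.
    rewrite -[Y w](@divfK _ (4 * expR 1)) ?gt_eqF ?mulr_gt0// [_ / _ * _]mulrC powRM ?divr_ge0 ?mulr_ge0 ?(ltW e0)//.
    rewrite -/(v w) ler_wpM2r// -[leRHS]powRr1 ?mulr_ge0 ?(ltW e0)//.
    by apply: ler_powR; [lra|case/andP: q1].
  have -> : (expR 1 * (expR 1 + 1))^-1 = r^-1 * (16 * expR 1) :> R.
    by rewrite /r; field; rewrite !gt_eqF ?addr_gt0.
  rewrite -mulrA ler_wpM2l ?invr_ge0 ?(ltW r0)// (le_trans h)// /G.
  have := T00 w; have := v0 w; move: (T0 w) (v w) (expR 1 : R) e1 => t z e e1 z0 t0.
  have et : t <= e * t by rewrite ler_peMl.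
  by nra.
- apply: (@le_trans _ _ (\int[P]_w (expR 1 * (2^-1 * expR (T0 w) + 2^-1 * expR (v w)))%:E)%E).
    apply: le_EE => w; rewrite lee_fin ?expR_ge0// /G expRD ler_wpM2l ?expR_ge0//.
    by have := expR_mid (T0 w) (v w); lra.
  have mT' := measurable_expR_comp mT; have mv' := measurable_expR_comp mv.
  rewrite EE_Zl ?expR_ge0//; last by apply: measurable_funD; exact: measurable_funM.
  rewrite EE_D; last 4 first.
  - exact: measurable_funM.
  - exact: measurable_funM.
  - by move=> w; rewrite mulr_ge0// ?invr_ge0// expR_ge0.
  - by move=> w; rewrite mulr_ge0// ?invr_ge0// expR_ge0.
  rewrite !EE_Zl// ?invr_ge0//; [|by move=> w; exact: expR_ge0..].
  rewrite EFinM; apply: lee_wpmul2l; first by rewrite lee_fin expR_ge0.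
  apply: (@le_trans _ _ (2^-1%:E * (expR 1)%:E + 2^-1%:E * (expR 1 + 1)%:E)%E).
    by apply: leeD; apply: lee_wpmul2l => //; rewrite lee_fin invr_ge0.
  by rewrite -!EFinM -EFinD lee_fin; lra.
Qed.

End exponential_tail.

(** * Rotation of a variable into an independent one, in Orlicz norm *)

Section rotation.
(** The right derivative of the convex function [psi], as the infimum of its difference quotients;
    it is a subgradient whether or not [psi] is differentiable. *)
Definition slope (u : R) : R := inf [set (psi (u + h) - psi u) / h | h in [set h : R | 0 < h]].

Lemma slope_has_lbound (u : R) : 0 <= u ->
  has_lbound [set (psi (u + h) - psi u) / h | h in [set h : R | 0 < h]].
Proof.
move=> u0; exists 0 => _ [h h0 <-]; have h0' : 0 < h by [].
by rewrite divr_ge0 ?(ltW h0')// subr_ge0 psi_mono// lerDl ltW.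
Qed.

Lemma slope_subgrad (u v : R) : 0 <= u -> 0 <= v -> psi u + slope u * (v - u) <= psi v.
Proof.
move=> u0 v0; have [vu|uv|->] := ltgtP v u; last by rewrite subrr mulr0 addr0.
- have du : 0 < u - v by rewrite subr_gt0.
  have : (psi u - psi v) / (u - v) <= slope u.
    apply: lb_le_inf; first by exists ((psi (u + 1) - psi u) / 1); exists 1; rewrite //= ltr01.
    move=> _ [h h0 <-]; have h0' : 0 < h by [].
    rewrite ler_pdivrMr// mulrAC ler_pdivlMr//.
    (* [u] lies between [v] and [u + h], with weight [l] on [v]; convexity at these three points
       compares the slope on the left with every difference quotient on the right. *)
    pose l := h / (h + (u - v)).
    have hd : 0 < h + (u - v) by rewrite addr_gt0.
    have l01 : 0 <= l <= 1.
      by rewrite divr_ge0 ?(ltW hd) ?(ltW h0')// ler_pdivrMr// mul1r lerDl ltW.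
    have := psi_cvx v0 (addr_ge0 u0 (ltW h0')) l01.
    have -> : l * v + (1 - l) * (u + h) = u by rewrite /l; field; rewrite gt_eqF.
    rewrite -(ler_pM2l hd).
    have -> : (h + (u - v)) * (l * psi v + (1 - l) * psi (u + h)) = h * psi v + (u - v) * psi (u + h).
      by rewrite /l; field; rewrite gt_eqF.
    by lra.
  rewrite ler_pdivrMr//; lra.
- have du : 0 < v - u by rewrite subr_gt0.
  have : slope u <= (psi v - psi u) / (v - u).
    apply: ge_inf; first exact: slope_has_lbound.
    by exists (v - u) => //; rewrite [u + _]addrC subrK.
  rewrite ler_pdivlMr//; lra.
Qed.

Lemma slope_ge0 (u : R) : 0 <= u -> 0 <= slope u.
Proof.
move=> u0; apply: lb_le_inf; first by exists ((psi (u + 1) - psi u) / 1); exists 1; rewrite //= ltr01.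
move=> _ [h h0 <-]; have h0' : 0 < h by [].
by rewrite divr_ge0 ?(ltW h0')// subr_ge0 psi_mono// lerDl ltW.
Qed.

Lemma slope_mono (u v : R) : 0 <= u -> u <= v -> slope u <= slope v.
Proof.
move=> u0; rewrite le_eqVlt => /predU1P[->//|uv].
have v0 : 0 <= v by rewrite (le_trans u0)// ltW.
have h1 := slope_subgrad u0 v0; have h2 := slope_subgrad v0 u0.
have d0 : 0 < v - u by rewrite subr_gt0.
by rewrite -(ler_pM2r d0); lra.
Qed.

(* [psi] is continued affinely beyond [K] so that its subgradients are bounded test functions. *)
Definition psi_trunc (K u : R) : R := psi (Num.min u K) + slope K * (u - Num.min u K).
Definition slope_trunc (K u : R) : R := slope (Num.min u K).

Section truncated.
Variable K : R.
Hypothesis K0 : 0 <= K.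

Let min_ge0 (u : R) : 0 <= u -> 0 <= Num.min u K.
Proof. by move=> u0; rewrite le_min u0. Qed.

Lemma slope_trunc_ge0 (u : R) : 0 <= u -> 0 <= slope_trunc K u.
Proof. by move=> u0; rewrite slope_ge0 ?min_ge0. Qed.

Lemma slope_trunc_le (u : R) : 0 <= u -> slope_trunc K u <= slope K.
Proof. by move=> u0; rewrite slope_mono ?min_ge0// ge_min lexx orbT. Qed.

Lemma psi_trunc_ge0 (u : R) : 0 <= u -> 0 <= psi_trunc K u.
Proof.
move=> u0; rewrite addr_ge0 ?psi_ge0 ?min_ge0// mulr_ge0 ?slope_ge0//.
by rewrite subr_ge0 ge_min lexx.
Qed.

Lemma psi_trunc_subgrad (u v : R) : 0 <= u -> 0 <= v ->
  psi_trunc K u + slope_trunc K u * (v - u) <= psi_trunc K v.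
Proof.
move=> u0 v0; have [uK|Ku] := leP u K; rewrite /psi_trunc /slope_trunc.
  rewrite (min_l uK) subrr mulr0 addr0; have v1 := min_ge0 v0.
  have := slope_subgrad u0 v1.
  have h : slope u * (v - Num.min v K) <= slope K * (v - Num.min v K).
    by rewrite ler_wpM2r ?slope_mono// subr_ge0 ge_min lexx.
  by move: h; set w := Num.min v K; lra.
rewrite (min_r (ltW Ku)); have := slope_subgrad K0 (min_ge0 v0).
by set w := Num.min v K; lra.
Qed.

Lemma psitE (u : R) : u <= K -> psi_trunc K u = psi u.
Proof. by move=> uK; rewrite /psi_trunc min_l// subrr mulr0 addr0. Qed.

Lemma psi_trunc_le (u : R) : 0 <= u -> psi_trunc K u <= psi u.
Proof.
move=> u0; have [uK|Ku] := leP u K; first by rewrite psitE.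
by rewrite /psi_trunc min_r ?(ltW Ku)// slope_subgrad.
Qed.

Lemma psi_trunc_mono (u v : R) : 0 <= u -> u <= v -> psi_trunc K u <= psi_trunc K v.
Proof.
move=> u0 uv; have v0 := le_trans u0 uv.
rewrite (le_trans _ (psi_trunc_subgrad u0 v0))// lerDl mulr_ge0 ?slope_trunc_ge0// subr_ge0//.
Qed.

Lemma psi_trunc_linear (u : R) : 0 <= u -> psi_trunc K u <= slope K * u.
Proof.
move=> u0; have := psi_trunc_subgrad u0 (lexx 0); rewrite [leRHS]psitE// psi_0.
have : slope_trunc K u * u <= slope K * u by rewrite ler_wpM2r ?slope_trunc_le.
by lra.
Qed.

Context {disp : measure_display} {T : measurableType disp} (P : probability T R).
Implicit Types X Q A : T -> R.

Lemma measurable_psi_trunc X a : measurable_fun setT X -> 0 < a ->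
  measurable_fun setT (fun w => psi_trunc K (`|X w| / a)).
Proof.
move=> mX a0; rewrite (_ : (fun w => _) = (fun x => psi_trunc K (Num.max 0 x)) \o (fun w => `|X w| / a)).
  apply: measurableT_comp; last by apply: measurable_funM => //; exact: measurableT_comp.
  apply: nondecreasing_measurable => // x y xy; apply: psi_trunc_mono; first by rewrite le_max lexx.
  by rewrite ge_max !le_max lexx xy orbT.
by apply/funext => w /=; rewrite max_r// divr_ge0// ltW.
Qed.

Lemma measurable_slope_trunc a : 0 < a ->
  measurable_fun setT (fun x : R => slope_trunc K (`|x| / a)).
Proof.
move=> a0; rewrite (_ : (fun w => _) = (fun x => slope_trunc K (Num.max 0 x)) \o (fun x => `|x| / a)).
  apply: measurableT_comp; last by apply: measurable_funM => //; exact: normr_measurable.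
  apply: nondecreasing_measurable => // x y xy; apply: slope_mono.
    by apply: min_ge0; rewrite le_max lexx.
  rewrite le_min !ge_min lexx orbT andbT; apply/orP; left.
  by rewrite ge_max !le_max lexx xy orbT.
by apply/funext => w /=; rewrite max_r// divr_ge0// ltW.
Qed.

Lemma itg_psi_trunc X a : itg P X -> 0 < a -> itg P (fun w => psi_trunc K (`|X w| / a)).
Proof.
move=> iX a0; have h w : 0 <= `|X w| / a by rewrite divr_ge0// ltW.
apply: (itg_le (g := fun w => slope K * (a^-1 * `|X w|))).
- exact: measurable_psi_trunc (itg_meas iX) a0.
- by do 2 apply: itgZ; exact: itg_norm.
- by move=> w; rewrite ger0_norm ?psi_trunc_ge0// [a^-1 * _]mulrC; exact: psi_trunc_linear.
Qed.

(* With [p] a subgradient of [psi] and [u = |X| / b]: if [E psi v <= 1 < E psi u] then [E p(u) v <= E p(u) u].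
   This is applied to [v = |cd X + sd X'| / y] and [v = |Q| / yQ]. *)
Lemma rotation_step X X' Q (cd sd y yQ b : R) :
  itg P X -> itg P X' -> itg P Q -> 0 <= cd -> 0 < y -> 0 < yQ -> 0 < b ->
  (forall phi : R -> R, measurable_fun setT phi -> (exists M, forall x, `|phi x| <= M) ->
     Ex P (fun w => X' w * phi (X w)) = Ex P (fun w => Q w * phi (X w))) ->
  Ex P (fun w => psi_trunc K (`|cd * X w + sd * X' w| / y)) <= 1 ->
  Ex P (fun w => psi_trunc K (`|Q w| / yQ)) <= 1 ->
  y + `|sd| * yQ < cd * b ->
  Ex P (fun w => psi_trunc K (`|X w| / b)) <= 1.
Proof.
move=> iX iX' iQ cd0 y0 yQ0 b0 hphi hXn hQ hb; rewrite leNgt; apply/negP => hX.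
pose u w := `|X w| / b; have u0 w : 0 <= u w by rewrite divr_ge0// ltW.
pose p w := slope_trunc K (u w); have p0 w : 0 <= p w by exact: slope_trunc_ge0.
have pK w : p w <= slope K by exact: slope_trunc_le.
have mp : measurable_fun setT p.
  exact: (measurableT_comp (measurable_slope_trunc b0) (itg_meas iX)).
have ip A : itg P A -> itg P (fun w => A w * p w).
  move=> iA; apply: (itg_le (g := fun w => slope K * `|A w|)).
  - by apply: measurable_funM => //; exact: (itg_meas iA).
  - by apply: itgZ; exact: itg_norm.
  - by move=> w; rewrite normrM mulrC (ger0_norm (p0 w)) ler_wpM2r.
have iu : itg P u.
  rewrite (_ : u = fun w => b^-1 * `|X w|); last by apply/funext => w; rewrite mulrC.
  by apply: itgZ; exact: itg_norm.
pose Th := Ex P (fun w => u w * p w).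
have key A a : itg P A -> 0 < a -> Ex P (fun w => psi_trunc K (`|A w| / a)) <= 1 ->
    Ex P (fun w => `|A w| * p w) < a * Th.
  move=> iA a0 hA.
  have iA' : itg P (fun w => `|A w| * p w) by apply: ip; exact: itg_norm.
  rewrite -ltr_pdivrMl// -ExZ//.
  apply: (@le_lt_trans _ _ (Ex P (fun w => psi_trunc K (`|A w| / a) - psi_trunc K (u w) + u w * p w))).
    apply: Ex_le; first exact: itgZ.
      by apply: itgD; [apply: itgB; exact: itg_psi_trunc|exact: ip].
    move=> w; have := psi_trunc_subgrad (u0 w) (_ : 0 <= `|A w| / a).
    rewrite divr_ge0 ?(ltW a0)// => /(_ isT); rewrite -/(p w).
    by have -> : a^-1 * (`|A w| * p w) = p w * (`|A w| / a); [ring|lra].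
  rewrite ExD; [|by apply: itgB; exact: itg_psi_trunc|exact: ip].
  rewrite ExB; [|exact: itg_psi_trunc..].
  by rewrite -/Th gtrDr subr_lt0 (le_lt_trans hA).
(* Bounded, with [X * phi X = |X| * p]: testing with it recovers the pairing of [X] with the
   subgradient, while [X'] may be exchanged for [Q]. *)
pose phi (x : R) := Num.sg x * slope_trunc K (`|x| / b).
have mphi : measurable_fun setT phi.
  apply: measurable_funM; last exact: measurable_slope_trunc.
  apply: nondecreasing_measurable => // x1 x2 h.
  have [h2|h2] := ltP x2 0; first by rewrite (ltr0_sg h2) (ltr0_sg (le_lt_trans h h2)).
  have [h1|h1] := leP x1 0; last by rewrite (gtr0_sg h1) (gtr0_sg (lt_le_trans h1 h)).
  by apply: (@le_trans _ _ 0); rewrite ?sgr_le0 ?sgr_ge0.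
have phib : exists M, forall x, `|phi x| <= M.
  exists (slope K) => x; have x0 : 0 <= `|x| / b by rewrite divr_ge0// ltW.
  rewrite normrM (ger0_norm (slope_trunc_ge0 x0)) (le_trans _ (slope_trunc_le x0))//.
  by rewrite ler_piMl ?slope_trunc_ge0// normr_sg; case: (x != 0).
have phiE w : phi (X w) = Num.sg (X w) * p w by [].
have iphi A : itg P A -> itg P (fun w => A w * phi (X w)).
  move=> iA; case: phib => M hM; apply: (itg_le (g := fun w => M * `|A w|)).
  - exact: measurable_funM (itg_meas iA) (measurableT_comp mphi (itg_meas iX)).
  - by apply: itgZ; exact: itg_norm.
  - by move=> w; rewrite normrM mulrC ler_wpM2r.
have bnd A : itg P A -> `|Ex P (fun w => A w * phi (X w))| <= Ex P (fun w => `|A w| * p w).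
  move=> iA; rewrite (le_trans (Ex_norm (iphi _ iA)))//; apply: Ex_le.
  - by apply: itg_norm; exact: iphi.
  - by apply: ip; exact: itg_norm.
  - move=> w; rewrite phiE !normrM (ger0_norm (p0 w)) ler_wpM2l//.
    by rewrite ler_piMl// normr_sg; case: (_ != 0).
have iXn : itg P (fun w => cd * X w + sd * X' w) by apply: itgD; exact: itgZ.
have h1 := key _ _ iXn y0 hXn; have h2 := key _ _ iQ yQ0 hQ.
have ThE : Ex P (fun w => X w * phi (X w)) = b * Th.
  rewrite /Th -ExZ; last exact: ip.
  apply: eq_Ex => w; rewrite phiE /u mulrA [X w * _]mulrC -normrEsg; field; rewrite gt_eqF//.
have E1 : Ex P (fun w => (cd * X w + sd * X' w) * phi (X w)) =
    cd * (b * Th) + sd * Ex P (fun w => Q w * phi (X w)).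
  rewrite -ThE -(hphi phi mphi phib) -ExZ; last exact: iphi.
  rewrite -ExZ; last exact: iphi.
  rewrite -ExD; [|by apply: itgZ; exact: iphi..].
  by apply: eq_Ex => w; ring.
have h3 := bnd _ iXn; rewrite E1 in h3.
have h4 := bnd _ iQ.
have Th0 : 0 < Th.
  rewrite -(pmulr_rgt0 _ y0); apply: le_lt_trans h1; apply: Ex_ge0 => w.
  by rewrite mulr_ge0.
have h5 : cd * (b * Th) <= y * Th + `|sd| * (yQ * Th).
  have := ler_norm (cd * (b * Th) + sd * Ex P (fun w => Q w * phi (X w))).
  have h6 : `|sd * Ex P (fun w => Q w * phi (X w))| <= `|sd| * (yQ * Th).
    by rewrite normrM ler_wpM2l// (le_trans h4)// ltW.
  have := ler_norm (- (sd * Ex P (fun w => Q w * phi (X w)))); rewrite normrN.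
  by lra.
have : (y + `|sd| * yQ) * Th < cd * b * Th by rewrite ltr_pM2r.
by lra.
Qed.

End truncated.

Section path.
Context {disp : measure_display} {T : measurableType disp} (P : probability T R).
Variables (X0 X1 Q : T -> R) (yQ : R).
Hypotheses (iX0 : itg P X0) (iX1 : itg P X1) (iQ : itg P Q).
Let X (b : R) w := cos b * X0 w + sin b * X1 w.
Let X' (b : R) w := - sin b * X0 w + cos b * X1 w.
Hypothesis hQ : forall (b : R) (phi : R -> R), measurable_fun setT phi ->
  (exists M, forall x, `|phi x| <= M) ->
  Ex P (fun w => X' b w * phi (X b w)) = Ex P (fun w => cos b * Q w * phi (X b w)).
Hypothesis admQ : orlicz_adm P Q yQ.

Let iX b : itg P (X b). Proof. by apply: itgD; exact: itgZ. Qed.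
Let iX' b : itg P (X' b). Proof. by apply: itgD; exact: itgZ. Qed.

Lemma sin_le_id (x : R) : `|sin x| <= `|x|.
Proof.
have h := @mvt_lipschitz R sin cos 1 (fun x => is_derive_sin x) (@cos_max R).
by have := h x 0; rewrite sin0 !subr0 mul1r.
Qed.

Lemma cos_ge_sqr (x : R) : 1 - x ^+ 2 / 2 <= cos x.
Proof.
have -> : cos x = 1 - 2 * sin (x / 2) ^+ 2.
  by rewrite {1}(splitr x) cosD -!expr2 cos2sin2; ring.
have : `|sin (x / 2)| ^+ 2 <= `|x / 2| ^+ 2 by rewrite lerXn2r ?nnegrE// sin_le_id.
rewrite !real_normK ?num_real//; lra.
Qed.

Lemma bernoulli (r : R) j : 0 <= r <= 1 -> 1 - j%:R * r <= (1 - r) ^+ j.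
Proof.
move=> /andP[r0 r1]; elim: j => [|j IH]; first by rewrite mul0r subr0 expr0.
rewrite exprS (@le_trans _ _ ((1 - r) * (1 - j%:R * r)))//; last by rewrite ler_wpM2l// subr_ge0.
have : 0 <= j%:R * (r * r) by rewrite !mulr_ge0.
by rewrite -natr1; lra.
Qed.

Lemma orlicz_adm_psi_trunc K Y a : 0 <= K -> itg P Y -> orlicz_adm P Y a -> Ex P (fun w => psi_trunc K (`|Y w| / a)) <= 1.
Proof.
move=> K0 iY [a0 ha]; rewrite -lee_fin -ExE; last exact: itg_psi_trunc.
apply: le_trans ha; apply: le_EE => w; have h : 0 <= `|Y w| / a by rewrite divr_ge0// ltW.
  by rewrite lee_fin psi_trunc_ge0.
by rewrite lee_fin psi_trunc_le.
Qed.

Lemma psi_trunc_orlicz_adm Y a : itg P Y -> 0 < a ->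
  (forall K, 0 <= K -> Ex P (fun w => psi_trunc K (`|Y w| / a)) <= 1) -> orlicz_adm P Y a.
Proof.
move=> iY a0 h; split => //.
apply: (EE_fatou (h := fun N w => psi_trunc N%:R (`|Y w| / a))) => [N|N w|w|N].
- exact: (measurable_psi_trunc _ (itg_meas iY)).
- by rewrite psi_trunc_ge0// divr_ge0// ltW.
- apply: cvg_near_cst; exists (Num.truncn (`|Y w| / a)).+1 => // N /= hN.
  by rewrite psitE// (le_trans (ltW (truncnS_gt _)))// ler_nat.
- by rewrite ExE ?lee_fin ?h//; exact: itg_psi_trunc.
Qed.

(** A quarter turn in [m] small rotations. [X] at the previous angle is [cos dl * X - sin dl * X']
    at the new one, the form in which [rotation_step] passes an admissible scale on. The sign [sg]
    gives both senses of rotation, one for each inequality between the norms. *)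
Lemma rotation_path (b0 sg y e : R) : `|sg| = 1 -> 0 < e ->
  orlicz_adm P (X b0) y -> orlicz_adm P (X (b0 + sg * (pi / 2))) (y + pi * yQ + e).
Proof.
move=> sg1 e0 hy; have [y0 _] := hy; have [yQ0 _] := admQ.
have pi0 : 0 < pi :> R := pi_gt0 R.
set A := y + pi * yQ; have A0 : 0 < A by rewrite addr_gt0// mulr_gt0.
have Ae0 : 0 < A + e by rewrite addr_gt0.
(* So many steps that the loss [(cos dl)^m >= 1 - 2/m] costs at most [e], that is
   [(A + e) (1 - 2/m) >= A]. *)
pose m := (Num.truncn (2 * (A + e) / e)).+1.
have m0 : 0 < m%:R :> R by rewrite ltr0n.
have hm : 2 * (A + e) <= e * m%:R.
  by rewrite [leRHS]mulrC -ler_pdivrMr//; exact/ltW/truncnS_gt.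
have m2 : 2 <= m%:R :> R.
  by rewrite -(ler_pM2l e0) (le_trans _ hm)// mulrC ler_pM2l// lerDr ltW.
pose dl := sg * (pi / (2 * m%:R)).
have dl0 : `|dl| = pi / (2 * m%:R) by rewrite normrM sg1 mul1r ger0_norm// divr_ge0// ltW// mulr_gt0.
have pi4 : pi <= 4 :> R by have /andP[_ h] := pihalf_02 R; move: h; lra.
have dlsq : dl ^+ 2 / 2 <= 2 / m%:R ^+ 2.
  rewrite -real_normK ?num_real// dl0.
  have -> : (pi / (2 * m%:R)) ^+ 2 / 2 = pi ^+ 2 / 8 / m%:R ^+ 2 :> R by field; rewrite gt_eqF.
  rewrite ler_pM2r ?invr_gt0 ?exprn_gt0//.
  have : pi ^+ 2 <= 4 ^+ 2 :> R by rewrite lerXn2r ?nnegrE// ltW.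
  lra.
pose r := 2 / m%:R ^+ 2 : R.
have r01 : 0 <= r <= 1.
  rewrite divr_ge0 ?exprn_ge0 ?(ltW m0)// ler_pdivrMr ?exprn_gt0// mul1r.
  by have : 0 <= (m%:R - 2) * m%:R :> R; [rewrite mulr_ge0 ?subr_ge0 ?(ltW m0)|rewrite expr2; lra].
have /andP[r0 r1] := r01.
have cr : 1 - r <= cos dl by have := cos_ge_sqr dl; rewrite /r; lra.
have rm : 2 / m%:R = m%:R * r by rewrite /r; field; rewrite gt_eqF.
have cm : 1 - 2 / m%:R <= cos dl ^+ m.
  rewrite rm (le_trans (bernoulli m r01))// lerXn2r ?nnegrE ?subr_ge0// (le_trans _ cr)// subr_ge0//.
have r1' : r < 1.
  rewrite /r ltr_pdivrMr ?exprn_gt0// mul1r.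
  by have : 0 <= (m%:R - 2) * m%:R :> R; [rewrite mulr_ge0 ?subr_ge0 ?(ltW m0)|rewrite expr2; lra].
have c0 : 0 < cos dl by apply: lt_le_trans cr; rewrite subr_gt0.
have c1 : cos dl <= 1 := cos_le1 dl.
have s0 : 0 < `|dl| by rewrite dl0 divr_gt0// mulr_gt0.
(* Each step adds [|sin dl| * yQ] and divides by [cos dl]. The increment is doubled to [2 |dl| yQ],
   since [rotation_step] wants a strict inequality; [m] increments sum to [pi * yQ]. *)
pose bj j := (y + 2 * j%:R * `|dl| * yQ) / cos dl ^+ j.
have bj0 j : 0 < bj j by rewrite divr_gt0 ?exprn_gt0// ltr_pwDl// !mulr_ge0// ltW.
have step j : bj j + `|sin dl| * yQ < cos dl * bj j.+1.
  have -> : cos dl * bj j.+1 = bj j + 2 * `|dl| * yQ / cos dl ^+ j.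
    by rewrite /bj exprS -natr1; field; rewrite expf_neq0 ?gt_eqF.
  apply: (@le_lt_trans _ _ (bj j + `|dl| * yQ)); first by rewrite lerD2l ler_wpM2r ?sin_le_id// ltW.
  rewrite ltrD2l ltr_pdivlMr ?exprn_gt0//.
  apply: (@le_lt_trans _ _ (`|dl| * yQ)).
    by rewrite ler_piMr ?mulr_ge0 ?(ltW yQ0)// exprn_ile1// ltW.
  by rewrite -mulrA ltr_pMl ?mulr_gt0// ltr1n.
have bound j K : 0 <= K -> Ex P (fun w => psi_trunc K (`|X (b0 + j%:R * dl) w| / bj j)) <= 1.
  move=> K0; elim: j => [|j IH].
    by rewrite mul0r addr0 /bj mulr0 !mul0r addr0 expr0 divr1; exact: orlicz_adm_psi_trunc.
  have hs := @rotation_step K K0 _ _ P (X (b0 + j.+1%:R * dl)) (X' (b0 + j.+1%:R * dl))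
    (fun w => cos (b0 + j.+1%:R * dl) * Q w) (cos dl) (- sin dl) (bj j) yQ (bj j.+1).
  apply: hs => //; try exact: itgZ.
  - exact: ltW.
  - by move=> phi mphi bphi; exact: hQ.
  - move: IH; rewrite (_ : (fun w => _) = (fun w => psi_trunc K (`|X (b0 + j%:R * dl) w| / bj j))) //.
    apply/funext => w; congr (psi_trunc K (`|_| / _)).
    have -> : b0 + j%:R * dl = b0 + j.+1%:R * dl - dl by rewrite -natr1; ring.
    by rewrite /X /X' cosB sinB; ring.
  (* The identity [hQ] supplies [cos b * Q] instead of [Q]; as [|cos b| <= 1], the scale [yQ] serves
     at every angle. *)
  - rewrite (le_trans _ (orlicz_adm_psi_trunc K0 iQ admQ))//; apply: Ex_le; [exact/itg_psi_trunc/yQ0/itgZ|exact: itg_psi_trunc|].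
    move=> w; apply: psi_trunc_mono => //; first by rewrite divr_ge0// ltW.
    rewrite ler_pM2r ?invr_gt0// normrM ler_piMl// cos_max//.
  - by rewrite normrN step.
have -> : b0 + sg * (pi / 2) = b0 + m%:R * dl by rewrite /dl; field; rewrite gt_eqF.
apply: (@orlicz_adm_le _ _ _ _ (bj m)); last by apply: psi_trunc_orlicz_adm => // K K0; exact: bound.
have hs : 2 * m%:R * `|dl| * yQ <= pi * yQ.
  by rewrite dl0 [2 * _ * _]mulrC divfK// gt_eqF// mulr_gt0.
have c2 : 0 < cos dl ^+ m by rewrite exprn_gt0.
rewrite /bj ler_pdivrMr// (@le_trans _ _ A)// ?lerD2l//.
rewrite (@le_trans _ _ ((A + e) * (1 - 2 / m%:R)))//; last by rewrite ler_pM2l.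
rewrite mulrBr mulr1 lerBrDr -lerBrDl (_ : A + e - A = e); last by ring.
by rewrite mulrA ler_pdivrMr// mulrC.
Qed.
End path.
End rotation.
End orlicz.

(** * Changes of measure on a product space *)

Section product_transport.
Context {d1 d2 : measure_display} {T1 : measurableType d1} {T2 : measurableType d2} {R : realType}.
Variables (P : probability T1 R) (Q : probability T2 R).

Lemma EE_fst (f : T1 -> \bar R) : measurable_fun setT f -> (forall x, 0 <= f x)%E ->
  (\int[P \x Q]_z f z.1 = \int[P]_x f x)%E.
Proof.
move=> mf f0; have mg : measurable_fun setT (fun z : T1 * T2 => f z.1) by exact: measurableT_comp.
have := fubini_tonelli1 (m1 := P) (m2 := Q) _ mg (fun z => f0 z.1); rewrite /fubini_F => ->.
apply: eq_integral => x _; have /= := @integral_cst _ _ _ Q setT measurableT (f x).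
by rewrite [X in (_ * X)%E]probability_setT mule1.
Qed.

Lemma EE_snd (f : T2 -> \bar R) : measurable_fun setT f -> (forall x, 0 <= f x)%E ->
  (\int[P \x Q]_z f z.2 = \int[Q]_x f x)%E.
Proof.
move=> mf f0; have mg : measurable_fun setT (fun z : T1 * T2 => f z.2) by exact: measurableT_comp.
have := fubini_tonelli2 (m1 := P) (m2 := Q) _ mg (fun z => f0 z.2); rewrite /fubini_G => ->.
apply: eq_integral => x _; have /= := @integral_cst _ _ _ P setT measurableT (f x).
by rewrite [X in (_ * X)%E]probability_setT mule1.
Qed.

Lemma transport_fst (s : T1 -> T1) (W : T1 -> R) : measurable_fun setT s -> measurable_fun setT W ->
  (forall h : T1 -> \bar R, measurable_fun setT h -> (forall x, 0 <= h x)%E ->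
    (\int[P]_x h (s x) = \int[P]_x (h x * (expR (W x))%:E))%E) ->
  forall h : T1 * T2 -> \bar R, measurable_fun setT h -> (forall z, 0 <= h z)%E ->
    (\int[P \x Q]_z h (s z.1, z.2) = \int[P \x Q]_z (h z * (expR (W z.1))%:E))%E.
Proof.
move=> ms mW hs h mh h0.
have m1 : measurable_fun setT (fun z : T1 * T2 => h (s z.1, z.2)).
  by apply: measurableT_comp mh _; apply: measurable_fun_pair => //; exact: measurableT_comp.
have m2 : measurable_fun setT (fun z : T1 * T2 => h z * (expR (W z.1))%:E)%E.
  apply: emeasurable_funM => //; apply/measurable_EFinP; apply: measurable_expR_comp.
  exact: measurableT_comp.
have p2 z : (0 <= h z * (expR (W z.1))%:E)%E by rewrite mule_ge0// lee_fin expR_ge0.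
have := fubini_tonelli2 (m1 := P) (m2 := Q) _ m1 (fun z => h0 _); rewrite /fubini_G => ->.
have := fubini_tonelli2 (m1 := P) (m2 := Q) _ m2 p2; rewrite /fubini_G => ->.
apply: eq_integral => y _ /=; apply: (hs (fun x => h (x, y))) => //.
exact: measurableT_comp.
Qed.

(** The map and its weight may depend on the first coordinate: the Gaussian variable will be shifted
    by an amount computed from the sample. *)
Lemma transport_snd (s : T1 -> T2 -> T2) (W : T1 -> T2 -> R) :
  measurable_fun setT (fun z : T1 * T2 => s z.1 z.2) -> measurable_fun setT (fun z : T1 * T2 => W z.1 z.2) ->
  (forall x (h : T2 -> \bar R), measurable_fun setT h -> (forall y, 0 <= h y)%E ->
    (\int[Q]_y h (s x y) = \int[Q]_y (h y * (expR (W x y))%:E))%E) ->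
  forall h : T1 * T2 -> \bar R, measurable_fun setT h -> (forall z, 0 <= h z)%E ->
    (\int[P \x Q]_z h (z.1, s z.1 z.2) = \int[P \x Q]_z (h z * (expR (W z.1 z.2))%:E))%E.
Proof.
move=> ms mW hs h mh h0.
have m1 : measurable_fun setT (fun z : T1 * T2 => h (z.1, s z.1 z.2)).
  by apply: measurableT_comp mh _; exact: measurable_fun_pair.
have m2 : measurable_fun setT (fun z : T1 * T2 => h z * (expR (W z.1 z.2))%:E)%E.
  by apply: emeasurable_funM => //; apply/measurable_EFinP; exact: measurable_expR_comp.
have p2 z : (0 <= h z * (expR (W z.1 z.2))%:E)%E by rewrite mule_ge0// lee_fin expR_ge0.
have := fubini_tonelli1 (m1 := P) (m2 := Q) _ m1 (fun z => h0 _); rewrite /fubini_F => ->.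
have := fubini_tonelli1 (m1 := P) (m2 := Q) _ m2 p2; rewrite /fubini_F => ->.
apply: eq_integral => x _ /=; apply: (hs x (fun y => h (x, y))) => //.
exact: measurableT_comp.
Qed.

End product_transport.

Lemma EE_exp_norm {disp : measure_display} {T : measurableType disp} {R : realType}
    (P : probability T R) (f : T -> R) : measurable_fun setT f ->
  (forall l : R, \int[P]_x (expR (l * f x))%:E < +oo)%E ->
  forall l : R, (\int[P]_x (expR (l * `|f x|))%:E < +oo)%E.
Proof.
move=> mf h l.
have me (a : R) : measurable_fun setT (fun x => expR (a * f x)).
  by apply: measurable_expR_comp; exact: measurable_funM.
apply: (@le_lt_trans _ _ (\int[P]_x (expR (l * f x) + expR (- l * f x))%:E)%E).
  apply: le_EE => x; rewrite lee_fin ?expR_ge0// mulNr.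
  have [hx|hx] := ger0P (f x); first by rewrite lerDl expR_ge0.
  by rewrite mulrN lerDr expR_ge0.
by rewrite EE_D//; [apply: lte_add_pinfty; exact: h|move=> x; exact: expR_ge0..].
Qed.
(** * The potential and the Fisher information *)

Section potential.
Context {R : realType} {d : nat}.
Variables (V : 'rV[R]_d -> R) (L M : R).
Hypotheses (M0 : 0 < M) (L0 : 0 < L).
Hypothesis ndV : ntimes_differentiable 2 V.
Hypothesis supV : (deriv_sup 2 V <= M%:E)%E.
Hypothesis lipV : (deriv_holder 2 1 V <= L%:E)%E.
Hypothesis cV : strictly_convex V.
Implicit Types (x y h u v w : 'rV[R]_d).

Local Notation dV x v := ('D_v V x).
Definition hess (x u v : 'rV[R]_d) : R := 'D_u (fun y => 'D_v V y) x.

Lemma differentiable_V x : differentiable V x. Proof. exact: ndV.1. Qed.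
Lemma differentiable_dV v x : differentiable (fun y => 'D_v V y) x.
Proof. exact: (ndV.2 v).1. Qed.

Lemma hess_le x u v : `|hess x u v| <= M * enorm u * enorm v.
Proof.
have := @deriv_sup_le _ _ V [:: u; v] x M ndV supV.
by rewrite !big_cons big_nil mulr1 mulrA.
Qed.

Lemma hess_lip x y u v : `|hess x u v - hess y u v| <= L * enorm (x - y) * enorm u * enorm v.
Proof.
have := @deriv_holder_le _ _ V [:: u; v] x y 1 L (ltW L0) ndV lipV.
by rewrite !big_cons big_nil mulr1 powRr1 ?enorm_ge0// !mulrA.
Qed.

Lemma dVE x v : dV x v = dot (gradient V x) v.
Proof. exact/derive_dot/differentiable_V. Qed.

Lemma dVD x u v : dV x (u + v) = dV x u + dV x v.
Proof. by rewrite !dVE dotDr. Qed.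

Lemma dVZ x (a : R) v : dV x (a *: v) = a * dV x v.
Proof. by rewrite !dVE dotZr. Qed.

Lemma dVN x v : dV x (- v) = - dV x v.
Proof. by rewrite !dVE dotNr. Qed.

Lemma hessE x u v : hess x u v = dot (gradient (fun y => 'D_v V y) x) u.
Proof. exact/derive_dot/differentiable_dV. Qed.

Lemma hessDl x u u' v : hess x (u + u') v = hess x u v + hess x u' v.
Proof. by rewrite !hessE dotDr. Qed.

Lemma hessZl x (a : R) u v : hess x (a *: u) v = a * hess x u v.
Proof. by rewrite !hessE dotZr. Qed.

Lemma hessDr x u v v' : hess x u (v + v') = hess x u v + hess x u v'.
Proof.
rewrite /hess -deriveD; [|exact/diff_derivable/differentiable_dV..].
by congr ('D_u _ x); apply/funext => y; rewrite dVD.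
Qed.

Lemma hessZr x u (a : R) v : hess x u (a *: v) = a * hess x u v.
Proof.
rewrite /hess (_ : (fun y => 'D_(a *: v) V y) = a \*: (fun y => 'D_v V y)).
  by apply: deriveZ; exact/diff_derivable/differentiable_dV.
by apply/funext => y; rewrite dVZ.
Qed.

Lemma hess0l x v : hess x 0 v = 0.
Proof. by rewrite hessE dot0r. Qed.

Lemma hess0r x u : hess x u 0 = 0.
Proof. by rewrite -(scale0r 0) hessZr mul0r. Qed.

Lemma hessNl x u v : hess x (- u) v = - hess x u v.
Proof. by rewrite !hessE dotNr. Qed.

Definition hessmx x : 'M[R]_d := \matrix_(i, j) hess x (delta_mx 0 i) (delta_mx 0 j).

Lemma hess_mx x u v : hess x u v = dot (u *m hessmx x) v.
Proof.
rewrite [in LHS](row_sum_delta u).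
rewrite (big_morph (fun u => hess x u v) (fun a b => hessDl x a b v) (hess0l x v)).
under eq_bigr => i _ do rewrite hessZl [X in hess _ _ X](row_sum_delta v)
  (big_morph (fun v => hess x _ v) (fun a b => hessDr x _ a b) (hess0r x _)).
under eq_bigr => i _ do rewrite mulr_sumr.
rewrite exchange_big; apply: eq_bigr => j _ /=.
rewrite mxE mulr_suml; apply: eq_bigr => i _.
by rewrite hessZr mxE; ring.
Qed.

Lemma dV_mvt x h v : exists2 c : R, 0 < c < 1 & dV (x + h) v - dV x v = hess (x + c *: h) h v.
Proof. by have := @mvt_rV _ _ (fun y => dV y v) x h (differentiable_dV v). Qed.

Lemma dV_lip x y v : `|dV x v - dV y v| <= M * enorm (x - y) * enorm v.
Proof.
have [c _] := dV_mvt y (x - y) v; rewrite [y + (x - y)]addrC subrK => ->.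
exact: hess_le.
Qed.

(** The Hessian is taken at a third point [x0]. In a sample [x0] is the observation and [x] the
    observation moved by the current iterate, so that a single empirical Hessian serves all
    iterates. *)
Lemma dV_taylor x0 x h v (r : R) : enorm (x - x0) + enorm h <= r ->
  `|dV (x + h) v - dV x v - hess x0 h v| <= L * r * enorm h * enorm v.
Proof.
move=> hr; have [c /andP[c0 c1] ->] := dV_mvt x h v.
rewrite (le_trans (hess_lip _ _ _ _))// !ler_wpM2r ?enorm_ge0// ler_wpM2l ?(ltW L0)//.
rewrite (le_trans _ hr)// (_ : x + _ - x0 = (x - x0) + c *: h); last by rewrite addrAC.
rewrite (le_trans (enormD _ _))// lerD2l enormZ gtr0_norm// ler_piMl ?enorm_ge0//.
exact: ltW.
Qed.

Lemma V_taylor x h : `|V (x + h) - V x - dV x h| <= M * enorm h ^+ 2.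
Proof.
have [c /andP[c0 c1] ->] := mvt_rV x h differentiable_V.
rewrite (le_trans (dV_lip _ _ _))// [x + _]addrC addrK enormZ gtr0_norm//.
rewrite expr2 mulrA ler_wpM2r ?enorm_ge0// ler_wpM2l ?(ltW M0)//.
by rewrite ler_piMl ?enorm_ge0// ltW.
Qed.

Lemma gradV_lip x y : enorm (gradient V x - gradient V y) <= M * enorm (x - y).
Proof.
apply: enorm_dual => [|v]; first by rewrite mulr_ge0 ?enorm_ge0 ?ltW.
by rewrite dotBl -!dVE (le_trans (ler_norm _))// dV_lip.
Qed.

Lemma hessmx_row_le x i : enorm (row i (hessmx x)) <= M.
Proof.
have e1 := @enorm_delta R d i.
apply: enorm_dual => [|v]; first exact: ltW.
rewrite rowE -hess_mx (le_trans (ler_norm _))// (le_trans (hess_le _ _ _))//.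
by rewrite e1 mulr1.
Qed.

Lemma measurable_V : measurable_fun setT V.
Proof. by apply: continuous_measurable_rV => x; exact/differentiable_continuous/differentiable_V. Qed.

Lemma measurable_dV v : measurable_fun setT (fun x => 'D_v V x).
Proof. by apply: continuous_measurable_rV => x; exact/differentiable_continuous/differentiable_dV. Qed.

Lemma continuous_hess u v : continuous (fun x => hess x u v).
Proof.
apply: (@enorm_lipschitz_continuous _ _ _ (L * enorm u * enorm v)) => x y.
by rewrite (le_trans (hess_lip _ _ _ _))// -!mulrA ler_wpM2l ?(ltW L0)// mulrC mulrA.
Qed.

Lemma measurable_hess u v : measurable_fun setT (fun x => hess x u v).
Proof. by apply: continuous_measurable_rV; exact: continuous_hess. Qed.

Lemma convex_dV_mono x y : dV x (y - x) <= V y - V x.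
Proof.
have [->|xy] := eqVneq x y; first by rewrite !subrr dVE dot0r.
have h := @derive_seq _ _ V x (y - x) (differentiable_V x).
apply: (ler_cvg_to h (cvg_cst _)).
apply: nearW => n; rewrite /= -ler_pdivlMl ?ltr0n//.
(* The chord of parameter 1 is an equality, treated apart because [strictly_convex] speaks of
   [0 < t < 1]. *)
case: n => [|n]; first by rewrite invr1 mul1r scale1r [x + _]addrC subrK.
have t1 : 0 < (n.+2%:R : R)^-1 < 1 by rewrite invr_gt0 ltr0n/= invf_lt1 ?ltr0n// ltr1n.
have yx : y <> x by move=> e; move: xy; rewrite e eqxx.
have /ltW := cV yx t1; rewrite (_ : _ *: y + _ = x + n.+2%:R^-1 *: (y - x)); last first.
  by rewrite scalerBl scale1r scalerBr addrCA addrA.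
by move: (n.+2%:R^-1) => t; rewrite mulrBl mul1r => h3; lra.
Qed.

Variables (P : probability 'rV[R]_d R) (m : R).
Hypothesis m0 : 0 < m.
Hypothesis hP : forall A, measurable A -> P A = density_law V 0 A.
Hypothesis fisher_ge : forall u : 'rV[R]_d,
  m * enorm u ^+ 2 <= (u *m fisher_information P V *m u^T) 0 0.
Local Notation In := (fisher_information P V).

Lemma V_shift_ge x v : dV x v - M * enorm v ^+ 2 <= V x - V (x - v).
Proof. by have := V_taylor x (- v); rewrite enormN dVN ler_norml => /andP[_]; lra. Qed.

(** By [location_shift] the weight [exp (V x - V (x - v))] has mean 1, and the bound [M] on the
    Hessian makes its exponent at least ['D_v V x - M |v|^2]. Scores are therefore sub-Gaussian. *)
Lemma dV_mgf v : (\int[P]_x (expR (dV x v))%:E <= (expR (M * enorm v ^+ 2))%:E)%E.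
Proof.
have mW : measurable_fun setT (fun x => expR (V x - V (x - v))).
  apply: measurable_expR_comp; apply: measurable_funB; first exact: measurable_V.
  by apply: (measurableT_comp measurable_V); exact: measurable_addrV.
have := location_shift measurable_V hP (g := cst 1%E) v (measurable_cst _) (fun x => lee01).
rewrite [X in X = _](EE_cst P 1) => /esym h1.
have {}h1 : (\int[P]_x (expR (V x - V (x - v)))%:E = 1)%E.
  by rewrite -[RHS]h1; apply: eq_integral => x _; rewrite mul1e.
 rewrite -[leRHS]mule1 -h1 -EE_Zl//.
apply: le_EE => x; rewrite lee_fin ?expR_ge0// -expRD ler_expR.
by have := V_shift_ge x v; lra.
Qed.

Lemma dV_exp_norm v (l : R) : (\int[P]_x (expR (l * `|dV x v|))%:E < +oo)%E.
Proof.
have me (a : R) : measurable_fun setT (fun x => expR (dV x (a *: v))).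
  by apply: measurable_expR_comp; exact: measurable_dV.
apply: (@le_lt_trans _ _ (\int[P]_x (expR (dV x (l *: v)) + expR (dV x ((- l) *: v)))%:E)%E).
  apply: le_EE => x; rewrite lee_fin ?expR_ge0// !dVZ mulNr.
  have [h|h] := ger0P (dV x v).
    by rewrite lerDl expR_ge0.
  by rewrite mulrN lerDr expR_ge0.
under eq_integral do rewrite EFinD.
rewrite ge0_integralD//.
- by rewrite lte_add_pinfty// (le_lt_trans (dV_mgf _))// ltry.
- exact/measurable_EFinP.
- exact/measurable_EFinP.
Qed.

Lemma tame_dV v : tame P (fun x => dV x v).
Proof. by have [] := tame_exp (measurable_dV v) (dV_exp_norm v). Qed.

Lemma tame_hess u v : tame P (fun x => hess x u v).
Proof. by apply: tame_bounded; [exact: measurable_hess|move=> x; exact: hess_le]. Qed.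

(** Integration by parts: the increments of [g] under translation are rewritten by [location_shift]
    with exponential weights, and both forms of the difference quotient converge. The uniform bound
    [B] is for dominated convergence. *)
Lemma dV_stein (g h : 'rV[R]_d -> R) v (B : R) : tame P g -> measurable_fun setT h ->
  (forall x, n.+1%:R * (g (x + n.+1%:R^-1 *: v) - g x) @[n --> \oo] --> h x) ->
  (forall x n, `|n.+1%:R * (g (x + n.+1%:R^-1 *: v) - g x)| <= B) ->
  Ex P h = Ex P (fun x => g x * dV x v).
Proof.
move=> tg mh cg gB; have mg := itg_meas (tame_itg tg).
have msh n : measurable_fun setT (fun x : 'rV[R]_d => g (x + n.+1%:R^-1 *: v)).
  by apply: (measurableT_comp mg); exact: measurable_addrV.
have mD n : measurable_fun setT (fun x => n.+1%:R * (g (x + n.+1%:R^-1 *: v) - g x)).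
  by apply: measurable_funM => //; exact: measurable_funB.
have h1 : Ex P (fun x => n.+1%:R * (g (x + n.+1%:R^-1 *: v) - g x)) @[n --> \oo] --> Ex P h.
  apply: (Ex_dominated_cvg (g := cst B)) => //; exact: itg_cst.
have h2 := @Ex_expB_cvg _ _ _ P (fun n x => V x - V (x - n.+1%:R^-1 *: v))
   (fun x => dV x v) (fun=> M * enorm v ^+ 2) g.
have {}h2 : n.+1%:R * (Ex P (fun x => g x * expR (V x - V (x - n.+1%:R^-1 *: v))) - Ex P g)
    @[n --> \oo] --> Ex P (fun x => g x * dV x v).
  apply: h2 => //.
  - move=> n; apply: measurable_funB; first exact: measurable_V.
    by apply: (measurableT_comp measurable_V); exact: measurable_addrV.
  - exact: measurable_dV.
  - exact: dV_exp_norm.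
  - by move=> l; rewrite EE_cst ltry.
  - move=> n x; have := V_taylor x (- (n.+1%:R^-1 *: v)).
    rewrite enormN enormZ dVN dVZ exprMn real_normK ?num_real// mulrCA.
    rewrite [`|M * _|]ger0_norm ?mulr_ge0 ?exprn_ge0 ?enorm_ge0 ?(ltW M0)//.
    by rewrite -normrN; congr (`|_| <= _); ring.
rewrite (_ : (fun n : nat => _) = (fun n => Ex P (fun x => n.+1%:R * (g (x + n.+1%:R^-1 *: v) - g x)))) in h2.
  exact: (cvg_unique _ h1 h2).
apply/funext => n; have hg : Ex P (fun x => g (x + n.+1%:R^-1 *: v)) =
    Ex P (fun x => g x * expR (V x - V (x - n.+1%:R^-1 *: v))).
  apply: (Ex_transport (s := fun x => x + n.+1%:R^-1 *: v)) => // k mk k0.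
  exact: (location_shift measurable_V hP).
have iD : itg P (fun x => g (x + n.+1%:R^-1 *: v) - g x).
  apply: (@itg_bounded _ _ _ _ _ (n.+1%:R^-1 * B)); first exact: measurable_funB.
  move=> x; rewrite -ler_pdivrMl ?invr_gt0// invrK -[X in X * _](ger0_norm (ler0n R n.+1)) -normrM.
  exact: gB.
have ish : itg P (fun x => g (x + n.+1%:R^-1 *: v)).
  rewrite (_ : (fun x => _) = (fun x => (g (x + n.+1%:R^-1 *: v) - g x) + g x)); last first.
    by apply/funext => x; rewrite subrK.
  by apply: itgD => //; exact: tame_itg.
by rewrite -hg ExZ// ExB//; exact: tame_itg.
Qed.

Lemma Ex_dV v : Ex P (fun x => dV x v) = 0.
Proof.
rewrite -[RHS](Ex_cst P 0) (@dV_stein (cst 1) (cst 0) v 0).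
- by apply: eq_Ex => x; rewrite mul1r.
- exact: tame_cst.
- exact: measurable_cst.
- by move=> x; under eq_fun do rewrite subrr mulr0; exact: cvg_cst.
- by move=> x n; rewrite subrr mulr0 normr0.
Qed.

(** Integration by parts applied to the score itself; it identifies the Fisher information with the
    mean Hessian. *)
Lemma Ex_hess u v : Ex P (fun x => hess x v u) = Ex P (fun x => dV x u * dV x v).
Proof.
apply: (@dV_stein _ _ v (M * enorm v * enorm u)).
- exact: tame_dV.
- exact: measurable_hess.
- by move=> x; have h := @derive_seq _ _ (fun y => 'D_u V y) x v (differentiable_dV u x).
- move=> x n; rewrite normrM ger0_norm// -ler_pdivlMl ?ltr0n//.
  rewrite (le_trans (dV_lip _ _ _))// [x + _]addrC addrK enormZ ger0_norm//.
  by rewrite !mulrA [M * _]mulrC.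
Qed.

Lemma fisherE u v : dot (u *m In) v = Ex P (fun x => dV x u * dV x v).
Proof.
have -> : (fun x => dV x u * dV x v) = (fun x => \sum_j \sum_i
    u 0 i * v 0 j * (gradient V x 0 i * gradient V x 0 j)).
  apply/funext => x; rewrite !dVE /dot mulr_suml exchange_big; apply: eq_bigr => i _ /=.
  by rewrite mulr_sumr; apply: eq_bigr => j _; ring.
have tg i : tame P (fun x => gradient V x 0 i).
  under eq_fun do rewrite mxE; exact: tame_dV.
have it i j : itg P (fun x => gradient V x 0 i * gradient V x 0 j).
  by apply: tame_itg; exact: tameM.
rewrite Ex_sum; last by move=> j _; apply: itg_sum => i _; exact: itgZ.
apply: eq_bigr => j _; rewrite Ex_sum; last by move=> i _; exact: itgZ.
rewrite mxE mulr_suml; apply: eq_bigr => i _.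
rewrite ExZ// mxE unlock /= mulrAC; congr (_ * _).
Qed.

Lemma fisher_posdef u : m * enorm u ^+ 2 <= dot (u *m In) u.
Proof. by rewrite -dot_mx; exact: fisher_ge. Qed.

Lemma fisher_norm_ge u : m * enorm u <= enorm (u *m In).
Proof.
have [->|u0] := eqVneq (enorm u) 0; first by rewrite mulr0 enorm_ge0.
have u1 : 0 < enorm u by rewrite lt0r u0 enorm_ge0.
rewrite -(ler_pM2r u1) -mulrA -expr2 (le_trans (fisher_posdef u))//.
exact: dot_le'.
Qed.

Lemma fisher_unit : In \in unitmx.
Proof.
rewrite -row_free_unit -kermx_eq0; apply/eqP/row_matrixP => i; rewrite row0.
have := fisher_norm_ge (row i (kermx In)).
rewrite -row_mul mulmx_ker row0 enorm0 pmulr_rle0// => h.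
by apply: enorm_eq0; apply/eqP; rewrite eq_le h enorm_ge0.
Qed.

Local Notation J := (invmx In).

Lemma inv_norm_le w : enorm (w *m J) <= m^-1 * enorm w.
Proof.
rewrite -ler_pdivrMl ?invr_gt0// invrK.
by have := fisher_norm_ge (w *m J); rewrite mulmxKV// fisher_unit.
Qed.

Lemma fisher_sym u v : dot (u *m In) v = dot (v *m In) u.
Proof. by rewrite !fisherE; apply: eq_Ex => x; rewrite mulrC. Qed.

Lemma fisher_hess u v : dot (u *m In) v = Ex P (fun x => hess x u v).
Proof. by rewrite fisherE Ex_hess; apply: eq_Ex => x; rewrite mulrC. Qed.

Lemma inv_sym u v : dot (u *m J) v = dot u (v *m J).
Proof.
rewrite -{1}(mulmxKV fisher_unit v) dotC fisher_sym.
by rewrite (mulmxKV fisher_unit).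
Qed.

Lemma m_le_M : (0 < d)%N -> m <= M.
Proof.
move=> d0; pose e : 'rV[R]_d := delta_mx 0 (Ordinal d0).
have e1 : enorm e = 1 by exact: enorm_delta.
have := fisher_posdef e; rewrite e1 expr1n mulr1 fisher_hess => h; rewrite (le_trans h)//.
apply: Ex_le_cst; first exact: tame_itg (tame_hess e e).
by move=> x; rewrite (le_trans (ler_norm _))// (le_trans (hess_le _ _ _))// e1 !mulr1.
Qed.

Lemma variance_tame (g : 'rV[R]_d -> R) : tame P g ->
  ('V_P[g] = (Ex P (fun x => g x ^+ 2) - Ex P g ^+ 2)%:E)%E.
Proof.
move=> tg; rewrite /variance covariance.unlock unlock.
set c := Ex P g; transitivity (\int[P]_x ((g x ^+ 2 - (2 * c) * g x) + c ^+ 2)%:E)%E.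
  apply: eq_integral => x _; transitivity ((g x - c) * (g x - c))%:E => //.
  by congr (_%:E); ring.
have t2 : tame P (fun x => g x ^+ 2) by exact: tameX.
have i1 : itg P (fun x => g x ^+ 2 - 2 * c * g x).
  by apply: tame_itg; apply: tameB => //; exact: tameZ.
rewrite ExE; last by apply: itgD => //; exact: itg_cst.
rewrite ExD//; last exact: itg_cst.
rewrite ExB; [|exact: tame_itg|by apply: tame_itg; exact: tameZ].
rewrite ExZ; last exact: tame_itg.
by rewrite Ex_cst -/c; congr (_%:E); ring.
Qed.

Definition poincare_admissible (C : R) := 0 <= C /\
  forall g : 'rV[R]_d -> R, [locally [lipschitz g x | x in setT]] ->
    ('V_P[g] <= C%:E * \int[P]_x (enorm (gradient g x) ^+ 2)%:E)%E.

Lemma poincare_admissible_ge (C : R) : (0 < d)%N -> poincare_admissible C -> m / M ^+ 2 <= C.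
Proof.
move=> d0 [C0 hC]; pose e : 'rV[R]_d := delta_mx 0 (Ordinal d0).
have e1 : enorm e = 1 by exact: enorm_delta.
have lip : [locally [lipschitz 'D_e V x | x in setT]].
  by apply: (enorm_lipschitz_locally (K := M)) => x y; rewrite (le_trans (dV_lip _ _ _))// e1 mulr1.
have := hC _ lip; rewrite variance_tame; last exact: tame_dV.
rewrite Ex_dV expr0n subr0 (_ : (fun x => _) = (fun x => dV x e * dV x e)); last first.
  by apply/funext => x; rewrite expr2.
rewrite -fisherE => h; rewrite ler_pdivrMr ?exprn_gt0// -lee_fin EFinM.
apply: (@le_trans _ _ (dot (e *m In) e)%:E).
  by have := fisher_posdef e; rewrite e1 expr1n mulr1 lee_fin.
apply: (le_trans h); rewrite lee_wpmul2l ?lee_fin// -(EE_cst P (M ^+ 2)).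
apply: le_EE => x; rewrite lee_fin ?sqr_ge0// lerXn2r ?nnegrE ?enorm_ge0 ?(ltW M0)//.
apply: enorm_dual => [|v]; first exact: ltW.
rewrite -hessE (le_trans (ler_norm _))// (le_trans (hess_le _ _ _))// e1 mulr1//.
Qed.

Definition opnorm_mx (A : 'M[R]_d) : R :=
  sup [set `|dot (uv.1 *m A) uv.2| | uv in [set uv : 'rV[R]_d * 'rV[R]_d | enorm uv.1 <= 1 /\ enorm uv.2 <= 1]].

Lemma opnorm_mx_le (A : 'M[R]_d) (K : R) :
  (forall u v, `|dot (u *m A) v| <= K * enorm u * enorm v) -> 0 <= K -> opnorm_mx A <= K.
Proof.
move=> h K0; apply: ge_sup; first by exists `|dot (0 *m A) 0|, (0, 0) => //=; rewrite enorm0.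
move=> _ [[u v] /= [u1 v1] <-]; rewrite (le_trans (h u v))// -mulrA ler_piMr//.
by rewrite mulr_ile1 ?enorm_ge0.
Qed.

(** The Frobenius norm: it dominates the operator norm, and its square is a sum over entries, whose
    expectations can be bounded one by one. *)
Definition frob (A : 'M[R]_d) : R := Num.sqrt (\sum_i enorm (row i A) ^+ 2).

Lemma frob_le (A : 'M[R]_d) u v : `|dot (u *m A) v| <= frob A * enorm u * enorm v.
Proof.
have -> : u *m A = \sum_i u 0 i *: row i A by rewrite mulmx_sum_row.
rewrite (le_trans (dot_le _ _))// ler_wpM2r ?enorm_ge0//.
rewrite (le_trans (enorm_sum _ _))//; under eq_bigr do rewrite enormZ.
pose a : 'rV[R]_d := \row_i `|u 0 i|; pose b : 'rV[R]_d := \row_i enorm (row i A).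
have -> : \sum_i `|u 0 i| * enorm (row i A) = dot a b.
  by apply: eq_bigr => i _; rewrite !mxE.
rewrite (le_trans (dot_le' _ _))// mulrC.
have -> : enorm b = frob A by congr Num.sqrt; apply: eq_bigr => i _; rewrite mxE.
have -> // : enorm a = enorm u.
by congr Num.sqrt; apply: eq_bigr => i _; rewrite mxE real_normK ?num_real.
Qed.

Lemma frob_ge0 (A : 'M[R]_d) : 0 <= frob A. Proof. exact: sqrtr_ge0. Qed.

Lemma opnorm_mx_frob (A : 'M[R]_d) : opnorm_mx A <= frob A.
Proof. by apply: opnorm_mx_le => [u v|]; [exact: frob_le|exact: frob_ge0]. Qed.

Lemma opnorm_mx_ubound (A : 'M[R]_d) u v : enorm u <= 1 -> enorm v <= 1 ->
  `|dot (u *m A) v| <= opnorm_mx A.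
Proof.
move=> u1 v1; apply: sup_upper_bound; last by exists (u, v).
split; first by exists `|dot (0 *m A) 0|, (0, 0) => //=; rewrite enorm0.
exists (frob A) => _ [[u' v'] /= [u'1 v'1] <-]; rewrite (le_trans (frob_le _ _ _))//.
by rewrite -mulrA ler_piMr ?frob_ge0// mulr_ile1 ?enorm_ge0.
Qed.

Lemma opnorm_mxP (A : 'M[R]_d) u v : `|dot (u *m A) v| <= opnorm_mx A * enorm u * enorm v.
Proof.
rewrite -{1}(unitvK u) -{1}(unitvK v) -scalemxAl dotZl dotZr mulrA normrM.
rewrite ger0_norm ?mulr_ge0 ?enorm_ge0// mulrC -mulrA ler_wpM2r ?mulr_ge0 ?enorm_ge0//.
by apply: opnorm_mx_ubound; exact: enorm_unitv.
Qed.

Lemma opnorm_mx_ge0 (A : 'M[R]_d) : 0 <= opnorm_mx A.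
Proof.
by apply: (le_trans (normr_ge0 _) (@opnorm_mx_ubound A 0 0 _ _)); rewrite enorm0.
Qed.

Lemma opnorm_mx_tri (A B : 'M[R]_d) (K : R) : 0 <= K ->
  (forall u v, `|dot (u *m A) v - dot (u *m B) v| <= K * enorm u * enorm v) ->
  opnorm_mx A <= opnorm_mx B + K.
Proof.
move=> K0 h; apply: opnorm_mx_le => [u v|]; last by rewrite addr_ge0// opnorm_mx_ge0.
have := ler_normD (dot (u *m B) v) (dot (u *m A) v - dot (u *m B) v).
rewrite addrC subrK => h1; rewrite (le_trans h1)// !mulrDl.
exact: lerD (opnorm_mxP _ _ _) (h _ _).
Qed.

(** * The estimator and its Newton approximation *)

Section sample_calculus.
Variable n : nat.
Hypothesis n0 : (0 < n)%N.
Implicit Types (t : n.-tuple 'rV[R]_d) (z : 'rV[R]_d).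

Let ni : R := n%:R^-1.
Let ni0 : 0 < ni. Proof. by rewrite invr_gt0 ltr0n. Qed.
Let nK : ni * n%:R = 1. Proof. by rewrite mulVf// pnatr_eq0 -lt0n. Qed.

Lemma avg_le (F : 'I_n -> R) (K : R) : (forall i, F i <= K) -> ni * \sum_i F i <= K.
Proof.
move=> h; apply: (@le_trans _ _ (ni * \sum_(i < n) K)).
  by rewrite ler_wpM2l ?(ltW ni0)// ler_sum.
by rewrite sumr_const card_ord -mulr_natl mulrA nK mul1r.
Qed.

Lemma avg_norm_le (F : 'I_n -> R) (K : R) : (forall i, `|F i| <= K) -> `|ni * \sum_i F i| <= K.
Proof.
move=> h; rewrite normrM gtr0_norm// (@le_trans _ _ (ni * \sum_i `|F i|))//.
  by rewrite ler_wpM2l ?(ltW ni0)// ler_norm_sum.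
exact: avg_le.
Qed.

(** Minus the gradient of [risk], in the centred variable [z], the estimate minus [theta]. *)
Definition score t z : 'rV[R]_d := ni *: \sum_i gradient V (tnth t i - z).
Definition eta t := score t 0.
Definition Hbar t : 'M[R]_d := ni *: \sum_i hessmx (tnth t i).
Definition delta t := Hbar t - In.
(* All errors are bounded by powers of [fluct]. *)
Definition fluct t : R := opnorm_mx (delta t) + enorm (eta t).

Lemma scoreE t z v : dot (score t z) v = ni * \sum_i dV (tnth t i - z) v.
Proof.
rewrite /score dotZl; congr (_ * _); rewrite dot_suml.
by apply: eq_bigr => i _; rewrite dVE.
Qed.

Lemma HbarE t u v : dot (u *m Hbar t) v = ni * \sum_i hess (tnth t i) u v.
Proof.
rewrite /Hbar -scalemxAr dotZl; congr (_ * _); rewrite mulmx_sumr dot_suml.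
by apply: eq_bigr => i _; rewrite hess_mx.
Qed.

Lemma score_taylor t z z' (r : R) v : enorm z' + enorm (z - z') <= r ->
  `|dot (score t z - score t z' + (z - z') *m Hbar t) v| <= L * r * enorm (z - z') * enorm v.
Proof.
move=> hr; rewrite dotDl dotBl !scoreE HbarE -mulrBr -mulrDr -sumrB -big_split /=.
apply: avg_norm_le => i.
have := @dV_taylor (tnth t i) (tnth t i - z') (- (z - z')) v r.
rewrite addrAC subrr add0r !enormN => /(_ hr); rewrite hessNl opprK.
by rewrite (_ : tnth t i - z' - (z - z') = tnth t i - z)//; rewrite opprB addrA subrK.
Qed.

Lemma score_lip t z z' : enorm (score t z - score t z') <= M * enorm (z - z').
Proof.
apply: enorm_dual => [|v]; first by rewrite mulr_ge0 ?enorm_ge0 ?ltW.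
rewrite (le_trans (ler_norm _))// dotBl !scoreE -mulrBr -sumrB; apply: avg_norm_le => i.
rewrite (le_trans (dV_lip _ _ _))// (_ : _ - _ - _ = - (z - z')) ?enormN//.
by apply/rowP => j; rewrite !mxE; ring.
Qed.

(* A Newton step with the Hessian replaced by the Fisher information: its iterates are explicit, hence Lipschitz
   functions of the sample, unlike the maximum likelihood estimator. *)
Definition newton t z : 'rV[R]_d := z + score t z *m J.

(** As [Hbar - delta] is the Fisher information, the identity part of the step cancels against it.
    What remains is the Taylor remainder of the score and [delta] applied to [z - z']. *)
Lemma newton_contract t z z' (r : R) : enorm z' + enorm (z - z') <= r ->
  enorm (newton t z - newton t z') <= m^-1 * (opnorm_mx (delta t) + L * r) * enorm (z - z').
Proof.
move=> hr; have -> : newton t z - newton t z' =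
    ((score t z - score t z' + (z - z') *m Hbar t) - (z - z') *m delta t) *m J.
  rewrite -[_ + _ - _ in RHS]addrA -mulmxBr (_ : Hbar t - delta t = In); last by rewrite opprB addrC subrK.
  rewrite mulmxDl mulmxBl (mulmxK fisher_unit) /newton opprD addrACA.
  by rewrite [RHS]addrC.
have r0 : 0 <= r by rewrite (le_trans _ hr)// addr_ge0// enorm_ge0.
rewrite (le_trans (inv_norm_le _))// -mulrA ler_wpM2l ?invr_ge0 ?(ltW m0)//.
apply: enorm_dual => [|v].
  by rewrite mulr_ge0 ?addr_ge0 ?opnorm_mx_ge0 ?mulr_ge0 ?enorm_ge0 ?(ltW L0).
rewrite dotBl; have h1 := score_taylor t v hr; have h2 := opnorm_mxP (delta t) (z - z') v.
move: h1 h2; rewrite !ler_norml !mulrDl => /andP[_ h1] /andP[h2 _].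
by lra.
Qed.

(** Holds for all samples, with a factor above 1; it serves the bounds on iterates that must remain
    valid where [fluct] is large. *)
Lemma newton_lip t z z' : enorm (newton t z - newton t z') <= (1 + M / m) * enorm (z - z').
Proof.
rewrite /newton opprD addrACA -mulmxBl (le_trans (enormD _ _))// mulrDl mul1r lerD2l.
rewrite (le_trans (inv_norm_le _))// [M / m]mulrC -mulrA ler_wpM2l ?invr_ge0 ?(ltW m0)//.
exact: score_lip.
Qed.

Definition newton_iter i t : 'rV[R]_d := iter i (newton t) 0.

(** Constants attached to the [i]-th iterate: [cz] for its size, [cb] for the distance of the next
    one from [eta *m J], [ca] for the distance from the zero of the score, [cl] and [cd] for its
    first and second order dependence on one observation. They involve [L], [M], [m] and [i]
    alone. *)
Fixpoint cz i : R := if i is j.+1 then (1 + M / m) * cz j + m^-1 else 0.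

Lemma Mm0 : 0 < 1 + M / m. Proof. by rewrite addr_gt0// divr_gt0. Qed.
Lemma cz_ge0 i : 0 <= cz i.
Proof. by elim: i => //= i IH; rewrite addr_ge0 ?mulr_ge0 ?(ltW Mm0) ?invr_ge0 ?(ltW m0). Qed.

Lemma newton_iter_le i t : enorm (newton_iter i t) <= cz i * enorm (eta t).
Proof.
elim: i => [|i IH]; first by rewrite /= enorm0 mul0r.
have -> : newton_iter i.+1 t = (newton t (newton_iter i t) - newton t 0) + newton t 0 by rewrite subrK.
rewrite (le_trans (enormD _ _))// mulrDl lerD//.
  by rewrite (le_trans (newton_lip _ _ _))// subr0 -mulrA ler_wpM2l ?(ltW Mm0).
by rewrite /newton add0r inv_norm_le.
Qed.

Lemma eta_le_W t : enorm (eta t) <= fluct t.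
Proof. by rewrite lerDr opnorm_mx_ge0. Qed.
Lemma opnorm_mx_le_W t : opnorm_mx (delta t) <= fluct t.
Proof. by rewrite lerDl enorm_ge0. Qed.
Lemma W_ge0 t : 0 <= fluct t.
Proof. by rewrite addr_ge0 ?opnorm_mx_ge0 ?enorm_ge0. Qed.

Lemma newton_iter_le_W i t : enorm (newton_iter i t) <= cz i * fluct t.
Proof. by rewrite (le_trans (newton_iter_le _ _))// ler_wpM2l ?cz_ge0// eta_le_W. Qed.

Definition cb i : R := m^-1 * (1 + L * cz i) * cz i.

(** [newton] sends [0] to [eta *m J], so this is the contraction between the [i]-th iterate and [0],
    whose distance is itself of order [fluct]. *)
Lemma newton_iter_linear i t : enorm (newton_iter i.+1 t - eta t *m J) <= cb i * fluct t ^+ 2.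
Proof.
have -> : newton_iter i.+1 t - eta t *m J = newton t (newton_iter i t) - newton t 0.
  by rewrite [in RHS]/newton add0r.
have h := @newton_contract t (newton_iter i t) 0 (cz i * fluct t).
rewrite enorm0 add0r subr0 in h; rewrite (le_trans (h (newton_iter_le_W _ _)))//.
rewrite /cb expr2 mulrACA ler_pM ?enorm_ge0 ?newton_iter_le_W//.
  by rewrite mulr_ge0 ?invr_ge0 ?(ltW m0)// addr_ge0 ?opnorm_mx_ge0// !mulr_ge0 ?cz_ge0 ?W_ge0// ltW.
rewrite -mulrA ler_wpM2l ?invr_ge0 ?(ltW m0)// mulrDl mul1r mulrA lerD2r.
exact: opnorm_mx_le_W.
Qed.

Fixpoint ca i : R := if i is j.+1 then m^-1 * (1 + L * (cz j + 4 / m)) * ca j else 2 / m.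

Lemma ca_ge0 i : 0 <= ca i.
Proof.
elim: i => [|i IH] /=; first by rewrite divr_ge0// ltW.
by rewrite !mulr_ge0 ?invr_ge0 ?(ltW m0)// addr_ge0// mulr_ge0 ?(ltW L0)// addr_ge0 ?cz_ge0// divr_ge0// ltW.
Qed.

(** A zero of the score is a fixed point of [newton], near which the step contracts by a factor of
    order [fluct], because [delta], the iterate and [z] all have that size. Each iteration gains one
    power of [fluct]. *)
Lemma newton_iter_zero i t z : score t z = 0 -> enorm z <= 2 / m * enorm (eta t) ->
  enorm (newton_iter i t - z) <= ca i * fluct t ^+ i.+1.
Proof.
move=> sz hz; elim: i => [|i IH].
  by rewrite /= sub0r enormN expr1 (le_trans hz)// ler_wpM2l ?eta_le_W// divr_ge0// ltW.
have Nz : newton t z = z by rewrite /newton sz mul0mx addr0.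
have -> : newton_iter i.+1 t - z = newton t (newton_iter i t) - newton t z by rewrite Nz.
pose r := (cz i + 4 / m) * fluct t.
have hr : enorm z + enorm (newton_iter i t - z) <= r.
  have := enormB (newton_iter i t) z; have := newton_iter_le_W i t; rewrite /r mulrDl.
  have : 2 / m * enorm (eta t) <= 2 / m * fluct t by rewrite ler_wpM2l ?eta_le_W// divr_ge0// ltW.
  have -> : 4 / m * fluct t = 2 / m * fluct t + 2 / m * fluct t by field; rewrite gt_eqF.
  by lra.
rewrite (le_trans (newton_contract _ hr))//=.
have -> : m^-1 * (1 + L * (cz i + 4 / m)) * ca i * fluct t ^+ i.+2 =
    (m^-1 * (1 + L * (cz i + 4 / m)) * fluct t) * (ca i * fluct t ^+ i.+1) by rewrite [fluct t ^+ i.+2]exprS; ring.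
have r0 : 0 <= r by rewrite (le_trans _ hr)// addr_ge0 ?enorm_ge0.
rewrite ler_pM ?enorm_ge0//.
  by rewrite mulr_ge0 ?invr_ge0 ?(ltW m0)// addr_ge0 ?opnorm_mx_ge0// mulr_ge0// ltW.
rewrite -mulrA ler_wpM2l ?invr_ge0 ?(ltW m0)// mulrDl mul1r -mulrA lerD2r.
exact: opnorm_mx_le_W.
Qed.

(** * Existence and localisation of the minimiser of the empirical risk *)

Definition risk t z : R := ni * \sum_i V (tnth t i - z).

Lemma risk_convex t z z' (s : R) : 0 <= s <= 1 ->
  risk t (s *: z + (1 - s) *: z') <= s * risk t z + (1 - s) * risk t z'.
Proof.
move=> /andP[s0 s1]; rewrite /risk mulrCA [(1 - s) * _]mulrCA -mulrDr ler_wpM2l ?(ltW ni0)//.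
rewrite !mulr_sumr -big_split; apply: ler_sum => i _ /=.
have -> : tnth t i - (s *: z + (1 - s) *: z') = s *: (tnth t i - z) + (1 - s) *: (tnth t i - z').
  by apply/rowP => j; rewrite !mxE; ring.
have [->|s0'] := eqVneq s 0; first by rewrite subr0 !scale0r !scale1r !mul0r !add0r mul1r.
have [->|s1'] := eqVneq s 1; first by rewrite subrr !scale0r !scale1r !mul0r !addr0 mul1r.
have [->|zz] := eqVneq (tnth t i - z) (tnth t i - z').
  by rewrite -scalerDl -mulrDl addrC subrK scale1r mul1r.
by apply/ltW/cV; [exact/eqP|rewrite lt_neqAle eq_sym s0' s0 lt_neqAle s1' s1].
Qed.

Lemma risk_continuous t : continuous (risk t).
Proof.
have h : forall z, differentiable (risk t) z.
  move=> z; rewrite (_ : risk t = ni \*: (\sum_i (fun z => V (tnth t i - z)))).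
    apply: differentiableZ; apply: differentiable_sum => i.
    apply: (@differentiable_comp _ _ _ _ (fun z => tnth t i - z) V); last exact: differentiable_V.
    exact: differentiableB.
  by apply/funext => y; rewrite /risk /= fct_sumE.
by move=> z; exact/differentiable_continuous/h.
Qed.

Lemma risk_grad t z v : risk t (z + v) - risk t z <= - dot (score t (z + v)) v.
Proof.
rewrite /risk scoreE -mulrBr -mulrN ler_wpM2l ?(ltW ni0)// -sumrB -sumrN.
apply: ler_sum => i _.
have := convex_dV_mono (tnth t i - (z + v)) (tnth t i - z).
rewrite (_ : tnth t i - z - (tnth t i - (z + v)) = v); last by apply/rowP => j; rewrite !mxE; ring.
by lra.
Qed.

(** If the score [w] did not vanish, moving by [w / (2M)] would lower the risk: the score changes by
    at most [|w| / 2] on the way and keeps pointing along [w]. *)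
Lemma risk_min_score t z : (forall z', risk t z <= risk t z') -> score t z = 0.
Proof.
move=> h; set w := score t z; pose s : R := (2 * M)^-1.
have s0 : 0 < s by rewrite invr_gt0 mulr_gt0.
have h1 : dot (score t (z + s *: w)) w <= 0.
  have := le_trans (risk_grad t z (s *: w)); have := h (z + s *: w).
  rewrite -subr_ge0 => h2 h3; have := le_trans h2 (risk_grad t z (s *: w)).
  by rewrite oppr_ge0 dotZr pmulr_rle0.
have h2 : `|dot (score t (z + s *: w) - w) w| <= M * (s * enorm w) * enorm w.
  rewrite (le_trans (dot_le _ _))// ler_wpM2r ?enorm_ge0//.
  by rewrite (le_trans (score_lip _ _ _))// [z + _]addrC addrK enormZ gtr0_norm.
have hs : M * s = 2^-1 by rewrite /s; field; rewrite gt_eqF.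
move: h2; rewrite mulrA hs -mulrA -expr2 dotBl -enorm_sqr ler_norml => /andP[h2 _].
apply/enorm_eq0/eqP; rewrite -sqrf_eq0 eq_le sqr_ge0 andbT.
by move: h1 h2; move: (enorm w ^+ 2) => e; lra.
Qed.

Lemma score_mono t z z' : dot (score t z - score t z') (z - z') <= 0.
Proof.
rewrite dotBl !scoreE -mulrBr -sumrB pmulr_rle0//; apply: sumr_le0 => i _.
have h1 := convex_dV_mono (tnth t i - z) (tnth t i - z').
have h2 := convex_dV_mono (tnth t i - z') (tnth t i - z).
move: h1 h2; rewrite (_ : tnth t i - z' - (tnth t i - z) = z - z'); last by apply/rowP => j; rewrite !mxE; ring.
rewrite (_ : tnth t i - z - (tnth t i - z') = - (z - z')); last by apply/rowP => j; rewrite !mxE; ring.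
by rewrite dVN; lra.
Qed.

(** The constant [m] of the Fisher information is reduced by [m/4] for [delta] and by [m/4] for the
    variation of the Hessians over [|z| <= m / (4L)]. *)
Lemma score_sub_eta t z : L * enorm z <= m / 4 -> opnorm_mx (delta t) <= m / 4 ->
  m / 2 * enorm z ^+ 2 <= dot (eta t - score t z) z.
Proof.
move=> hz ho; have h1 := @score_taylor t z 0 (enorm z) z.
rewrite enorm0 add0r subr0 in h1; have {}h1 := h1 (lexx _).
have h2 := opnorm_mxP (delta t) z z; have h3 := fisher_posdef z.
have h4 : dot (z *m Hbar t) z = dot (z *m In) z + dot (z *m delta t) z.
  by rewrite -dotDl -mulmxDr addrC subrK.
have h5 : L * enorm z * enorm z * enorm z <= m / 4 * enorm z ^+ 2.
  by rewrite -mulrA -expr2 ler_wpM2r ?sqr_ge0.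
have h6 : opnorm_mx (delta t) * enorm z * enorm z <= m / 4 * enorm z ^+ 2.
  by rewrite -mulrA -expr2 ler_wpM2r ?sqr_ge0.
rewrite dotDl dotBl h4 ler_norml in h1; rewrite ler_norml in h2.
case/andP: h1 => _ h1; case/andP: h2 => h2 _.
rewrite -/(eta t) in h1; rewrite dotBl; move: h1 h2 h3 h5 h6.
move: (enorm z ^+ 2) (dot (eta t) z) (dot (score t z) z) (dot (z *m delta t) z) (dot (z *m In) z)
  (L * _ * _ * _) (opnorm_mx _ * _ * _) => *; lra.
Qed.
Definition rad : R := m / (4 * L).
Lemma rad_gt0 : 0 < rad. Proof. by rewrite divr_gt0// mulr_gt0. Qed.
Lemma radE : L * rad = m / 4. Proof. by rewrite /rad; field; rewrite gt_eqF. Qed.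

Lemma score_ball t z : opnorm_mx (delta t) <= m / 4 -> enorm z <= rad ->
  0 <= dot (score t z) z -> enorm z <= 2 / m * enorm (eta t).
Proof.
move=> ho hz hs; have hL : L * enorm z <= m / 4 by rewrite -radE ler_wpM2l// ltW.
have h1 := score_sub_eta hL ho.
have h2 : m / 2 * enorm z ^+ 2 <= enorm (eta t) * enorm z.
  have h2 : dot (eta t - score t z) z <= dot (eta t) z by rewrite dotBl lerBlDr lerDl.
  exact: le_trans h1 (le_trans h2 (dot_le' _ _)).
have [->|z0] := eqVneq (enorm z) 0; first by rewrite mulr_ge0 ?enorm_ge0// divr_ge0// ltW.
have z1 : 0 < enorm z by rewrite lt0r z0 enorm_ge0.
move: h2; rewrite expr2 mulrA ler_pM2r// => h2.
rewrite -(ler_pM2l (x := m / 2)) ?divr_gt0// (le_trans h2)//.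
by rewrite mulrA (_ : m / 2 * (2 / m) = 1) ?mul1r//; field; rewrite gt_eqF.
Qed.

(** A minimiser beyond [rad] is scaled back to the sphere of that radius. Monotonicity of the score
    between the two points gives the sign required by [score_ball], which then bounds [rad] by
    [2/m * |eta|], a contradiction. *)
Lemma min_in_ball t z : opnorm_mx (delta t) <= m / 4 -> 2 / m * enorm (eta t) < rad ->
  (forall z', risk t z <= risk t z') -> enorm z <= 2 / m * enorm (eta t).
Proof.
move=> ho he hz; have s0 := risk_min_score hz.
have [zr|zr] := leP (enorm z) rad; first by apply: score_ball => //; rewrite s0 dot0l.
have z1 : 0 < enorm z := lt_trans rad_gt0 zr.
pose s := rad / enorm z; have sp : 0 < s by rewrite divr_gt0// rad_gt0.
have s1 : s < 1 by rewrite ltr_pdivrMr// mul1r.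
have sz : enorm (s *: z) = rad by rewrite enormZ gtr0_norm// /s divfK// gt_eqF.
have h : 0 <= dot (score t (s *: z)) (s *: z).
  have := score_mono t (s *: z) z; rewrite s0 subr0.
  rewrite (_ : s *: z - z = (s - 1) *: z); last by rewrite scalerBl scale1r.
  by rewrite !dotZr nmulr_rle0 ?subr_lt0// pmulr_rge0.
have := score_ball ho (_ : enorm (s *: z) <= rad) h.
by rewrite sz => /(_ (lexx _)) /le_lt_trans /(_ he); rewrite ltxx.
Qed.

(** [mle] falls back on [0] if there is no minimiser, so existence is proved where it is used: the
    minimum over a compact ball is interior, and convexity makes it global. *)
Lemma min_exists t : opnorm_mx (delta t) <= m / 4 -> 2 / m * enorm (eta t) < rad / 2 ->
  exists z, forall z', risk t z <= risk t z'.
Proof.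
move=> ho he; have r0 := rad_gt0.
pose A : set 'rV[R]_d := [set z | enorm z <= rad].
have cA : compact A.
  apply: bounded_closed_compact.
    exists rad; split; first exact: num_real.
    by move=> K hK z /= Az; rewrite (le_trans (norm_le_enorm z))// (le_trans Az)// ltW.
  apply: (@closed_comp _ _ (@enorm R d) [set x : R | x <= rad]) => [z _|]; last exact: closed_le.
  apply: (@enorm_lipschitz_continuous _ _ _ 1) => x y; rewrite mul1r; exact: ler_dist_enorm.
have A0 : A !=set0 by exists 0; rewrite /A /= enorm0 ltW.
have [|z /set_mem zA zmin] := EVT_min_rV A0 cA (f := risk t).
  by apply: continuous_subspaceT => z; exact: risk_continuous.
have zr : enorm z < rad.
  rewrite ltNge; apply/negP => rz; have zE : enorm z = rad by apply/eqP; rewrite eq_le rz andbT.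
  (* A minimiser on the sphere is compared with the point at half its length, because [risk_grad]
     evaluates the score at the end of the step. This is the origin of [rad / 2] in the hypothesis
     on [eta]. *)
  have h2 : enorm (2^-1 *: z) = rad / 2 by rewrite enormZ gtr0_norm// zE mulrC.
  have h : 0 <= dot (score t (2^-1 *: z)) (2^-1 *: z).
    have := risk_grad t z (- (2^-1 *: z)).
    rewrite (_ : z - 2^-1 *: z = 2^-1 *: z); last by apply/rowP => j; rewrite !mxE; field.
    rewrite dotNr opprK; apply: le_trans; rewrite subr_ge0; apply: zmin; apply/mem_set.
    by rewrite /A /= h2; lra.
  have := score_ball ho (_ : enorm (2^-1 *: z) <= rad) h.
  rewrite h2 => /(_ _); have h3 : rad / 2 <= rad by lra.
  by move=> /(_ h3) /le_lt_trans /(_ he); rewrite ltxx.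
exists z => z'.
have [zz|zz] := eqVneq (enorm (z' - z)) 0.
  by have /subr0_eq -> := enorm_eq0 zz.
have z0 : 0 < enorm (z' - z) by rewrite lt0r zz enorm_ge0.
pose s := Num.min 1 ((rad - enorm z) / enorm (z' - z)).
have s0 : 0 < s by rewrite lt_min ltr01 divr_gt0// subr_gt0.
have s1 : s <= 1 by rewrite ge_min lexx.
have := @risk_convex t z' z s; rewrite (ltW s0) s1 => /(_ isT) h.
have : risk t z <= risk t (s *: z' + (1 - s) *: z).
  apply: zmin; apply/mem_set; rewrite /A /=.
  rewrite (_ : _ + _ = z + s *: (z' - z)); last by apply/rowP => j; rewrite !mxE; ring.
  rewrite (le_trans (enormD _ _))// enormZ gtr0_norm// -lerBrDl -ler_pdivlMr//.
  by rewrite ge_min lexx orbT.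
move=> /le_trans /(_ h); rewrite -subr_ge0 (_ : _ - _ = s * (risk t z' - risk t z)); last by ring.
by rewrite pmulr_rge0// subr_ge0.
Qed.

(** Below this level [fluct] meets both smallness conditions of [min_exists], on [delta] and on
    [eta]. *)
Definition W_bad : R := Num.min (m / 4) (m / 2 * (rad / 2)) / 2.
Lemma W_bad_gt0 : 0 < W_bad.
Proof. by rewrite divr_gt0// lt_min !(divr_gt0, mulr_gt0, rad_gt0). Qed.

Definition ck N : R := ca N + W_bad^-1 ^+ N.+1.

(* The estimate holds on the whole space: where [fluct] is not small the right-hand side exceeds 1. *)
Lemma mle_approx N (x : 'I_n -> 'rV[R]_d) theta :
  Num.min 1 (enorm (mle V x - theta - newton_iter N [tuple x i - theta | i < n])) <=
  ck N * fluct [tuple x i - theta | i < n] ^+ N.+1.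
Proof.
set t := [tuple _ | _ < _]; have w0 := W_bad_gt0.
have [hW|hW] := leP W_bad (fluct t).
  rewrite ge_min; apply/orP; left; rewrite mulrDl -exprMn -[leLHS]add0r lerD//.
    by rewrite mulr_ge0 ?ca_ge0// exprn_ge0// W_ge0.
  by rewrite exprn_ege1// mulrC ler_pdivlMr// mul1r.
have ho : opnorm_mx (delta t) <= m / 4.
  rewrite (le_trans (opnorm_mx_le_W t))// (le_trans (ltW hW))// /W_bad ler_pdivrMr//.
  by rewrite ge_min; apply/orP; left; rewrite ler_peMr ?ler1n// divr_ge0// ltW.
have he : 2 / m * enorm (eta t) < rad / 2.
  have h1 : enorm (eta t) < m / 2 * (rad / 2).
    rewrite (le_lt_trans (eta_le_W t))// (lt_le_trans hW)// /W_bad ler_pdivrMr//.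
    rewrite ge_min; apply/orP; right; rewrite ler_pMr ?ler1n//.
    by rewrite mulr_gt0// divr_gt0// rad_gt0.
  rewrite -(ltr_pM2l (x := m / 2)) ?divr_gt0// mulrA.
  by rewrite (_ : m / 2 * (2 / m) = 1) ?mul1r//; field; rewrite gt_eqF.
have riskE z : risk t (z - theta) = n%:R^-1 * \sum_j V (x j - z).
  rewrite /risk; congr (_ * _); apply: eq_bigr => i _; rewrite tnth_mktuple.
  by congr V; apply/rowP => j; rewrite !mxE; ring.
have hm : forall z', risk t (mle V x - theta) <= risk t z'.
  have [z hz] := min_exists ho he.
  have : [set z0 : 'rV[R]_d | forall z1, n%:R^-1 * \sum_j V (x j - z0) <= n%:R^-1 * \sum_j V (x j - z1)] (mle V x).
    rewrite /mle; apply: (@xgetPex _ 0); exists (z + theta) => t' /=.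
    by rewrite -!riskE addrK.
  by move=> /= hm z'; rewrite riskE -[z'](addrK theta) riskE.
have hr : 2 / m * enorm (eta t) < rad by rewrite (lt_le_trans he)// ler_pdivrMr// ler_peMr ?ler1n// ltW ?rad_gt0.
have hz := min_in_ball ho hr hm.
rewrite ge_min; apply/orP; right; rewrite enormBC.
rewrite (le_trans (newton_iter_zero N (risk_min_score hm) hz))//.
rewrite ler_wpM2r ?exprn_ge0 ?W_ge0// lerDl exprn_ge0// invr_ge0 ltW//.
Qed.

(** * Sensitivity of the iterates to one observation *)

Lemma newton_sample_lip t t' z (K : R) (w : 'rV[R]_d) : 0 <= K ->
  enorm (score t' z - score t z - w) <= K ->
  enorm (newton t' z - newton t z - w *m J) <= m^-1 * K.
Proof.
move=> K0 h; rewrite (_ : newton t' z - newton t z - w *m J = (score t' z - score t z - w) *m J).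
  by rewrite (le_trans (inv_norm_le _))// ler_wpM2l// invr_ge0 ltW.
rewrite /newton opprD addrACA subrr add0r -mulmxBl; set a := score t' z - score t z.
by rewrite -mulmxBl.
Qed.

Lemma score_updT t j y z : score (upd_tuple t j y) z - score t z =
  ni *: (gradient V (y - z) - gradient V (tnth t j - z)).
Proof.
rewrite /score -scalerBr; congr (_ *: _); rewrite -sumrB (bigD1 j)//= tnth_updT eqxx big1 ?addr0//.
by move=> i ij; rewrite tnth_updT (negPf ij) subrr.
Qed.

Fixpoint cl i : R := if i is j.+1 then (1 + M / m) * cl j + M / m else 0.

Lemma cl_ge0 i : 0 <= cl i.
Proof. by elim: i => //= i IH; rewrite addr_ge0 ?mulr_ge0 ?(ltW Mm0) ?invr_ge0 ?(ltW m0) ?(ltW M0). Qed.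

Lemma newton_iter_lip i t j y : enorm (newton_iter i (upd_tuple t j y) - newton_iter i t) <= ni * cl i * enorm (y - tnth t j).
Proof.
set t' := upd_tuple t j y; elim: i => [|i IH]; first by rewrite /= subrr enorm0 mulr0 mul0r.
have -> : newton_iter i.+1 t' - newton_iter i.+1 t =
    (newton t' (newton_iter i t') - newton t' (newton_iter i t)) + (newton t' (newton_iter i t) - newton t (newton_iter i t)).
  by rewrite addrA subrK.
have h : enorm (newton t' (newton_iter i t) - newton t (newton_iter i t)) <= m^-1 * (ni * (M * enorm (y - tnth t j))).
  rewrite -[X in enorm X]subr0 -[X in _ - X](mul0mx _ J); apply: newton_sample_lip.
    by rewrite !mulr_ge0 ?enorm_ge0// ltW.
  rewrite subr0 score_updT enormZ gtr0_norm// ler_wpM2l ?(ltW ni0)//.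
  rewrite (le_trans (gradV_lip _ _))// (_ : _ - _ - _ = y - tnth t j)//.
  by apply/rowP => k; rewrite !mxE; ring.
rewrite (le_trans (enormD _ _))//= mulrDr mulrDl lerD//.
  rewrite (le_trans (newton_lip _ _ _))// mulrCA -mulrA ler_wpM2l ?(ltW Mm0)//.
by rewrite (le_trans h)// (_ : m^-1 * _ = ni * (M / m) * enorm (y - tnth t j))//; ring.
Qed.

Lemma deltaE t u v : dot (u *m delta t) v = ni * (\sum_i hess (tnth t i) u v) - dot (u *m In) v.
Proof. by rewrite /delta mulmxBr dotBl HbarE. Qed.

Lemma zitS i t : newton_iter i.+1 t = newton_iter i t + score t (newton_iter i t) *m J.
Proof. by []. Qed.

Lemma delta_updT t j y : opnorm_mx (delta (upd_tuple t j y)) <= opnorm_mx (delta t) + ni * (L * enorm (y - tnth t j)).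
Proof.
apply: opnorm_mx_tri => [|u v]; first by rewrite !mulr_ge0 ?enorm_ge0// ltW.
have gen (a b c : R) : (a - c) - (b - c) = a - b by ring.
rewrite (etrans (congr2 (fun p q : R => p - q) (deltaE (upd_tuple t j y) u v) (deltaE t u v)) (gen _ _ _)).
rewrite -mulrBr -sumrB.
rewrite (bigD1 j)//= tnth_updT eqxx big1 ?addr0; last first.
  by move=> i ij; rewrite tnth_updT (negPf ij) subrr.
rewrite normrM gtr0_norm// -!mulrA ler_wpM2l ?(ltW ni0)// !mulrA.
exact: hess_lip.
Qed.

(** A mixed second difference of the gradient: both increments over [h] are compared with the
    Hessian at [x]. *)
Lemma gradV_taylor2 x z h :
  enorm (gradient V (x - z + h) - gradient V (x - z) - (gradient V (x + h) - gradient V x)) <=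
  L * (enorm z + 2 * enorm h) * enorm h.
Proof.
apply: enorm_dual => [|v].
  by rewrite !mulr_ge0 ?addr_ge0 ?mulr_ge0 ?enorm_ge0// ltW.
have h1 := @dV_taylor x (x - z) h v (enorm z + enorm h).
have h2 := @dV_taylor x x h v (enorm h).
rewrite addrAC subrr add0r enormN in h1; rewrite subrr enorm0 add0r in h2.
have {}h1 := h1 (lexx _); have {}h2 := h2 (lexx _).
rewrite !dotBl -!dVE.
rewrite ler_norml in h1; rewrite ler_norml in h2.
case/andP: h1 => _ h1; case/andP: h2 => h2 _.
have -> : L * (enorm z + 2 * enorm h) * enorm h * enorm v =
   L * (enorm z + enorm h) * enorm h * enorm v + L * enorm h * enorm h * enorm v by ring.
by move: h1 h2; lra.
Qed.

Fixpoint cd i : R := if i is j.+1 then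
  m^-1 * ((1 + L + L * cz j + L * cl j) * cl j + L * (cz j + 2)) else 0.

(** To first order, replacing one observation moves the iterate as it moves [eta *m J]. The relative
    error is [fluct] plus the size of the replacement, and the latter vanishes in the derivative. *)
Lemma newton_iter_lip2 i t j y :
  enorm (newton_iter i.+1 (upd_tuple t j y) - newton_iter i.+1 t - (ni *: (gradient V y - gradient V (tnth t j))) *m J) <=
  ni * cd i.+1 * (fluct t + enorm (y - tnth t j)) * enorm (y - tnth t j).
Proof.
set t' := upd_tuple t j y; set e := enorm (y - tnth t j); set w := ni *: _.
have e0 : 0 <= e by exact: enorm_ge0.
have ni1 : ni <= 1 by rewrite /ni invf_le1 ?ltr0n// ler1n.
have gen (a b c w' : 'rV[R]_d) : a - b - w' = (a - c) + (c - b - w') by rewrite !addrA subrK.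
have -> : newton_iter i.+1 t' - newton_iter i.+1 t - w *m J =
    (newton t' (newton_iter i t') - newton t' (newton_iter i t)) + (newton t' (newton_iter i t) - newton t (newton_iter i t) - w *m J).
  exact: gen.
have hz := newton_iter_le_W i t; have hl := newton_iter_lip i t j y; rewrite -/t' -/e in hl.
have cz0 := cz_ge0 i; have cl0 := cl_ge0 i; have W0 := W_ge0 t.
have h1 : enorm (newton t' (newton_iter i t) - newton t (newton_iter i t) - w *m J) <=
    m^-1 * (ni * (L * (cz i * fluct t + 2 * e) * e)).
  apply: newton_sample_lip; first by rewrite !mulr_ge0 ?addr_ge0 ?mulr_ge0// ltW.
  rewrite score_updT /w -scalerBr enormZ gtr0_norm// ler_wpM2l ?(ltW ni0)//.
  have := gradV_taylor2 (tnth t j) (newton_iter i t) (y - tnth t j).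
  rewrite -/e (_ : tnth t j - newton_iter i t + (y - tnth t j) = y - newton_iter i t); last first.
    by apply/rowP => k; rewrite !mxE; ring.
  rewrite (_ : tnth t j + (y - tnth t j) = y); last by rewrite addrC subrK.
  move=> h; rewrite (le_trans h)// ler_wpM2r// ler_wpM2l ?(ltW L0)//.
  by rewrite lerD2r.
have h2 : enorm (newton t' (newton_iter i t') - newton t' (newton_iter i t)) <=
    m^-1 * ((fluct t + L * e) + L * (cz i * fluct t + cl i * e)) * (ni * cl i * e).
  have hr : enorm (newton_iter i t) + enorm (newton_iter i t' - newton_iter i t) <= cz i * fluct t + cl i * e.
    rewrite lerD// (le_trans hl)// ler_wpM2r// ler_piMl//.
  rewrite (le_trans (newton_contract _ hr))// ler_pM ?enorm_ge0//.
    apply: mulr_ge0; first by rewrite invr_ge0 ltW.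
    apply: addr_ge0; first exact: opnorm_mx_ge0.
    by apply: mulr_ge0; [exact: ltW|rewrite addr_ge0// mulr_ge0].
  rewrite ler_wpM2l ?invr_ge0 ?(ltW m0)// lerD2r (le_trans (delta_updT _ _ _))//.
  rewrite lerD ?opnorm_mx_le_W// -/e ler_piMl ?mulr_ge0 ?(ltW L0)//.
rewrite (le_trans (enormD _ _))// (le_trans (lerD h2 h1))//=.
rewrite -subr_ge0.
have -> : ni * (m^-1 * ((1 + L + L * cz i + L * cl i) * cl i + L * (cz i + 2))) * (fluct t + e) * e -
   (m^-1 * (fluct t + L * e + L * (cz i * fluct t + cl i * e)) * (ni * cl i * e) +
    m^-1 * (ni * (L * (cz i * fluct t + 2 * e) * e))) =
   m^-1 * ni * e * (cl i * (e + L * fluct t + L * cz i * e + L * cl i * fluct t) + L * (cz i * e + 2 * fluct t)) by ring.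
have L0' := ltW L0; have ni0' := ltW ni0; have mi0 : 0 <= m^-1 by rewrite invr_ge0 ltW.
by repeat first [assumption | exact: ler0n | apply: mulr_ge0 | apply: addr_ge0].
Qed.

(** The iterates involve [V] only through its gradient, which is differentiable; a true Newton step
    would bring in the Hessian, which is merely Lipschitz. *)
Lemma newton_iter_differentiable i t j k y : differentiable (fun y => newton_iter i (upd_tuple t j y) 0 k) y.
Proof.
elim: i k y => [|i IH] k y.
  by rewrite (_ : (fun y => _) = cst 0)//; apply/funext => y'; rewrite /= mxE.
have dz : differentiable (fun y => newton_iter i (upd_tuple t j y)) y by apply: differentiable_rV => k'.
have dg a (l : 'I_n) : differentiable (fun y => gradient V (tnth (upd_tuple t j y) l - newton_iter i (upd_tuple t j y)) 0 a) y.
  rewrite (_ : (fun y => _) = (fun x => 'D_(delta_mx 0 a) V x) \o (fun y => tnth (upd_tuple t j y) l - newton_iter i (upd_tuple t j y))); last first.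
    by apply/funext => y' /=; rewrite mxE.
  apply: differentiable_comp; last exact: differentiable_dV.
  apply: differentiableB => //; rewrite (_ : (fun y => _) = if l == j then id else cst (tnth t l)).
    by case: ifP.
  by apply/funext => y'; rewrite tnth_updT; case: ifP.
rewrite (_ : (fun y => _) = (fun y => newton_iter i (upd_tuple t j y) 0 k) + \sum_a
    (J a k * ni) \*: \sum_l (fun y => gradient V (tnth (upd_tuple t j y) l - newton_iter i (upd_tuple t j y)) 0 a)); last first.
  apply/funext => y'; rewrite zitS; move: (newton_iter i) dz dg => Z dz dg.
  rewrite mxE [in RHS]fctE; congr (_ + _); rewrite mxE fct_sumE; apply: eq_bigr => a _.
  by rewrite /score mxE summxE /= fct_sumE mulrC mulrA.
apply: differentiableD => //; apply: differentiable_sum => a.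
by apply: differentiableZ; apply: differentiable_sum => l.
Qed.

(** * Exponential moments of the fluctuation *)

Local Notation PP := (piid P n).

Lemma measurable_gradV_comp {disp} {T : measurableType disp} (Z : T -> 'rV[R]_d) k :
  measurable_fun setT Z -> measurable_fun setT (fun a : T => gradient V (Z a) 0 k).
Proof.
move=> mZ; under eq_fun do rewrite mxE.
exact: (measurableT_comp (measurable_dV _) mZ).
Qed.

Lemma measurable_coord {disp} {T : measurableType disp} (Z : T -> 'rV[R]_d) k :
  measurable_fun setT Z -> measurable_fun setT (fun a : T => Z a 0 k).
Proof. by move=> mZ; exact: (measurableT_comp (measurable_coord_rV k) mZ). Qed.

Lemma measurable_score (Z : n.-tuple 'rV[R]_d -> 'rV[R]_d) : measurable_fun setT Z ->
  measurable_fun setT (fun t => score t (Z t)).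
Proof.
move=> mZ; apply: measurable_fun_rVP => k; under eq_fun do rewrite /score mxE summxE.
apply: measurable_funM => //; apply: measurable_sum => i.
apply: measurable_gradV_comp; apply: measurable_fun_rVP => l; under eq_fun do rewrite !mxE.
apply: measurable_funB; apply: measurable_coord => //; exact: measurable_tnth.
Qed.

Lemma measurable_newton_iter i : measurable_fun setT (newton_iter i).
Proof.
elim: i => [|i IH]; first exact: measurable_cst.
apply: measurable_fun_rVP => k; under eq_fun do rewrite zitS !mxE.
apply: measurable_funD; first exact: measurable_coord.
apply: measurable_sum => l; apply: measurable_funM => //.
by apply: measurable_coord; exact: measurable_score.
Qed.

Lemma measurable_eta : measurable_fun setT eta.
Proof. exact: measurable_score. Qed.

Lemma measurable_enorm {disp} {T : measurableType disp} (Z : T -> 'rV[R]_d) :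
  measurable_fun setT Z -> measurable_fun setT (fun a : T => enorm (Z a)).
Proof.
move=> mZ; apply: (measurableT_comp (f := @Num.sqrt R)).
  by apply: continuous_measurable_fun => x; exact: sqrt_continuous.
by apply: measurable_sum => k; apply: measurable_funX; exact: measurable_coord.
Qed.

(** The supremum runs over uncountably many vectors; it is measurable as a continuous function of
    the matrix entries. *)
Lemma measurable_opnorm_mx_delta : measurable_fun setT (fun t => opnorm_mx (delta t)).
Proof.
pose G (v : 'rV[R]_(d * d)) := opnorm_mx (vec_mx v).
have cG : continuous G.
  apply: (@enorm_lipschitz_continuous _ _ _ d%:R) => v w.
  have h a b : G a <= G b + d%:R * enorm (a - b).
    apply: opnorm_mx_tri => [|x y]; first by rewrite mulr_ge0 ?enorm_ge0.
    rewrite -dotBl -mulmxBr (le_trans (frob_le _ _ _))// !ler_wpM2r ?enorm_ge0//.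
    rewrite -(@ler_pXn2r _ 2)// ?nnegrE ?mulr_ge0 ?enorm_ge0 ?frob_ge0//.
    rewrite sqr_sqrtr; last by apply: sumr_ge0 => i _; rewrite sqr_ge0.
    apply: (@le_trans _ _ (\sum_(i < d) \sum_(j < d) enorm (a - b) ^+ 2)).
      apply: ler_sum => i _; rewrite enorm_sqr; apply: ler_sum => j _.
      rewrite -expr2 -(real_normK (num_real (row i _ 0 j))) lerXn2r ?nnegrE ?enorm_ge0//.
      rewrite mxE -linearB mxE; exact: coord_le_enorm.
    rewrite exprMn sumr_const card_ord sumr_const card_ord -mulrnA -[leLHS]mulr_natl natrM expr2//.
  rewrite ler_distl; have := h v w; have := h w v; rewrite (enormBC w v).
  by move=> h1 h2; apply/andP; split; lra.
rewrite (_ : (fun t => _) = G \o (fun t => mxvec (delta t))); last first.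
  by apply/funext => t; rewrite /G /= mxvecK.
apply: measurableT_comp; first exact: continuous_measurable_rV.
apply: measurable_fun_rVP => k; case/mxvec_indexP: k => i j.
under eq_fun do rewrite mxvecE /delta /Hbar !mxE summxE.
apply: measurable_funB => //; apply: measurable_funM => //; apply: measurable_sum => l.
under eq_fun do rewrite mxE.
by apply: (measurableT_comp (measurable_hess _ _)); exact: measurable_tnth.
Qed.

Lemma measurable_W : measurable_fun setT fluct.
Proof.
apply: measurable_funD; first exact: measurable_opnorm_mx_delta.
by apply: measurable_enorm; exact: measurable_eta.
Qed.

(** [dV_mgf] makes [sqrt n * eta] sub-Gaussian in every direction with parameter [s^2 = 2M], whence
    the denominator [8M = 4 s^2]; each of the [d] coordinates contributes a factor [e]. *)
Lemma eta_exp_sqr :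
  (\int[PP]_t (expR (n%:R * enorm (eta t) ^+ 2 / (8 * M)))%:E <= (expR 1 ^+ d)%:E)%E.
Proof.
pose s : R := Num.sqrt (2 * M); have s0 : 0 < s by rewrite sqrtr_gt0 mulr_gt0.
have s2 : s ^+ 2 = 2 * M by rewrite sqr_sqrtr// mulr_ge0// ltW.
pose q : R := Num.sqrt n%:R; have q0 : 0 < q by rewrite sqrtr_gt0 ltr0n.
have q2 : q ^+ 2 = n%:R by rewrite sqr_sqrtr.
have h := @subgaussian_exp_sqr _ _ _ PP d (fun i t => q * eta t 0 i) (cst 0) 1 s s0 ler01 _ _ _.
rewrite mul1r in h; apply: le_trans (h _ _ _).
- apply: le_EE => t; rewrite lee_fin ?expR_ge0// ler_expR addr0.
  rewrite enorm_sqr /dot mulrAC mulr_sumr ler_sum// => i _.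
  rewrite s2 exprMn q2 (_ : 4 * (2 * M) = 8 * M); last by ring.
  by rewrite -expr2 mulrAC.
- move=> i; apply: measurable_funM => //; apply: measurable_coord; exact: measurable_eta.
- exact: measurable_cst.
- move=> u; pose v : 'rV[R]_d := (ni * q) *: \row_i u i.
  have E t : \sum_i u i * (q * eta t 0 i) + cst 0 t = \sum_j dV (tnth t j) v.
    rewrite addr0; transitivity (q * dot (eta t) (\row_i u i)).
      by rewrite /dot mulr_sumr; apply: eq_bigr => i _; rewrite mxE; ring.
    rewrite scoreE mulrA [q * _]mulrC mulr_sumr; apply: eq_bigr => j _.
    by rewrite /v dVZ subr0.
  under eq_integral do rewrite E.
  have h2 := @iid_mgf_le _ _ _ P n (fun x => dV x v) (expR (M * enorm v ^+ 2)).
  apply: (le_trans (h2 (measurable_dV v) (expR_ge0 _) (dV_mgf v))).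
  rewrite lee_fin mul1r -expRM_natl ler_expR s2 /v enormZ exprMn real_normK ?num_real//.
  rewrite enorm_sqr /dot; under eq_bigr do rewrite mxE -expr2.
  rewrite exprMn q2.
  have -> : n%:R * (M * (ni ^+ 2 * n%:R * \sum_(i < d) u i ^+ 2)) = 
     (ni * n%:R) ^+ 2 * (M * \sum_(i < d) u i ^+ 2) by ring.
  by rewrite nK expr1n mul1r (_ : 2 * M / 2 = M)//; field.
Qed.

Lemma fisher_le u v : `|dot (u *m In) v| <= M * enorm u * enorm v.
Proof.
rewrite fisher_hess; apply: Ex_norm_le_cst => [|x]; first exact: measurable_hess.
exact: hess_le.
Qed.

Lemma opnorm_mx_delta_bounded t : `|opnorm_mx (delta t)| <= 2 * M.
Proof.
rewrite ger0_norm ?opnorm_mx_ge0//; apply: opnorm_mx_le => [u v|]; last by rewrite mulr_ge0// ltW.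
have E := deltaE t u v.
apply: (@le_trans _ _ `|ni * (\sum_i hess (tnth t i) u v) - dot (u *m In) v|); first by rewrite E.
rewrite (le_trans (ler_normB _ _))//.
have -> : 2 * M * enorm u * enorm v = M * enorm u * enorm v + M * enorm u * enorm v by ring.
apply: lerD; last exact: fisher_le.
by apply: avg_norm_le => i; exact: hess_le.
Qed.

Lemma opnorm_mx_delta_diff t i y y' : `|opnorm_mx (delta (upd_tuple t i y)) - opnorm_mx (delta (upd_tuple t i y'))| <= ni * (2 * M).
Proof.
have h y1 y2 : opnorm_mx (delta (upd_tuple t i y1)) <= opnorm_mx (delta (upd_tuple t i y2)) + ni * (2 * M).
  apply: opnorm_mx_tri => [|u v]; first by rewrite !mulr_ge0// ltW.
  have gen (a b c : R) : (a - c) - (b - c) = a - b by ring.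
  rewrite (etrans (congr2 (fun p q : R => p - q) (deltaE (upd_tuple t i y1) u v) (deltaE (upd_tuple t i y2) u v)) (gen _ _ _)).
  rewrite -mulrBr -sumrB (bigD1 i)//= !tnth_updT eqxx big1 ?addr0; last first.
    by move=> j ij; rewrite !tnth_updT (negPf ij) subrr.
  rewrite normrM gtr0_norm// -!mulrA ler_wpM2l ?(ltW ni0)//.
  rewrite (le_trans (ler_normB _ _))//.
  have -> : 2 * (M * (enorm u * enorm v)) = M * enorm u * enorm v + M * enorm u * enorm v by ring.
  by apply: lerD; exact: hess_le.
by rewrite ler_distl; apply/andP; split; [rewrite lerBlDr; exact: h|exact: h].
Qed.

Lemma avg_updT (g : 'rV[R]_d -> R) t l y : ni * (\sum_q g (tnth (upd_tuple t l y) q)) =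
  ni * (\sum_(q | q != l) g (tnth t q)) + ni * g y.
Proof.
rewrite (bigD1 l)//= tnth_updT eqxx mulrDr addrC; congr (_ * _ + _).
by apply: eq_bigr => q ql; rewrite tnth_updT (negPf ql).
Qed.

(** The Frobenius norm dominates, and its second moment is a sum of entrywise variances. The rows of
    the Hessian have norm at most [M], so the [d^2] entries add up to [d M^2] only. *)
Lemma Ex_opnorm_mx_delta_sqr : Ex PP (fun t => opnorm_mx (delta t)) ^+ 2 <= M ^+ 2 * (d%:R / n%:R).
Proof.
have mo := measurable_opnorm_mx_delta.
pose Hb i j t := ni * \sum_l hess (tnth t l) (delta_mx 0 i) (delta_mx 0 j).
have mHb i j : measurable_fun setT (Hb i j).
  apply: measurable_funM => //; apply: measurable_sum => l.
  by apply: (measurableT_comp (measurable_hess _ _)); exact: measurable_tnth.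
have Hbb i j t : `|Hb i j t| <= M.
  apply: avg_norm_le => l; rewrite (le_trans (hess_le _ _ _))// !enorm_delta !mulr1//.
have io : itg PP (fun t => opnorm_mx (delta t) ^+ 2).
  apply: (@itg_bounded _ _ _ _ _ ((2 * M) ^+ 2)) => [|t]; first exact: measurable_funX.
  by rewrite normrX lerXn2r ?nnegrE// ?mulr_ge0 ?(ltW M0)// opnorm_mx_delta_bounded.
have h0 : Ex PP (fun t => opnorm_mx (delta t)) ^+ 2 <= Ex PP (fun t => opnorm_mx (delta t) ^+ 2).
  by have [] := Ex_cauchy_schwarz_norm mo io.
pose c i j := Ex P (fun x => hess x (delta_mx 0 i) (delta_mx 0 j)).
have ExHb i j : Ex PP (Hb i j) = c i j.
  rewrite /Hb; have ih : itg P (fun x => hess x (delta_mx 0 i) (delta_mx 0 j)) by exact/tame_itg/tame_hess.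
  rewrite ExZ; last by apply: itg_sum => l _; have [] := Ex_tnth l ih.
  rewrite Ex_sum; last by move=> l _; have [] := Ex_tnth l ih.
  under eq_bigr => l _ do rewrite (Ex_tnth l ih).2.
  by rewrite sumr_const card_ord -mulr_natl mulrA nK mul1r.
have var i j : Ex PP (fun t => (Hb i j t - c i j) ^+ 2) <=
    ni * Ex P (fun x => hess x (delta_mx 0 i) (delta_mx 0 j) ^+ 2).
  pose h x := hess x (delta_mx 0 i) (delta_mx 0 j).
  have th : tame P h by exact: tame_hess.
  pose Dc := ni ^+ 2 * Ex P (fun x => h x ^+ 2).
  have Dc0 : 0 <= Dc by rewrite mulr_ge0 ?sqr_ge0// Ex_ge0// => x; exact: sqr_ge0.
  have es := @efron_stein _ _ _ P n (Hb i j) (fun=> Dc) M (mHb i j) (Hbb i j) (measurable_cst _) (fun=> Dc0).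
  have iH : itg PP (Hb i j) by apply: (@itg_bounded _ _ _ _ _ M).
  have iH2 : itg PP (fun t => Hb i j t ^+ 2).
    apply: (@itg_bounded _ _ _ _ _ (M ^+ 2)) => [|t]; first exact: measurable_funX.
    by rewrite normrX lerXn2r ?nnegrE// ltW.
  have -> : Ex PP (fun t => (Hb i j t - c i j) ^+ 2) = Ex PP (fun t => Hb i j t ^+ 2) - Ex PP (Hb i j) ^+ 2.
    rewrite ExHb (_ : (fun t => _) = (fun t => (Hb i j t ^+ 2 - (2 * c i j) * Hb i j t) + c i j ^+ 2)); last first.
      by apply/funext => t; ring.
    rewrite ExD; [|by apply: itgB => //; exact: itgZ|exact: itg_cst].
    rewrite ExB//; last exact: itgZ.
    by rewrite ExZ// Ex_cst ExHb; ring.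
  have DcE : n%:R * Dc = ni * Ex P (fun x => h x ^+ 2).
    by rewrite /Dc mulrA expr2 mulrA [n%:R * ni]mulrC nK mul1r.
  rewrite -DcE -lee_fin EFinM -(EE_cst PP Dc); apply: es => t l.
  rewrite [leRHS](EE_cst P Dc) lee_fin.
  pose r0 := ni * \sum_(q | q != l) hess (tnth t q) (delta_mx 0 i) (delta_mx 0 j).
  have E y : Hb i j (upd_tuple t l y) = r0 + ni * h y.
    exact: (avg_updT h).
  have ih := tame_itg th; have ih2 : itg P (fun x => h x ^+ 2) by apply: tame_itg; exact: tameX.
  rewrite (eq_Ex P E) (eq_Ex P (fun y => congr1 (fun b => b ^+ 2) (E y))).
  exact: variance_affine_le.
apply: (le_trans h0).
have ib i j : itg PP (fun t => (Hb i j t - c i j) ^+ 2).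
  apply: (@itg_bounded _ _ _ _ _ ((M + `|c i j|) ^+ 2)) => [|t].
    by apply: measurable_funX; exact: measurable_funB.
  rewrite normrX lerXn2r ?nnegrE ?addr_ge0 ?(ltW M0)//.
  by rewrite (le_trans (ler_normB _ _))// lerD.
apply: (@le_trans _ _ (Ex PP (fun t => \sum_i \sum_j (Hb i j t - c i j) ^+ 2))).
  apply: Ex_le => //; first by apply: itg_sum => i _; exact: itg_sum.
  move=> t; rewrite (@le_trans _ _ (frob (delta t) ^+ 2))//.
    by rewrite lerXn2r ?nnegrE ?opnorm_mx_ge0 ?frob_ge0// opnorm_mx_frob.
  rewrite sqr_sqrtr; last by apply: sumr_ge0 => i _; rewrite sqr_ge0.
  apply: ler_sum => i _; rewrite enorm_sqr; apply: ler_sum => j _.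
  rewrite -expr2 (_ : row i (delta t) 0 j = Hb i j t - c i j)//.
  rewrite mxE /delta /Hbar !mxE summxE; congr (_ * _ - _).
    by apply: eq_bigr => l _; rewrite mxE.
  rewrite /c -fisher_hess -rowE /dot (bigD1 j)//= big1 ?addr0 => [|k /negPf kj].
    by rewrite !mxE !eqxx mulr1.
  by rewrite !mxE kj andbF mulr0.
rewrite Ex_sum; last by move=> i _; exact: itg_sum.
apply: (@le_trans _ _ (\sum_i \sum_j ni * Ex P (fun x => hess x (delta_mx 0 i) (delta_mx 0 j) ^+ 2))).
  by apply: ler_sum => i _; rewrite Ex_sum//; apply: ler_sum => j _.
apply: (@le_trans _ _ (\sum_(i < d) ni * M ^+ 2)).
  apply: ler_sum => i _; rewrite -mulr_sumr ler_wpM2l ?(ltW ni0)//.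
  have ih2 j : itg P (fun x => hess x (delta_mx 0 i) (delta_mx 0 j) ^+ 2).
    by apply: tame_itg; apply: tameX; exact: tame_hess.
  rewrite -Ex_sum//; apply: Ex_le_cst => [|x]; first exact: itg_sum.
  rewrite (le_trans _ (lerXn2r 2 _ _ (hessmx_row_le x i))) ?nnegrE ?enorm_ge0 ?(ltW M0)//.
  by rewrite enorm_sqr; apply: ler_sum => j _; rewrite !mxE expr2.
by rewrite sumr_const card_ord -[leLHS]mulr_natl mulrA mulrC.
Qed.

(** From [W_sqr_arith]: [512 = 4 * 64 * 2] for the operator norm part of [excess] and
    [32 = 2 * 8 * 2] for its score part, the last factor 2 undoing the halving in [excess]. *)
Definition cW : R := 512 * M ^+ 2 + 32 * M.
Lemma cW_ge0 : 0 <= cW. Proof. by apply: addr_ge0; apply: mulr_ge0; [exact: ler0n|exact: sqr_ge0|exact: ler0n|exact: ltW]. Qed.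

(* What [fluct] exceeds its typical size [sqrt (d/n)] by, normalised to have an exponential moment. *)
Definition excess t : R :=
  (Num.max (n%:R * enorm (eta t) ^+ 2 / (8 * M) - d%:R) 0 +
   n%:R * (opnorm_mx (delta t) - Ex PP (fun t => opnorm_mx (delta t))) ^+ 2 / (64 * M ^+ 2)) / 2.

Lemma excess_ge0 t : 0 <= excess t.
Proof.
rewrite divr_ge0// addr_ge0//; first by rewrite le_max lexx orbT.
by apply: divr_ge0; apply: mulr_ge0; rewrite ?sqr_ge0 ?ler0n.
Qed.

Lemma measurable_T : measurable_fun setT excess.
Proof.
have me : measurable_fun setT (fun t => enorm (eta t)) by apply: measurable_enorm; exact: measurable_eta.
have mo := measurable_opnorm_mx_delta.
apply: measurable_funM => //; apply: measurable_funD.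
  apply: measurable_maxr => //; apply: measurable_funB => //.
  by do 2![apply: measurable_funM => //]; exact: measurable_funX.
by do 2![apply: measurable_funM => //]; apply: measurable_funX; exact: measurable_funB.
Qed.

(** One observation changes the operator norm by at most [2M/n], so [mcdiarmid] gives the
    sub-Gaussian parameter [s^2 = 16 M^2 / n], and [64 M^2 = 4 n s^2]. The mean is bounded
    separately by [Ex_opnorm_mx_delta_sqr]. *)
Lemma opnorm_mx_delta_exp_sqr :
  (\int[PP]_t (expR (n%:R * (opnorm_mx (delta t) - Ex PP (fun t => opnorm_mx (delta t))) ^+ 2 / (64 * M ^+ 2)))%:E
   <= (expR 1)%:E)%E.
Proof.
have mo := measurable_opnorm_mx_delta; set e := Ex PP _.
pose q : R := Num.sqrt n%:R; have q0 : 0 < q by rewrite sqrtr_gt0 ltr0n.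
have q2 : q ^+ 2 = n%:R by rewrite sqr_sqrtr.
pose s := 4 * M / q; have s0 : 0 < s by rewrite divr_gt0// mulr_gt0.
have s2 : s ^+ 2 = 16 * M ^+ 2 * ni by rewrite /s exprMn exprVn q2 exprMn; congr (_ * _ * _); ring.
have mY : measurable_fun setT (fun t => opnorm_mx (delta t) - e) by exact: measurable_funB.
have := @subgaussian_exp_sqr1 _ _ _ PP (fun t => opnorm_mx (delta t) - e) s s0 mY.
under eq_integral => t _.
  rewrite s2 (_ : _ / _ = n%:R * (opnorm_mx (delta t) - e) ^+ 2 / (64 * M ^+ 2)); last first.
    rewrite (_ : 4 * (16 * M ^+ 2 * ni) = 64 * M ^+ 2 * ni); last by ring.
    by rewrite invfM invrK mulrCA mulrC [_ * n%:R]mulrC mulrA.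
  over.
apply => l.
have := @mcdiarmid _ _ _ P n (fun t => l * opnorm_mx (delta t)) (`|l| * (2 * M)) (`|l| * (ni * (2 * M))).
have iO : itg PP (fun t => opnorm_mx (delta t)).
  by apply: (@itg_bounded _ _ _ _ _ (2 * M)) => // t; exact: opnorm_mx_delta_bounded.
rewrite ExZ// -/e; under eq_integral do rewrite -mulrBr.
move=> h; apply: le_trans (h _ _ _ _) _.
- exact: measurable_funM.
- by move=> t; rewrite normrM ler_wpM2l// opnorm_mx_delta_bounded.
- by rewrite !mulr_ge0// ltW.
- by move=> t i y y'; rewrite -mulrBr normrM ler_wpM2l// opnorm_mx_delta_diff.
rewrite lee_fin ler_expR s2 !exprMn real_normK ?num_real//.
have -> : n%:R * (2 * (l ^+ 2 * (ni ^+ 2 * (2 ^+ 2 * M ^+ 2)))) = (ni * n%:R) * (8 * l ^+ 2 * ni * M ^+ 2) by ring.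
by rewrite nK mul1r le_eqVlt; apply/orP; left; apply/eqP; field.
Qed.

(** The halving in [excess] lets the two exponential moments be averaged, the subtracted [d]
    compensates [e^d] in [eta_exp_sqr], and the positive part adds at most 1. In total
    [1/2 + e/2 + 1/2 <= e]. *)
Lemma T_exp : (\int[PP]_t (expR (excess t))%:E <= (expR 1)%:E)%E.
Proof.
pose A t := n%:R * enorm (eta t) ^+ 2 / (8 * M).
pose B t := n%:R * (opnorm_mx (delta t) - Ex PP (fun t => opnorm_mx (delta t))) ^+ 2 / (64 * M ^+ 2).
have mA : measurable_fun setT A.
  apply: measurable_funM => //; apply: measurable_funM => //; apply: measurable_funX.
  by apply: measurable_enorm; exact: measurable_eta.
have mB : measurable_fun setT B.
  apply: measurable_funM => //; apply: measurable_funM => //; apply: measurable_funX.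
  by apply: measurable_funB => //; exact: measurable_opnorm_mx_delta.
have [iA EA] := EE_leE (measurable_expR_comp mA) (fun t => expR_ge0 _) eta_exp_sqr.
have [iB EB] := EE_leE (measurable_expR_comp mB) (fun t => expR_ge0 _) opnorm_mx_delta_exp_sqr.
have e2 : 2 <= expR 1 :> R by rewrite (le_trans _ (expR_ge1Dx 1)).
pose g t := expR (- d%:R) / 2 * expR (A t) + 2^-1 * expR (B t) + 2^-1.
have ig : itg PP g by apply: itgD; [apply: itgD; exact: itgZ|exact: itg_cst].
apply: (@le_trans _ _ (\int[PP]_t (g t)%:E)%E).
  apply: le_EE => t; rewrite lee_fin ?expR_ge0// /excess -/(A t) -/(B t).
  set a := Num.max _ _.
  have h1 := expR_mid a (B t).
  have h2 : expR a <= expR (- d%:R) * expR (A t) + 1.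
    rewrite -expRD addrC [- _ + _]addrC /a; have [h|h] := leP (A t - d%:R) 0.
      by rewrite expR0 lerDl expR_ge0.
    by rewrite lerDr.
  by rewrite /g; lra.
rewrite ExE// lee_fin ExD; [|by apply: itgD; exact: itgZ|exact: itg_cst].
rewrite ExD; [|exact: itgZ..]; rewrite !ExZ// Ex_cst.
have h3 : expR (- d%:R) * Ex PP (fun t => expR (A t)) <= 1.
  rewrite -(ler_pM2l (expR_gt0 d%:R)) mulr1 mulrA -expRD subrr expR0 mul1r.
  by rewrite (le_trans EA)// -expRM_natl mulr1.
rewrite -[_ / 2 * _]mulrA [2^-1 * Ex _ _]mulrC mulrA.
have gen (r1 r2 r3 : R) : r1 <= 1 -> r2 <= r3 -> 2 <= r3 -> r1 / 2 + 2^-1 * r2 + 2^-1 <= r3 by lra.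
exact: (gen _ _ _ h3 EB e2).
Qed.

Lemma W_sqr_arith (B A D T a2 e2 x2 q N : R) : a2 * q = 64 * N ^+ 2 * B ->
  e2 * q <= N ^+ 2 * D -> x2 * q = 8 * N * A -> A - D <= 2 * T - B -> 0 <= 2 * T - B ->
  0 <= B -> 0 <= T -> 0 <= D -> 0 <= N ->
  (4 * a2 + 4 * e2 + 2 * x2) * q <= (512 * N ^+ 2 + 32 * N) * (D + T).
Proof.
move=> ha he hx h1 h0 B0 T0 D0 N0.
have -> : (4 * a2 + 4 * e2 + 2 * x2) * q = 4 * (a2 * q) + 4 * (e2 * q) + 2 * (x2 * q) by ring.
rewrite ha hx; move: (sqr_ge0 N) he; move: (N ^+ 2) => N2 N20 he.
have q1 : N * A <= N * (D + 2 * T - B) by rewrite ler_wpM2l//; lra.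
have q2 : N2 * B <= N2 * (2 * T) by rewrite ler_wpM2l//; lra.
have q3 : 0 <= N * B by rewrite mulr_ge0.
have q4 : 0 <= N2 * T by rewrite mulr_ge0.
have q5 : 0 <= N * D by rewrite mulr_ge0.
have q6 : 0 <= N2 * D by rewrite mulr_ge0.
rewrite -subr_ge0 in q1; rewrite -subr_ge0 in q2; rewrite -subr_ge0 in he; rewrite -subr_ge0.
have -> : (512 * N2 + 32 * N) * (D + T) - (4 * (64 * N2 * B) + 4 * (e2 * q) + 2 * (8 * N * A)) =
  256 * (N2 * (2 * T) - N2 * B) + 508 * (N2 * D) + 4 * (N2 * D - e2 * q) +
  16 * (N * (D + 2 * T - B) - N * A) + 16 * (N * D) + 16 * (N * B) by ring.
by repeat first [assumption | exact: ler0n | apply: addr_ge0 | apply: mulr_ge0].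
Qed.

Lemma W_sqr_le t : fluct t ^+ 2 <= cW * (d%:R + excess t) / n%:R.
Proof.
rewrite ler_pdivlMr ?ltr0n//.
set e := Ex PP (fun t => opnorm_mx (delta t)); have he := Ex_opnorm_mx_delta_sqr; rewrite -/e in he.
set a := opnorm_mx (delta t) - e.
have hn : (0 : R) < n%:R by rewrite ltr0n.
have he2 : e ^+ 2 * n%:R <= M ^+ 2 * d%:R.
  by move: he; rewrite mulrA ler_pdivlMr.
set A := n%:R * enorm (eta t) ^+ 2 / (8 * M).
have hA : enorm (eta t) ^+ 2 * n%:R = 8 * M * A.
  by rewrite /A mulrC; field; rewrite gt_eqF.
set B := n%:R * a ^+ 2 / (64 * M ^+ 2).
have hB : a ^+ 2 * n%:R = 64 * M ^+ 2 * B.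
  by rewrite /B mulrC; field; rewrite gt_eqF.
have B0 : 0 <= B by apply: divr_ge0; apply: mulr_ge0; rewrite ?sqr_ge0 ?ler0n.
have TE : 2 * excess t = Num.max (A - d%:R) 0 + B by rewrite /excess -/A -/e -/a -/B; field.
have h1 : A - d%:R <= 2 * excess t - B by rewrite TE addrK le_max lexx.
have h0 : 0 <= 2 * excess t - B by rewrite TE addrK le_max lexx orbT.
have hW : fluct t ^+ 2 <= 4 * a ^+ 2 + 4 * e ^+ 2 + 2 * enorm (eta t) ^+ 2.
  rewrite /fluct (_ : opnorm_mx (delta t) = a + e); last by rewrite /a subrK.
  have := sqr_ge0 (a + e - enorm (eta t)); have := sqr_ge0 (a - e).
  by move: (enorm (eta t)) => x; nra.
apply: (@le_trans _ _ ((4 * a ^+ 2 + 4 * e ^+ 2 + 2 * enorm (eta t) ^+ 2) * n%:R)).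
  by rewrite ler_wpM2r.
exact: W_sqr_arith hB he2 hA h1 h0 B0 (excess_ge0 t) (ler0n _ _) (ltW M0).
Qed.

Hypothesis d0 : (0 < d)%N.
Hypothesis hdn : d%:R <= n%:R :> R.
Let a : R := Num.sqrt (d%:R / n%:R).

Lemma a_sqr : a ^+ 2 = d%:R / n%:R.
Proof. by rewrite sqr_sqrtr// divr_ge0. Qed.
Lemma a_gt0 : 0 < a. Proof. by rewrite sqrtr_gt0 divr_gt0 ?ltr0n. Qed.
Lemma a_le1 : a <= 1.
Proof. by rewrite -[X in _ <= X]sqrtr1 ler_wsqrtr// ler_pdivrMr ?ltr0n// mul1r. Qed.
Let a0 := a_gt0.

Lemma W_sqr_le1 t : fluct t ^+ 2 <= cW * a ^+ 2 * (1 + excess t).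
Proof.
rewrite (le_trans (W_sqr_le t))// a_sqr.
have -> : cW * (d%:R + excess t) / n%:R = cW * (ni * (d%:R + excess t)) by rewrite /ni; ring.
have -> : cW * (d%:R / n%:R) * (1 + excess t) = cW * (ni * (d%:R * (1 + excess t))) by rewrite /ni; ring.
apply: ler_wpM2l; first exact: cW_ge0.
apply: ler_wpM2l; first exact: ltW.
by rewrite mulrDr mulr1 lerD2l ler_peMl ?excess_ge0// ler1n.
Qed.

Lemma T1_moment q : itg PP (fun t => (1 + excess t) ^+ q) /\
  Ex PP (fun t => (1 + excess t) ^+ q) <= q`!%:R * expR 1 ^+ 2.
Proof.
have mT1 : measurable_fun setT (fun t => 1 + excess t) by apply: measurable_funD => //; exact: measurable_T.
have T10 t : 0 <= 1 + excess t by rewrite addr_ge0 ?excess_ge0.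
apply: EE_leE; [exact: measurable_funX|by move=> t; rewrite exprn_ge0|].
apply: EE_exp_moment => //.
apply: (@le_trans _ _ ((expR 1)%:E * \int[PP]_t (expR (excess t))%:E)%E).
  rewrite -EE_Zl//; last by apply: measurable_expR_comp; exact: measurable_T.
  by apply: le_EE => t; rewrite lee_fin ?expR_ge0// expRD.
by rewrite expr2 EFinM lee_wpmul2l ?lee_fin ?expR_ge0// T_exp.
Qed.

Definition cM q : R := 1 + cW ^+ q * (q`!%:R * expR 1 ^+ 2).
Lemma cM_ge0 q : 0 <= cM q.
Proof.
apply: addr_ge0 => //; apply: mulr_ge0; first exact/exprn_ge0/cW_ge0.
by apply: mulr_ge0 => //; apply: exprn_ge0; exact: expR_ge0.
Qed.

(** Only the square of [fluct] is bounded by [excess]; other powers are reached through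
    [2 a^q W^q <= a^(2q) + W^(2q)], with [W] for [fluct]. *)
Lemma W_pow_le q t : fluct t ^+ q <= a ^+ q * (1 + cW ^+ q * (1 + excess t) ^+ q).
Proof.
have hs := sqr_ge0 (fluct t ^+ q - a ^+ q).
have h : (fluct t ^+ q) ^+ 2 <= (a ^+ q) ^+ 2 * (cW ^+ q * (1 + excess t) ^+ q).
  rewrite -!exprM mulnC !exprM -!exprMn lerXn2r ?nnegrE ?exprn_ge0 ?W_ge0//.
    rewrite !mulr_ge0 ?cW_ge0 ?exprn_ge0 ?(ltW a0)// addr_ge0 ?excess_ge0//.
  by rewrite (le_trans (W_sqr_le1 t))// mulrCA mulrA.
have aq0 : 0 < a ^+ q by rewrite exprn_gt0.
rewrite -(ler_pM2l aq0); move: h hs (sqr_ge0 (fluct t ^+ q)) (sqr_ge0 (a ^+ q)).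
move: (fluct t ^+ q) (a ^+ q) (_ * _ ^+ q) => w b c; rewrite sqrrB.
have -> : b * (b * (1 + c)) = b ^+ 2 + b ^+ 2 * c by ring.
rewrite [b * w]mulrC; move: (b ^+ 2 * c) (b ^+ 2) (w ^+ 2) (w * b) => x1 x2 x3 x4; lra.
Qed.

Lemma W_moment q : itg PP (fun t => fluct t ^+ q) /\ Ex PP (fun t => fluct t ^+ q) <= cM q * a ^+ q.
Proof.
have [i1 h1] := T1_moment q; have mW := measurable_W.
have ib : itg PP (fun t => a ^+ q * (1 + cW ^+ q * (1 + excess t) ^+ q)).
  by apply: itgZ; apply: itgD; [exact: itg_cst|exact: itgZ].
have iW : itg PP (fun t => fluct t ^+ q).
  apply: itg_le ib _ => [|t]; first exact: measurable_funX.
  by rewrite ger0_norm ?exprn_ge0 ?W_ge0// W_pow_le.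
split=> //; rewrite (le_trans (Ex_le iW ib (W_pow_le q)))//.
rewrite ExZ; last by apply: itgD; [exact: itg_cst|exact: itgZ].
rewrite mulrC ler_wpM2r ?exprn_ge0 ?(ltW a0)// ExD; [|exact: itg_cst|exact: itgZ].
by rewrite Ex_cst ExZ// lerD2l ler_wpM2l// exprn_ge0 ?cW_ge0.
Qed.

Lemma Ex_eta v : itg PP (fun t => dot v (eta t)) /\ Ex PP (fun t => dot v (eta t)) = 0.
Proof.
have E t : dot v (eta t) = ni * \sum_i dV (tnth t i) v.
  by rewrite dotC scoreE; congr (_ * _); apply: eq_bigr => i _; rewrite subr0.
have iV : itg P (fun x => dV x v) by exact/tame_itg/tame_dV.
have iT i := (@Ex_tnth _ _ _ P n i _ iV).1.
have -> : (fun t => dot v (eta t)) = (fun t => ni * \sum_i dV (tnth t i) v) by apply/funext.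
have iS : itg PP (fun t => \sum_i dV (tnth t i) v) by apply: itg_sum => i _; exact: iT.
split; first exact: itgZ.
rewrite ExZ// Ex_sum// big1 ?mulr0// => i _.
by rewrite (Ex_tnth i iV).2 Ex_dV.
Qed.

Lemma measurable_dot {disp} {T : measurableType disp} (v : 'rV[R]_d) (A : T -> 'rV[R]_d) :
  measurable_fun setT A -> measurable_fun setT (fun b : T => dot v (A b)).
Proof.
by move=> mA; apply: measurable_sum => i; apply: measurable_funM => //; exact: measurable_coord.
Qed.

Lemma measurable_rVB {disp} {T : measurableType disp} (A B : T -> 'rV[R]_d) :
  measurable_fun setT A -> measurable_fun setT B -> measurable_fun setT (fun b : T => A b - B b).
Proof.
move=> mA mB; apply: measurable_fun_rVP => i; under eq_fun do rewrite !mxE.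
by apply: measurable_funB; exact: measurable_coord.
Qed.

Lemma measurable_rVM {disp} {T : measurableType disp} (A : T -> 'rV[R]_d) (B : 'M[R]_d) :
  measurable_fun setT A -> measurable_fun setT (fun b : T => A b *m B).
Proof.
move=> mA; apply: measurable_fun_rVP => i; under eq_fun do rewrite mxE.
by apply: measurable_sum => j; apply: measurable_funM => //; exact: measurable_coord.
Qed.

(** * Bias reduction *)

Section bias.
Variable k : nat.
Let Z := newton_iter k.+1.
Let mZ : measurable_fun setT Z. Proof. exact: measurable_newton_iter. Qed.
Let z1 : R := cz k.+1.

Lemma Z_itg q : itg PP (fun t => enorm (Z t) ^+ q).
Proof.
apply: (@itg_le _ _ _ _ _ (fun t => z1 ^+ q * fluct t ^+ q)) => [||t].
- by apply: measurable_funX; exact: measurable_enorm.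
- by apply: itgZ; have [] := W_moment q.
rewrite ger0_norm ?exprn_ge0 ?enorm_ge0// -exprMn lerXn2r ?nnegrE ?enorm_ge0//.
  by rewrite mulr_ge0 ?cz_ge0 ?W_ge0.
exact: newton_iter_le_W.
Qed.

Lemma Z_moment q : Ex PP (fun t => enorm (Z t) ^+ q) <= z1 ^+ q * cM q * a ^+ q.
Proof.
have [iW hW] := W_moment q.
apply: (@le_trans _ _ (Ex PP (fun t => z1 ^+ q * fluct t ^+ q))); last first.
  by rewrite ExZ// -mulrA ler_wpM2l// exprn_ge0// cz_ge0.
apply: Ex_le => [||t]; [exact: Z_itg|exact: itgZ|].
rewrite -exprMn lerXn2r ?nnegrE ?enorm_ge0//; last exact: newton_iter_le_W.
by rewrite mulr_ge0 ?cz_ge0 ?W_ge0.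
Qed.

Let iZ : itg PP (fun t => enorm (Z t)). Proof. exact: (Z_itg 1). Qed.
Let e1 := Ex PP (fun t => enorm (Z t)).
Let c1 : R := z1 * cM 1.
Lemma e1_le : e1 <= c1 * a. Proof. by have := Z_moment 1; rewrite !expr1. Qed.
Lemma e1_ge0 : 0 <= e1. Proof. by apply: Ex_ge0 => t; exact: enorm_ge0. Qed.
Lemma c1_ge0 : 0 <= c1. Proof. by rewrite mulr_ge0 ?cM_ge0// cz_ge0. Qed.

Let c2 : R := cb k * cM 2.
(** The linear part [eta *m J] is centred, so only the quadratic deviation contributes: the mean is
    of order [a^2], while [E |Z|] is of order [a]. *)
Lemma Z_mean v : `|Ex PP (fun t => dot v (Z t))| <= c2 * a ^+ 2 * enorm v.
Proof.
have [ie Ee] := Ex_eta (v *m J); have [iW hW] := W_moment 2.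
have E t : dot v (eta t *m J) = dot (v *m J) (eta t) by rewrite inv_sym.
have il : itg PP (fun t => dot v (Z t - eta t *m J)).
  apply: (@itg_le _ _ _ _ _ (fun t => enorm v * (cb k * fluct t ^+ 2))) => [||t].
  - apply: measurable_dot; apply: measurable_rVB => //; apply: measurable_rVM; exact: measurable_eta.
  - by do 2! apply: itgZ.
  - by rewrite (le_trans (dot_le _ _))// ler_wpM2l ?enorm_ge0// newton_iter_linear.
have -> : (fun t => dot v (Z t)) = (fun t => dot (v *m J) (eta t) + dot v (Z t - eta t *m J)).
  by apply/funext => t; rewrite -E -dotDr addrC subrK.
rewrite ExD// Ee add0r (le_trans (Ex_norm il))//.
apply: (@le_trans _ _ (Ex PP (fun t => enorm v * (cb k * fluct t ^+ 2)))).
  apply: Ex_le => [||t]; [exact: itg_norm|by do 2! apply: itgZ|].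
  by rewrite (le_trans (dot_le _ _))// ler_wpM2l ?enorm_ge0// newton_iter_linear.
rewrite !ExZ//; last exact: itgZ.
rewrite mulrC ler_wpM2r ?enorm_ge0// /c2 -mulrA ler_wpM2l//.
by rewrite /cb !mulr_ge0 ?invr_ge0 ?(ltW m0) ?cz_ge0// addr_ge0// mulr_ge0 ?cz_ge0// ltW.
Qed.

Variables (rho K : R) (f : 'rV[R]_d -> R).
Hypothesis r01 : 0 < rho <= 1.
Hypothesis hf : holder_ball k.+1 rho K f.

(** The fractional power is normalised at the typical size [a], so that only integer moments have to
    be integrated. *)
Lemma powR_scale (b : R) : 0 <= b -> b `^ rho <= a `^ rho * (1 + b / a).
Proof.
move=> b0; have ba0 : 0 <= b / a by rewrite divr_ge0// ltW.
rewrite -{1}[b](divfK (lt0r_neq0 a0)) powRM// ?(ltW a0)// mulrC ler_wpM2l ?powR_ge0//.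
exact: powR_le_1D.
Qed.

Lemma Z_powR_itg : itg PP (fun t => enorm (Z t) * enorm (Z t) `^ rho) /\
  Ex PP (fun t => enorm (Z t) * enorm (Z t) `^ rho) <= (c1 + z1 ^+ 2 * cM 2) * (a * a `^ rho).
Proof.
have ib : itg PP (fun t => a `^ rho * (enorm (Z t) + a^-1 * enorm (Z t) ^+ 2)).
  by apply: itgZ; apply: itgD => //; apply: itgZ; exact: Z_itg.
have hb t : enorm (Z t) * enorm (Z t) `^ rho <= a `^ rho * (enorm (Z t) + a^-1 * enorm (Z t) ^+ 2).
  have -> : a `^ rho * (enorm (Z t) + a^-1 * enorm (Z t) ^+ 2) =
     enorm (Z t) * (a `^ rho * (1 + enorm (Z t) / a)) by ring.
  by rewrite ler_wpM2l ?enorm_ge0// powR_scale// enorm_ge0.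
have iZ2 := Z_itg 2.
have i0 : itg PP (fun t => enorm (Z t) * enorm (Z t) `^ rho).
  apply: itg_le ib _ => [|t]; last by rewrite ger0_norm ?mulr_ge0 ?powR_ge0 ?enorm_ge0.
  have me : measurable_fun setT (fun t => enorm (Z t)) by exact: measurable_enorm.
  by apply: measurable_funM => //; apply: (measurableT_comp (measurable_powR _)).
split=> //; rewrite (le_trans (Ex_le i0 ib hb))// ExZ; last by apply: itgD => //; exact: itgZ.
rewrite [a * _]mulrC mulrA [_ * a `^ rho]mulrC -mulrA ler_wpM2l ?powR_ge0//.
rewrite ExD//; last exact: itgZ.
rewrite ExZ// mulrDl lerD//; first exact: e1_le.
rewrite -(ler_pM2l a0) mulrA mulfV ?gt_eqF// mul1r (le_trans (Z_moment 2))//.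
by rewrite le_eqVlt; apply/orP; left; apply/eqP; rewrite [a ^+ 2]expr2; ring.
Qed.

Definition debiased : 'rV[R]_d -> R := fun p => \sum_(j < k.+1) (-1) ^+ j * iter j (bias_op PP Z) f p.

Let it_hol j : (j <= k.+1)%N -> holder_ball (k.+1 - j) rho (K * e1 ^+ j) (iter j (bias_op PP Z) f).
Proof. by move=> jk; apply: iter_bias_op_hol. Qed.

Let it_hol1 (j : 'I_k.+1) : holder_ball (k - j).+1 rho (K * e1 ^+ j) (iter j (bias_op PP Z) f).
Proof. by rewrite -subSn ?leq_ord//; apply: it_hol; exact: ltnW. Qed.

Definition cB : R := c1 ^+ k * (c2 + 2 * (c1 + z1 ^+ 2 * cM 2)).
Let K0 : 0 <= K. Proof. exact: holder_ball_ge0 hf. Qed.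

(** After [k] applications the function is still in [C^(1 + rho)], where [bias_op_second_order]
    applies; its term [a^2] is at most [a^(1 + rho)] because [a <= 1]. *)
Lemma bias_op_last p : `|iter k.+1 (bias_op PP Z) f p| <= K * (cB * (a ^+ k.+1 * a `^ rho)).
Proof.
have hk := it_hol1 ord_max; rewrite /= subnn in hk.
have [i3 h3] := Z_powR_itg.
have e20 : 0 <= c2 * a ^+ 2.
  by rewrite mulr_ge0 ?sqr_ge0// mulr_ge0 ?cM_ge0// /cb !mulr_ge0 ?invr_ge0 ?(ltW m0) ?cz_ge0// addr_ge0// mulr_ge0 ?cz_ge0// ltW.
rewrite iterS (le_trans (bias_op_second_order mZ iZ p e20 r01 hk Z_mean i3))//.
rewrite -mulrA ler_wpM2l// /cB -mulrA exprS.
have aa : a ^+ 2 <= a * a `^ rho.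
  rewrite expr2 ler_wpM2l ?(ltW a0)// -[leLHS]powRr1 ?(ltW a0)//.
  by case/andP: r01 => r0 r1; apply: ger_powR => //; rewrite a0 a_le1.
have h2 : c2 * a ^+ 2 + 2 * Ex PP (fun t => enorm (Z t) * enorm (Z t) `^ rho) <=
    (c2 + 2 * (c1 + z1 ^+ 2 * cM 2)) * (a * a `^ rho).
  have -> : (c2 + 2 * (c1 + z1 ^+ 2 * cM 2)) * (a * a `^ rho) =
     c2 * (a * a `^ rho) + 2 * ((c1 + z1 ^+ 2 * cM 2) * (a * a `^ rho)) by ring.
  apply: lerD; last by rewrite ler_wpM2l.
  by rewrite ler_wpM2l// mulr_ge0 ?cM_ge0// /cb !mulr_ge0 ?invr_ge0 ?(ltW m0) ?cz_ge0// addr_ge0// mulr_ge0 ?cz_ge0// ltW.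
rewrite (_ : c1 ^+ k * _ = (c1 * a) ^+ k * ((c2 + 2 * (c1 + z1 ^+ 2 * cM 2)) * (a * a `^ rho))); last first.
  rewrite [(c1 * a) ^+ k]exprMn [a ^+ k.+1]exprS.
  by move: (c1 ^+ k) (a ^+ k) => b1 b2; ring.
apply: ler_pM => //; first exact/exprn_ge0/e1_ge0.
  apply: addr_ge0 => //; apply: mulr_ge0 => //; apply: Ex_ge0 => t.
  by apply: mulr_ge0; [exact: enorm_ge0|exact: powR_ge0].
apply: lerXn2r; rewrite ?nnegrE; [exact: e1_ge0| |exact: e1_le].
by apply: mulr_ge0; [exact: c1_ge0|exact: ltW].
Qed.

Let it_itg (j : 'I_k.+1) p : itg PP (fun t => iter j (bias_op PP Z) f (p + Z t)).
Proof. by have h2 := bias_op_itg PP mZ p (it_hol1 j). Qed.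

Lemma debiased_itg p : itg PP (fun t => debiased (p + Z t)).
Proof. by apply: itg_sum => j _; apply: itgZ; exact: it_itg. Qed.

(** Averaging over the proxy estimator is [1 + B], so the alternating sum telescopes to
    [f + (-1)^k B^(k+1) f]. *)
Lemma debiased_mean p : `|Ex PP (fun t => debiased (p + Z t)) - f p| <= K * (cB * (a ^+ k.+1 * a `^ rho)).
Proof.
have E : Ex PP (fun t => debiased (p + Z t)) = f p + (-1) ^+ k * iter k.+1 (bias_op PP Z) f p.
  rewrite /debiased Ex_sum; last by move=> j _; apply: itgZ; exact: it_itg.
  have Ej (j : 'I_k.+1) : Ex PP (fun t => (-1) ^+ j * iter j (bias_op PP Z) f (p + Z t)) =
      (-1) ^+ j * iter j (bias_op PP Z) f p - (-1) ^+ j.+1 * iter j.+1 (bias_op PP Z) f p.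
    rewrite ExZ; last exact: it_itg.
    by rewrite iterS /bias_op exprS; ring.
  under eq_bigr do rewrite Ej.
  rewrite -(big_mkord xpredT (fun j => (-1) ^+ j * iter j (bias_op PP Z) f p - (-1) ^+ j.+1 * iter j.+1 (bias_op PP Z) f p)).
  rewrite -[LHS]opprK -sumrN; under eq_bigr do rewrite opprB.
  by rewrite telescope_sumr// opprB expr0 mul1r exprS mulN1r mulNr opprK.
rewrite E addrAC subrr add0r normrM normrX normrN1 expr1n mul1r.
exact: bias_op_last.
Qed.

Definition cF : R := \sum_(j < k.+1) c1 ^+ j.
Lemma cF_ge0 : 0 <= cF. Proof. by apply: sumr_ge0 => j _; rewrite exprn_ge0// c1_ge0. Qed.

Lemma e1_pow_le j : e1 ^+ j <= c1 ^+ j.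
Proof.
rewrite lerXn2r ?nnegrE ?e1_ge0 ?c1_ge0// (le_trans e1_le)//.
by rewrite ler_piMr ?c1_ge0// a_le1.
Qed.

Lemma debiased_differentiable p : differentiable debiased p.
Proof.
rewrite (_ : debiased = \sum_(j < k.+1) ((-1) ^+ j) \*: iter j (bias_op PP Z) f); last first.
  by apply/funext => q; rewrite /debiased fct_sumE.
apply: differentiable_sum => j; apply: differentiableZ; exact: holder_ball_differentiable (it_hol1 j).
Qed.

Lemma debiased_derive p v : 'D_v debiased p = \sum_(j < k.+1) (-1) ^+ j * 'D_v (iter j (bias_op PP Z) f) p.
Proof.
rewrite (_ : debiased = \sum_(j < k.+1) ((-1) ^+ j) \*: iter j (bias_op PP Z) f); last first.
  by apply/funext => q; rewrite /debiased fct_sumE.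
have dj (j : 'I_k.+1) : derivable (iter j (bias_op PP Z) f) p v.
  exact/diff_derivable/(holder_ball_differentiable _ (it_hol1 j)).
rewrite derive_sum => [|j]; last exact: derivableZ.
by apply: eq_bigr => j _; rewrite deriveZ.
Qed.

Lemma debiased_derive_le p v : `|'D_v debiased p| <= K * cF * enorm v.
Proof.
rewrite debiased_derive (le_trans (ler_norm_sum _ _ _))// /cF mulr_sumr mulr_suml ler_sum// => j _.
rewrite normrM normrX normrN1 expr1n mul1r (le_trans (holder_ball_derive_le _ _ (it_hol1 j)))//.
by rewrite ler_wpM2r ?enorm_ge0// ler_wpM2l// e1_pow_le.
Qed.

Lemma debiased_lip p q : `|debiased p - debiased q| <= K * cF * enorm (p - q).
Proof.
have [c _] := mvt_rV q (p - q) debiased_differentiable.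
by rewrite [q + (p - q)]addrC subrK => ->; exact: debiased_derive_le.
Qed.

Lemma debiased_bounded p : `|debiased p| <= K * cF.
Proof.
rewrite (le_trans (ler_norm_sum _ _ _))// /cF mulr_sumr ler_sum// => j _.
rewrite normrM normrX normrN1 expr1n mul1r (le_trans (holder_ball_le _ (it_hol1 j)))//.
by rewrite ler_wpM2l// e1_pow_le.
Qed.

Definition cG : R := c1 * \sum_(j < k) c1 ^+ j.
Lemma cG_ge0 : 0 <= cG.
Proof. by rewrite mulr_ge0 ?c1_ge0// sumr_ge0// => j _; rewrite exprn_ge0 ?c1_ge0. Qed.

(** Every term beyond [f] carries at least one factor [E |Z|], which is of order [a]. *)
Lemma debiased_derive_sub p v : `|'D_v debiased p - 'D_v f p| <= K * (cG * a) * enorm v.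
Proof.
rewrite debiased_derive big_ord_recl expr0 mul1r /= addrAC subrr add0r.
rewrite (le_trans (ler_norm_sum _ _ _))// /cG.
have -> : K * (c1 * (\sum_(j < k) c1 ^+ j) * a) * enorm v = (\sum_(j < k) c1 ^+ j) * (K * (c1 * a) * enorm v) by ring.
rewrite mulr_suml ler_sum// => j _.
rewrite normrM normrX normrN1 expr1n mul1r.
have jk : (bump 0 j < k.+1)%N by rewrite /bump /= add1n ltnS.
rewrite (le_trans (holder_ball_derive_le p v (it_hol1 (Ordinal jk))))//=.
have -> : c1 ^+ j * (K * (c1 * a) * enorm v) = K * (c1 ^+ j * (c1 * a)) * enorm v by ring.
rewrite ler_wpM2r ?enorm_ge0// ler_wpM2l// /bump /= add1n exprSr.
by apply: ler_pM; [exact/exprn_ge0/e1_ge0|exact: e1_ge0|exact: e1_pow_le|exact: e1_le].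
Qed.

End bias.

Section estimator_bias.
Context {disp : measure_display} {T : measurableType disp}.
Variables (Pr : 'rV[R]_d -> probability T R) (X : 'I_n -> {mfun T >-> 'rV[R]_d}).
Hypothesis hX : location_sample V Pr X.
Variable k : nat.
Let Z := newton_iter k.+1.
Let mZ : measurable_fun setT Z. Proof. exact: measurable_newton_iter. Qed.

Definition that (b : T) : 'rV[R]_d := mle V (fun i => X i b).
Definition Ct theta (b : T) : n.-tuple 'rV[R]_d := centered X theta b.
Definition mle_error t : R := ck k.+1 * fluct t ^+ k.+2.

Lemma mle_error_ge0 t : 0 <= mle_error t.
Proof.
apply: mulr_ge0; last exact/exprn_ge0/W_ge0.
apply: addr_ge0; first exact: ca_ge0.
by apply: exprn_ge0; rewrite invr_ge0 ltW// W_bad_gt0.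
Qed.

Lemma that_close theta b :
  Num.min 1 (enorm (that b - (theta + Z (Ct theta b)))) <= mle_error (Ct theta b).
Proof.
have h := mle_approx k.+1 (fun i => X i b) theta.
rewrite /that opprD addrA; exact: h.
Qed.

Lemma Ex_centered theta (g : n.-tuple 'rV[R]_d -> R) : itg PP g ->
  itg (Pr theta) (fun b => g (Ct theta b)) /\ Ex (Pr theta) (fun b => g (Ct theta b)) = Ex PP g.
Proof.
move=> ig; have mg := itg_meas ig; have mC := measurable_centered X theta.
have ge0 (h : n.-tuple 'rV[R]_d -> R) : itg PP h -> (forall t, 0 <= h t) ->
    itg (Pr theta) (fun b => h (Ct theta b)) /\ Ex (Pr theta) (fun b => h (Ct theta b)) = Ex PP h.
  move=> ih h0; have mh := itg_meas ih.
  have e : (\int[Pr theta]_b (h (Ct theta b))%:E = (Ex PP h)%:E)%E.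
    rewrite (ge0_integral_centered measurable_V hP hX theta (h := EFin \o h))//; first exact: ExE.
    exact/measurable_EFinP.
  have := @EE_leE _ _ _ (Pr theta) (fun b => h (Ct theta b)) (Ex PP h).
  case=> //; [exact: measurableT_comp|by rewrite e|move=> i1 _].
  by split=> //; apply/EFin_inj; rewrite -ExE.
have [i1 e1] := ge0 _ (itg_norm ig) (fun=> normr_ge0 _).
have [||i2 e2] := ge0 (fun t => `|g t| - g t).
- by apply: itgB => //; exact: itg_norm.
- by move=> b; rewrite subr_ge0 ler_norm.
have i3 : itg (Pr theta) (fun b => g (Ct theta b)).
  rewrite (_ : (fun b => _) = (fun b => `|g (Ct theta b)| - (`|g (Ct theta b)| - g (Ct theta b)))).
    exact: itgB.
  by apply/funext => b; rewrite opprB addrC subrK.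
split=> //; move: e2; rewrite ExB// e1 ExB//; last exact: itg_norm.
by move/addrI/oppr_inj.
Qed.

Variables (rho K : R) (f : 'rV[R]_d -> R).
Hypothesis r01 : 0 < rho <= 1.
Hypothesis hf : holder_ball k.+1 rho K f.

Lemma lip_min l (q : R) (g : 'rV[R]_d -> R) (p p' : 'rV[R]_d) : holder_ball l.+1 rho q g ->
  `|g p - g p'| <= 2 * q * Num.min 1 (enorm (p - p')).
Proof.
move=> hg; have q0 := holder_ball_ge0 hg.
have h1 := holder_ball_lip p p' hg; have h2 := holder_ball_le p hg; have h3 := holder_ball_le p' hg.
have [h|h] := leP 1 (enorm (p - p')).
  by rewrite mulr1 (le_trans (ler_normB _ _))// mulr2n mulrDl mul1r lerD.
rewrite (le_trans h1)// -mulrA ler_peMl ?ler1n// mulr_ge0 ?enorm_ge0//.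
Qed.

(** [calT] integrates [g \o that], which is not known to be measurable; [fine_sandwich] confines the
    value by integrals of functions of the sample. [eps] is the error already accumulated in [g]. *)
Lemma calT_close l (q eps : R) (g h : 'rV[R]_d -> R) (theta : 'rV[R]_d) : holder_ball l.+1 rho q h -> (forall p, `|g p - h p| <= eps) ->
  `|calT Pr that g theta - Ex PP (fun t => h (theta + Z t))| <= eps + 2 * q * Ex PP mle_error.
Proof.
move=> hh hgh; have q0 := holder_ball_ge0 hh.
have iD : itg PP mle_error by apply: itgZ; have [] := W_moment k.+2.
have ih : itg PP (fun t => h (theta + Z t)) by exact: (bias_op_itg PP mZ theta hh).
have [iD' eD'] := Ex_centered theta iD; have [ih' eh'] := Ex_centered theta ih.
have iS : itg (Pr theta) (fun b => eps + 2 * q * mle_error (Ct theta b)).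
  by apply: itgD; [exact: itg_cst|exact: itgZ].
have hc b : `|g (that b) - h (theta + Z (Ct theta b))| <= eps + 2 * q * mle_error (Ct theta b).
  have gen (b1 b2 b3 : R) : b1 - b3 = (b1 - b2) + (b2 - b3) by ring.
  rewrite (gen _ (h (that b))).
  rewrite (le_trans (ler_normD _ _))// lerD// (le_trans (lip_min _ _ hh))//.
  by rewrite ler_wpM2l ?mulr_ge0// that_close.
have eS : Ex (Pr theta) (fun b => eps + 2 * q * mle_error (Ct theta b)) = eps + 2 * q * Ex PP mle_error.
  rewrite (ExD (itg_cst _ eps) (itgZ (2 * q) iD')) (ExZ (2 * q) iD').
  by apply: congr2; [exact: Ex_cst|exact: congr1 eD'].
have hs := @fine_sandwich _ _ _ (Pr theta) (g \o that) _ _ ih' iS hc.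
by rewrite -eS -eh' /calT unlock.
Qed.

Let e1 := Ex PP (fun t => enorm (Z t)).

(** Since [B] is [T] minus the identity, an earlier error returns twice; the new application of [T]
    adds twice the size of the current iterate of [bias_op]. *)
Fixpoint ceps (j : nat) : R := if j is i.+1 then 2 * ceps i + 2 * (cz k.+1 * cM 1) ^+ i else 0.

Lemma ceps_ge0 j : 0 <= ceps j.
Proof.
elim: j => //= j IH; apply: addr_ge0; apply: mulr_ge0 => //; apply: exprn_ge0.
by apply: mulr_ge0; [exact: (cz_ge0 k.+1)|exact: cM_ge0].
Qed.

Lemma iter_calB_close j theta : (j <= k.+1)%N ->
  `|iter j (calB Pr that) f theta - iter j (bias_op PP Z) f theta| <= K * ceps j * Ex PP mle_error.
Proof.
have K0 := holder_ball_ge0 hf.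
have D0 : 0 <= Ex PP mle_error by apply: Ex_ge0 => t; exact: mle_error_ge0.
elim: j theta => [|j IH] theta jk; first by rewrite subrr normr0 mulr0 mul0r.
have hj : holder_ball (k - j).+1 rho (K * e1 ^+ j) (iter j (bias_op PP Z) f).
  rewrite -subSn//; apply: iter_bias_op_hol => //; [exact: (Z_itg k 1)|exact: ltnW].
have h1 := calT_close theta hj (fun p => IH p (ltnW jk)).
have h2 := IH theta (ltnW jk).
rewrite !iterS {1}/calB /bias_op.
set A := calT _ _ _ _ in h1 *; set B := Ex PP _ in h1 *; set b1 := iter j _ f theta in h2 *.
set b2 := iter j _ f theta in h2 *.
have -> : A - b1 - (B - b2) = (A - B) - (b1 - b2) by ring.
rewrite (le_trans (ler_normB _ _))// (le_trans (lerD h1 h2))//=.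
have h3 : 2 * (K * e1 ^+ j) * Ex PP mle_error <= K * (2 * (cz k.+1 * cM 1) ^+ j) * Ex PP mle_error.
  rewrite ler_wpM2r// mulrCA ler_wpM2l// ler_wpM2l//; exact: e1_pow_le.
rewrite mulrDr mulrDl [X in _ <= X + _](_ : _ = K * ceps j * Ex PP mle_error + K * ceps j * Ex PP mle_error); last by ring.
by rewrite -addrA [X in _ + X]addrC addrA; apply: lerD.
Qed.

Definition cS : R := \sum_(j < k.+1) ceps j.

Lemma bias_sub_le theta :
  `|bias_reduced Pr that k f theta - debiased k f theta| <= K * cS * (ck k.+1 * cM k.+2) * a ^+ k.+2.
Proof.
have K0 := holder_ball_ge0 hf.
rewrite /bias_reduced /debiased -sumrB (le_trans (ler_norm_sum _ _ _))//.
apply: (@le_trans _ _ (\sum_(j < k.+1) K * ceps j * Ex PP mle_error)).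
  apply: ler_sum => j _; rewrite -mulrBr normrM normrX normrN1 expr1n mul1r.
  by apply: iter_calB_close; exact: ltnW.
rewrite -mulr_suml -mulr_sumr -/cS -!mulrA ler_wpM2l// ler_wpM2l//.
  by apply: sumr_ge0 => j _; exact: ceps_ge0.
have [iW hW] := W_moment k.+2.
rewrite /mle_error ExZ// ler_wpM2l//.
apply: addr_ge0; first exact: ca_ge0.
by apply: exprn_ge0; rewrite invr_ge0 ltW// W_bad_gt0.
Qed.

End estimator_bias.

(** * Concentration of the remainder *)

Section fluctuation.
Variables (k : nat) (rho K : R) (f : 'rV[R]_d -> R) (theta : 'rV[R]_d).
Hypothesis r01 : 0 < rho <= 1.
Hypothesis hf : holder_ball k.+1 rho K f.
Let Z := newton_iter k.+1.
Let K0 : 0 <= K. Proof. exact: holder_ball_ge0 hf. Qed.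

Definition newton_dir : 'rV[R]_d := gradient f theta *m J.
Definition linear_term t : R := ni * \sum_i dV (tnth t i) newton_dir.
Definition remainder t : R := debiased k f (theta + Z t) - linear_term t.

Lemma linear_termE t : linear_term t = 'D_(eta t *m J) f theta.
Proof.
rewrite derive_dot; last exact: holder_ball_differentiable hf.
rewrite dotC inv_sym dotC -/newton_dir dotC scoreE /linear_term; congr (_ * _).
by apply: eq_bigr => i _; rewrite subr0.
Qed.

Let cl' := cl k.+1.
Let cd' := cd k.+1.
Let cz' := cz k.+1.

Lemma ni_le1 : ni <= 1.
Proof. by rewrite /ni invf_le1 ?ltr0n// ler1n. Qed.

(** The increment splits into three: the derivative of [debiased] against that of [f], of order [a];
    the derivative of [f] at the displaced point against that at [theta], of order [a^rho] by Holder
    continuity; and the nonlinear part of the motion of the iterate. Its linear part is cancelled by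
    [linear_term]. *)
Lemma remainder_diff t j (e : 'rV[R]_d) :
  `|remainder (upd_tuple t j (tnth t j + e)) - remainder t| <= K * (ni * enorm e *
    (cl' * (cG k * a + 2 * (a `^ rho * (1 + (cz' * fluct t + cl' * enorm e) / a))) + cd' * (fluct t + enorm e))).
Proof.
set t' := upd_tuple t j _; set b := enorm e.
have b0 : 0 <= b by exact: enorm_ge0.
have cl0 : 0 <= cl' by exact: (cl_ge0 k.+1).
have ez : tnth t j + e - tnth t j = e by rewrite addrC addKr.
have hd := newton_iter_lip k.+1 t j (tnth t j + e); rewrite ez -/b -/t' -/Z in hd.
have hd2 := newton_iter_lip2 k t j (tnth t j + e); rewrite ez -/b -/t' -/Z in hd2.
set dl := Z t' - Z t in hd hd2.
set w := ni *: (gradient V (tnth t j + e) - gradient V (tnth t j)) in hd2.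
have hw : eta t' - eta t = w by rewrite /eta score_updT !subr0.
have dff p := holder_ball_differentiable p hf.
have hS : linear_term t' - linear_term t = 'D_(w *m J) f theta.
  by rewrite !linear_termE !derive_dot// -dotBr -mulmxBl hw.
have [c /andP[c0 c1] hc] := mvt_rV (theta + Z t) dl (debiased_differentiable hf).
set q := theta + Z t + c *: dl in hc.
have -> : remainder t' - remainder t = ('D_dl (debiased k f) q - 'D_dl f q) + ('D_dl f q - 'D_dl f theta) + 'D_(dl - w *m J) f theta.
  have -> : 'D_(dl - w *m J) f theta = 'D_dl f theta - 'D_(w *m J) f theta by rewrite !derive_dot// dotBr.
  have eZ : theta + Z t + dl = theta + Z t' by rewrite /dl addrA addrAC addrK.
  rewrite eZ in hc.
  have gen (b1 b2 b3 b4 b5 s1 s2 : R) : b3 = b1 - b2 -> (b1 - s1) - (b2 - s2) = (b3 - b4) + (b4 - b5) + (b5 - (s1 - s2)) by move=> ->; ring.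
  by rewrite -hS; exact: (gen _ _ _ _ _ _ _ (esym hc)).
have qd : enorm (q - theta) <= cz' * fluct t + cl' * b.
  rewrite /q (_ : _ - theta = Z t + c *: dl); last by rewrite -(addrA theta) [LHS]addrC addKr.
  rewrite (le_trans (enormD _ _))//; apply: lerD; first exact: newton_iter_le_W.
  rewrite enormZ gtr0_norm// (@le_trans _ _ (enorm dl))//; first by rewrite ler_piMl ?enorm_ge0// ltW.
  by rewrite (le_trans hd)// ler_wpM2r// ler_piMl// ni_le1.
have h1 : `|'D_dl (debiased k f) q - 'D_dl f q| <= K * (cG k * a) * (ni * cl' * b).
  rewrite (le_trans (debiased_derive_sub hf _ _))// ler_wpM2l// mulr_ge0// mulr_ge0 ?(ltW a0)//.
  exact: cG_ge0.
have h2 : `|'D_dl f q - 'D_dl f theta| <= 2 * K * (ni * cl' * b) * (a `^ rho * (1 + (cz' * fluct t + cl' * b) / a)).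
  rewrite (le_trans (holder_ball_derive_holder _ _ _ r01 hf))//.
  apply: ler_pM; [|exact: powR_ge0| |].
  - by rewrite !mulr_ge0 ?enorm_ge0.
  - by rewrite ler_wpM2l// mulr_ge0.
  - rewrite (le_trans (powR_scale r01 (enorm_ge0 _)))// ler_wpM2l ?powR_ge0// lerD2l.
    by apply: ler_wpM2r qd; rewrite invr_ge0; exact: ltW a0.
have h3 : `|'D_(dl - w *m J) f theta| <= K * (ni * cd' * (fluct t + b) * b).
  by rewrite (le_trans (holder_ball_derive_le _ _ hf))// ler_wpM2l.
rewrite (le_trans (ler_normD _ _))// (le_trans (lerD (ler_normD _ _) (lexx _)))//.
rewrite (le_trans (lerD (lerD h1 h2) h3))// le_eqVlt; apply/orP; left; apply/eqP.
by ring.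
Qed.

Definition c5 : R := cl' * (cG k + 2 + 2 * cz') + cd'.
Definition Qt t : R := K * ni * a `^ rho * c5 * (1 + fluct t / a).

Lemma cd_ge0 i : 0 <= cd i.
Proof.
case: i => //= i; have h1 := cl_ge0 i; have h2 := cz_ge0 i; have L0' := ltW L0.
have mi : 0 <= m^-1 by rewrite invr_ge0 ltW.
by repeat first [assumption | exact: ler0n | exact: ler01 | apply: addr_ge0 | apply: mulr_ge0].
Qed.

Lemma c5_ge0 : 0 <= c5.
Proof.
have h1 : 0 <= cl' := cl_ge0 k.+1; have h2 : 0 <= cz' := cz_ge0 k.+1.
have h3 : 0 <= cd' := cd_ge0 k.+1; have h4 := cG_ge0 k.
by repeat first [assumption | exact: ler0n | apply: addr_ge0 | apply: mulr_ge0].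
Qed.

Lemma Qt_ge0 t : 0 <= Qt t.
Proof.
apply: mulr_ge0; last by apply: addr_ge0 => //; apply: divr_ge0; [exact: W_ge0|exact: ltW].
apply: mulr_ge0; last exact: c5_ge0.
by apply: mulr_ge0; [apply: mulr_ge0 => //; exact: ltW|exact: powR_ge0].
Qed.

Lemma remainder_differentiable t j y : differentiable (fun y => remainder (upd_tuple t j y)) y.
Proof.
apply: differentiableB.
  apply: (@differentiable_comp _ _ _ _ (fun y => theta + Z (upd_tuple t j y)) (debiased k f)); last exact: (debiased_differentiable hf).
  apply: differentiableD; first exact: differentiable_cst.
  by apply: differentiable_rV => i; exact: newton_iter_differentiable.
rewrite (_ : (fun y => linear_term (upd_tuple t j y)) = cst (ni * \sum_(q | q != j) dV (tnth t q) newton_dir) + ni \*: (fun y => dV y newton_dir)); last first.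
  by apply/funext => y'; rewrite /linear_term (avg_updT (fun x => dV x newton_dir)).
by apply: differentiableD => //; apply: differentiableZ; exact: differentiable_dV.
Qed.

(** Perturbations [v / (i+1)] with [i] growing remove the terms of [remainder_diff] that are
    quadratic in the perturbation; [a <= a^rho] then collects what is left into [Qt]. *)
Lemma remainder_derive_le0 t j v :
  `|'D_v (fun y => remainder (upd_tuple t j y)) (tnth t j)| <= Qt t * enorm v.
Proof.
have cl0 : 0 <= cl' := cl_ge0 k.+1; have cz0 : 0 <= cz' := cz_ge0 k.+1.
have cd0 : 0 <= cd' := cd_ge0 k.+1; have g0 := cG_ge0 k.
pose B (x : R) := K * (ni * enorm v * (cl' * (cG k * a + 2 * (a `^ rho * (1 + (cz' * fluct t + cl' * x) / a))) + cd' * (fluct t + x))).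
apply: (@le_trans _ _ (B 0)).
  rewrite -[X in `|X|]subr0.
  apply: (derive_bound (b := fun i => B (i.+1%:R^-1 * enorm v)) (remainder_differentiable t j (tnth t j))).
    move=> i; rewrite mulr0 subr0 upd_tuple_id.
    have := remainder_diff t j (i.+1%:R^-1 *: v); rewrite enormZ (ger0_norm (_ : 0 <= i.+1%:R^-1))//.
    move=> h; rewrite (le_trans h)// /B le_eqVlt; apply/orP; left; apply/eqP; ring.
  pose B1 := K * (ni * enorm v * (cl' * (2 * (a `^ rho * ((cl' * enorm v) / a))) + cd' * enorm v)).
  apply: (@cvg_harmonic_bound _ _ _ `|B1|) => i.
  have -> : B (i.+1%:R^-1 * enorm v) - B 0 = i.+1%:R^-1 * B1 by rewrite /B /B1; ring.
  by rewrite normrM ger0_norm.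
rewrite /B /Qt mulr0 !addr0 -[K * ni]mulrC.
have ar : a <= a `^ rho.
  rewrite -{1}[a]powRr1 ?(ltW a0)//; case/andP: r01 => r0 r1.
  by apply: ger_powR => //; rewrite a0 a_le1.
set p := a `^ rho in ar *; set w := fluct t / a.
have w0 : 0 <= w by apply: divr_ge0; [exact: W_ge0|exact: ltW].
have WE : fluct t = a * w by rewrite /w mulrCA mulfV ?mulr1// gt_eqF.
have -> : cz' * fluct t / a = cz' * w by rewrite /w mulrA.
rewrite WE; have p0 : 0 <= p by exact: powR_ge0.
have e0 : 0 <= ni * K * enorm v by rewrite !mulr_ge0 ?enorm_ge0// ltW.
have -> : K * (ni * enorm v * (cl' * (cG k * a + 2 * (p * (1 + cz' * w))) + cd' * (a * w))) =
   (ni * K * enorm v) * (cl' * (cG k * a + 2 * (p * (1 + cz' * w))) + cd' * (a * w)) by ring.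
have -> : ni * K * p * c5 * (1 + w) * enorm v = (ni * K * enorm v) * (p * c5 * (1 + w)) by ring.
rewrite ler_wpM2l// /c5.
have q1 : cG k * a <= cG k * p by rewrite ler_wpM2l.
have q2 : cl' * (cG k * a) <= cl' * (cG k * p) by rewrite ler_wpM2l.
have q3 : a * w <= p * w by rewrite ler_wpM2r.
have q4 : cd' * (a * w) <= cd' * (p * w) by rewrite ler_wpM2l.
rewrite -subr_ge0.
have -> : p * (cl' * (cG k + 2 + 2 * cz') + cd') * (1 + w) -
   (cl' * (cG k * a + 2 * (p * (1 + cz' * w))) + cd' * (a * w)) =
   (cl' * (cG k * p) - cl' * (cG k * a)) + (cd' * (p * w) - cd' * (a * w)) +
   cl' * (p * (w * cG k + 2 * w + 2 * cz')) + cd' * p by ring.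
rewrite -subr_ge0 in q2; rewrite -subr_ge0 in q4.
by repeat first [assumption | exact: ler0n | apply: addr_ge0 | apply: mulr_ge0].
Qed.

Lemma remainder_derive_le t j y v :
  `|'D_v (fun y => remainder (upd_tuple t j y)) y| <= Qt (upd_tuple t j y) * enorm v.
Proof.
have := remainder_derive_le0 (upd_tuple t j y) j v; rewrite tnth_updT eqxx.
by under eq_fun do rewrite upd_tuple_updT.
Qed.

(** Only the existence of some [q] matters: it makes the remainder a legitimate test function for
    [poincare_admissible], while the sharp gradient bound is [remainder_derive_le]. *)
Lemma remainder_lip t j : exists2 q : R, 0 <= q & forall y y', `|remainder (upd_tuple t j y) - remainder (upd_tuple t j y')| <= q * enorm (y - y').
Proof.
exists (K * cF k * (ni * cl') + ni * (M * enorm newton_dir)).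
  have h1 := cF_ge0 k; have h2 : 0 <= cl' := cl_ge0 k.+1; have h3 := ltW ni0; have h4 := enorm_ge0 newton_dir.
  have h5 := ltW M0.
  by repeat first [assumption | apply: addr_ge0 | apply: mulr_ge0].
move=> y y'; have gen (b1 b2 b3 b4 : R) : (b1 - b2) - (b3 - b4) = (b1 - b3) - (b2 - b4) by ring.
rewrite /remainder gen (le_trans (ler_normB _ _))// mulrDl; apply: lerD.
  apply: (@le_trans _ _ (K * cF k * (ni * cl' * enorm (y - y')))); last by rewrite !mulrA.
  apply: le_trans (debiased_lip hf _ _) _; apply: ler_wpM2l; first by apply: mulr_ge0 => //; exact: cF_ge0.
  rewrite (_ : theta + _ - _ = Z (upd_tuple t j y) - Z (upd_tuple t j y')); last by rewrite opprD addrACA subrr add0r.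
  have := newton_iter_lip k.+1 (upd_tuple t j y') j y; rewrite upd_tuple_updT tnth_updT eqxx; exact.
rewrite /linear_term !(avg_updT (fun x => dV x newton_dir)) addrAC opprD addrA subrr add0r addrC -mulrBr.
rewrite normrM gtr0_norm// -mulrA ler_wpM2l ?(ltW ni0)//.
by rewrite (le_trans (dV_lip _ _ _))// mulrAC.
Qed.

Lemma measurable_remainder : measurable_fun setT remainder.
Proof.
apply: measurable_funB.
  by apply: itg_meas; exact: (debiased_itg hf).
apply: measurable_funM => //; apply: measurable_sum => i.
by apply: (measurableT_comp (measurable_dV _)); exact: measurable_tnth.
Qed.

Lemma itg_linear_term : itg PP linear_term.
Proof.
apply: itgZ; apply: itg_sum => i _.
by have [] := @Ex_tnth _ _ _ P n i _ (tame_itg (tame_dV newton_dir)).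
Qed.

Lemma Ex_linear_term : Ex PP linear_term = 0.
Proof.
have iV : itg P (fun x => dV x newton_dir) by exact/tame_itg/tame_dV.
have iT i := (@Ex_tnth _ _ _ P n i _ iV).1.
rewrite ExZ; last by apply: itg_sum => i _; exact: iT.
rewrite Ex_sum; last by move=> i _; exact: iT.
by rewrite big1 ?mulr0// => i _; rewrite (Ex_tnth i iV).2 Ex_dV.
Qed.

Lemma itg_remainder : itg PP remainder.
Proof. by apply: itgB; [exact: (debiased_itg hf)|exact: itg_linear_term]. Qed.

Lemma Ex_remainder : Ex PP remainder = Ex PP (fun t => debiased k f (theta + Z t)).
Proof. by rewrite ExB ?Ex_linear_term ?subr0//; [exact: (debiased_itg hf)|exact: itg_linear_term]. Qed.

Definition c6 : R := c5 ^+ 2 * (2 * (1 + cW)) * expR 1 ^+ 2.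
Definition b2 : R := (K * ni * a `^ rho) ^+ 2 * c6.

Lemma c6_ge0 : 0 <= c6.
Proof.
have h1 := cW_ge0; apply: mulr_ge0; last exact: sqr_ge0.
apply: mulr_ge0; first exact: sqr_ge0.
by apply: mulr_ge0 => //; apply: addr_ge0.
Qed.

Lemma measurable_Qt : measurable_fun setT Qt.
Proof.
apply: measurable_funM => //; apply: measurable_funD => //; apply: measurable_funM => //.
exact: measurable_W.
Qed.

(** [Qt^2 <= b0 (1 + excess)], so the [j]-th moment of [Qt^2] is at most [b0^j j! e^2]; then
    [j! <= j^j <= (2j)^j] and [e^2 <= (e^2)^j]. *)
Lemma Qt_moment i : (0 < i)%N ->
  (\int[PP]_t (Qt t ^+ (2 ^ i))%:E <= (b2 ^+ (2 ^ i.-1) * (2 ^ i)%:R ^+ (2 ^ i.-1))%:E)%E.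
Proof.
case: i => // i _ /=; set j := (2 ^ i)%N.
have j1 : (0 < j)%N by rewrite expn_gt0.
have jE : (2 ^ i.+1 = 2 * j)%N by rewrite expnS.
pose b0 := (K * ni * a `^ rho * c5) ^+ 2 * (2 * (1 + cW)).
have b00 : 0 <= b0.
  apply: mulr_ge0; first exact: sqr_ge0.
  by apply: mulr_ge0 => //; apply: addr_ge0 => //; exact: cW_ge0.
have hQ t : Qt t ^+ 2 <= b0 * (1 + excess t).
  have -> : b0 * (1 + excess t) = (K * ni * a `^ rho * c5) ^+ 2 * (2 * (1 + cW) * (1 + excess t)).
    by rewrite /b0 -mulrA.
  rewrite [Qt t ^+ 2]exprMn; apply: ler_wpM2l; first exact: sqr_ge0.
  have hw : (fluct t / a) ^+ 2 <= cW * (1 + excess t).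
    rewrite exprMn exprVn ler_pdivrMr ?exprn_gt0//.
    by rewrite mulrAC; exact: W_sqr_le1.
  have := excess_ge0 t; have := cW_ge0; have := sqr_ge0 (1 - fluct t / a).
  move: hw; move: (fluct t / a) (excess t) (cW) => w T c hw hs c0 T0.
  have cT : 0 <= c * T by rewrite mulr_ge0.
  by nra.
have [i1 h1] := T1_moment j.
have mT1 : measurable_fun setT (fun t => (1 + excess t) ^+ j) by exact: itg_meas i1.
have T10 t : 0 <= 1 + excess t by rewrite addr_ge0 ?excess_ge0.
apply: (@le_trans _ _ (\int[PP]_t (b0 ^+ j * (1 + excess t) ^+ j)%:E)%E).
  apply: le_EE => t; rewrite lee_fin; first by apply: exprn_ge0; exact: Qt_ge0.
  have -> : Qt t ^+ (2 ^ i.+1) = (Qt t ^+ 2) ^+ j by rewrite jE exprM.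
  have -> : b0 ^+ j * (1 + excess t) ^+ j = (b0 * (1 + excess t)) ^+ j by exact/esym/exprMn.
  apply: lerXn2r; rewrite ?nnegrE ?sqr_ge0//; apply: mulr_ge0 => //.
rewrite ExE; last exact: itgZ.
rewrite ExZ// lee_fin (@le_trans _ _ (b0 ^+ j * (j`!%:R * expR 1 ^+ 2)))//.
  by rewrite ler_wpM2l// exprn_ge0.
have -> : b2 = b0 * expR 1 ^+ 2 by rewrite /b2 /c6 /b0; ring.
rewrite [(b0 * _) ^+ j]exprMn -mulrA; apply: ler_wpM2l; first exact: exprn_ge0.
rewrite mulrC; apply: ler_pM; [exact: sqr_ge0|exact: ler0n| |].
  rewrite -{1}[expR 1 ^+ 2]expr1 ler_eXn2l //.
  by apply: exprn_egt1 => //; rewrite -expR0 ltr_expR.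
rewrite jE -natrX ler_nat (leq_trans (_ : _ <= j ^ j)%N)//; last by rewrite leq_exp2r// leq_pmull.
rewrite -ffactnn ffact_prod (@leq_trans (\prod_(q < j) j))//.
  by apply: leq_prod => q _; exact: leq_subr.
by rewrite prod_nat_const card_ord.
Qed.

Lemma remainder_moment (C : R) i : poincare_admissible C -> (0 < i)%N ->
  (\int[PP]_t ((remainder t - Ex PP remainder) ^+ (2 ^ i))%:E <=
   ((n%:R * C * b2) ^+ (2 ^ i.-1) * (2 ^ i)%:R ^+ (3 * 2 ^ i.-1))%:E)%E.
Proof.
move=> [C0 hC] i0; have b20 : 0 <= b2 by apply: mulr_ge0; [exact: sqr_ge0|exact: c6_ge0].
apply: (@poincare_moment _ _ _ P n C b2 remainder Qt C0 b20 measurable_remainder measurable_Qt Qt_ge0 itg_remainder _ Qt_moment i i0).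
move=> phi phi' dphi cphi' [B1 hB1] [B2 hB2] t j.
pose G y := remainder (upd_tuple t j y); pose g y := phi (G y).
have mG : measurable_fun setT G by apply: (measurableT_comp measurable_remainder); exact: measurable_upd_tuple.
have dphid (x : R) : differentiable phi x by apply/derivable1_diffP; exact: (@ex_derive _ _ _ _ _ _ _ (dphi x)).
have cphi : continuous phi by move=> x; exact/differentiable_continuous/dphid.
have mphi : measurable_fun setT phi by exact: continuous_measurable_fun.
have mphi' : measurable_fun setT phi' by exact: continuous_measurable_fun.
have tg : tame P g by apply: tame_bounded (measurableT_comp mphi mG) (fun y => hB1 (G y)).
have dg y : differentiable g y by apply: (differentiable_comp (remainder_differentiable t j y)).
have gD y v : 'D_v g y = 'D_v G y * phi' (G y).
  exact: (derive_comp1 _ (remainder_differentiable t j y) (dphi (G y))).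
have lipg : [locally [lipschitz g x | x in setT]].
  have [q q0 hq] := remainder_lip t j.
  apply: (enorm_lipschitz_locally (K := B2 * q)) => y y'.
  have B20 : 0 <= B2 by exact: le_trans (hB2 0).
  have lphi (x1 x2 : R) : `|phi x1 - phi x2| <= B2 * `|x1 - x2|.
    exact: (mvt_lipschitz dphi hB2).
  apply: le_trans (lphi _ _) _; rewrite -mulrA; apply: ler_wpM2l => //; exact: hq.
have := hC g lipg; rewrite (variance_tame tg) => h; apply: (le_trans h).
have mD : measurable_fun setT (fun y => phi' (G y) ^+ 2 * Qt (upd_tuple t j y) ^+ 2).
  apply: measurable_funM; apply: measurable_funX; first exact: measurableT_comp.
  by apply: (measurableT_comp measurable_Qt); exact: measurable_upd_tuple.
rewrite [leRHS]EE_Zl//; last by move=> y; rewrite mulr_ge0 ?sqr_ge0.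
apply: lee_wpmul2l; first by rewrite lee_fin.
apply: le_EE => y; rewrite lee_fin ?sqr_ge0// -exprMn.
rewrite -[leRHS]real_normK ?num_real//; apply: lerXn2r; rewrite ?nnegrE ?enorm_ge0//.
apply: enorm_dual => // v; rewrite -derive_dot//.
rewrite gD; apply: le_trans (ler_norm _) _; rewrite [X in X <= _]normrM [leLHS]mulrC.
have -> : `|phi' (remainder (upd_tuple t j y)) * Qt (upd_tuple t j y)| = `|phi' (G y)| * Qt (upd_tuple t j y).
  by rewrite normrM; congr (_ * _); apply: ger0_norm; exact: Qt_ge0.
by rewrite -[leRHS]mulrA; apply: ler_pM; rewrite ?normr_ge0//; exact: remainder_derive_le.
Qed.

End fluctuation.

(** * Normal approximation of the linear term *)

Section interpolation.
Variables (u0 : 'rV[R]_d) (s : R).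
Hypothesis s0 : 0 < s.
Hypothesis s2E : s ^+ 2 = Ex P (fun x => hess x u0 u0).
Local Notation gam := (@normal_prob R 0 1).
Local Notation PG := (PP \x gam)%E.
Let rn : R := (Num.sqrt n%:R)^-1.
Let rn0 : 0 < rn. Proof. by rewrite invr_gt0 sqrtr_gt0 ltr0n. Qed.
Let rn2 : rn ^+ 2 = ni. Proof. by rewrite /rn exprVn sqr_sqrtr. Qed.

Definition std_score t : R := rn * \sum_i dV (tnth t i) u0.
(** The average [tau] of the overview: to first order, the rate at which [std_score] changes when
    the whole sample is translated along [n^(-1/2) u0]. *)
Definition mean_hess t : R := ni * \sum_i hess (tnth t i) u0 u0.

Let M1 : R := M * enorm u0 ^+ 2.
Let M10 : 0 <= M1. Proof. by rewrite mulr_ge0 ?exprn_ge0 ?enorm_ge0// ltW. Qed.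

Lemma mean_hess_le t : `|mean_hess t| <= M1.
Proof.
rewrite /mean_hess normrM gtr0_norm// -(ler_pM2l (x := n%:R)) ?ltr0n// mulrA [n%:R * ni]mulrC nK mul1r.
rewrite (le_trans (ler_norm_sum _ _ _))//; apply: (@le_trans _ _ (\sum_(i < n) M1)); first apply: ler_sum => i _.
  by rewrite (le_trans (hess_le _ _ _))// -mulrA -expr2.
by rewrite sumr_const card_ord mulr_natl.
Qed.

Lemma measurable_std_score : measurable_fun setT std_score.
Proof.
apply: measurable_funM => //; apply: measurable_sum => i.
by apply: (measurableT_comp (measurable_dV u0)); exact: measurable_tnth.
Qed.

Lemma measurable_mean_hess : measurable_fun setT mean_hess.
Proof.
apply: measurable_funM => //; apply: measurable_sum => i.
by apply: (measurableT_comp (measurable_hess u0 u0)); exact: measurable_tnth.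
Qed.

Lemma itg_mean_hess : itg PP mean_hess.
Proof. exact: (itg_bounded PP measurable_mean_hess mean_hess_le). Qed.

Lemma Ex_mean_hess : Ex PP mean_hess = s ^+ 2.
Proof.
have iV : itg P (fun x => hess x u0 u0) by exact/tame_itg/tame_hess.
have iT i := (@Ex_tnth _ _ _ P n i _ iV).1.
rewrite ExZ; last by apply: itg_sum => i _; exact: iT.
rewrite Ex_sum; last by move=> i _; exact: iT.
rewrite (eq_bigr (fun=> s ^+ 2)) => [|i _]; last by rewrite (Ex_tnth i iV).2 s2E.
by rewrite sumr_const card_ord -[s ^+ 2 *+ n]mulr_natl mulrA nK mul1r.
Qed.

Lemma std_score_exp (l : R) : (\int[PP]_t (expR (l * std_score t))%:E < +oo)%E.
Proof.
have h := iid_mgf_le (P := P) n (measurable_dV ((l * rn) *: u0)) (expR_ge0 _) (dV_mgf _).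
apply: le_lt_trans (le_trans _ h) (ltry _); rewrite le_eqVlt; apply/orP; left; apply/eqP.
apply: eq_integral => t _; rewrite /std_score mulrA mulr_sumr; congr (expR _)%:E.
by apply: eq_bigr => i _; rewrite dVZ.
Qed.

Lemma tame_X0 : tame PG (fun q => std_score q.1).
Proof.
have m1 : measurable_fun setT (fun q : n.-tuple 'rV[R]_d * R => std_score q.1).
  exact: (measurableT_comp measurable_std_score).
have [] // := @tame_exp _ _ _ PG _ m1 => l.
rewrite (EE_fst PP gam (f := fun t => (expR (l * `|std_score t|))%:E)) => [||t].
- exact: (EE_exp_norm measurable_std_score std_score_exp).
- apply/measurable_EFinP; apply: measurable_expR_comp; apply: measurable_funM => //.
  exact: (measurableT_comp _ measurable_std_score).
- by rewrite lee_fin expR_ge0.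
Qed.

Lemma gauss_exp_norm (l : R) : (\int[PG]_q (expR (l * `|q.2|))%:E < +oo)%E.
Proof.
rewrite (EE_snd PP gam (f := fun r => (expR (l * `|r|))%:E)) => [||t].
- apply: (@EE_exp_norm _ _ _ gam (fun r : R => r)) => // l'; rewrite integral_gauss_exp; exact: ltry.
- by apply/measurable_EFinP; apply: measurable_expR_comp; apply: measurable_funM => //; exact: normr_measurable.
- by rewrite lee_fin expR_ge0.
Qed.

Lemma tame_Z : tame PG (fun q => q.2).
Proof. by have [] := @tame_exp _ _ _ PG _ measurable_snd gauss_exp_norm. Qed.

Section identity.
Variables (b : R) (phi : R -> R).
Hypothesis mphi : measurable_fun setT phi.
Hypothesis bphi : exists B : R, forall y : R, `|phi y| <= B.
Let Xb (q : n.-tuple 'rV[R]_d * R) : R := cos b * std_score q.1 + sin b * (s * q.2).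
Let g q := phi (Xb q).
(** The factor [sin b] makes up for the one in the denominator of [kap]: the matching Gaussian shift
    stays proportional to the step as [sin b] tends to 0. *)
Let w0 : 'rV[R]_d := (sin b * rn) *: u0.

Let mXb : measurable_fun setT Xb.
Proof.
apply: measurable_funD; last by do 2 apply: measurable_funM => //.
by apply: measurable_funM => //; exact: (measurableT_comp measurable_std_score).
Qed.

Let mg : measurable_fun setT g. Proof. exact: measurableT_comp. Qed.

Let tg : tame PG g.
Proof. by case: bphi => B hB; exact: (tame_bounded PG mg (fun q => hB (Xb q))). Qed.

(** The solution of [shift_eq]. If [sin b = 0] any value solves it, and the one taken makes
    [kap_lin] exact. *)
Let kap (j : nat) t : R :=
  if sin b == 0 then j.+1%:R^-1 * (cos b * mean_hess t / s)
  else cos b * (std_score (shiftT (j.+1%:R^-1 *: w0) t) - std_score t) / (sin b * s).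

Let mkap j : measurable_fun setT (kap j).
Proof.
case: (boolP (sin b == 0)) => sb.
  rewrite (_ : kap j = fun t => j.+1%:R^-1 * (cos b * mean_hess t / s)); last by apply/funext => t; rewrite /kap sb.
  by do 3 apply: measurable_funM => //; exact: measurable_mean_hess.
rewrite (_ : kap j = fun t => cos b * (std_score (shiftT (j.+1%:R^-1 *: w0) t) - std_score t) / (sin b * s)); last first.
  by apply/funext => t; rewrite /kap (negPf sb).
do 2 apply: measurable_funM => //; apply: measurable_funB; last exact: measurable_std_score.
by apply: (measurableT_comp measurable_std_score); exact: measurable_shiftT.
Qed.

Let shift_eq j t (r : R) : Xb (shiftT (j.+1%:R^-1 *: w0) t, r) = Xb (t, r + kap j t).
Proof.
rewrite /Xb /kap /=; have [sb|sb] := eqVneq (sin b) 0.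
  have -> : shiftT (j.+1%:R^-1 *: w0) t = t; last by rewrite sb !mul0r.
  apply: eq_from_tnth => i; rewrite tnth_mktuple /w0 sb mul0r scale0r scaler0 addr0//.
set X2 := std_score _; set X1 := std_score t; move: (cos b) (sin b) sb => c1 c2 sb.
by field; rewrite sb gt_eqF.
Qed.

Let E1 : R := rn * L * enorm u0 ^+ 3 / s.
Let E10 : 0 <= E1.
Proof. by rewrite divr_ge0 ?mulr_ge0 ?exprn_ge0 ?enorm_ge0// ltW. Qed.

Let kap_lin j t : `|kap j t - j.+1%:R^-1 * (cos b * mean_hess t / s)| <= j.+1%:R^-1 ^+ 2 * E1.
Proof.
set h := j.+1%:R^-1; have h0 : 0 <= h by rewrite invr_ge0.
rewrite /kap; have [sb|sb] := eqVneq (sin b) 0.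
  by rewrite subrr normr0 mulr_ge0// exprn_ge0.
set v := h *: w0.
have hv : enorm v = h * (`|sin b| * rn * enorm u0).
  by rewrite /v /w0 !enormZ (ger0_norm h0) normrM (gtr0_norm rn0).
have lin i : `|dV (tnth t i + v) u0 - dV (tnth t i) u0 - h * (sin b * rn) * hess (tnth t i) u0 u0|
    <= L * enorm v ^+ 2 * enorm u0.
  have := @dV_taylor (tnth t i) (tnth t i) v u0 (enorm v); rewrite subrr enorm0 add0r lexx => /(_ isT).
  have -> : hess (tnth t i) v u0 = h * (sin b * rn) * hess (tnth t i) u0 u0 by rewrite /v /w0 scalerA hessZl.
  by move=> h'; apply: le_trans h' _; rewrite [enorm v ^+ 2]expr2 mulrA.
have XE : std_score (shiftT v t) - std_score t - h * sin b * mean_hess t =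
    rn * \sum_i (dV (tnth t i + v) u0 - dV (tnth t i) u0 - h * (sin b * rn) * hess (tnth t i) u0 u0).
  rewrite sumrB -mulr_sumr sumrB /std_score /mean_hess -rn2.
  under eq_bigr do rewrite tnth_mktuple.
  by ring.
have -> : cos b * (std_score (shiftT v t) - std_score t) / (sin b * s) - h * (cos b * mean_hess t / s) =
   cos b / (sin b * s) * (std_score (shiftT v t) - std_score t - h * sin b * mean_hess t).
  move: (std_score (shiftT v t)) (std_score t) (cos b) (sin b) sb => x1 x2 c1 c2 sb.
  by field; rewrite sb gt_eqF.
rewrite XE normrM [X in _ * X <= _]normrM (gtr0_norm rn0).
apply: (@le_trans _ _ ((`|sin b| * s)^-1 * (rn * (n%:R * (L * enorm v ^+ 2 * enorm u0))))).
  apply: ler_pM; rewrite ?normr_ge0// ?mulr_ge0 ?(ltW rn0)//.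
    rewrite normrM normfV normrM (gtr0_norm s0) -[leRHS]mul1r; apply: ler_wpM2r; last exact: cos_max.
    by rewrite invr_ge0 mulr_ge0// ltW.
  rewrite ler_wpM2l ?(ltW rn0)// (le_trans (ler_norm_sum _ _ _))//.
  apply: (@le_trans _ _ (\sum_(i < n) (L * enorm v ^+ 2 * enorm u0))); first by apply: ler_sum => i _; exact: lin.
  by rewrite sumr_const card_ord mulr_natl.
have sb0 : 0 < `|sin b| by rewrite normr_gt0.
have nrn : n%:R * rn ^+ 2 = 1 by rewrite rn2 mulrC nK.
have -> : (`|sin b| * s)^-1 * (rn * (n%:R * (L * enorm v ^+ 2 * enorm u0))) =
    (n%:R * rn ^+ 2) * (`|sin b| * (h ^+ 2 * E1)).
  rewrite hv /E1; move: (`|sin b|) sb0 => c1 c10.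
  by field; rewrite !gt_eqF.
by rewrite nrn mul1r; apply: ler_piMl; [rewrite mulr_ge0// exprn_ge0|exact: sin_max].
Qed.

Let B1 (q : n.-tuple 'rV[R]_d * R) : R := sin b * std_score q.1.
Let B2 (q : n.-tuple 'rV[R]_d * R) : R := q.2 * (cos b * mean_hess q.1 / s).
Let c3 : R := M1 / s.
Let E2 (q : n.-tuple 'rV[R]_d * R) : R := E1 * `|q.2| + (c3 + E1) ^+ 2.
Let U1 (j : nat) (q : n.-tuple 'rV[R]_d * R) : R :=
  \sum_i (V (tnth q.1 i) - V (tnth q.1 i - j.+1%:R^-1 *: w0)).
Let U2 (j : nat) (q : n.-tuple 'rV[R]_d * R) : R := kap j q.1 * q.2 - kap j q.1 ^+ 2 / 2.

Let c30 : 0 <= c3. Proof. by rewrite divr_ge0// ltW. Qed.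

Let btau t : `|cos b * mean_hess t / s| <= c3.
Proof.
have -> : `|cos b * mean_hess t / s| = `|cos b| * `|mean_hess t| / s.
  by rewrite normrM normfV (gtr0_norm s0) [X in X / _]normrM.
apply: ler_wpM2r; first by rewrite invr_ge0 ltW.
by rewrite -[leRHS]mul1r; apply: ler_pM; rewrite ?normr_ge0//; [exact: cos_max|exact: mean_hess_le].
Qed.

Let mU1 j : measurable_fun setT (U1 j).
Proof.
apply: measurable_sum => i.
have mt : measurable_fun setT (fun q : n.-tuple 'rV[R]_d * R => tnth q.1 i).
  by apply: (measurableT_comp (f := fun t : n.-tuple 'rV[R]_d => tnth t i) _ measurable_fst); exact: measurable_tnth.
apply: measurable_funB; first exact: (measurableT_comp measurable_V mt).
apply: (measurableT_comp measurable_V).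
exact: (measurableT_comp (measurable_addrV _) mt).
Qed.

Let mU2 j : measurable_fun setT (U2 j).
Proof.
have mk : measurable_fun setT (fun q : n.-tuple 'rV[R]_d * R => kap j q.1).
  exact: (measurableT_comp (mkap j) measurable_fst).
apply: measurable_funB; first exact: measurable_funM.
by apply: measurable_funM => //; exact: measurable_funX.
Qed.

Let mB1 : measurable_fun setT B1.
Proof. by apply: measurable_funM => //; exact: (measurableT_comp measurable_std_score measurable_fst). Qed.

Let mB2 : measurable_fun setT B2.
Proof.
apply: measurable_funM => //; apply: measurable_funM => //; apply: measurable_funM => //.
exact: (measurableT_comp measurable_mean_hess measurable_fst).
Qed.

Let eB1 (l : R) : (\int[PG]_q (expR (l * `|B1 q|))%:E < +oo)%E.
Proof.
apply: (@le_lt_trans _ _ (\int[PG]_q (expR (`|l| * `|std_score q.1|))%:E)%E).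
  apply: le_EE => q; rewrite lee_fin ?expR_ge0// ler_expR (le_trans (ler_norm _))//.
  by rewrite normrM normr_id ler_wpM2l// /B1 normrM ler_piMl// sin_max.
rewrite (EE_fst PP gam (f := fun t => (expR (`|l| * `|std_score t|))%:E)) => [||t].
- exact: (EE_exp_norm measurable_std_score std_score_exp).
- apply/measurable_EFinP; apply: measurable_expR_comp; apply: measurable_funM => //.
  exact: (measurableT_comp _ measurable_std_score).
- by rewrite lee_fin expR_ge0.
Qed.

Let eB2 (l : R) : (\int[PG]_q (expR (l * `|B2 q|))%:E < +oo)%E.
Proof.
apply: le_lt_trans (gauss_exp_norm (`|l| * c3)).
apply: le_EE => q; rewrite lee_fin ?expR_ge0// ler_expR (le_trans (ler_norm _))//.
rewrite normrM normr_id -mulrA ler_wpM2l// /B2 normrM mulrC ler_wpM2r//.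
Qed.

Let mE2 : measurable_fun setT E2.
Proof. by apply: measurable_funD => //; apply: measurable_funM => //; exact: measurableT_comp. Qed.

Let E20 q : 0 <= E2 q. Proof. by rewrite addr_ge0 ?sqr_ge0// mulr_ge0. Qed.

Let eE2 (l : R) : (\int[PG]_q (expR (l * `|E2 q|))%:E < +oo)%E.
Proof.
have mz : measurable_fun setT (fun q : n.-tuple 'rV[R]_d * R => expR ((l * E1) * `|q.2|)).
  by apply: measurable_expR_comp; apply: measurable_funM => //; exact: measurableT_comp.
under eq_integral => q _ do rewrite ger0_norm// /E2 mulrDr mulrA addrC expRD.
rewrite EE_Zl ?expR_ge0//.
by apply: lte_mul_pinfty; rewrite ?lee_fin ?expR_ge0//; exact: gauss_exp_norm.
Qed.

Let lin1 j q : `|U1 j q - j.+1%:R^-1 * B1 q| <= j.+1%:R^-1 ^+ 2 * `|n%:R * (M * enorm w0 ^+ 2)|.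
Proof.
have -> : U1 j q - j.+1%:R^-1 * B1 q =
    \sum_i (V (tnth q.1 i) - V (tnth q.1 i - j.+1%:R^-1 *: w0) - j.+1%:R^-1 * dV (tnth q.1 i) w0).
  rewrite sumrB -mulr_sumr /U1; congr (_ - _ * _).
  by rewrite /B1 /std_score mulrA mulr_sumr; apply: eq_bigr => i _; rewrite dVZ.
have M20 : 0 <= M * enorm w0 ^+ 2 by rewrite mulr_ge0 ?exprn_ge0 ?enorm_ge0// ltW.
rewrite (ger0_norm (mulr_ge0 (ler0n _ _) M20)).
rewrite (le_trans (ler_norm_sum _ _ _))//.
apply: (@le_trans _ _ (\sum_(i < n) (j.+1%:R^-1 ^+ 2 * (M * enorm w0 ^+ 2)))); first apply: ler_sum => i _.
  have := V_taylor (tnth q.1 i) (- (j.+1%:R^-1 *: w0)).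
  rewrite enormN enormZ dVN dVZ exprMn real_normK ?num_real// mulrCA -[`|_ - _ - _|]normrN.
  by have -> : - (V (tnth q.1 i - j.+1%:R^-1 *: w0) - V (tnth q.1 i) - - (j.+1%:R^-1 * dV (tnth q.1 i) w0)) =
    V (tnth q.1 i) - V (tnth q.1 i - j.+1%:R^-1 *: w0) - j.+1%:R^-1 * dV (tnth q.1 i) w0 by ring.
by rewrite sumr_const card_ord -[_ *+ n]mulr_natl mulrCA.
Qed.

Let lin2 j q : `|U2 j q - j.+1%:R^-1 * B2 q| <= j.+1%:R^-1 ^+ 2 * `|E2 q|.
Proof.
have := kap_lin j q.1; have hb := btau q.1; rewrite (ger0_norm (E20 q)) /U2 /B2 /E2.
have h1 : (j.+1%:R : R)^-1 <= 1 by rewrite invf_le1 ?ltr0n// ler1n.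
have h0 : 0 <= (j.+1%:R : R)^-1 by rewrite invr_ge0.
move: (kap j q.1) (cos b * mean_hess q.1 / s) hb (j.+1%:R^-1) h0 h1 => k1 p hp h h0 h1 hk.
have hk2 : `|k1| <= h * (c3 + E1).
  have := ler_normD (k1 - h * p) (h * p); rewrite subrK normrM (ger0_norm h0) => hh.
  have q1 : h * `|p| <= h * c3 by rewrite ler_wpM2l.
  have q2 : h ^+ 2 * E1 <= h * E1 by rewrite ler_wpM2r// expr2 ler_piMl.
  by rewrite mulrDr; lra.
have k2 : k1 ^+ 2 <= h ^+ 2 * (c3 + E1) ^+ 2.
  by rewrite -exprMn -(real_normK (num_real k1)) lerXn2r ?nnegrE// mulr_ge0// addr_ge0.
have -> : k1 * q.2 - k1 ^+ 2 / 2 - h * (q.2 * p) = (k1 - h * p) * q.2 - k1 ^+ 2 / 2 by ring.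
rewrite (le_trans (ler_normB _ _))// normrM mulrDr mulrA; apply: lerD; first by rewrite ler_wpM2r.
by rewrite ger0_norm ?divr_ge0 ?sqr_ge0//; have := sqr_ge0 k1; lra.
Qed.

Let same j : Ex PG (fun q => g q * expR (U1 j q)) = Ex PG (fun q => g q * expR (U2 j q)).
Proof.
set v := j.+1%:R^-1 *: w0.
have h1 : Ex PG (fun q => g (shiftT v q.1, q.2)) = Ex PG (fun q => g q * expR (U1 j q)).
  apply: (@Ex_transport _ _ _ PG (fun q : n.-tuple 'rV[R]_d * R => (shiftT v q.1, q.2)) (U1 j) g) => // h mh h0.
  apply: (@transport_fst _ _ _ _ _ PP gam (shiftT v) (fun t => \sum_i (V (tnth t i) - V (tnth t i - v)))) => //.
  - exact: measurable_shiftT.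
  - apply: measurable_sum => i; apply: measurable_funB.
      by apply: (measurableT_comp measurable_V); exact: measurable_tnth.
    apply: (measurableT_comp measurable_V); apply: (measurableT_comp (measurable_addrV _)).
    exact: measurable_tnth.
  - by move=> h' mh' h0'; exact: (piid_shift measurable_V hP).
have mk : measurable_fun setT (fun q : n.-tuple 'rV[R]_d * R => kap j q.1).
  exact: (measurableT_comp (mkap j) measurable_fst).
have h2 : Ex PG (fun q => g (q.1, q.2 + kap j q.1)) = Ex PG (fun q => g q * expR (U2 j q)).
  apply: (@Ex_transport _ _ _ PG (fun q : n.-tuple 'rV[R]_d * R => (q.1, q.2 + kap j q.1)) (U2 j) g) => // h mh h0.
  apply: (@transport_snd _ _ _ _ _ PP gam (fun t (r : R) => r + kap j t) (fun t (r : R) => kap j t * r - kap j t ^+ 2 / 2)) => //.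
  - exact: measurable_funD.
  - exact: mU2.
  - by move=> t h' mh' h0'; exact: integral_gauss_shift.
rewrite -h1 -h2; by apply: eq_Ex => -[t r] /=; rewrite /g; congr (phi _); exact: shift_eq.
Qed.

(* Translating the sample by [h w0] has the same effect on [Xb] as translating the Gaussian variable by [kap],
   where [kap] is arbitrary if [sin b = 0]; the first order terms in [h] of the two changes of variables agree. *)
Lemma interpolation_identity :
  Ex PG (fun q => (- sin b * std_score q.1 + cos b * (s * q.2)) * phi (Xb q)) =
  Ex PG (fun q => cos b * (q.2 * (s - mean_hess q.1 / s)) * phi (Xb q)).
Proof.
have eK (l : R) : (\int[PG]_q (expR (l * `|n%:R * (M * enorm w0 ^+ 2)|))%:E < +oo)%E by rewrite EE_cst ltry.
have c1 := @Ex_expB_cvg _ _ _ PG U1 B1 (fun=> n%:R * (M * enorm w0 ^+ 2)) g mU1 mB1 eB1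
   (measurable_cst _) eK lin1 tg.
have c2 := @Ex_expB_cvg _ _ _ PG U2 B2 E2 g mU2 mB2 eB2 mE2 eE2 lin2 tg.
have e12 : Ex PG (fun q => g q * B1 q) = Ex PG (fun q => g q * B2 q).
  rewrite (_ : (fun j : nat => _) = (fun j => j.+1%:R * (Ex PG (fun q => g q * expR (U2 j q)) - Ex PG g))) in c1.
    exact: (cvg_unique _ c1 c2).
  by apply/funext => j; rewrite same.
have tX : tame PG (fun q => g q * B1 q) by apply: tameM => //; apply: tameZ; exact: tame_X0.
have tZg : tame PG (fun q => g q * q.2) by apply: tameM => //; exact: tame_Z.
have tB2 : tame PG (fun q => g q * B2 q).
  apply: tameM => //; apply: tameM; first exact: tame_Z.
  apply: (tame_bounded PG _ (fun q => btau q.1)).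
  do 2 apply: measurable_funM => //; exact: (measurableT_comp measurable_mean_hess measurable_fst).
(* The sample part of the derivative is [- B1]; trading it for [- B2] turns [s * Z] into
   [Z * (s - mean_hess / s)], up to the factor [cos b]. *)
transitivity (cos b * s * Ex PG (fun q => g q * q.2) - Ex PG (fun q => g q * B1 q)).
  rewrite -ExZ; last exact: tame_itg.
  rewrite -ExB; [|by apply: itgZ; exact: tame_itg|exact: tame_itg].
  by apply: eq_Ex => q; rewrite /g /B1; ring.
rewrite e12 -ExZ; last exact: tame_itg.
rewrite -ExB; [|by apply: itgZ; exact: tame_itg|exact: tame_itg].
by apply: eq_Ex => q; rewrite /g /B2; ring.
Qed.

End identity.

Lemma s2_le_M1 : s ^+ 2 <= M1.
Proof. by rewrite -Ex_mean_hess; apply: le_trans (ler_norm _) _; apply: Ex_norm_le_cst measurable_mean_hess mean_hess_le. Qed.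

Let M1p : 0 < M1. Proof. by rewrite (lt_le_trans _ s2_le_M1)// exprn_gt0. Qed.

Lemma mean_hess_diff t i (v1 v2 : 'rV[R]_d) : `|mean_hess (upd_tuple t i v1) - mean_hess (upd_tuple t i v2)| <= ni * (2 * M1).
Proof.
have h (y : 'rV[R]_d) := avg_updT (fun x => hess x u0 u0) t i y.
have hb (y : 'rV[R]_d) : `|hess y u0 u0| <= M1.
  by rewrite (le_trans (hess_le _ _ _))// -mulrA -expr2.
rewrite [mean_hess (upd_tuple t i v1)]h [mean_hess (upd_tuple t i v2)]h.
have gen (r1 r2 r3 : R) : (r1 + ni * r2) - (r1 + ni * r3) = ni * (r2 - r3) by ring.
rewrite gen normrM (gtr0_norm ni0); apply: ler_wpM2l; first exact: ltW.
by rewrite (le_trans (ler_normB _ _))// mulr2n mulrDl mul1r lerD.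
Qed.

Lemma mean_hess_exp_sqr :
  (\int[PP]_t (expR (n%:R * (mean_hess t - s ^+ 2) ^+ 2 / (64 * M1 ^+ 2)))%:E <= (expR 1)%:E)%E.
Proof.
pose q1 := 4 * M1 * rn; have q10 : 0 < q1 by rewrite mulr_gt0// mulr_gt0.
have q2 : q1 ^+ 2 = 16 * M1 ^+ 2 * ni by rewrite /q1 exprMn rn2 exprMn; congr (_ * _ * _); ring.
have mY : measurable_fun setT (fun t => mean_hess t - s ^+ 2) by apply: measurable_funB => //; exact: measurable_mean_hess.
have := @subgaussian_exp_sqr1 _ _ _ PP (fun t => mean_hess t - s ^+ 2) q1 q10 mY.
under eq_integral => t _.
  rewrite q2 (_ : _ / _ = n%:R * (mean_hess t - s ^+ 2) ^+ 2 / (64 * M1 ^+ 2)); last first.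
    rewrite (_ : 4 * (16 * M1 ^+ 2 * ni) = 64 * M1 ^+ 2 * ni); last by ring.
    by rewrite invfM invrK mulrCA mulrC [_ * n%:R]mulrC mulrA.
  over.
apply => l.
have := @mcdiarmid _ _ _ P n (fun t => l * mean_hess t) (`|l| * M1) (`|l| * (ni * (2 * M1))).
rewrite ExZ; last exact: itg_mean_hess.
rewrite Ex_mean_hess; under eq_integral do rewrite -mulrBr.
move=> h; apply: le_trans (h _ _ _ _) _.
- by apply: measurable_funM => //; exact: measurable_mean_hess.
- by move=> t; rewrite normrM ler_wpM2l// mean_hess_le.
- by apply: mulr_ge0 => //; apply: mulr_ge0; [exact: ltW|exact: mulr_ge0].
- by move=> t i y y'; rewrite -mulrBr normrM ler_wpM2l// mean_hess_diff.
rewrite lee_fin ler_expR q2 !exprMn real_normK ?num_real//.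
have gen (l2 N1 N2 M2 : R) : N1 * (2 * (l2 * (N2 ^+ 2 * (2 ^+ 2 * M2)))) = (N2 * N1) * (8 * l2 * N2 * M2) by ring.
by rewrite gen nK mul1r le_eqVlt; apply/orP; left; apply/eqP; field.
Qed.

Section psi_bounds.
Variables (psi : R -> R) (c : R).
Hypothesis psi_cvx : forall x1 x2 l : R, 0 <= x1 -> 0 <= x2 -> 0 <= l <= 1 ->
  psi (l * x1 + (1 - l) * x2) <= l * psi x1 + (1 - l) * psi x2.
Hypothesis psi_mono : forall x1 x2 : R, 0 <= x1 -> x1 <= x2 -> psi x1 <= psi x2.
Hypothesis psi_0 : psi 0 = 0.
Hypothesis c0 : 0 < c.
Hypothesis psi_exp : forall r : R, 0 <= r -> psi r <= expR ((c * r) `^ (2 / 3)) - 1.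

Let Qt' (q : n.-tuple 'rV[R]_d * R) : R := q.2 * (s - mean_hess q.1 / s).
Definition yQ : R := kappa c * (16 * (M1 / s) * rn).

(** The product of a Gaussian variable and a sub-Gaussian deviation of order [n^(-1/2)] has
    exponential tails, being dominated by weighted squares whose exponential moments are known. *)
Lemma orlicz_adm_Q : orlicz_adm psi PG Qt' yQ.
Proof.
have sn : Num.sqrt n%:R ^+ 2 = n%:R :> R by rewrite sqr_sqrtr.
have sn0 : 0 < Num.sqrt n%:R :> R by rewrite sqrtr_gt0 ltr0n.
have mt : measurable_fun setT (fun t => n%:R * (mean_hess t - s ^+ 2) ^+ 2 / (64 * M1 ^+ 2)).
  apply: measurable_funM => //; apply: measurable_funM => //; apply: measurable_funX.
  by apply: measurable_funB => //; exact: measurable_mean_hess.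
have mz : measurable_fun setT (fun r : R => r ^+ 2 / 4).
  by apply: measurable_funM => //; exact: measurable_funX.
pose T1 (q : n.-tuple 'rV[R]_d * R) : R := q.2 ^+ 2 / 4.
pose T2 (q : n.-tuple 'rV[R]_d * R) : R := n%:R * (mean_hess q.1 - s ^+ 2) ^+ 2 / (64 * M1 ^+ 2).
have mT1 : measurable_fun setT T1 by exact: (measurableT_comp mz measurable_snd).
have mT2 : measurable_fun setT T2 by exact: (measurableT_comp mt measurable_fst).
have T10 q : 0 <= T1 q by rewrite divr_ge0// sqr_ge0.
have T20 q : 0 <= T2 q by apply: divr_ge0; apply: mulr_ge0; rewrite ?sqr_ge0 ?ler0n.
apply: (@orlicz_adm_mix _ psi psi_mono psi_0 _ _ PG c c0 psi_exp _ (fun q => (T1 q + T2 q) / 2) (fun=> 0)) => //.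
- by rewrite mulr_gt0// mulr_gt0// divr_gt0.
- by apply: measurable_funM => //; exact: measurable_funD.
- by move=> q; rewrite divr_ge0// addr_ge0.
- apply: (@le_trans _ _ (\int[PG]_q (2^-1 * expR (T1 q) + 2^-1 * expR (T2 q))%:E)%E).
    apply: le_EE => q; rewrite lee_fin ?expR_ge0//.
    by have := expR_mid (T1 q) (T2 q); lra.
  have me1 := measurable_expR_comp mT1; have me2 := measurable_expR_comp mT2.
  rewrite EE_D; last 4 first.
  - exact: measurable_funM.
  - exact: measurable_funM.
  - by move=> q; rewrite mulr_ge0 ?invr_ge0 ?expR_ge0.
  - by move=> q; rewrite mulr_ge0 ?invr_ge0 ?expR_ge0.
  rewrite !EE_Zl ?invr_ge0//.
  have h1 : (\int[PG]_q (expR (T1 q))%:E <= (expR 1)%:E)%E.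
    rewrite (EE_snd PP gam (f := fun r => (expR (r ^+ 2 / 4))%:E)) => [||r].
    - exact: integral_gauss_exp_sqr.
    - by apply/measurable_EFinP; exact: (measurable_expR_comp mz).
    - by rewrite lee_fin expR_ge0.
  have h2 : (\int[PG]_q (expR (T2 q))%:E <= (expR 1)%:E)%E.
    rewrite (EE_fst PP gam (f := fun t => (expR (n%:R * (mean_hess t - s ^+ 2) ^+ 2 / (64 * M1 ^+ 2)))%:E)) => [||t].
    - exact: mean_hess_exp_sqr.
    - by apply/measurable_EFinP; exact: (measurable_expR_comp mt).
    - by rewrite lee_fin expR_ge0.
  apply: (@le_trans _ _ (2^-1%:E * (expR 1)%:E + 2^-1%:E * (expR 1)%:E)%E).
    by apply: leeD; apply: lee_wpmul2l => //; rewrite lee_fin invr_ge0.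
  by rewrite -!EFinM -EFinD lee_fin; move: (expR 1) => r1; lra.
- under eq_integral do rewrite mul0r powR0 ?expR0//.
  by rewrite EE_cst lee_fin lerDr expR_ge0.
- move=> q; rewrite addr0 /Qt' /T1 /T2.
  have -> : s - mean_hess q.1 / s = - (mean_hess q.1 - s ^+ 2) / s by field; rewrite gt_eqF.
  have nE : n%:R = rn ^- 2 by rewrite rn2 /ni invrK.
  rewrite nE; move: (mean_hess q.1 - s ^+ 2) (q.2) => r1 r2.
  have r0 := rn0; rewrite !normrM normrN normfV (gtr0_norm s0).
  have -> : 16 * (M1 / s) * rn * (1 + (r2 ^+ 2 / 4 + rn ^- 2 * r1 ^+ 2 / (64 * M1 ^+ 2)) / 2) =
     (16 * M1 * rn + 2 * M1 * rn * r2 ^+ 2 + r1 ^+ 2 / (8 * M1 * rn)) / s.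
    by field; rewrite !gt_eqF.
  rewrite mulrA; apply: ler_wpM2r; first by rewrite invr_ge0 ltW.
  have p0 : 0 < M1 * rn by exact: mulr_gt0.
  rewrite -[16 * M1 * rn]mulrA -[2 * M1 * rn]mulrA -[8 * M1 * rn]mulrA.
  move: (M1 * rn) p0 => p p0.
  (* The constant 16 in [yQ] is fitted to this inequality: the weights [2 p] and [1 / (8 p)] have
     product [1/4], just what the arithmetic-geometric mean inequality needs. *)
  have h : `|r2| * `|r1| <= 2 * p * r2 ^+ 2 + r1 ^+ 2 / (8 * p).
    have p80 : 0 < 8 * p by rewrite mulr_gt0.
    rewrite -(ler_pM2r p80) [leRHS]mulrDl divfK ?gt_eqF//.
    have := sqr_ge0 (4 * p * `|r2| - `|r1|).
    by rewrite -[r1 ^+ 2]real_normK ?num_real// -[r2 ^+ 2]real_normK ?num_real//; lra.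
  by rewrite (le_trans h)// -addrA lerDr mulr_ge0// ltW.
Qed.

Let X1g (q : n.-tuple 'rV[R]_d * R) : R := s * q.2.
Let X0g (q : n.-tuple 'rV[R]_d * R) : R := std_score q.1.

Let iX0 : itg PG X0g. Proof. exact/tame_itg/tame_X0. Qed.
Let iX1 : itg PG X1g. Proof. exact/itgZ/tame_itg/tame_Z. Qed.
Let iQ : itg PG Qt'.
Proof.
apply: tame_itg; apply: tameM; first exact: tame_Z.
apply: (@tame_bounded _ _ _ PG _ (s + M1 / s)).
  apply: measurable_funB => //; apply: measurable_funM => //.
  exact: (measurableT_comp measurable_mean_hess measurable_fst).
move=> q; rewrite (le_trans (ler_normB _ _))// (gtr0_norm s0) lerD2l normrM normfV (gtr0_norm s0).
by apply: ler_wpM2r; [rewrite invr_ge0 ltW|exact: mean_hess_le].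
Qed.

Let hQ (b : R) (phi : R -> R) : measurable_fun setT phi ->
  (exists B : R, forall r : R, `|phi r| <= B) ->
  Ex PG (fun q => (- sin b * X0g q + cos b * X1g q) * phi (cos b * X0g q + sin b * X1g q)) =
  Ex PG (fun q => cos b * Qt' q * phi (cos b * X0g q + sin b * X1g q)).
Proof. by move=> mphi bphi; exact: (interpolation_identity b mphi bphi). Qed.

Let path (b0 sg y1 e : R) : `|sg| = 1 -> 0 < e ->
  orlicz_adm psi PG (fun q => cos b0 * X0g q + sin b0 * X1g q) y1 ->
  orlicz_adm psi PG (fun q => cos (b0 + sg * (pi / 2)) * X0g q + sin (b0 + sg * (pi / 2)) * X1g q) (y1 + pi * yQ + e).
Proof. exact: (rotation_path psi_cvx psi_mono psi_0 iX0 iX1 iQ hQ orlicz_adm_Q). Qed.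

Lemma orlicz_adm_fst (a1 : R) : orlicz_adm psi PG X0g a1 <-> orlicz_adm psi PP std_score a1.
Proof.
have E : 0 < a1 -> (\int[PG]_q (psi (`|X0g q| / a1))%:E = \int[PP]_t (psi (`|std_score t| / a1))%:E)%E.
  move=> a10; rewrite (EE_fst PP gam (f := fun t => (psi (`|std_score t| / a1))%:E)) => [//||t].
    by apply/measurable_EFinP; exact: (measurable_psi psi_mono measurable_std_score a10).
  by rewrite lee_fin; exact: psi_abs_ge0.
by rewrite /orlicz_adm; split=> -[a10 h]; split=> //; move: h; rewrite (E a10).
Qed.

Lemma orlicz_adm_snd (a1 : R) : orlicz_adm psi PG (fun q => q.2) a1 <-> orlicz_adm psi gam id a1.
Proof.
have E : 0 < a1 -> (\int[PG]_q (psi (`|q.2| / a1))%:E = \int[gam]_r (psi (`|r| / a1))%:E)%E.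
  move=> a10; rewrite (EE_snd PP gam (f := fun r => (psi (`|r| / a1))%:E)) => [//||t].
    apply/measurable_EFinP; apply: (measurable_psi (T := measurableTypeR R) psi_mono (g := fun r => r)) a10.
    exact: measurable_id.
  by rewrite lee_fin; exact: psi_abs_ge0.
by rewrite /orlicz_adm; split=> -[a10 h]; split=> //; move: h; rewrite (E a10).
Qed.

(** The path is at [s * Z] for [b = pi/2] and at [std_score] for [b = 0]; here it is run backwards,
    in [orlicz_adm_X0_gauss] forwards. *)
Lemma orlicz_adm_gauss_X0 (a1 e : R) : 0 < e -> orlicz_adm psi gam id a1 -> orlicz_adm psi PP std_score (s * a1 + pi * yQ + e).
Proof.
move=> e0 /orlicz_adm_snd h; apply/orlicz_adm_fst.
have h1 : orlicz_adm psi PG X1g (s * a1) by exact: orlicz_adm_scale.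
have := @path (pi / 2) (-1) (s * a1) e _ e0; rewrite normrN normr1 => /(_ erefl).
rewrite mulN1r subrr cos0 sin0 cos_pihalf sin_pihalf.
have -> : (fun q : n.-tuple 'rV[R]_d * R => 0 * X0g q + 1 * X1g q) = X1g by apply/funext => q; rewrite mul0r mul1r add0r.
have -> : (fun q : n.-tuple 'rV[R]_d * R => 1 * X0g q + 0 * X1g q) = X0g by apply/funext => q; rewrite mul0r mul1r addr0.
exact.
Qed.

Lemma orlicz_adm_X0_gauss (a1 e : R) : 0 < e -> orlicz_adm psi PP std_score a1 -> orlicz_adm psi gam id ((a1 + pi * yQ + e) / s).
Proof.
move=> e0 /orlicz_adm_fst h; apply/orlicz_adm_snd.
have := @path 0 1 a1 e _ e0; rewrite normr1 => /(_ erefl).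
rewrite mul1r add0r cos0 sin0 cos_pihalf sin_pihalf.
have -> : (fun q : n.-tuple 'rV[R]_d * R => 0 * X0g q + 1 * X1g q) = X1g by apply/funext => q; rewrite mul0r mul1r add0r.
have -> : (fun q : n.-tuple 'rV[R]_d * R => 1 * X0g q + 0 * X1g q) = X0g by apply/funext => q; rewrite mul0r mul1r addr0.
have s1 : 0 < s^-1 by rewrite invr_gt0.
move=> /(_ h) h1; have := orlicz_adm_scale psi_mono psi_0 s1 h1; rewrite [s^-1 * (_ + _)]mulrC.
by have -> : (fun q : n.-tuple 'rV[R]_d * R => s^-1 * X1g q) = (fun q => q.2) by apply/funext => q; rewrite /X1g mulKf ?gt_eqF.
Qed.

End psi_bounds.
End interpolation.

Definition cm (k : nat) : R := 1 + ck k.+1 * (1 + (2 * cW) ^+ k.+2).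

Lemma ck_ge0 N : 0 <= ck N.
Proof.
apply: addr_ge0; first exact: ca_ge0.
by apply: exprn_ge0; rewrite invr_ge0 ltW// W_bad_gt0.
Qed.

Lemma cm_ge0 k : 0 <= cm k.
Proof.
have h1 := ck_ge0 k.+1; have h2 := cW_ge0; rewrite /cm.
by apply: addr_ge0 => //; apply: mulr_ge0 => //; apply: addr_ge0 => //; apply: exprn_ge0; exact: mulr_ge0.
Qed.

(* With [T := excess t]: if [T/n] exceeds [a^2] then [fluct^2 <= 2 cW T/n], and the truncation at 1 turns
   [(T/n)^((k+2)/2)] into [T/n]. *)
Lemma min_Dk_le k t : Num.min 1 (mle_error k t) <= cm k * (a ^+ k.+2 + ni * excess t).
Proof.
have a2 := a_sqr; have W0 := W_ge0 t; have T0 := excess_ge0 t; have q0 := ck_ge0 k.+1; have c0 := cW_ge0.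
have hW : fluct t ^+ 2 <= cW * (a ^+ 2 + ni * excess t).
  rewrite (le_trans (W_sqr_le t))// a2 -mulrA ler_wpM2l// mulrDl [excess t / _]mulrC//.
have al1 := a_le1; have a00 := a0.
rewrite /mle_error /cm; move: (fluct t) (excess t) (ck k.+1) (cW) W0 T0 q0 c0 hW => W T q c W0 T0 q0 c0 hW.
set g := (2 * c) ^+ k.+2; have g0 : 0 <= g by rewrite exprn_ge0// mulr_ge0.
set tau := ni * T in hW *; have t0 : 0 <= tau by rewrite mulr_ge0// ltW.
have gen (b1 : R) : 0 <= b1 -> W ^+ 2 <= 2 * c * b1 -> (W ^+ k.+2) ^+ 2 <= g * b1 ^+ k.+2.
  by move=> b10 h; rewrite exprAC /g -exprMn lerXn2r ?nnegrE ?sqr_ge0// !mulr_ge0.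
have root (b1 b3 : R) : 0 <= b1 -> 0 <= b3 -> b1 ^+ 2 <= g * b3 ^+ 2 -> b1 <= (1 + g) * b3.
  move=> b10 b30 h; rewrite -(@ler_pXn2r _ 2)// ?nnegrE ?mulr_ge0 ?addr_ge0//.
  rewrite (le_trans h)// exprMn ler_wpM2r ?sqr_ge0//.
  by have := sqr_ge0 g; rewrite sqrrD expr1n mul1r mulr2n; lra.
have We0 : 0 <= W ^+ k.+2 by rewrite exprn_ge0.
have ae0 : 0 <= a ^+ k.+2 by rewrite exprn_ge0// ltW.
have fin b3 : 0 <= b3 -> b3 <= a ^+ k.+2 + tau -> W ^+ k.+2 <= (1 + g) * b3 ->
    Num.min 1 (q * W ^+ k.+2) <= (1 + q * (1 + g)) * (a ^+ k.+2 + tau).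
  move=> b30 hb h; rewrite (@le_trans _ _ (q * W ^+ k.+2))//; first by rewrite ge_min lexx orbT.
  rewrite (@le_trans _ _ (q * ((1 + g) * b3)))//; first by rewrite ler_wpM2l.
  rewrite mulrA ler_pM// ?mulr_ge0 ?addr_ge0// lerDr//.
have [ta|ta] := leP tau (a ^+ 2).
  apply: (fin (a ^+ k.+2)) => //; first by rewrite lerDl.
  apply: root => //; rewrite [X in g * X]exprAC; apply: gen; first exact: sqr_ge0.
  by rewrite (le_trans hW)// [2 * c]mulrC -mulrA ler_wpM2l//; lra.
have [t1|t1] := leP 1 tau.
  rewrite (@le_trans _ _ 1)//; first by rewrite ge_min lexx.
  rewrite (@le_trans _ _ (1 * tau))//; first by rewrite mul1r.
  by apply: ler_pM => //; [rewrite lerDl mulr_ge0 ?addr_ge0|rewrite lerDr].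
apply: (fin tau) => //; first by rewrite lerDr.
apply: root => //; rewrite (@le_trans _ _ (g * tau ^+ k.+2))//.
  by apply: gen => //; rewrite (le_trans hW)// [2 * c]mulrC -mulrA ler_wpM2l//; lra.
by rewrite ler_wpM2l//; apply: ler_wiXn2l => //; exact: ltW.
Qed.

Lemma a_le_powR (rho : R) : 0 < rho <= 1 -> a <= a `^ rho.
Proof.
move=> /andP[r0 r1]; rewrite -{1}[a]powRr1 ?(ltW a0)//.
by apply: ger_powR => //; rewrite a0 a_le1.
Qed.

(** * The risk bound *)

Section orlicz_bound.
Context {disp : measure_display} {T : measurableType disp}.
Variables (Pr : 'rV[R]_d -> probability T R) (X : 'I_n -> {mfun T >-> 'rV[R]_d}).
Hypothesis hX : location_sample V Pr X.
Variables (k : nat) (rho K : R) (f : 'rV[R]_d -> R).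
Hypothesis r01 : 0 < rho <= 1.
Hypothesis hf : holder_ball k.+1 rho K f.
Hypothesis Kp : 0 < K.
Local Notation th := (that X).
Local Notation Ct := (Ct X).
Let S1 : R := a ^+ k.+1 * a `^ rho.
Let cA : R := cS k * (ck k.+1 * cM k.+2) + 2 * cF k * cm k + cB k.

Lemma S1_ge0 : 0 <= S1.
Proof. by apply: mulr_ge0; [exact/exprn_ge0/ltW|exact: powR_ge0]. Qed.

Lemma a_S1 : a ^+ k.+2 <= S1.
Proof. by rewrite /S1 exprSr; apply: ler_wpM2l; [exact/exprn_ge0/ltW|exact: a_le_powR]. Qed.

Lemma cS_ge0 : 0 <= cS k.
Proof. by apply: sumr_ge0 => j _; exact: ceps_ge0. Qed.

Lemma cB_ge0 : 0 <= cB k.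
Proof.
have h1 := c1_ge0 k; have h2 := cM_ge0 2; have h3 := cz_ge0 k.+1; have L00 := ltW L0; have m00 : 0 <= m^-1 by rewrite invr_ge0 ltW.
have h4 : 0 <= cb k.
  have h5 := cz_ge0 k; apply: mulr_ge0 => //; apply: mulr_ge0 => //; apply: addr_ge0 => //; exact: mulr_ge0.
by repeat first [assumption | exact: ler0n | apply: exprn_ge0 | apply: addr_ge0 | apply: mulr_ge0].
Qed.

Lemma cA_ge0 : 0 <= cA.
Proof.
have h1 := cS_ge0; have h2 := ck_ge0 k.+1; have h3 := cM_ge0 k.+2; have h4 := cF_ge0 k.
have h5 := cm_ge0 k; have h6 := cB_ge0.
by repeat first [assumption | exact: ler0n | apply: addr_ge0 | apply: mulr_ge0].
Qed.

Definition centered_remainder theta t : R := remainder k f theta t - Ex PP (remainder k f theta).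
Definition estimation_error theta (b : T) : R := bias_reduced Pr th k f (th b) - f theta.

Lemma debiased_that_le theta b :
  `|debiased k f (th b) - debiased k f (theta + newton_iter k.+1 (Ct theta b))| <=
  K * (2 * cF k * cm k) * (a ^+ k.+2 + ni * excess (Ct theta b)).
Proof.
have K0 := ltW Kp; have F0 := cF_ge0 k.
set p := theta + _; have h1 := debiased_lip hf (th b) p.
have h2 := debiased_bounded hf (th b); have h3 := debiased_bounded hf p.
have h4 := that_close X k theta b; rewrite -/p in h4.
have KF : 0 <= K * cF k by exact: mulr_ge0.
have h5 : `|debiased k f (th b) - debiased k f p| <= 2 * (K * cF k) * Num.min 1 (enorm (th b - p)).
  have [h|h] := leP 1 (enorm (th b - p)).
    by rewrite mulr1 (le_trans (ler_normB _ _))// mulr2n mulrDl mul1r lerD.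
  apply: le_trans h1 _; apply: ler_wpM2r; first exact: enorm_ge0.
  by apply: ler_peMl => //; rewrite ler1n.
rewrite (le_trans h5)//.
have -> : K * (2 * cF k * cm k) * (a ^+ k.+2 + ni * excess (Ct theta b)) =
   2 * (K * cF k) * (cm k * (a ^+ k.+2 + ni * excess (Ct theta b))).
  by move: (cF k) (cm k) (a ^+ k.+2 + _) => b1 b3 b4; ring.
apply: ler_wpM2l; first by rewrite mulr_ge0.
apply: le_trans (min_Dk_le k (Ct theta b)); rewrite le_min ge_min lexx/=.
exact: h4.
Qed.

(** Four differences: [f_k] against [debiased], the estimator against the iterate inside [debiased],
    the mean of the remainder against [f theta], and the centred remainder. The first three give the
    summands of [cA]. *)
Lemma Y_close theta b :
  `|estimation_error theta b - linear_term f theta (Ct theta b)| <=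
  K * cA * (S1 + ni * excess (Ct theta b)) + `|centered_remainder theta (Ct theta b)|.
Proof.
have K0 := ltW Kp; set t := Ct theta b.
have h1 := bias_sub_le hX hf (th b).
have h2 := debiased_that_le theta b; rewrite -/t in h2.
have h3 := debiased_mean r01 hf theta; rewrite -(Ex_remainder theta hf) in h3.
have E : estimation_error theta b - linear_term f theta t =
   (bias_reduced Pr th k f (th b) - debiased k f (th b)) + (debiased k f (th b) - debiased k f (theta + newton_iter k.+1 t)) +
   (Ex PP (remainder k f theta) - f theta) + centered_remainder theta t.
  rewrite /estimation_error /centered_remainder [remainder k f theta t]/remainder.
  move: (bias_reduced _ _ _ _ _) (f theta) (linear_term _ _ _) (debiased k f _) (debiased k f _) (Ex _ _) => b1 b3 b4 b5 b6 b7.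
  by ring.
rewrite E (le_trans (ler_normD _ _))// lerD2r.
rewrite (le_trans (ler_normD _ _))// (le_trans (lerD (ler_normD _ _) (lexx _)))//.
apply: le_trans (lerD (lerD h1 h2) h3) _.
have hS := S1_ge0; have aS := a_S1; have T0 : 0 <= ni * excess t by rewrite mulr_ge0 ?excess_ge0// ltW.
have q1 : 0 <= K * cS k * (ck k.+1 * cM k.+2).
  by apply: mulr_ge0; apply: mulr_ge0 => //; [exact: cS_ge0|exact: ck_ge0|exact: cM_ge0].
have q2 : 0 <= K * (2 * cF k * cm k).
  by apply: mulr_ge0 => //; apply: mulr_ge0; [apply: mulr_ge0 => //; exact: cF_ge0|exact: cm_ge0].
have q3 : 0 <= K * cB k by apply: mulr_ge0 => //; exact: cB_ge0.
have -> : K * cA * (S1 + ni * excess t) = K * cS k * (ck k.+1 * cM k.+2) * (S1 + ni * excess t) +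
    K * (2 * cF k * cm k) * (S1 + ni * excess t) + K * cB k * (S1 + ni * excess t).
  by rewrite /cA; move: (S1 + _) (cS k) (ck k.+1 * _) (cF k) (cm k) (cB k) => b1 b3 b4 b5 b6 b7; ring.
apply: lerD; [apply: lerD|].
- by apply: ler_wpM2l => //; rewrite (le_trans aS)// lerDl.
- by apply: ler_wpM2l => //; rewrite lerD2r.
- by rewrite mulrA; apply: ler_wpM2l => //; rewrite lerDl.
Qed.

Variable C : R.
Hypothesis hC : poincare_admissible C.

Lemma C_gt0 : 0 < C.
Proof. by apply: lt_le_trans (poincare_admissible_ge d0 hC); rewrite divr_gt0// exprn_gt0. Qed.

(** The variance scale of [remainder_moment], with [c6 + 1] in place of [c6] to make it positive, as
    [dyadic_moment_exp] divides by its root. *)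
Let bU : R := n%:R * C * ((K * ni * a `^ rho) ^+ 2 * (c6 k + 1)).
Let sU : R := Num.sqrt (C * ni) * a `^ rho.

Lemma bU_gt0 : 0 < bU.
Proof.
apply: mulr_gt0; first by rewrite mulr_gt0 ?ltr0n// C_gt0.
apply: mulr_gt0; last by rewrite ltr_wpDl// c6_ge0.
by apply: exprn_gt0; apply: mulr_gt0; [exact: mulr_gt0|exact: powR_gt0].
Qed.

Lemma sqrt_bU : Num.sqrt bU = K * Num.sqrt (c6 k + 1) * sU.
Proof.
have c60 : 0 <= c6 k + 1 by rewrite addr_ge0 ?c6_ge0.
have C0 := ltW C_gt0; have ni00 := ltW ni0; have K0 := ltW Kp; have p0 := powR_ge0 a rho.
have -> : bU = (K * a `^ rho) ^+ 2 * ((c6 k + 1) * (C * ni)).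
  rewrite /bU; have nn := nK; move: (c6 k + 1) (a `^ rho) => b1 b3.
  have -> : n%:R * C * ((K * ni * b3) ^+ 2 * b1) = (ni * n%:R) * ((K * b3) ^+ 2 * (b1 * (C * ni))) by ring.
  by rewrite nn mul1r.
rewrite sqrtrM ?sqr_ge0// sqrtr_sqr ger0_norm ?mulr_ge0// sqrtrM// /sU.
by move: (Num.sqrt _) (Num.sqrt _) (a `^ rho) => b1 b3 b4; ring.
Qed.

Lemma U_exp theta :
  (\int[PP]_t (expR ((`|centered_remainder theta t| / Num.sqrt bU / (4 * expR 1)) `^ (2 / 3)))%:E <= (expR 1 + 1)%:E)%E.
Proof.
have mU : measurable_fun setT (centered_remainder theta) by apply: measurable_funB => //; exact: (measurable_remainder theta hf).
apply: dyadic_moment_exp bU_gt0 mU _ => i i0.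
apply: le_trans (remainder_moment theta r01 hf hC i0) _.
have C0 := ltW C_gt0.
rewrite lee_fin; apply: ler_wpM2r; first exact: exprn_ge0.
have h6 := c6_ge0 k.
apply: lerXn2r; rewrite ?nnegrE; [|exact/ltW/bU_gt0|].
  by apply: mulr_ge0; [exact: mulr_ge0|apply: mulr_ge0 => //; exact: sqr_ge0].
apply: ler_wpM2l; first exact: mulr_ge0.
by rewrite /b2; apply: ler_wpM2l; [exact: sqr_ge0|rewrite lerDl].
Qed.

Section psi_bound.
Variables (psi : R -> R) (c : R).
Hypothesis psi_cvx : forall x1 x2 l : R, 0 <= x1 -> 0 <= x2 -> 0 <= l <= 1 ->
  psi (l * x1 + (1 - l) * x2) <= l * psi x1 + (1 - l) * psi x2.
Hypothesis psi_mono : forall x1 x2 : R, 0 <= x1 -> x1 <= x2 -> psi x1 <= psi x2.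
Hypothesis psi_0 : psi 0 = 0.
Hypothesis c0 : 0 < c.
Hypothesis psi_exp : forall r : R, 0 <= r -> psi r <= expR ((c * r) `^ (2 / 3)) - 1.
Local Notation gam := (@normal_prob R 0 1).

Let BD : R := K * cA * (S1 + ni) + Num.sqrt bU.
Let error_bound theta t : R := K * cA * (S1 + ni * excess t) + `|centered_remainder theta t|.

Lemma BD_gt0 : 0 < BD.
Proof.
apply: ltr_wpDl; last by rewrite sqrtr_gt0 bU_gt0.
apply: mulr_ge0; first by apply: mulr_ge0; [exact: ltW|exact: cA_ge0].
by apply: addr_ge0; [exact: S1_ge0|exact: ltW].
Qed.

Lemma error_bound_ge0 theta t : 0 <= error_bound theta t.
Proof.
apply: addr_ge0 => //; apply: mulr_ge0; first by apply: mulr_ge0; [exact: ltW|exact: cA_ge0].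
by apply: addr_ge0; [exact: S1_ge0|apply: mulr_ge0; [exact: ltW|exact: excess_ge0]].
Qed.

Lemma measurable_centered_remainder theta : measurable_fun setT (centered_remainder theta).
Proof. by apply: measurable_funB => //; exact: (measurable_remainder theta hf). Qed.

Lemma measurable_error_bound theta : measurable_fun setT (error_bound theta).
Proof.
apply: measurable_funD; last exact: (measurableT_comp _ (measurable_centered_remainder theta)).
apply: measurable_funM => //; apply: measurable_funD => //; apply: measurable_funM => //.
exact: measurable_T.
Qed.

Lemma orlicz_adm_D theta : orlicz_adm psi PP (error_bound theta) (kappa c * BD).
Proof.
have b0 : 0 < Num.sqrt bU by rewrite sqrtr_gt0 bU_gt0.
apply: (@orlicz_adm_mix _ psi psi_mono psi_0 _ _ PP c c0 psi_exp _ excess (fun t => `|centered_remainder theta t| / Num.sqrt bU)).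
- exact: BD_gt0.
- exact: measurable_T.
- by apply: measurable_funM => //; exact: (measurableT_comp _ (measurable_centered_remainder theta)).
- exact: excess_ge0.
- by move=> t; apply: divr_ge0 => //; exact: ltW.
- exact: T_exp.
- exact: U_exp.
- move=> t; rewrite (ger0_norm (error_bound_ge0 theta t)) /error_bound /BD.
  have K0 : 0 <= K * cA by apply: mulr_ge0; [exact: ltW|exact: cA_ge0].
  have T0 := excess_ge0 t; have U0 := normr_ge0 (centered_remainder theta t); have hS := S1_ge0; have ni00 := ltW ni0.
  move: (K * cA) (excess t) `|centered_remainder theta t| (Num.sqrt bU) S1 (ni) b0 K0 T0 U0 hS ni00 => q tt u1 r s1 N r0 q0 t0 u0 s0 N0.
  have -> : (q * (s1 + N) + r) * (1 + tt + u1 / r) =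
     q * (s1 + N * tt) + u1 + (q * (N + s1 * tt + (s1 + N) * (u1 / r)) + r * (1 + tt)).
    by field; rewrite gt_eqF.
  rewrite lerDl; have ur : 0 <= u1 / r by rewrite divr_ge0// ltW.
  have r00 := ltW r0.
  by repeat first [assumption | exact: ler01 | apply: addr_ge0 | apply: mulr_ge0].
Qed.

Lemma orlicz_adm_centered theta (g : n.-tuple 'rV[R]_d -> R) (x1 : R) : measurable_fun setT g ->
  orlicz_adm psi (Pr theta) (fun b => g (Ct theta b)) x1 <-> orlicz_adm psi PP g x1.
Proof.
move=> mg; have E : 0 < x1 -> (\int[Pr theta]_b (psi (`|g (Ct theta b)| / x1))%:E = \int[PP]_t (psi (`|g t| / x1))%:E)%E.
  move=> x10; apply: (ge0_integral_centered measurable_V hP hX theta (h := fun t => (psi (`|g t| / x1))%:E)).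
    by apply/measurable_EFinP; exact: (measurable_psi psi_mono mg x10).
  by move=> t; rewrite lee_fin; exact: psi_abs_ge0.
by rewrite /orlicz_adm; split=> -[x10 h]; split=> //; move: h; rewrite (E x10).
Qed.

Lemma orlicz_adm_normal : exists x1 : R, orlicz_adm psi gam id x1.
Proof.
exists (kappa c * 1).
have mz : measurable_fun setT (fun r : R => r ^+ 2 / 4).
  by apply: measurable_funM => //; exact: measurable_funX.
apply: (@orlicz_adm_mix _ psi psi_mono psi_0 _ _ gam c c0 psi_exp _ (fun r => r ^+ 2 / 4) (fun=> 0)) => //.
- by move=> r; rewrite divr_ge0// sqr_ge0.
- exact: integral_gauss_exp_sqr.
- under eq_integral do rewrite mul0r powR0 ?expR0//.
  by rewrite EE_cst lee_fin lerDr expR_ge0.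
- move=> r; rewrite mul1r addr0 -[r ^+ 2]real_normK ?num_real//.
  by have := sqr_ge0 (`|r| - 2); rewrite sqrrB; lra.
Qed.

Lemma measurable_linear_term theta : measurable_fun setT (linear_term f theta).
Proof. exact: (itg_meas (itg_linear_term f theta)). Qed.

Lemma gradient_norm_le theta : enorm (gradient f theta) <= K.
Proof.
apply: enorm_dual => [|v]; first exact: ltW.
rewrite -derive_dot; last exact: holder_ball_differentiable hf.
exact: le_trans (ler_norm _) (holder_ball_derive_le _ _ hf).
Qed.

Lemma sigma_fE theta : sigma_f In f theta ^+ 2 = Ex P (fun x => hess x (newton_dir f theta) (newton_dir f theta)).
Proof.
rewrite -fisher_hess /newton_dir mulmxKV ?fisher_unit// dotC -dot_mx sqr_sqrtr//.
rewrite dot_mx -{2}[gradient f theta](mulmxKV fisher_unit) dotC.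
by apply: le_trans (fisher_posdef _); apply: mulr_ge0; [exact: ltW|exact/exprn_ge0/enorm_ge0].
Qed.

Let rn : R := (Num.sqrt n%:R)^-1.
Let rn0 : 0 < rn. Proof. by rewrite invr_gt0 sqrtr_gt0 ltr0n. Qed.
Let rn2 : rn ^+ 2 = ni. Proof. by rewrite /rn exprVn sqr_sqrtr. Qed.
Let sg theta : R := sigma_f In f theta.
Let u1 theta := newton_dir f theta.

Lemma sg_ge0 theta : 0 <= sg theta. Proof. exact: sqrtr_ge0. Qed.

Lemma linear_term_std_score theta t : linear_term f theta t = rn * std_score (u1 theta) t.
Proof. by rewrite /linear_term /std_score mulrA -/rn -expr2 rn2. Qed.

Lemma newton_dir_le theta : enorm (u1 theta) <= m^-1 * K.
Proof.
by apply: le_trans (inv_norm_le _) _; apply: ler_wpM2l; [rewrite invr_ge0 ltW|exact: gradient_norm_le].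
Qed.

Lemma sg_ge theta : Num.sqrt m * enorm (u1 theta) <= sg theta.
Proof.
rewrite -(@ler_pXn2r _ 2)// ?nnegrE ?sg_ge0 ?mulr_ge0 ?sqrtr_ge0 ?enorm_ge0//.
rewrite exprMn sqr_sqrtr ?(ltW m0)// sigma_fE -fisher_hess; exact: fisher_posdef.
Qed.

Let yG theta : R := pi * yQ (u1 theta) (sg theta) c * rn.
Let cG1 : R := pi * (kappa c * 16 * (M / Num.sqrt m * m^-1)).

Lemma kappa_ge0 : 0 <= kappa c. Proof. exact/ltW/kappa_gt0. Qed.

Lemma yG_ge0 theta : 0 <= yG theta.
Proof.
apply: mulr_ge0; last exact: ltW.
apply: mulr_ge0; first exact: pi_ge0.
apply: mulr_ge0; first exact: kappa_ge0.
apply: mulr_ge0; last exact: ltW.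
apply: mulr_ge0 => //; apply: divr_ge0; last exact: sg_ge0.
by apply: mulr_ge0; [exact: ltW|exact/exprn_ge0/enorm_ge0].
Qed.

(** The division by [sigma] is harmless: [sg_ge] gives [|u1|^2 / sigma <= |u1| / sqrt m], which
    stays bounded as [sigma] tends to 0. *)
Lemma yG_le theta : yG theta <= K * cG1 * ni.
Proof.
have k0 := kappa_ge0; have p0 := pi_ge0 R.
have m00 : 0 < Num.sqrt m by rewrite sqrtr_gt0.
have h1 : M * enorm (u1 theta) ^+ 2 / sg theta <= M / Num.sqrt m * m^-1 * K.
  have [u0|u0] := eqVneq (enorm (u1 theta)) 0.
    rewrite u0 expr0n mulr0 mul0r; apply: mulr_ge0; last exact: ltW.
    by apply: mulr_ge0; [apply: divr_ge0; exact: ltW|rewrite invr_ge0 ltW].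
  have up : 0 < enorm (u1 theta) by rewrite lt0r u0 enorm_ge0.
  have sp : 0 < sg theta by apply: lt_le_trans (sg_ge theta); exact: mulr_gt0.
  rewrite ler_pdivrMr//.
  apply: (@le_trans _ _ (M / Num.sqrt m * m^-1 * K * (Num.sqrt m * enorm (u1 theta)))); last first.
    apply: ler_wpM2l (sg_ge theta); apply: mulr_ge0; last exact: ltW.
    by apply: mulr_ge0; [apply: divr_ge0; exact: ltW|rewrite invr_ge0 ltW].
  have -> : M / Num.sqrt m * m^-1 * K * (Num.sqrt m * enorm (u1 theta)) = M * enorm (u1 theta) * (m^-1 * K).
    by field; rewrite !gt_eqF.
  rewrite expr2 mulrA; apply: ler_wpM2l; last exact: newton_dir_le.
  by apply: mulr_ge0; [exact: ltW|exact: ltW].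
have -> : yG theta = pi * (kappa c * 16 * ni) * (M * enorm (u1 theta) ^+ 2 / sg theta).
  by rewrite /yG /yQ -/rn -rn2; move: (kappa c) (_ / sg theta) (rn) pi => b1 b3 b4 b5; ring.
have -> : K * cG1 * ni = pi * (kappa c * 16 * ni) * (M / Num.sqrt m * m^-1 * K).
  by rewrite /cG1; move: (kappa c) (M / _ * _) (ni) pi => b1 b3 b4 b5; ring.
apply: ler_wpM2l h1; apply: mulr_ge0 => //; apply: mulr_ge0; last exact: ltW.
exact: mulr_ge0.
Qed.

(** One factor [n^(-1/2)] is paid for by [C >= m / M^2], the other by [n^(-1/2) <= a <= a^rho], as
    [d >= 1]. *)
Lemma ni_le_sU : ni <= M / Num.sqrt m * sU.
Proof.
have m00 : 0 < Num.sqrt m by rewrite sqrtr_gt0.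
have Cn : 0 <= C * ni by apply: mulr_ge0; [exact/ltW/C_gt0|exact: ltW].
have h1 : Num.sqrt m / M * rn <= Num.sqrt (C * ni).
  rewrite -(@ler_pXn2r _ 2)// ?nnegrE ?sqrtr_ge0//; last first.
    by apply: mulr_ge0; [apply: divr_ge0; exact: ltW|exact: ltW].
  rewrite (sqr_sqrtr Cn) exprMn rn2 exprMn exprVn (sqr_sqrtr (ltW m0)).
  apply: ler_wpM2r; first exact: ltW.
  exact: poincare_admissible_ge d0 hC.
have h2 : rn <= a `^ rho.
  apply: le_trans (a_le_powR r01); rewrite -(@ler_pXn2r _ 2)// ?nnegrE ?(ltW a0) ?(ltW rn0)//.
  rewrite rn2 a_sqr /ni -[leLHS]mul1r; apply: ler_wpM2r; first by rewrite invr_ge0.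
  by rewrite ler1n.
have h3 : Num.sqrt m / M * rn * rn <= sU.
  by apply: ler_pM => //; [apply: mulr_ge0; [apply: divr_ge0; exact: ltW|exact: ltW]|exact: ltW].
have -> : ni = M / Num.sqrt m * (Num.sqrt m / M * rn * rn).
  by rewrite -rn2; field; rewrite !gt_eqF.
by apply: ler_wpM2l => //; apply: divr_ge0; exact: ltW.
Qed.

Definition cE : R := kappa c * (cA * (1 + M / Num.sqrt m) + Num.sqrt (c6 k + 1)) + cG1 * (M / Num.sqrt m).

Lemma error_le theta : kappa c * BD + yG theta <= K * cE * (sU + S1).
Proof.
have K0 := ltW Kp; have k0 := kappa_ge0; have hA := cA_ge0; have hS := S1_ge0; have hn := ni_le_sU.
have q0 : 0 <= M / Num.sqrt m by apply: divr_ge0; [exact: ltW|exact: sqrtr_ge0].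
have s0 : 0 <= sU by apply: mulr_ge0; [exact: sqrtr_ge0|exact: powR_ge0].
have r0 := sqrtr_ge0 (c6 k + 1).
have g0 : 0 <= cG1.
  apply: mulr_ge0; first exact: pi_ge0.
  apply: mulr_ge0; first exact: mulr_ge0.
  by apply: mulr_ge0 => //; rewrite invr_ge0 ltW.
have hy := yG_le theta.
apply: le_trans (lerD (lexx _) hy) _.
rewrite /BD sqrt_bU /cE; have n00 := ltW ni0.
move: (kappa c) cA (M / Num.sqrt m) (Num.sqrt (c6 k + 1)) cG1 sU S1 ni k0 hA q0 r0 g0 s0 hS hn n00.
move=> kp cA' q r g s1 s2 N k0 hA q0 r0 g0 s0 hS hn n00.
rewrite -subr_ge0.
have -> : K * (kp * (cA' * (1 + q) + r) + g * q) * (s1 + s2) -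
  (kp * (K * cA' * (s2 + N) + K * r * s1) + K * g * N) =
  K * (kp * (cA' * (q * s1 - N) + cA' * (s1 + q * s2) + r * s2) + g * (q * s1 - N) + g * (q * s2)) by ring.
have d0' : 0 <= q * s1 - N by rewrite subr_ge0.
by repeat first [assumption | exact: ler0n | apply: addr_ge0 | apply: mulr_ge0].
Qed.

Theorem orlicz_bound theta :
  (`| orlicz_norm (Pr theta) psi (estimation_error theta)
      - (sg theta * rn)%:E * orlicz_norm gam psi id | <= (K * cE * (sU + S1))%:E)%E.
Proof.
have yy0 := yG_ge0 theta; have kp0 := kappa_gt0 c0.
have hBD := BD_gt0; have y0 : 0 <= kappa c * BD + yG theta by rewrite addr_ge0// mulr_ge0// ltW.
apply: (@le_trans _ _ (kappa c * BD + yG theta)%:E); last by rewrite lee_fin; exact: error_le.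
have sn0 : 0 <= sg theta * rn by apply: mulr_ge0; [exact: sg_ge0|exact: ltW].
have mS := measurable_linear_term theta; have mD := measurable_error_bound theta; have mC := measurable_centered X theta.
have mSC : measurable_fun setT (fun b => linear_term f theta (Ct theta b)) by exact: (measurableT_comp mS mC).
have mDC : measurable_fun setT (fun b => error_bound theta (Ct theta b)) by exact: (measurableT_comp mD mC).
have aD : orlicz_adm psi (Pr theta) (fun b => error_bound theta (Ct theta b)) (kappa c * BD).
  by apply/(orlicz_adm_centered theta _ mD); exact: orlicz_adm_D.
have hY b : `|estimation_error theta b| <= `|linear_term f theta (Ct theta b)| + `|error_bound theta (Ct theta b)|.
  have := Y_close theta b; rewrite -/(error_bound theta _) (ger0_norm (error_bound_ge0 _ _)) => h.
  by have := ler_normD (linear_term f theta (Ct theta b)) (estimation_error theta b - linear_term f theta (Ct theta b)); rewrite subrKC; lra.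
have hS b : `|linear_term f theta (Ct theta b)| <= `|estimation_error theta b| + `|error_bound theta (Ct theta b)|.
  have := Y_close theta b; rewrite -/(error_bound theta _) (ger0_norm (error_bound_ge0 _ _)) distrC => h.
  by have := ler_normD (estimation_error theta b) (linear_term f theta (Ct theta b) - estimation_error theta b); rewrite subrKC; lra.
(* The rotation divides by [sigma]. If [sigma = 0], then [newton_dir] and the linear term vanish,
   and the error bound alone gives the claim. *)
have [sg0|sg0] := eqVneq (sg theta) 0.
  have u0 : u1 theta = 0.
    apply: enorm_eq0; apply/eqP; rewrite eq_le enorm_ge0 andbT.
    by have := sg_ge theta; rewrite sg0 pmulr_rle0 ?sqrtr_gt0.
  have St0 t : linear_term f theta t = 0.
    by rewrite /linear_term -/(u1 theta) u0 big1 ?mulr0// => i _; rewrite dVE dot0r.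
  apply: (orlicz_close (psi := psi)) => //.
  - exact: orlicz_adm_normal.
  - move=> a1 e e0 _; rewrite sg0 mul0r mul0r add0r.
    apply: (@orlicz_adm_le _ psi psi_mono psi_0 _ _ _ _ (kappa c * BD)).
      by rewrite -addrA lerDl addr_ge0// ltW.
    apply: (orlicz_adm_mono psi_mono psi_0 _ aD) => b.
    by have := hY b; rewrite St0 normr0 add0r.
  - by move=> a1 e e0; rewrite sg0 mul0r ltxx.
have sp : 0 < sg theta by rewrite lt0r sg0 sg_ge0.
have s2 : sg theta ^+ 2 = Ex P (fun x => hess x (u1 theta) (u1 theta)) by exact: sigma_fE.
apply: (orlicz_close (psi := psi)) => //.
- exact: orlicz_adm_normal.
- move=> a1 e e0 ha.
  have e1 : 0 < e / rn by exact: divr_gt0.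
  have h1 := orlicz_adm_gauss_X0 sp s2 psi_cvx psi_mono psi_0 c0 psi_exp e1 ha.
  have h2 := orlicz_adm_scale psi_mono psi_0 rn0 h1.
  have {}h2 : orlicz_adm psi PP (linear_term f theta) (rn * (sg theta * a1 + pi * yQ (u1 theta) (sg theta) c + e / rn)).
    by rewrite (_ : linear_term f theta = fun t => rn * std_score (u1 theta) t)//; apply/funext => t; exact: linear_term_std_score.
  have h3 := (orlicz_adm_centered theta _ mS).2 h2.
  have := orlicz_adm_triangle psi_cvx psi_mono psi_0 mSC mDC hY h3 aD.
  congr orlicz_adm; rewrite /yG; move: (pi * _) (kappa c * BD) rn0 => b1 b3 r0.
  by field; rewrite gt_eqF.
- move=> a1 e e0 sr ha.
  have e1 : 0 < e / rn by exact: divr_gt0.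
  have h1 := orlicz_adm_lower psi_cvx psi_mono psi_0 mSC mDC hS ha aD.
  have h2 := (orlicz_adm_centered theta _ mS).1 h1.
  have ri : 0 < rn^-1 by rewrite invr_gt0.
  have h3 := orlicz_adm_scale psi_mono psi_0 ri h2.
  have {}h3 : orlicz_adm psi PP (std_score (u1 theta)) (rn^-1 * (a1 + kappa c * BD)).
    rewrite (_ : std_score (u1 theta) = fun t => rn^-1 * linear_term f theta t)//; apply/funext => t.
    by rewrite linear_term_std_score mulKf// gt_eqF.
  have := orlicz_adm_X0_gauss sp s2 psi_cvx psi_mono psi_0 c0 psi_exp e1 h3.
  congr orlicz_adm; rewrite /yG; move: (pi * _) (kappa c * BD) rn0 => b1 b3 r0.
  by field; rewrite !gt_eqF.
Qed.

End psi_bound.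
End orlicz_bound.

End sample_calculus.
End potential.

(** * From the bound at a fixed parameter to the supremum and the Poincare constant *)

Lemma convex_function_ineq {R : realType} (psi : R -> R) :
  convex_function (E := R^o) [set u | 0 <= u] psi ->
  forall x y l : R, 0 <= x -> 0 <= y -> 0 <= l <= 1 ->
  psi (l * x + (1 - l) * y) <= l * psi x + (1 - l) * psi y.
Proof.
move=> h x y l x0 y0 /andP[l0 l1].
by have := h (Itv01 l0 l1) x y; rewrite !inE => /(_ x0 y0).
Qed.

Lemma holder_norm_ge0 {R : realType} {d : nat} (l : nat) (rho : R) (f : 'rV[R]_d -> R) :
  (0 <= holder_norm l rho f)%E.
Proof. by rewrite /holder_norm le_max bigmax_ge_id. Qed.

Lemma bias_reduced_cst0 {R : realType} {d : nat} {disp : measure_display} {T : measurableType disp}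
    (Pr : 'rV[R]_d -> probability T R) (th : T -> 'rV[R]_d) (k : nat) theta :
  bias_reduced Pr th k (fun=> 0) theta = 0.
Proof.
have B0 : calB Pr th (fun=> 0) = fun=> 0.
  apply/funext => p; rewrite /calB /calT subr0.
  by rewrite unlock (_ : \int[_]_w _ = 0)%E// integral0_eq.
have it j : iter j (calB Pr th) (fun=> 0) = fun=> 0 by elim: j => //= j ->.
by rewrite /bias_reduced big1// => j _; rewrite it mulr0.
Qed.

Lemma sigma_f_cst0 {R : realType} {d : nat} (I : 'M[R]_d) theta :
  sigma_f I (fun=> 0) theta = 0 :> R.
Proof.
rewrite /sigma_f (_ : gradient _ _ = 0) ?mul0mx ?mxE ?sqrtr0//.
by apply/rowP => i; rewrite !mxE derive_cst.
Qed.

Lemma orlicz_norm0 {R : realType} {disp : measure_display} {T : measurableType disp}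
    (P : probability T R) (psi : R -> R) : psi 0 = 0 -> orlicz_norm P psi (fun=> 0) = 0%E.
Proof.
move=> psi_0; apply/eqP; rewrite eq_le; apply/andP; split; last first.
  by apply: le_ereal_inf_tmp => _ [a [a0 _] <-]; rewrite lee_fin ltW.
apply/lee_addgt0Pr => e e0; rewrite add0e; apply: ereal_inf_lbound; exists e => //; split=> //.
by under eq_integral do rewrite normr0 mul0r psi_0; rewrite integral0_eq.
Qed.

(** [C] is chosen after [c], which compares [psi] with [psi_{2/3}], because the error scales are
    proportional to it; the smoothness [s] is encoded by [k] and [rho]. *)
Theorem corollary2p3 (R : realType) :
  exists2 c0 : R, 0 < c0 &
  forall (L M m : R) (k : nat) (rho c : R),
    0 < L -> 0 < M -> 0 < m -> 0 < rho <= 1 -> 0 < c ->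
  exists2 C : R, 0 < C &
  forall (n d : nat) (V : 'rV[R]_d -> R) (P : probability 'rV[R]_d R)
    (disp : measure_display) (T : measurableType disp)
    (Pr : 'rV[R]_d -> probability T R) (X : 'I_n -> {mfun T >-> 'rV[R]_d})
    (f : 'rV[R]_d -> R) (psi : R -> R),
    (0 < n)%N -> (0 < d)%N ->
    (\int[leb d]_x (expR (- V x))%:E = 1)%E ->
    (forall A, measurable A -> P A = density_law V 0 A) ->
    location_sample V Pr X ->
    assumption1 P V L M m ->
    d%:R <= c0 * Num.min (m / M) (m ^+ 2 / (L * Num.sqrt M)) ^+ 2 * n%:R ->
    holder_class k.+1 rho f ->
    convex_function (E := R^o) [set u | 0 <= u] psi ->
    (forall u v, 0 <= u -> u <= v -> psi u <= psi v) ->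
    psi 0 = 0 ->
    (forall u, 0 <= u -> psi u <= expR ((c * u) `^ (2 / 3)) - 1) ->
    let s := k.+1%:R + rho in
    let that w := mle V (fun i => X i w) in
    let f_k := bias_reduced Pr that k f in
    (ereal_sup [set
        `| orlicz_norm (Pr theta) psi (fun w => (f_k (that w) - f theta)%R)
           - (sigma_f (fisher_information P V) f theta / Num.sqrt n%:R)%:E
             * orlicz_norm (normal_prob 0 1) psi id |
        | theta in [set: 'rV[R]_d]]
     <= C%:E * holder_norm k.+1 rho f *
        (sqrte (poincare_constant P * (n%:R^-1)%:E)
           * ((d%:R / n%:R) `^ (rho / 2))%:E
         + (Num.sqrt (d%:R / n%:R) `^ s)%:E))%E.
Proof.
(* As [m <= M], the minimum is at most 1, so [c0 = 1] turns the dimension condition into [d <= n],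
   the form in which the estimates use it. *)
exists 1 => // L M m k rho c L0 M0 m0 r01 c0.
(* The factor 2 pays for an admissible constant above the infimum; the absolute value and the added
   1 ensure positivity. *)
exists (2 * (`|cE L M m k c| + 1)); first by rewrite mulr_gt0// ltr_wpDl.
move=> n d V P disp T Pr X f psi n0 d0 _ hP hX [cV [ndV _] supV lipV hm] hd [ndf hf] psic psi_mono psi_0 psi_exp; lazy zeta.
set s := k.+1%:R + rho; set that := fun w => mle _ _; set f_k := bias_reduced _ _ _ _.
have psi_cvx := convex_function_ineq psic.
have mM : m <= M by exact: (m_le_M M0 L0 ndV supV lipV hP hm d0).
have hdn : d%:R <= n%:R :> R.
  rewrite (le_trans hd)// mul1r ler_piMl// exprn_ile1//.
    by rewrite le_min !divr_ge0 ?exprn_ge0 ?mulr_ge0 ?sqrtr_ge0 ?(ltW L0) ?(ltW M0) ?(ltW m0).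
  by rewrite ge_min ler_pdivrMr// mul1r mM.
have [A hA] : exists A : R, holder_norm k.+1 rho f = A%:E.
  have := holder_norm_ge0 k.+1 rho f; move: hf.
  by case: (holder_norm k.+1 rho f) => [A _ _| |]//; exists A.
have A0 : 0 <= A by have := holder_norm_ge0 k.+1 rho f; rewrite hA lee_fin.
have hfh : holder_ball k.+1 rho A f by apply: holder_class_hol => //; rewrite hA.
have n0' : 0 < n%:R :> R by rewrite ltr0n.
have dn0 : 0 <= d%:R / n%:R :> R by rewrite divr_ge0.
rewrite hA; apply: ge_ereal_sup => _ [theta _ <-].
(* [orlicz_bound] asks for a positive radius. A vanishing Holder norm forces [f = 0], and then both
   sides are 0. *)
have [Az|AN0] := eqVneq A 0.
  have f0 : f = fun=> 0.
    by apply/funext => p; apply/eqP; rewrite -normr_le0 -Az; exact: (holder_ball_le p hfh).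
  rewrite /f_k f0 sigma_f_cst0 mul0r mul0e sube0.
  rewrite (_ : (fun w => _) = fun=> 0); last by apply/funext => w; rewrite bias_reduced_cst0 subr0.
  by rewrite orlicz_norm0// abse0 Az mule0 mul0e.
have {}A0 : 0 < A by rewrite lt0r AN0.
set a := Num.sqrt (d%:R / n%:R).
have powE : (d%:R / n%:R) `^ (rho / 2) = a `^ rho.
  by rewrite /a -powR12_sqrt// -powRrM [2^-1 * rho]mulrC.
have a0 : 0 < a by rewrite sqrtr_gt0 divr_gt0// ltr0n.
have powS : a `^ s = a ^+ k.+1 * a `^ rho.
  by rewrite /s powRD ?(gt_eqF a0) ?implybT// powR_mulrn// ltW.
rewrite powE powS.
have bound C : poincare_admissible P C ->
    (`| orlicz_norm (Pr theta) psi (fun w => (f_k (that w) - f theta)%R)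
       - (sigma_f (fisher_information P V) f theta / Num.sqrt n%:R)%:E
         * orlicz_norm (normal_prob 0 1) psi id | <=
     (A * cE L M m k c * (Num.sqrt (C / n%:R) * a `^ rho + a ^+ k.+1 * a `^ rho))%:E)%E.
  move=> hC; exact: (orlicz_bound M0 L0 ndV supV lipV cV m0 hP hm n0 d0 hdn hX r01 hfh A0 hC psi_cvx
    psi_mono psi_0 c0 psi_exp theta).
have pc_ge : ((m / M ^+ 2)%:E <= poincare_constant P)%E.
  apply: le_ereal_inf_tmp => _ [C hC <-]; rewrite lee_fin.
  exact: (poincare_admissible_ge M0 ndV supV hP hm d0 hC).
have mM0 : 0 < m / M ^+ 2 by rewrite divr_gt0// exprn_gt0.
have ar0 : 0 < a `^ rho by exact: powR_gt0.
have as0 : 0 <= a ^+ k.+1 * a `^ rho by rewrite mulr_ge0 ?exprn_ge0// ltW.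
have K0 : 0 < 2 * (`|cE L M m k c| + 1) * A by rewrite mulr_gt0// mulr_gt0// ltr_wpDl.
move: pc_ge; case E : (poincare_constant P) => [p| |]//.
  rewrite lee_fin => pm; have p0 : 0 < p by exact: lt_le_trans pm.
  (* The infimum need not be attained; since [p >= m / M^2 > 0], some admissible [C] lies below
     [4 * p], at the price of a factor 2 after the square root. *)
  have : (poincare_constant P < (4 * p)%:E)%E by rewrite E lte_fin ltr_pMl// ltr1n.
  move=> /ereal_inf_lt[_ [C hC <-]]; rewrite lte_fin => Cp.
  apply: le_trans (bound C hC) _; rewrite -EFinM /= lee_fin.
  have sC : Num.sqrt (C / n%:R) <= 2 * Num.sqrt (p / n%:R).
    rewrite (_ : 2 = Num.sqrt (2 ^+ 2)); last by rewrite sqrtr_sqr ger0_norm.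
    rewrite -sqrtrM ?exprn_ge0// ler_wsqrtr// mulrA ler_wpM2r ?invr_ge0//.
    by rewrite (le_trans (ltW Cp))// ler_wpM2r ?(ltW p0)// expr2 -natrM.
  set S := a ^+ k.+1 * a `^ rho in as0 *.
  have sp0 := sqrtr_ge0 (p / n%:R).
  have h1 : Num.sqrt (C / n%:R) * a `^ rho + S <= 2 * (Num.sqrt (p / n%:R) * a `^ rho + S).
    have : Num.sqrt (C / n%:R) * a `^ rho <= 2 * Num.sqrt (p / n%:R) * a `^ rho by rewrite ler_wpM2r// ltW.
    by lra.
  have h0 : 0 <= Num.sqrt (C / n%:R) * a `^ rho + S by rewrite addr_ge0// mulr_ge0 ?sqrtr_ge0// ltW.
  have h2 : A * cE L M m k c <= A * (`|cE L M m k c| + 1).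
    by rewrite ler_wpM2l ?(ltW A0)// (le_trans (ler_norm _))// lerDl.
  rewrite (le_trans (ler_wpM2r h0 h2))//.
  have h3 : 0 <= A * (`|cE L M m k c| + 1) by rewrite mulr_ge0 ?addr_ge0// ltW.
  rewrite (le_trans (ler_wpM2l h3 h1))// le_eqVlt; apply/orP; left; apply/eqP.
  by move: (`|cE L M m k c|) (Num.sqrt _) (a `^ rho) => b1 b2 b3; ring.
(* Without an admissible constant the right-hand side is [+oo], all its factors being positive. *)
rewrite -EFinM mulyr gtr0_sg ?invr_gt0// mul1e /= gt0_mulye ?lte_fin// addye//.
by move=> _; rewrite gt0_muley ?lte_fin// leey.
Qed.
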